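(* For every $\xi\ge0$ the limit $R_2^{\mathfrak T}(\xi)=\lim_{Q\to\infty}R_Q^{\mathfrak T}(\xi)$ exists, the function $R_2^{\mathfrak T}$ is $C^1$ on $[0,\infty)$, and $$R_2^{\mathfrak T}\Big(\frac38\xi\Big)=\frac{8}{3\zeta(2)}\Bigg(\sum_{M\in\mathfrak S}\operatorname{Vol}(S_{M,\xi})+\sum_{\ell\in[0,\xi)}\ \sum_{K\in[1,\xi)}\operatorname{Vol}(T_{K,\ell,\xi})\Bigg),$$ where $\ell,K$ run over integers in the indicated intervals, $$S_{M,\xi}=\Big\{(x,y,z)\in[0,1]^3:\ |\Xi_M(x,y)|\le\xi,\ x^2X_M+y^2Y_M+2xyZ_M\le\frac1{1+z^2}\Big\},$$ and $T_{K,\ell,\xi}$ is the set of $(x,y,z)\in[0,1]^3$ (with $x,y>0$) such that $$0<L_{\ell+1}(x,y)\le1,\qquad\Upsilon_{\ell,K}(x,y)\le\xi,\qquad\max\{x^2+y^2,\ L_\ell(x,y)^2+L_{\ell+1}(x,y)^2\}\le\frac1{1+z^2}.$$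
   Context: For a matrix $g$ with rows $(a,b)$, $(c,d)$ put $X_g=a^2+b^2$, $Y_g=c^2+d^2$, $Z_g=ac+bd$, $\|g\|^2=X_g+Y_g$. For $g\in\mathrm{PSL}_2(\mathbb Z)$, $\theta_g\in[-\pi,\pi]$ is the angle at $i$ in the upper half-plane between the vertical geodesic from $i$ to $0$ and the geodesic ray from $i$ to $gi$; when $Z_g>0$, $\tan\frac{\theta_g}{2}=\frac{\sqrt{\|g\|^4-4}+X_g-Y_g}{2Z_g}$. $\Gamma_{\mathbf I}$ is the set of integer matrices $\begin{pmatrix}a&b\\c&d\end{pmatrix}$ of determinant $1$ with $a,b,c,d\ge0$ and $0\le\frac bd<\frac ac\le1$. $B_Q=\#\{\gamma\in\Gamma_{\mathbf I}:\|\gamma\|\le Q\}$. Define $$R_Q^{\mathfrak T}(\xi)=\frac1{B_Q}\#\Big\{(\gamma,\gamma')\in\Gamma_{\mathbf I}^2:\ \|\gamma\|,\|\gamma'\|\le Q,\ \gamma'\ne\gamma,\ 0\le\tan\tfrac{\theta_{\gamma'}}2-\tan\tfrac{\theta_\gamma}2\le\tfrac{\xi}{B_Q}\Big\}.$$ $\mathfrak S$ is the set of matrices in $\mathrm{SL}_2(\mathbb Z)$ with nonnegative entries, different from the identity. For $M\in\mathfrak S$, $$\Xi_M(x,y)=\frac{xy(Y_M-X_M)+(x^2-y^2)Z_M}{(x^2+y^2)(x^2X_M+y^2Y_M+2xyZ_M)}.$$ Functions $L_i$, $\Upsilon_{\ell,K}$. Let $T(x,y)=\big(y,\big[\frac{1+x}{y}\big]y-x\big)$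 on $(0,1]^2$ ($[\cdot]$ is the integer part); $T$ maps $(0,1]^2$ into $\{(x,y)\in(0,1]^2:x+y>1\}$. Set $L_{-1}(x,y)=x$, $L_0(x,y)=y$ and $(L_{i-1},L_i)=T^i$ for $0\le i\le\ell$. For fixed integers $\ell\ge0$, $K\ge1$ the symbol $L_{\ell+1}$ denotes $L_{\ell+1}=KL_\ell-L_{\ell-1}$, and $$\Upsilon_{\ell,K}=\frac{L_{-1}}{L_0(L_{-1}^2+L_0^2)}+\sum_{i=1}^{\ell}\frac1{L_{i-1}L_i}+\frac{L_{\ell+1}}{L_\ell(L_\ell^2+L_{\ell+1}^2)} .$$ *)

(* Defs.v *)
From HB Require Import structures.
From mathcomp Require Import all_boot all_order all_algebra.
From mathcomp Require Import all_classical all_reals all_analysis.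
From mathcomp Require Import finmap complex.

Set Implicit Arguments.
Unset Strict Implicit.
Unset Printing Implicit Defensive.

Import Order.TTheory GRing.Theory Num.Theory.
Import numFieldNormedType.Exports.

Local Open Scope classical_set_scope.
Local Open Scope ring_scope.
Local Open Scope complex_scope.

Definition Xg (g : 'M[int]_2) : int := g 0 0 ^+ 2 + g 0 1 ^+ 2.
Definition Yg (g : 'M[int]_2) : int := g 1 0 ^+ 2 + g 1 1 ^+ 2.
Definition Zg (g : 'M[int]_2) : int := g 0 0 * g 1 0 + g 0 1 * g 1 1.

Section Angles.
Context {R : realType}.

Definition normg (g : 'M[int]_2) : R := Num.sqrt (Xg g + Yg g)%:~R.

Definition mobius (h : 'M[R]_2) (z : R[i]) : R[i] :=
  ((h 0 0)%:C * z + (h 0 1)%:C) / ((h 1 0)%:C * z + (h 1 1)%:C).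

                                                                        
                                                          
Definition is_geodesic (c : R -> R[i]) : Prop :=
  exists h : 'M[R]_2, \det h = 1 /\ forall t, c t = mobius h (0 +i* expR t).

Definition has_velocity (c : R -> R[i]) (t : R) (v : R[i]) : Prop :=
  is_derive t 1 (fun s => complex.Re (c s)) (complex.Re v) /\
  is_derive t 1 (fun s => complex.Im (c s)) (complex.Im v).

                                                                            
                                                                           
                                                                          
                                                                        
                                                                            
                               
Definition is_angle (w : R[i]) (theta : R) : Prop :=
  - pi <= theta <= pi /\
  exists c : R -> R[i], [/\ is_geodesic c, c 0 = 0 +i* 1,
    (exists2 t, 0 < t & c t = w) &
    has_velocity c 0 ((cos theta +i* sin theta) * (0 +i* (- 1)))].

                                                                              
                                                                               
Definition theta (g : 'M[int]_2) : R :=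
  xget 0 [set t | is_angle (mobius (map_mx intr g) (0 +i* 1)) t].

End Angles.

Definition GammaI : set 'M[int]_2 :=
  [set g | [/\ \det g = 1,
               (forall i j, 0 <= g i j),
               g 1 0 != 0, g 1 1 != 0 &
               0 <= (g 0 1)%:Q / (g 1 1)%:Q
               /\ (g 0 1)%:Q / (g 1 1)%:Q < (g 0 0)%:Q / (g 1 0)%:Q <= 1]].

Section PairCorrelation.
Context {R : realType}.

                                                                              
                                                                     
Definition BQ (Q : R) : nat :=
  #|` fset_set [set g : 'M[int]_2 | GammaI g /\ normg g <= Q]|.

Definition tanhalf (g : 'M[int]_2) : R := tan (theta g / 2).

Definition pairsQ (Q xi : R) : set ('M[int]_2 * 'M[int]_2) :=
  [set p | let: (g, g') := p in
    [/\ GammaI g /\ GammaI g', normg g <= Q /\ normg g' <= Q, g' <> g &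
        0 <= tanhalf g' - tanhalf g <= xi / (BQ Q)%:R]].

Definition RQ (Q xi : R) : R := #|` fset_set (pairsQ Q xi)|%:R / (BQ Q)%:R.

End PairCorrelation.

Definition frakS : set 'M[int]_2 :=
  [set M | [/\ \det M = 1, (forall i j, 0 <= M i j) & M <> 1%:M]].

Section Volumes.
Context {R : realType}.

Definition quadM (M : 'M[int]_2) (x y : R) : R :=
  x ^+ 2 * (Xg M)%:~R + y ^+ 2 * (Yg M)%:~R + 2 * x * y * (Zg M)%:~R.

Definition XiM (M : 'M[int]_2) (x y : R) : R :=
  (x * y * ((Yg M)%:~R - (Xg M)%:~R) + (x ^+ 2 - y ^+ 2) * (Zg M)%:~R) /
  ((x ^+ 2 + y ^+ 2) * quadM M x y).

Definition Tmap (p : R * R) : R * R :=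
  (p.2, (Num.floor ((1 + p.1) / p.2))%:~R * p.2 - p.1).

                                                            
Definition Lpred (i : nat) (p : R * R) : R := (iter i Tmap p).1.
Definition L (i : nat) (p : R * R) : R := (iter i Tmap p).2.

Definition Llast (l K : nat) (p : R * R) : R := K%:R * L l p - Lpred l p.

Definition Upsilon (l K : nat) (p : R * R) : R :=
  Lpred 0 p / (L 0 p * (Lpred 0 p ^+ 2 + L 0 p ^+ 2))
  + \sum_(1 <= i < l.+1) 1 / (Lpred i p * L i p)
  + Llast l K p / (L l p * (L l p ^+ 2 + Llast l K p ^+ 2)).

Definition unit_cube : set (R * R * R) :=
  [set p | let: (x, y, z) := p in
    [/\ 0 <= x <= 1, 0 <= y <= 1 & 0 <= z <= 1]].

Definition Sset (M : 'M[int]_2) (xi : R) : set (R * R * R) :=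
  unit_cube `&` [set p | let: (x, y, z) := p in
    `|XiM M x y| <= xi /\ quadM M x y <= 1 / (1 + z ^+ 2)].

Definition Tset (K l : nat) (xi : R) : set (R * R * R) :=
  unit_cube `&` [set p | let: (x, y, z) := p in
    [/\ 0 < x /\ 0 < y,
        0 < Llast l K (x, y) <= 1,
        Upsilon l K (x, y) <= xi &
        Num.max (x ^+ 2 + y ^+ 2) (L l (x, y) ^+ 2 + Llast l K (x, y) ^+ 2)
          <= 1 / (1 + z ^+ 2)]].

Definition Vol (A : set (R * R * R)) : \bar R :=
  ((lebesgue_measure \x lebesgue_measure) \x lebesgue_measure)%E A.

Definition zeta (s : nat) : R :=
  limn (series (fun n : nat => 1 / n.+1%:R ^+ s : R)).

                                                                               
                                                    
Definition C1_on (A : set R) (f : R -> R) : Prop :=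
  exists f' : R -> R,
    (forall x, A x -> (f y - f x) / (y - x) @[y --> within A x^'] --> f' x) /\
    {within A, continuous f'}.

End Volumes.

(* Main.v *)
Require Import Defs.
From HB Require Import structures.
From mathcomp Require Import all_boot all_order all_algebra.
From mathcomp Require Import all_classical all_reals all_analysis.
From mathcomp Require Import complex finmap measurable_realfun.
From mathcomp Require Import zify ring lra.

Set Implicit Arguments.
Unset Strict Implicit.
Unset Printing Implicit Defensive.

Import Order.TTheory GRing.Theory Num.Theory.
Import numFieldNormedType.Exports.

(* The lower row (c, d) and the entry a of a matrix in GammaI determine it, since
   a d = 1 mod c.  A fourth-moment bound makes the Kloosterman sums o(c), so
   units and their inverses are jointly equidistributed mod c, and the points
   (d/c, a/c, c^2/Q^2) become equidistributed for Lebesgue measure with density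
   1 / (2 zeta(2)).  For fixed M in SL2(Z), the difference of the half-angle tangents
   of g and g M is, up to lower order, XiM M (c, d); hence the number of pairs
   (g, g M) is asymptotic to Q^2 / (2 zeta(2)) times the volume of an explicit region.
   Levels c^2 + d^2 of size eta Q^2 contribute little, which reduces the sum over M to
   finitely many M.  Either M has nonnegative entries, which yields the sets S, or
   M 0 0 <= 0 after possibly swapping the pair; the latter M factor uniquely, at almost
   every point (x, y), through l steps of the map T followed by a last digit K,
   and |XiM M| is then Upsilon l K, which yields the sets T.
   For the C^1 claim, the increments of the total volume F satisfy
   (1/s - 1/t) P(s) <= F(t) - F(s) <= (1/s - 1/t) P(t) with P continuous, so
   F'(t) = P(t) / t^2; this is nondecreasing near 0, where only nonnegative M
   contribute, hence it has a limit at 0. *)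

(** * Kloosterman sums *)

(** Any power saving in the Kloosterman sums suffices: a Fejer kernel of fixed degree detects a
    cell, so boundedly many frequencies occur for a given precision, and no rate of convergence is
    claimed. The fourth moment saves about c^(1/4) by counting solutions. Cells are counted from
    below only. Upper bounds follow by complementation, since the number of matrices in a whole box
    has the same main term. The constant 3/8 is the limit of B_Q / Q^2: the region of the identity
    matrix has volume pi^2/8, and (pi^2/8) / (2 zeta(2)) = 3/8 by zeta(2) = pi^2/6, which is proved
    on the way. The connecting matrices are infinitely many, and their volumes are never estimated
    one by one: pairs of small level control the tails of the counts, and comparing counts at one
    large Q transfers this to the tails of the volumes. The coordinates (x, y, z) with v = y/x and w
    = x^2 halve volumes. A set T belongs to no single matrix, since the digits of M vary with (x,
    y); the two sums are therefore matched point by point under the integral. *)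

Section Annihilators.
Variable n : nat.
Local Notation Z := 'Z_n.+2.
Local Open Scope ring_scope.

Definition ann (a : Z) : nat := #|[set y : Z | a * y == 0]|.

(** A nonempty fibre of multiplication by [a] is a translate of the annihilator of [a]. *)
Lemma card_fiber_le_ann (a b : Z) : (#|[set y : Z | (a * y == b)%R]| <= ann a)%N.
Proof.
case: (pickP [pred y : Z | a * y == b]) => [y0 /eqP ey0|e0]; last first.
  by rewrite (@eq_card0 _ [set y : Z | a * y == b]) // => y; rewrite inE; exact: e0.
rewrite -(card_imset _ (@addIr Z (- y0))); apply: subset_leq_card.
apply/fintype.subsetP => t /imsetP[y]; rewrite inE => /eqP ey ->.
by rewrite inE mulrBr ey ey0 subrr.
Qed.

(** Sort the y killed by a b according to t = b y: each t is killed by [a] and has at most [ann b]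
    preimages. *)
Lemma ann_mul (a b : Z) : (ann (a * b)%R <= ann a * ann b)%N.
Proof.
rewrite /ann -sum1dep_card.
rewrite (partition_big (fun y => b * y) (fun t => a * t == 0)) /=; last first.
  by move=> y; rewrite mulrA.
rewrite -[#|[set y : Z | a * y == 0]|]sum1dep_card big_distrl /=.
apply: leq_sum => t _; rewrite mul1n sum1dep_card.
apply: leq_trans (card_fiber_le_ann b t).
by apply: subset_leq_card; apply/fintype.subsetP => y; rewrite !inE; case/andP.
Qed.

Lemma mulZ_eq0 (u y : Z) : (u * y == 0) = (n.+2 %| u * y)%N.
Proof. by rewrite -val_eqE /= /dvdn. Qed.

(** With g = gcd(u, N), u y = 0 forces N/g to divide y, so y is determined by its quotient by N/g,
    which is less than g. *)
Lemma ann_le_gcd (u : Z) : (ann u <= gcdn u n.+2)%N.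
Proof.
set g := gcdn _ _.
have g0 : (0 < g)%N by rewrite gcdn_gt0 orbT.
have gN : (g %| n.+2)%N by apply: dvdn_gcdr.
have N' : (n.+2 = n.+2 %/ g * g)%N by rewrite divnK.
have N0 : (0 < n.+2 %/ g)%N by rewrite divn_gt0 // dvdn_leq.
have H (y : Z) : y \in [set y : Z | u * y == 0] -> (n.+2 %/ g %| y)%N.
  rewrite inE mulZ_eq0 => h.
  have cp : coprime (n.+2 %/ g) (u %/ g).
    rewrite /coprime -(eqn_pmul2r g0) muln_gcdl mul1n !divnK ?dvdn_gcdl //.
    by rewrite gcdnC.
  rewrite -(Gauss_dvdr _ cp) -(dvdn_pmul2r g0) -N' mulnAC divnK //.
  exact: dvdn_gcdl.
rewrite -(card_ord g).
pose f (y : Z) : 'I_g := insubd (Ordinal g0) (y %/ (n.+2 %/ g))%N.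
have fE y : val (f y) = (y %/ (n.+2 %/ g))%N.
  rewrite val_insubd ifT // ltn_divLR // mulnC -N'.
  exact: ltn_ord.
apply: (@leq_card_in _ _ f).
move=> y1 y2 /H h1 /H h2 /(congr1 val); rewrite !fE => /(congr1 (muln^~ (n.+2 %/ g)%N)).
by rewrite !divnK // => e; apply: val_inj.
Qed.

Lemma ann_nat (k : nat) : (0 < k)%N -> (ann k%:R <= k)%N.
Proof.
move=> k0; apply: leq_trans (ann_le_gcd _) _.
rewrite val_Zp_nat //= gcdn_modl; exact/dvdn_leq/dvdn_gcdl.
Qed.

(** Each gcd(u, N) is at most the sum of the divisors of N that divide u. After exchanging the sums
    a divisor d contributes d for each of its N/d multiples, that is N. *)
Lemma sum_ann : (\sum_(u : Z) ann u <= n.+2 * size (divisors n.+2))%N.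
Proof.
apply: (@leq_trans (\sum_(u < n.+2) gcdn u n.+2)).
  by apply: leq_sum => u _; apply: ann_le_gcd.
rewrite -sum1_size big_distrr /= -(big_mkord predT (fun u => gcdn u n.+2)).
apply: (@leq_trans (\sum_(0 <= u < n.+2) \sum_(d <- divisors n.+2 | (d %| u)%N) d)).
  apply: leq_sum => u _.
  have gd : gcdn u n.+2 \in divisors n.+2 by rewrite -dvdn_divisors // dvdn_gcdr.
  by rewrite (big_rem (gcdn u n.+2)) //= dvdn_gcdl leq_addr.
rewrite (exchange_big_dep predT) //= big_seq [leqRHS]big_seq; apply: leq_sum => d.
rewrite -dvdn_divisors // => dN.
set m := n.+2 in dN *; have d0 : (0 < d)%N by case: d dN.
rewrite muln1 big_mkcond /=.
rewrite -[leqRHS](divnK dN) divn_count_dvd big_distrl /=.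
rewrite {1}/m big_nat_recl // dvdn0 [leqRHS]big_add1 /= [leqRHS]big_nat_recr //= dN mul1n.
rewrite addnC leq_add2r.
by apply: leq_sum => i _; case: ifP => //; rewrite mul1n.
Qed.
End Annihilators.

Section Kloosterman.
Variables (C : numClosedFieldType) (n : nat) (w : C).
Local Notation N := n.+2.
Local Notation Z := 'Z_n.+2.
Local Open Scope ring_scope.
Hypothesis prim_w : N.-primitive_root w.

Definition chi (x : Z) : C := w ^+ x.

Lemma chi0 : chi 0 = 1. Proof. by []. Qed.

Lemma chiD (x y : Z) : chi (x + y) = chi x * chi y.
Proof. by rewrite /chi /= prim_expr_mod // exprD. Qed.

Lemma chi_eq1 (x : Z) : (chi x == 1) = (x == 0).
Proof.
rewrite /chi -[1](expr0 w) (eq_prim_root_expr prim_w) mod0n modn_small ?ltn_ord //.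
Qed.

Lemma norm_chi (x : Z) : `|chi x| = 1.
Proof.
apply/eqP; rewrite -(@pexpr_eq1 _ _ N) // -normrX -exprM mulnC exprM.
by rewrite (prim_expr_order prim_w) expr1n normr1.
Qed.

Lemma conj_chi (x : Z) : (chi x)^* = chi (- x).
Proof.
have c0 : chi x != 0 by rewrite -normr_eq0 norm_chi oner_eq0.
apply: (mulfI c0); rewrite -normCK norm_chi expr1n -chiD subrr.
by rewrite chi0.
Qed.

Lemma sum_chi (a : Z) : \sum_h chi (h * a) = if a == 0 then N%:R else 0.
Proof.
case: eqP => [->|/eqP a0].
  under eq_bigr do rewrite mulr0 chi0.
  by rewrite sumr_const card_ord.
have : (chi a - 1) * \sum_h chi (h * a) = 0.
  rewrite mulrBl mul1r big_distrr /= [X in X - _](reindex_inj (addrI (-1))) /=.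
  apply/eqP; rewrite subr_eq0; apply/eqP; apply: eq_bigr => h _.
  by rewrite -chiD mulrDl mulN1r addrA subrr add0r.
by move/eqP; rewrite mulf_eq0 subr_eq0 chi_eq1 (negbTE a0) => /eqP.
Qed.

Definition klo (h k : Z) : C := \sum_(x : Z | x \is a GRing.unit) chi (h * x + k / x).

Lemma klo_sym (h k : Z) : klo h k = klo k h.
Proof.
rewrite /klo [RHS](reindex_inj (@invr_inj Z)) /=.
apply: eq_big => [x|x _]; first by rewrite unitrV.
by rewrite invrK addrC.
Qed.

(** The substitution x -> u x. It makes a single sum appear once for every unit in the fourth
    moment, which is how a bound for the moment bounds each sum. *)
Lemma klo_scale (h k u : Z) : u \is a GRing.unit -> klo (h * u) (k / u) = klo h k.
Proof.
move=> uu; rewrite /klo [RHS](reindex_inj (mulrI uu)) /=.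
apply: eq_big => [x|x xx]; first by rewrite unitrM uu.
by rewrite invrM // -!mulrA [_^-1 * u^-1]mulrC.
Qed.

Lemma klo_conj (h k : Z) : (klo h k)^* = klo (- h) (- k).
Proof.
rewrite /klo rmorph_sum; apply: eq_bigr => x _.
by rewrite -[LHS]/((chi _)^*) conj_chi opprD !mulNr.
Qed.

Definition quads : {set Z * Z * (Z * Z)} :=
  [set p | [&& p.1.1 \is a GRing.unit, p.1.2 \is a GRing.unit,
     p.2.1 \is a GRing.unit, p.2.2 \is a GRing.unit,
     p.1.1 + p.1.2 - p.2.1 - p.2.2 == 0 &
     p.1.1^-1 + p.1.2^-1 - p.2.1^-1 - p.2.2^-1 == 0]].

(** After expanding |K|^4 into quadruples of units, orthogonality in h and in k keeps those with
    equal sums and equal sums of inverses. *)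
Lemma klo_moment4 : \sum_h \sum_k `|klo h k| ^+ 4 = (N ^ 2 * #|quads|)%:R.
Proof.
have klo4 h k : `|klo h k| ^+ 4 =
  \sum_(p : Z * Z * (Z * Z) | [&& p.1.1 \is a GRing.unit, p.1.2 \is a GRing.unit,
     p.2.1 \is a GRing.unit & p.2.2 \is a GRing.unit])
     chi (h * (p.1.1 + p.1.2 - p.2.1 - p.2.2)) *
     chi (k * (p.1.1^-1 + p.1.2^-1 - p.2.1^-1 - p.2.2^-1)).
  rewrite -[4%N]/(2 * 2)%N exprM normCK exprMn klo_conj expr2 [X in _ * X]expr2.
  rewrite {1 2}/klo big_distrlr pair_big /= [klo (-h) (-k) * _]big_distrlr pair_big /=.
  rewrite big_distrlr pair_big /=; apply: eq_big => [p|p _]; first by rewrite !andbA.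
  rewrite -!chiD; congr chi.
  by ring.
under eq_bigr => h _ do under eq_bigr => k _ do rewrite klo4.
under eq_bigr => h _ do rewrite exchange_big /=.
rewrite exchange_big /= natrM -sum1_card natr_sum big_distrr /=.
rewrite big_mkcond [RHS]big_mkcond /=; apply: eq_bigr => p _.
rewrite inE; do 4 (case: (_ \is a GRing.unit) => //=).
under eq_bigr do rewrite -big_distrr /= sum_chi.
rewrite -big_distrl /= sum_chi; do 2 case: eqP => _; rewrite ?mul0r ?mulr0 //=.
by rewrite mulr1 -natrM.
Qed.

(** Put a = x3 - x1 and b = x3 - x2. Eliminating x4 turns the equation between the inverses into (x1
    + x2) a b = 0, which is linear in x3: 2 a b x3 = (a + b) a b. For given a and b it has at most 2
    [ann a] [ann b] solutions. *)
Lemma card_quads : (#|quads| <= 2 * (N * size (divisors N)) ^ 2)%N.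
Proof.
pose f (p : Z * Z * (Z * Z)) : Z * Z * Z := (p.2.1 - p.1.1, p.2.1 - p.1.2, p.2.1).
have finj : {in quads &, injective f}.
  move=> [[x1 x2] [x3 x4]] [[y1 y2] [y3 y4]]; rewrite !inE /=.
  case/and5P=> _ _ _ _ /andP[/eqP ex _] /and5P[_ _ _ _ /andP[/eqP ey _]].
  case/pair_equal_spec=> /pair_equal_spec[e1 e2] e3.
  simpl fst in e1, e2, e3; simpl snd in e1, e2, e3.
  have E1 : x1 = y1 by apply: oppr_inj; apply: (addrI x3); rewrite e1 e3.
  have E2 : x2 = y2 by apply: oppr_inj; apply: (addrI x3); rewrite e2 e3.
  congr (_, _, (_, _)) => //.
  by apply: oppr_inj; apply: (addrI (x1 + x2 - x3)); rewrite ex -ey E1 E2 e3.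
rewrite -(card_in_imset finj).
apply: (@leq_trans #|[set t : Z * Z * Z | ((2%:R * (t.1.1 * t.1.2)) * t.2 ==
    (t.1.1 + t.1.2) * (t.1.1 * t.1.2))%R]|).
  apply: subset_leq_card; apply/fintype.subsetP => t /imsetP[[[x1 x2] [x3 x4]]].
  rewrite !inE /= => /and5P[u1 u2 u3 u4 /andP[/eqP ea /eqP eb]] ->.
  rewrite /f /=.
  have e4 : x4 = x1 + x2 - x3 by apply/eqP; rewrite eq_sym -subr_eq0 ea.
  have h : (x1 + x2) * (x3 * x4 - x1 * x2) = 0.
    have -> : (x1 + x2) * (x3 * x4 - x1 * x2) =
      x1 * x2 * x3 * x4 * (x1^-1 + x2^-1) - x1 * x2 * (x3 + x4).
      rewrite mulrBr; congr (_ - _); last by rewrite e4; ring.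
      rewrite mulrDr; have -> : x1 * x2 * x3 * x4 / x1 = x2 * x3 * x4.
        by rewrite -!mulrA mulrC -!mulrA mulVr // mulr1.
      have -> : x1 * x2 * x3 * x4 / x2 = x1 * x3 * x4.
        by rewrite -!mulrA [x2 * _]mulrC -!mulrA mulVr // mulr1.
      by ring.
    have -> : x1^-1 + x2^-1 = x3^-1 + x4^-1.
      by apply/eqP; rewrite -subr_eq0 opprD addrA eb.
    have -> : x1 * x2 * x3 * x4 * (x3^-1 + x4^-1) = x1 * x2 * (x4 + x3).
      rewrite [LHS]mulrDr [RHS]mulrDr -!mulrA; congr +%R.
        by rewrite [x4 / x3]mulrC [x3 * (_ * _)]mulrA divrr // mul1r.
      by rewrite divrr // mulr1.
    by rewrite [x4 + x3]addrC subrr.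
  rewrite e4 in h; rewrite -subr_eq0 -oppr_eq0; apply/eqP; rewrite -[RHS]h; ring.
rewrite -sum1dep_card.
rewrite (eq_bigr (fun t : Z * Z * Z => (fun (p : Z * Z) (y : Z) => 1%N) t.1 t.2)) //.
rewrite (eq_bigl (fun t : Z * Z * Z => predT t.1 && (fun (p : Z * Z) (y : Z) =>
   ((2%:R * (p.1 * p.2)) * y == (p.1 + p.2) * (p.1 * p.2))%R) t.1 t.2)) //.
rewrite -(pair_big_dep predT (fun (p : Z * Z) (y : Z) =>
   ((2%:R * (p.1 * p.2)) * y == (p.1 + p.2) * (p.1 * p.2))%R) (fun _ _ => 1%N)) /=.
apply: (@leq_trans (\sum_(p : Z * Z) 2 * (ann p.1 * ann p.2))%N).
  apply: leq_sum => p _; rewrite sum1dep_card.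
  apply: (leq_trans (card_fiber_le_ann _ _)); apply: (leq_trans (ann_mul _ _)).
  by apply: leq_mul; [apply: ann_nat | apply: ann_mul].
rewrite -big_distrr /= leq_mul2l /= expnS expn1.
rewrite -(pair_bigA _ (fun x y : Z => ann x * ann y)%N) /= -big_distrlr /=.
by apply: leq_mul; apply: sum_ann.
Qed.

(** The sums at (h u, k / u), u a unit, all equal the one at (h, k), and a pair of frequencies
    arises from at most h units. So phi(N) copies of |K|^4 fit into h times the fourth moment. *)
Lemma klo_bound (h : nat) (k : Z) : (0 < h)%N ->
  `|klo h%:R k| ^+ 4 * (totient N)%:R <= (2 * h * N ^ 4 * size (divisors N) ^ 2)%:R.
Proof.
move=> h0.
have sumU : \sum_(u : Z | u \is a GRing.unit) `|klo (h%:R * u) (k / u)| ^+ 4 =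
    `|klo h%:R k| ^+ 4 * (totient N)%:R.
  rewrite (eq_bigr (fun=> `|klo h%:R k| ^+ 4)); last by move=> u uu; rewrite klo_scale.
  rewrite sumr_const mulr_natr; congr (_ *+ _).
  rewrite totient_count_coprime -sum1_card big_mkcond /= big_mkord.
  by apply: eq_bigr => x _; rewrite -[x \is a _]/(coprime N x); case: coprime.
rewrite -sumU.
apply: (@le_trans _ _ (h%:R * \sum_a \sum_b `|klo a b| ^+ 4)).
  rewrite pair_bigA /= (partition_big (fun u : Z => (h%:R * u, k / u)) predT) //= mulr_sumr.
  apply: ler_sum => -[a b] _ /=.
  rewrite (eq_bigr (fun=> `|klo a b| ^+ 4)); last by move=> u /andP[_ /eqP[-> ->]].
  rewrite sumr_const -[_ *+ _]mulr_natl; apply: ler_wpM2r; rewrite ?exprn_ge0 // ler_nat.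
  apply: leq_trans (ann_nat _ h0); apply: leq_trans (card_fiber_le_ann h%:R a).
  apply: subset_leq_card; apply/fintype.subsetP => u; rewrite !inE => /andP[_ /eqP[-> _]] //.
rewrite klo_moment4 -natrM ler_nat.
apply: (@leq_trans (h * (N ^ 2 * (2 * (N * size (divisors N)) ^ 2)))).
  by rewrite !leq_mul2l card_quads !orbT.
rewrite leq_eqVlt; apply/orP; left; apply/eqP; rewrite !expnMn -[4%N]/(2 + 2)%N expnD; ring.
Qed.
End Kloosterman.

(** * Bounds for the number of divisors and for the totient *)

Section DivisorBound.
Local Open Scope nat_scope.

Lemma size_divisors_coprime_pexp p e m : prime p -> coprime p m -> 0 < m ->
  size (divisors (p ^ e * m)) <= e.+1 * size (divisors m).
Proof.
move=> pp cpm m0.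
pose s := [seq p ^ i * d | i <- iota 0 e.+1, d <- divisors m].
have -> : e.+1 * size (divisors m) = size s by rewrite size_allpairs size_iota.
apply: uniq_leq_size; first exact: divisors_uniq.
have p0 := prime_gt0 pp.
move=> x; rewrite -dvdn_divisors ?muln_gt0 ?expn_gt0 ?p0 // => xd.
have x0 : 0 < x by apply: dvdn_gt0 xd; rewrite muln_gt0 expn_gt0 p0.
case: (pfactor_coprime pp x0) => d cpd xE.
apply/allpairsP; exists (logn p x, d); split; last by rewrite mulnC.
  rewrite mem_iota add0n ltnS leq0n andTb.
  have : p ^ logn p x %| p ^ e.
    rewrite -(@Gauss_dvdl _ _ m); last by rewrite coprimeXl.
    by apply: dvdn_trans xd; rewrite {2}xE dvdn_mull.
  by rewrite dvdn_Pexp2l // prime_gt1.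
rewrite -dvdn_divisors // -(@Gauss_dvdr _ (p ^ e)); last by rewrite coprimeXr // coprime_sym.
by apply: dvdn_trans xd; rewrite xE dvdn_mulr.
Qed.

(** The ratio (e + 1)^4 / 2^e is largest at e = 5, where it is 40.5; from e = 7 on the induction
    step holds. *)
Lemma exp4_le41 e : e.+1 ^ 4 <= 41 * 2 ^ e.
Proof.
do 7 (case: e => [//|e]).
elim: e => // e IH.
rewrite [2 ^ _]expnS mulnCA; apply: (@leq_trans (2 * e.+4.+4 ^ 4)); last first.
  by rewrite leq_mul2l IH.
have -> : e.+4.+4 = 8 + e by [].
have -> : e.+1.+4.+4 = 9 + e by [].
clear IH; rewrite -[4]/(2 * 2) !expnM; nia.
Qed.

(** For a prime p >= 16 this gives (e + 1)^4 <= p^e, so such primes cost no constant. *)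
Lemma exp4_le16 e : e.+1 ^ 4 <= 16 ^ e.
Proof.
rewrite -[16]/(2 ^ 4) expnAC leq_exp2r //; exact: ltn_expl.
Qed.

Lemma size_divisors_step p e m C : prime p -> coprime p m -> 0 < m ->
  size (divisors m) ^ 4 <= C * m -> size (divisors (p ^ e * m)) ^ 4 <= (41 * C) * (p ^ e * m).
Proof.
move=> pp cpm m0 hm.
apply: (@leq_trans ((e.+1 * size (divisors m)) ^ 4)).
  by rewrite leq_exp2r // size_divisors_coprime_pexp.
rewrite expnMn; apply: (@leq_trans ((41 * p ^ e) * (C * m))); last by rewrite mulnACA.
apply: leq_mul => //; apply: (leq_trans (exp4_le41 e)).
by rewrite leq_mul2l; case: (posnP e) => [->//|e0]; rewrite leq_exp2r ?prime_gt1.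
Qed.

Lemma size_divisors_rough n : 0 < n ->
  (forall p, prime p -> p %| n -> 16 <= p) -> size (divisors n) ^ 4 <= n.
Proof.
have [k] := ubnP n; elim: k n => // k IH n nk n0 hp.
have [n1|n1] := leqP n 1.
  by have -> : n = 1 by apply/eqP; rewrite eqn_leq n1.
have pp := pdiv_prime n1; set p := pdiv n in pp.
case: (pfactor_coprime pp n0) => m cpm nE.
have m0 : 0 < m by move: n0; rewrite nE muln_gt0 => /andP[].
have e0 : 0 < logn p n by rewrite logn_gt0 pi_pdiv.
have mn : m < n.
  rewrite [X in _ < X]nE -[X in X < _]muln1 ltn_pmul2l //.
  by rewrite -[1](expn0 p) ltn_exp2l // prime_gt1.
have := size_divisors_coprime_pexp (logn p n) pp cpm m0.
rewrite [p ^ _ * m]mulnC -nE => h; apply: (@leq_trans (((logn p n).+1 * size (divisors m)) ^ 4)).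
  by rewrite leq_exp2r.
rewrite expnMn [leqRHS]nE mulnC; apply: leq_mul.
  apply: IH => //; first exact: leq_trans mn _.
  by move=> q pq qm; apply: hp => //; rewrite nE dvdn_mulr.
apply: (leq_trans (exp4_le16 _)); rewrite leq_exp2r //.
by apply: hp => //; apply: pdiv_dvd.
Qed.

(** The six primes below 16 cost a factor 41 each; the rest of n is covered by
    [size_divisors_rough]. *)
Lemma size_divisors4 n : 0 < n -> size (divisors n) ^ 4 <= 41 ^ 6 * n.
Proof.
move=> n0.
have step p (P : pred nat) j : prime p ->
  (forall m, 0 < m -> (forall q, prime q -> q %| m -> (q != p) && P q) ->
     size (divisors m) ^ 4 <= 41 ^ j * m) ->
  forall m, 0 < m -> (forall q, prime q -> q %| m -> P q) ->
     size (divisors m) ^ 4 <= 41 ^ j.+1 * m.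
  move=> pp H m m0 hm; case: (pfactor_coprime pp m0) => m' cpm mE.
  have m'0 : 0 < m' by move: m0; rewrite mE muln_gt0 => /andP[].
  rewrite mE [m' * _]mulnC (expnS 41); apply: size_divisors_step => //; apply: H => // q pq qm.
  apply/andP; split; last by apply: hm => //; rewrite mE dvdn_mulr.
  apply/eqP => qp; move: cpm; rewrite prime_coprime // -qp qm //.
apply: (step 2 predT) => //; apply: (step 3) => //; apply: (step 5) => //.
apply: (step 7) => //; apply: (step 11) => //; apply: (step 13) => //.
move=> m m0 hm; rewrite mul1n; apply: size_divisors_rough => // q pq /(hm q pq).
rewrite leqNgt => hq; apply/negP => q16; move: q16 pq hq.
by do 16 (case: q => [//|q]).
Qed.

(** Multiply by one prime p at a time: phi does not decrease, whether or not p already divides d. *)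
Lemma leq_totient_mulr d k : 0 < d * k -> totient d <= totient (d * k).
Proof.
have [j] := ubnP k; elim: j d k => // j IH d k kj dk0.
have [d0 k0] : 0 < d /\ 0 < k by move: dk0; rewrite muln_gt0 => /andP[].
have [k1|k1] := leqP k 1.
  by have -> : k = 1 by [apply/eqP; rewrite eqn_leq k1]; rewrite muln1.
have pp := pdiv_prime k1; set p := pdiv k in pp.
have kE : k = p * (k %/ p) by rewrite mulnC divnK // pdiv_dvd.
have kp : 0 < k %/ p by rewrite divn_gt0 ?prime_gt0 // dvdn_leq // pdiv_dvd.
rewrite kE mulnA; apply: (@leq_trans (totient (d * p))); last first.
  apply: IH; last by rewrite !muln_gt0 d0 prime_gt0.
  apply: leq_trans (_ : k <= j) => //; apply: ltn_Pdiv => //; exact: prime_gt1.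
case: (pfactor_coprime pp d0) => m cpm dE.
rewrite dE -mulnA -expnSr !totient_coprime ?coprimeXr // 1?coprime_sym //.
rewrite leq_mul2l; apply/orP; right.
case: (logn p d) => [|e].
  have := prime_gt1 pp; rewrite expn0 expn1 (totient_prime pp).
  by case: (p) => [|[]].
rewrite totient_pfactor //.
rewrite totient_pfactor // leq_mul2l leq_exp2l ?prime_gt1 //= leqnSn orbT //.
Qed.

(** n is the sum of phi(d) over its divisors d, and phi(d) <= phi(n) for each of them. *)
Lemma leq_totient_divisors n : 0 < n -> n <= size (divisors n) * totient n.
Proof.
move=> n0; rewrite -{1}(cyclic.sum_totient_dvd n).
rewrite -(big_mkord (fun d => d %| n) totient).
rewrite -big_filter (perm_big (divisors n)); last first.
  apply: uniq_perm; rewrite ?filter_uniq ?iota_uniq ?divisors_uniq // => d.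
  rewrite mem_filter mem_index_iota /= -dvdn_divisors //.
  by case E : (d %| n); rewrite //= ltnS dvdn_leq.
rewrite -sum1_size big_distrl /= big_seq [leqRHS]big_seq; apply: leq_sum => d.
rewrite -dvdn_divisors // mul1n => dn.
by rewrite -(divnK dn) mulnC leq_totient_mulr // mulnC divnK.
Qed.
End DivisorBound.

(** * Joint equidistribution of units and their inverses *)

Section Fejer.
Variable R : realType.
Local Open Scope ring_scope.
Local Open Scope complex_scope.
Local Notation C := R[i].

(** The character exp(2 pi i t). *)
Definition ee (t : R) : C := cos (2 * pi * t) +i* sin (2 * pi * t).

Lemma ee0 : ee 0 = 1.
Proof. by rewrite /ee mulr0 cos0 sin0. Qed.

Lemma eeD s t : ee (s + t) = ee s * ee t.
Proof.
rewrite /ee mulrDr cosD sinD; apply/eqP; rewrite eq_complex /= eqxx /=.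
by apply/eqP; ring.
Qed.

Lemma norm_ee t : `|ee t| = 1.
Proof. by rewrite normc_def /= cos2Dsin2 sqrtr1. Qed.

Lemma ee_neq0 t : ee t != 0.
Proof. by rewrite -normr_eq0 norm_ee oner_eq0. Qed.

Lemma eeN t : ee (- t) = (ee t)^-1.
Proof. by apply: (mulfI (ee_neq0 t)); rewrite -eeD subrr ee0 divff // ee_neq0. Qed.

Lemma ee1 : ee 1 = 1.
Proof. by rewrite /ee mulr1 mulr_natl cos2pi sin2pi. Qed.

Lemma eeMn t n : ee (t *+ n) = ee t ^+ n.
Proof.
elim: n => [|n IH]; first by rewrite mulr0n ee0 expr0.
by rewrite mulrS eeD IH exprS.
Qed.

Lemma conj_ee t : (ee t)^*%R = ee (- t).
Proof. by apply: (mulfI (ee_neq0 t)); rewrite -normCK norm_ee expr1n -eeD subrr ee0. Qed.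

Lemma norm_1Bee t : `|1 - ee t| ^+ 2 = (2 - 2 * cos (2 * pi * t))%:C.
Proof.
rewrite -add_Re2_Im2 /=; congr (_%:C).
rewrite sub0r sqrrN sin2cos2; ring.
Qed.

(** The reflection u -> 1 - u reduces to |u| <= 1/2, where the cosine of 2 pi |u| decreases. *)
Lemma cos_far (d u : R) : 0 <= d -> d <= `|u| -> `|u| <= 1 - d ->
  cos (2 * pi * u) <= cos (2 * pi * d).
Proof.
move=> d0 du ud.
have -> : cos (2 * pi * u) = cos (2 * pi * `|u|).
  by rewrite -[LHS]cos_norm normrM ger0_norm // mulr_ge0 // pi_ge0.
move: (`|u|) du ud => {}u du ud.
have pi0 := pi_gt0 R.
wlog u2 : u du ud / u <= 1 / 2.
  move=> H; have [|u2] := leP u (1 / 2); first exact: H.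
  have -> : cos (2 * pi * u) = cos (2 * pi * (1 - u)).
    rewrite -[RHS]cosN -(cosD2pi (- _)); congr cos; rewrite -mulr_natl; ring.
  by apply: H; lra.
have [->//|ne] := eqVneq d u.
have lt : d < u by rewrite lt_neqAle ne.
apply: ltW; rewrite ltr_cos ?in_itv /=.
- by rewrite ltr_pM2l // mulr_gt0.
- by apply/andP; split; nra.
- by apply/andP; split; nra.
Qed.

Lemma ee_far (d : R) : 0 < d -> d <= 1 / 2 -> exists2 m : R, 0 < m &
  forall u, d <= `|u| -> `|u| <= 1 - d -> m%:C <= `|1 - ee u| ^+ 2.
Proof.
move=> d0 d2; exists (2 - 2 * cos (2 * pi * d)).
  suff : cos (2 * pi * d) < cos (2 * pi * 0) by rewrite mulr0 cos0; lra.
  have pi0 := pi_gt0 R.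
  rewrite ltr_cos ?in_itv /=.
  - by rewrite ltr_pM2l // mulr_gt0.
  - by apply/andP; split; nra.
  - by apply/andP; split; nra.
move=> u du ud; rewrite norm_1Bee lecR lerD2l lerN2 ler_pM2l //.
by apply: cos_far => //; apply: ltW.
Qed.

Lemma ee_neq1 u : 0 < `|u| < 1 -> ee u != 1.
Proof.
move=> /andP[u0 u1].
have [m m0 Hm] : exists2 m : R, 0 < m & m%:C <= `|1 - ee u| ^+ 2.
  have [u2|u2] := leP `|u| (1 / 2).
    by have [m m0 H] := ee_far u0 u2; exists m => //; apply: H => //; lra.
  have d0 : 0 < 1 - `|u| by lra.
  have d2 : 1 - `|u| <= 1 / 2 by lra.
    by have [m m0 H] := ee_far d0 d2; exists m => //; apply: H; lra.
apply/eqP => e; move: Hm; rewrite e subrr normr0 expr0n -[_%:R]/((0 : R)%:C) lecR.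
by rewrite leNgt m0.
Qed.

Lemma sum_root1 (z : C) n : z ^+ n = 1 -> z != 1 -> \sum_(j < n) z ^+ j = 0.
Proof.
move=> zn z1; apply: (mulfI (x := z - 1)); first by rewrite subr_eq0.
by rewrite -subrX1 zn subrr mulr0.
Qed.

Variable N : nat.
Hypothesis N0 : (0 < N)%N.
Let N0R : (0 : C) < N%:R. Proof. by rewrite ltr0n. Qed.
Let N0r : (0 : R) < N%:R. Proof. by rewrite ltr0n. Qed.

(** Fejer kernels of length N centred at the points s/N, s in A, scaled so that all N centres
    together give the constant 1. The sum is a smooth substitute for the indicator of a cell. *)
Definition fejer (A : {set 'I_N}) (t : R) : C :=
  N%:R ^- 2 * \sum_(s in A) `|\sum_(j < N) ee (j%:R * (t - s%:R / N%:R))| ^+ 2.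

Definition fejer_coef (A : {set 'I_N}) (q : 'I_N * 'I_N) : C :=
  N%:R ^- 2 * \sum_(s in A) ee ((q.2%:R - q.1%:R) * s%:R / N%:R).

Lemma fejerE A t :
  fejer A t = \sum_q fejer_coef A q * ee ((q.1%:R - q.2%:R) * t).
Proof.
rewrite /fejer /fejer_coef.
under [RHS]eq_bigr do rewrite -mulrA mulr_suml.
rewrite -mulr_sumr exchange_big /=; congr (_ * _); apply: eq_bigr => s _.
rewrite normCK rmorph_sum big_distrlr pair_big /=; apply: eq_bigr => q _.
by rewrite -[X in _ * X]/((ee _)^*%R) conj_ee -!eeD; congr ee; ring.
Qed.

Lemma fejer_ge0 A t : 0 <= fejer A t.
Proof.
rewrite mulr_ge0 ?invr_ge0 ?exprn_ge0 ?ler0n //.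
by apply: sumr_ge0 => s _; rewrite exprn_ge0.
Qed.

(** Off the diagonal the coefficient sums a nontrivial N-th root of unity over a full period. *)
Lemma fejer_coef_setT (q : 'I_N * 'I_N) : fejer_coef [set: 'I_N] q = if q.1 == q.2 then N%:R^-1 else 0.
Proof.
rewrite /fejer_coef; case: eqP => [->|/eqP ne].
  rewrite (eq_bigr (fun=> 1)); last by move=> s _; rewrite subrr mul0r mul0r ee0.
  rewrite sumr_const cardsT card_ord; field; exact: lt0r_neq0.
rewrite (eq_bigl predT); last by move=> s; rewrite finset.in_setT.
set u : R := (q.2%:R - q.1%:R) / N%:R.
have uN : u * N%:R = q.2%:R - q.1%:R by rewrite /u divfK // lt0r_neq0.
rewrite (eq_bigr (fun s : 'I_N => ee u ^+ s)); last first.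
  by move=> s _; rewrite -eeMn -mulr_natr /u; congr ee; ring.
rewrite sum_root1 ?mulr0 //.
  rewrite -eeMn -mulr_natr uN eeD eeN.
  by rewrite !eeMn ee1 !expr1n invr1 mulr1.
apply: ee_neq1; rewrite /u normrM normfV (ger0_norm (ltW N0r)).
apply/andP; split.
  by rewrite divr_gt0 // normr_gt0 subr_eq0 eqr_nat eq_sym.
rewrite ltr_pdivrMr // mul1r.
have := ltn_ord q.1; have := ltn_ord q.2; rewrite -!(ltr_nat R) => h1 h2.
have h3 := ler0n R q.1; have h4 := ler0n R q.2.
by rewrite ltr_norml; apply/andP; split; lra.
Qed.

Lemma fejer_setT t : fejer [set: 'I_N] t = 1.
Proof.
rewrite fejerE (eq_bigr (fun q : 'I_N * 'I_N => if q.1 == q.2 then N%:R^-1 else 0)).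
  rewrite -(pair_bigA _ (fun i j : 'I_N => if i == j then N%:R^-1 else 0)) /=.
  rewrite (eq_bigr (fun=> N%:R^-1)); last first.
    by move=> i _; rewrite -big_mkcond /=; apply: big_pred1 => j; rewrite eq_sym.
  by rewrite sumr_const card_ord -[_ *+ _]mulr_natl divff // lt0r_neq0.
move=> q _; rewrite fejer_coef_setT; case: eqP => [->|_]; last by rewrite mul0r.
by rewrite subrr mul0r ee0 mulr1.
Qed.

Lemma fejer_le1 A t : fejer A t <= 1.
Proof.
rewrite -(fejer_setT t) /fejer ler_wpM2l ?invr_ge0 ?exprn_ge0 ?ler0n //.
rewrite [leRHS](bigID (mem A)) /=.
rewrite [X in _ <= X + _](eq_bigl (mem A)); last by move=> s; rewrite finset.in_setT.
by rewrite lerDl sumr_ge0 // => s _; rewrite exprn_ge0.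
Qed.

(** The geometric sum satisfies |sum|^2 |1 - e(u)|^2 = |1 - e(N u)|^2 <= 4. *)
Lemma fejer_far (A : {set 'I_N}) t (m : R) : 0 < m ->
  (forall s : 'I_N, s \in A -> m%:C <= `|1 - ee (t - s%:R / N%:R)| ^+ 2) ->
  fejer A t <= (4 / (N%:R * m))%:C.
Proof.
move=> m0 Hm.
have mC : (0 : C) < m%:C by rewrite ltcR.
rewrite fmorph_div rmorphM !rmorph_nat.
apply: (@le_trans _ _ (N%:R ^- 2 * \sum_(s in A) 4 / m%:C)).
  rewrite ler_wpM2l ?invr_ge0 ?exprn_ge0 ?ler0n //; apply: ler_sum => s sA.
  have h := Hm s sA; move: h; set u := t - _ => h.
  rewrite ler_pdivlMr //; apply: (@le_trans _ _ (`|\sum_(j < N) ee (j%:R * u)| ^+ 2 * `|1 - ee u| ^+ 2)).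
    by rewrite ler_wpM2l ?exprn_ge0.
  rewrite -exprMn -normrM.
  have -> : (\sum_(j < N) ee (j%:R * u)) * (1 - ee u) = 1 - ee (u *+ N).
    rewrite eeMn -[RHS]opprB subrX1 -mulNr opprB mulrC; congr (_ * _).
    by apply: eq_bigr => j _; rewrite -eeMn mulr_natl.
  rewrite -[4](_ : 2 ^+ 2 = 4); last by rewrite -natrX.
  rewrite lerXn2r ?nnegrE // (le_trans (ler_normB _ _)) // normr1 norm_ee.
  by rewrite -[2]/(1 + 1) lexx.
rewrite sumr_const -[4 / _ *+ _]mulr_natr.
rewrite [leRHS](_ : _ = N%:R ^- 2 * (4 / m%:C * N%:R)); last first.
  by field; rewrite !lt0r_neq0.
rewrite ler_wpM2l ?invr_ge0 ?exprn_ge0 ?ler0n // ler_wpM2l ?divr_ge0 ?(ltW mC) //.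
by rewrite ler_nat -[leqRHS]card_ord max_card.
Qed.

Lemma fejer_coef_le A q : `|fejer_coef A q| <= N%:R^-1.
Proof.
rewrite /fejer_coef normrM ger0_norm ?invr_ge0 ?exprn_ge0 ?ler0n //.
apply: (@le_trans _ _ (N%:R ^- 2 * N%:R)); last first.
  rewrite le_eqVlt; apply/orP; left; apply/eqP; field; exact: lt0r_neq0.
rewrite ler_wpM2l ?invr_ge0 ?exprn_ge0 ?ler0n //; apply: (le_trans (ler_norm_sum _ _ _)).
rewrite (eq_bigr (fun=> 1)); last by move=> s _; rewrite norm_ee.
by rewrite sumr_const ler_nat -[leqRHS]card_ord max_card.
Qed.

Lemma fejer_coef_diag A (q : 'I_N * 'I_N) : q.1 = q.2 -> fejer_coef A q = #|A|%:R / N%:R ^+ 2.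
Proof.
move=> e; rewrite /fejer_coef (eq_bigr (fun=> 1)); last first.
  by move=> s _; rewrite e subrr mul0r mul0r ee0.
by rewrite sumr_const mulrC.
Qed.

Variables (T : finType) (x y : T -> R) (B : R).
Hypothesis HB : forall j l j' l' : 'I_N, (j, j') != (l, l') ->
  `|\sum_t ee ((j%:R - l%:R) * x t + (j'%:R - l'%:R) * y t)| <= B%:C.
Hypothesis B0 : 0 <= B.

(** In the product of the two Fourier expansions the terms with both frequencies 0 give the main
    term. Each of the remaining terms, at most N^4 in number, has coefficients of product at most
    1/N^2 and an exponential sum of size at most B, whence the error N^2 B. *)
Lemma weyl_sum (A A' : {set 'I_N}) :
  ((#|A| * #|A'| * #|T|)%:R / N%:R ^+ 2 - N%:R ^+ 2 * B)%:C
   <= \sum_t fejer A (x t) * fejer A' (y t).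
Proof.
set S := (X in _ <= X).
have SR : S \is Num.real.
  by apply: ger0_real; apply: sumr_ge0 => t _; rewrite mulr_ge0 ?fejer_ge0.
have SE : S =
  \sum_(p : 'I_N * 'I_N * ('I_N * 'I_N)) fejer_coef A p.1 * fejer_coef A' p.2 *
     \sum_t ee ((p.1.1%:R - p.1.2%:R) * x t + (p.2.1%:R - p.2.2%:R) * y t).
  rewrite /S; under eq_bigr do rewrite !fejerE big_distrlr pair_big /=.
  rewrite exchange_big /=; apply: eq_bigr => p _; rewrite mulr_sumr.
  by apply: eq_bigr => t _; rewrite eeD; ring.
move: SE; rewrite (bigID (fun p => (p.1.1 == p.1.2) && (p.2.1 == p.2.2))) /=.
have -> : \sum_(p : 'I_N * 'I_N * ('I_N * 'I_N) | (p.1.1 == p.1.2) && (p.2.1 == p.2.2))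
  fejer_coef A p.1 * fejer_coef A' p.2 *
     \sum_t ee ((p.1.1%:R - p.1.2%:R) * x t + (p.2.1%:R - p.2.2%:R) * y t)
  = ((#|A| * #|A'| * #|T|)%:R / N%:R ^+ 2)%:C.
  rewrite (eq_bigr (fun=> (#|A| * #|A'| * #|T|)%:R / N%:R ^+ 4)); last first.
    move=> p /andP[/eqP e1 /eqP e2]; rewrite !fejer_coef_diag // e1 e2.
    rewrite (eq_bigr (fun=> 1)); last by move=> t _; rewrite !subrr !mul0r addr0 ee0.
    rewrite sumr_const !natrM; field; exact: lt0r_neq0.
  rewrite sumr_const.
  have -> : #|[pred p : 'I_N * 'I_N * ('I_N * 'I_N) | (p.1.1 == p.1.2) && (p.2.1 == p.2.2)]| = (N ^ 2)%N.
    pose f (q : 'I_N * 'I_N) := (q.1, q.1, (q.2, q.2)).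
    have fi : injective f by move=> [a b] [c d] [-> _ ->].
    rewrite (eq_card (B := [set f q | q in [set: 'I_N * 'I_N]])).
      by rewrite card_imset // cardsT card_prod card_ord expnS expn1.
    move=> [[a b] [c d]]; apply/idP/imsetP => [/andP[/= /eqP <- /eqP <-]|[q _ ->]].
      by exists (a, c); rewrite ?finset.in_setT.
    by rewrite inE /= !eqxx.
  rewrite -[_ *+ (N ^ 2)%N]mulr_natr natrX fmorph_div rmorphXn !rmorph_nat; field; exact: lt0r_neq0.
set E := (X in _ = _ + X) => SE.
have HE : `|E| <= (N%:R ^+ 2 * B)%:C.
  apply: (le_trans (ler_norm_sum _ _ _)).
  apply: (@le_trans _ _ (\sum_(p : 'I_N * 'I_N * ('I_N * 'I_N)) N%:R ^- 2 * B%:C)).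
    rewrite big_mkcond /=; apply: ler_sum => p _; case: ifPn => [h|_]; last first.
      by rewrite mulr_ge0 ?ler0c // invr_ge0 exprn_ge0 ?ler0n.
    rewrite (normrM (_ * _)) (normrM (fejer_coef _ _)); apply: ler_pM; rewrite ?mulr_ge0 ?normr_ge0 //.
      by rewrite expr2 invfM; apply: ler_pM => //; apply: fejer_coef_le.
    apply: HB; apply: contraNneq h => -[-> ->]; rewrite !eqxx //.
  have -> : (N%:R ^+ 2 * B)%:C = N%:R ^+ 2 * B%:C :> C by rewrite rmorphM rmorphXn rmorph_nat.
  rewrite sumr_const !card_prod card_ord -[_ *+ _]mulr_natr.
  by rewrite !natrM le_eqVlt; apply/orP; left; apply/eqP; field; exact: lt0r_neq0.
have ER : E \is Num.real.
  have -> : E = S - ((#|A| * #|A'| * #|T|)%:R / N%:R ^+ 2)%:C by rewrite SE addrC addKr.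
  by apply: rpredB => //; apply/complex_realP; eexists.
rewrite SE rmorphB /= lerD2l.
by have := le_refl `|E|; rewrite real_ler_norml // => /andP[h _]; apply: le_trans h; rewrite lerN2.
Qed.

(** The kernels take values in [0, 1], so their product is at most 1 where P and Q both hold and at
    most e elsewhere. *)
Lemma weyl_count (A A' : {set 'I_N}) (P Q : pred T) (e : R) :
  (forall t, ~~ P t -> fejer A (x t) <= e%:C) ->
  (forall t, ~~ Q t -> fejer A' (y t) <= e%:C) -> 0 <= e ->
  (#|A| * #|A'| * #|T|)%:R / N%:R ^+ 2 - N%:R ^+ 2 * B - e * #|T|%:R
    <= #|[pred t | P t && Q t]|%:R.
Proof.
move=> HP HQ e0; rewrite lerBlDr -lecR; apply: (le_trans (weyl_sum A A')).
rewrite rmorphD rmorphM !rmorph_nat.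
have -> : (#|T|%:R : C) = \sum_(t : T) 1 by rewrite sumr_const.
have -> : (#|[pred t | P t && Q t]|%:R : C) = \sum_(t : T | P t && Q t) 1 by rewrite sumr_const.
rewrite mulr_sumr [in leRHS]big_mkcond -big_split; apply: ler_sum => t _.
have f1 := fejer_le1 A (x t); have g1 := fejer_le1 A' (y t).
have f0 := fejer_ge0 A (x t); have g0 := fejer_ge0 A' (y t).
have e0C : (0 : C) <= e%:C by rewrite ler0c.
rewrite mulr1; case: (boolP (P t)) => [Pt|/HP h] /=; last first.
  by rewrite add0r -[e%:C]mulr1; apply: ler_pM.
case: (boolP (Q t)) => [Qt|/HQ h] /=; last first.
  by rewrite add0r -[e%:C]mul1r; apply: ler_pM.
by rewrite (@le_trans _ _ 1) ?lerDl // -[1]mulr1 ler_pM.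
Qed.
End Fejer.

(** * Units and their inverses in small cells *)

Section UnitCells.
Variable R : realType.
Local Open Scope ring_scope.
Local Open Scope complex_scope.
Local Notation C := R[i].

Section Modulus.
Variable n : nat.
Local Notation c := n.+2.
Local Notation Z := 'Z_c.
Let c0 : (0 : R) < c%:R. Proof. by rewrite ltr0n. Qed.
Let w : C := ee (c%:R^-1).

Let prim_w : c.-primitive_root w.
Proof.
rewrite /primitive_root_of_unity /=; apply/forallP => i; apply/eqP.
rewrite unity_rootE /w -eeMn -[_ *+ i.+1]mulr_natr.
have [->|ne] := eqVneq i.+1 c; first by rewrite mulVf ?ee1 ?eqxx // lt0r_neq0.
apply/negbTE/ee_neq1; rewrite ger0_norm ?mulr_ge0 ?invr_ge0 ?ler0n //.
rewrite mulr_gt0 ?invr_gt0 ?ltr0n //= mulrC ltr_pdivrMr // mul1r ltr_nat.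
by rewrite ltn_neqAle ne /= ltn_ord.
Qed.

Lemma chi_mulnat (j : nat) (x : Z) : chi w (j%:R * x) = ee (j%:R * (x%:R / c%:R)).
Proof.
rewrite /chi -[LHS]/(w ^+ (((j%:R : Z) * x) %% c)%N) (prim_expr_mod prim_w).
rewrite val_Zp_nat // -(prim_expr_mod prim_w) modnMml (prim_expr_mod prim_w).
by rewrite /w -eeMn -[_ *+ (j * x)]mulr_natr natrM; congr ee; ring.
Qed.

Lemma chi_eeB (j l : nat) (x : Z) :
  chi w ((j%:R - l%:R) * x) = ee ((j%:R - l%:R) * (x%:R / c%:R)).
Proof.
rewrite !mulrBl (chiD prim_w) -(conj_chi prim_w) !chi_mulnat.
by rewrite conj_ee -eeD.
Qed.

Lemma sum_ee_klo (j l j' l' : nat) :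
  \sum_(t : {unit Z}) ee ((j%:R - l%:R) * ((val t : Z)%:R / c%:R) +
     (j'%:R - l'%:R) * (((val t)^-1 : Z)%:R / c%:R))
  = @klo C n w (j%:R - l%:R) (j'%:R - l'%:R).
Proof.
rewrite /klo [RHS](reindex_onto (val : {unit Z} -> Z) (insubd (1%g : {unit Z}))) /=; last first.
  by move=> x xu; rewrite insubdK.
apply: eq_big => [t|t _]; first by rewrite valKd eqxx andbT (valP t).
by rewrite eeD -!chi_eeB -(chiD prim_w).
Qed.

(** Let tau be the number of divisors of c. From |K|^4 phi(c) <= 2 h c^4 tau^2 and c <= tau phi(c)
    follows |K|^4 c <= 2 h c^4 tau^3; the fourth power of this and tau^4 <= 41^6 c yield |K|^16 <=
    (2 h)^4 41^18 c^15. Hence the exponents 16 and 18. *)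
Lemma klo_small (h N : nat) (k : Z) (e : R) : (0 < h <= N)%N -> 0 < e ->
  (2 * N%:R) ^+ 4 * 41 ^+ 18 <= e ^+ 16 * c%:R -> `|klo w h%:R k| <= (e * c%:R)%:C.
Proof.
move=> /andP[h0 hN] e0 hc.
have := klo_bound prim_w k h0.
rewrite normc_def.
set r := Num.sqrt _; have r0 : 0 <= r by exact: sqrtr_ge0.
rewrite -[_%:R]/(((_)%:R : C)) -(rmorph_nat (real_complex R) (totient c)).
rewrite -(rmorph_nat (real_complex R) (_ * _)) -rmorphXn -rmorphM !lecR => H.
rewrite leNgt; apply/negP => lt.
set t := size (divisors c) in H.
have t4 : (t%:R : R) ^+ 4 <= 41 ^+ 6 * c%:R.
  by rewrite -!natrX -natrM ler_nat size_divisors4.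
have tp : (c%:R : R) <= t%:R * (totient c)%:R by rewrite -natrM ler_nat leq_totient_divisors.
have t0 : (0 : R) <= t%:R := ler0n _ _.
have r4 : (e * c%:R) ^+ 4 < r ^+ 4 by apply: ltrXn2r => //; apply: mulr_ge0; apply: ltW.
have H1 : r ^+ 4 * c%:R <= 2 * N%:R * c%:R ^+ 4 * t%:R ^+ 3.
  apply: (@le_trans _ _ (r ^+ 4 * (t%:R * (totient c)%:R))).
    by rewrite ler_wpM2l // exprn_ge0.
  rewrite [t%:R ^+ 3]exprS [t%:R * _ ^+ 2]mulrC [leRHS]mulrA [t%:R * _]mulrC [leLHS]mulrA.
  rewrite ler_wpM2r //; apply: (le_trans H); rewrite 3!natrM 2!natrX.
  by rewrite ler_wpM2r ?exprn_ge0 // ler_wpM2r ?exprn_ge0 ?ler0n // ler_wpM2l // ler_nat.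
have H2 : e ^+ 4 * c%:R < 2 * N%:R * t%:R ^+ 3.
  rewrite -(ltr_pM2l (exprn_gt0 4 c0)).
  apply: lt_le_trans (_ : r ^+ 4 * c%:R <= _).
    by rewrite mulrA ltr_pM2r // -exprMn mulrC.
  by apply: (le_trans H1); rewrite le_eqVlt; apply/orP; left; apply/eqP; ring.
have H3 : (e ^+ 4 * c%:R) ^+ 4 < (2 * N%:R * t%:R ^+ 3) ^+ 4.
  by apply: ltrXn2r => //; apply: mulr_ge0; rewrite ?exprn_ge0 // ltW.
have H4 : (2 * N%:R * t%:R ^+ 3 : R) ^+ 4 <= (2 * N%:R) ^+ 4 * (41 ^+ 6 * c%:R) ^+ 3.
  rewrite exprMn -exprM ler_wpM2l ?exprn_ge0 ?mulr_ge0 ?ler0n //.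
  by rewrite (exprM _ 4 3) lerXn2r ?nnegrE ?exprn_ge0 ?mulr_ge0.
have := lt_le_trans H3 H4.
rewrite [(e ^+ 4 * _) ^+ 4]exprMn [(41 ^+ 6 * _) ^+ 3]exprMn -(exprM e) -(exprM 41) (exprS c%:R 3).
by rewrite [ltLHS]mulrA [ltRHS]mulrA ltr_pM2r ?exprn_gt0 // ltNge hc.
Qed.

(** At least one difference of frequencies is nonzero. The symmetry of the sum in its arguments
    moves it to the first place, and conjugation makes it positive. *)
Lemma klo_small_int (j l j' l' N : nat) (e : R) : (j < N)%N -> (l < N)%N ->
  (j' < N)%N -> (l' < N)%N -> (j, j') != (l, l') -> 0 < e ->
  (2 * N%:R) ^+ 4 * 41 ^+ 18 <= e ^+ 16 * c%:R ->
  `|@klo C n w (j%:R - l%:R) (j'%:R - l'%:R)| <= (e * c%:R)%:C.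
Proof.
have main a b (k : Z) : (a < N)%N -> (b < N)%N -> a != b -> 0 < e ->
    (2 * N%:R) ^+ 4 * 41 ^+ 18 <= e ^+ 16 * c%:R -> `|@klo C n w (a%:R - b%:R) k| <= (e * c%:R)%:C.
  wlog : a b k / (b < a)%N.
    move=> H aN bN ab e0 hc; have [ba|ab'|//] := ltngtP b a; first exact: H.
      rewrite -norm_conjC (klo_conj prim_w) opprB; apply: H => //.
      by rewrite eq_sym.
    by move=> ab'; rewrite ab' eqxx in ab.
  move=> ba aN bN _ e0 hc; rewrite -natrB ?(ltnW ba) //.
  apply: klo_small hc => //; rewrite subn_gt0 ba /=.
  by apply: (leq_trans (leq_subr _ _)); apply: ltnW.
move=> jN lN j'N l'N ne e0 hc; have [e1|ne1] := eqVneq j l; last exact: main.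
rewrite klo_sym; apply: main => //; apply: contraNneq ne => ->; by rewrite e1.
Qed.
End Modulus.

(** The cell (j/n, (j + 1)/n]. It is open on the left so that n cells tile (0, 1], where the
    quotients of units by c lie. *)
Definition cellb (n j : nat) (t : R) : bool := (j%:R < t * n%:R) && (t * n%:R <= j.+1%:R).

(** A consists of points s/N of the cell that keep a distance d from its ends. A point t outside the
    cell then stays at distance d, modulo 1, from all of them. *)
Lemma fejer_cell (n : nat) (e : R) : (0 < n)%N -> 0 < e ->
  exists2 N, (0 < N)%N & forall j, (j < n)%N -> exists A : {set 'I_N},
   n%:R^-1 - e <= #|A|%:R / N%:R /\
   forall t, 0 < t <= 1 -> ~~ cellb n j t -> fejer A t <= e%:C.
Proof.
move=> n0 e0.
have n0R : (0 : R) < n%:R by rewrite ltr0n.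
(* The cell is cut into L parts and the two end parts are dropped, which loses the proportion 2/L <
   e. *)
pose L := (Num.truncn (2 / e)).+3.
have L0 : (0 : R) < L%:R by rewrite ltr0n.
have Le : 2 / e < L%:R.
  by apply: (lt_le_trans (truncnS_gt (2 / e))); rewrite ler_nat; do 2 apply: leqW.
pose d : R := 1 / (n%:R * L%:R).
have d0 : 0 < d by rewrite divr_gt0 // mulr_gt0.
have d2 : d <= 1 / 2.
  rewrite ler_pdivrMr ?mulr_gt0 // mulrC mulrA mulr1 ler_pdivlMr // mul1r -natrM ler_nat.
  rewrite /L; lia.
have [m m0 Hm] := ee_far d0 d2.
(* K makes the tail 4/(N m) of the kernel at most e. *)
pose K := (Num.truncn (4 / (m * e))).+1.
have K0 : (0 : R) < K%:R by rewrite ltr0n.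
have Ke : 4 / (m * e) < K%:R by exact: truncnS_gt.
pose N := (n * L * K)%N.
have N0 : (0 < N)%N by rewrite !muln_gt0 n0.
have N0R : (0 : R) < N%:R by rewrite ltr0n.
exists N => // j jn.
have bd (i : 'I_((L - 2) * K)) : (j * L * K + K + i < N)%N.
  apply: (@leq_trans (j * L * K + K + (L - 2) * K)%N); first by rewrite ltn_add2l.
  rewrite /N -[X in (_ + X + _)%N]mul1n -!mulnDl leq_mul2r; apply/orP; right.
  have : (j.+1 * L <= n * L)%N by rewrite leq_mul2r jn orbT.
  have : (2 < L)%N by [].
  by clearbody L; rewrite mulSn; lia.
pose f (i : 'I_((L - 2) * K)) : 'I_N := Ordinal (bd i).
have fi : injective f by move=> a b /(congr1 val) /= /addnI /val_inj.
exists [set f i | i in [set: 'I_((L - 2) * K)]].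
have nLK : (N%:R : R) = n%:R * L%:R * K%:R by rewrite !natrM.
split.
  rewrite card_imset // cardsT card_ord natrM natrB // nLK.
  have -> : (L%:R - 2%:R) * K%:R / (n%:R * L%:R * K%:R) = n%:R^-1 - (2 / L%:R) * n%:R^-1 :> R.
    by field; rewrite !lt0r_neq0.
  rewrite lerD2l lerN2; apply: (@le_trans _ _ (e * 1)); last by rewrite mulr1.
  apply: ler_pM; rewrite ?invr_ge0 ?divr_ge0 ?ler0n //.
    by rewrite ler_pdivrMr // -ler_pdivrMl // mulrC ltW.
  by rewrite invf_le1 // ler1n.
move=> t /andP[t0 t1] nc.
apply: (le_trans (fejer_far N0 m0 _)); last first.
  rewrite lecR ler_pdivrMr ?mulr_gt0 //.
  have KN : K%:R <= N%:R :> R by rewrite ler_nat; apply: leq_pmull; rewrite muln_gt0 n0.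
  move: Ke; rewrite ltr_pdivrMr ?mulr_gt0 // => /ltW/le_trans; apply.
  rewrite (_ : e * (N%:R * m) = N%:R * (m * e)); last by ring.
  by apply: ler_wpM2r => //; rewrite ltW // mulr_gt0.
move=> _ /imsetP[i _ ->] /=.
have sE : ((j * L * K + K + i)%:R / N%:R : R) = j%:R / n%:R + d + i%:R / N%:R.
  by rewrite nLK !natrD !natrM /d; field; rewrite !lt0r_neq0.
have iN : 0 <= (i%:R / N%:R : R) < n%:R^-1 - 2 * d.
  rewrite divr_ge0 ?ler0n //= ltr_pdivrMr //.
  have -> : (n%:R^-1 - 2 * d) * N%:R = ((L - 2) * K)%:R.
    by rewrite natrM natrB // nLK /d; field; rewrite !lt0r_neq0.
  by rewrite ltr_nat.
have jn' : 0 <= (j%:R / n%:R : R) /\ j%:R / n%:R + n%:R^-1 <= 1 :> R.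
  rewrite divr_ge0 ?ler0n //; split => //.
  have -> : j%:R / n%:R + n%:R^-1 = j.+1%:R / n%:R :> R by rewrite -natr1 mulrDl mul1r.
  by rewrite ler_pdivrMr // mul1r ler_nat.
apply: Hm; rewrite sE.
  move: nc; rewrite negb_and -leNgt -ltNge => /orP[tl|tr].
    have tl' : t <= j%:R / n%:R by rewrite ler_pdivlMr.
    rewrite ler0_norm; lra.
  have tr' : j%:R / n%:R + n%:R^-1 < t.
    have -> : j%:R / n%:R + n%:R^-1 = j.+1%:R / n%:R :> R by rewrite -natr1 mulrDl mul1r.
    by rewrite ltr_pdivrMr.
  by rewrite ger0_norm; lra.
rewrite ler_norml; apply/andP; split; lra.
Qed.

Lemma unit_cells (n : nat) (e : R) : (0 < n)%N -> 0 < e ->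
  exists c0, forall c, (c0 <= c.+2)%N -> forall j k, (j < n)%N -> (k < n)%N ->
  (totient c.+2)%:R / n%:R ^+ 2 - e * c.+2%:R <=
  #|[pred t : {unit 'Z_c.+2} | cellb n j ((val t : 'Z_c.+2)%:R / c.+2%:R) &&
       cellb n k (((val t)^-1 : 'Z_c.+2)%:R / c.+2%:R)]|%:R.
Proof.
move=> n0 e0; set e1 := e / 4.
have e10 : 0 < e1 by rewrite divr_gt0.
have [N N0 HN] := fejer_cell n0 e10.
have n0R : (0 : R) < n%:R by rewrite ltr0n.
have N0R : (0 : R) < N%:R by rewrite ltr0n.
(* Dividing by N^2 undoes the factor N^2 in the error of [weyl_count]. *)
set e2 := e1 / N%:R ^+ 2; have e20 : 0 < e2 by rewrite divr_gt0 ?exprn_gt0.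
exists (Num.truncn ((2 * N%:R) ^+ 4 * 41 ^+ 18 / e2 ^+ 16)).+1 => c cc0 j k jn kn.
have [A [HA1 HA2]] := HN j jn; have [A' [HB1 HB2]] := HN k kn.
have c0R : (0 : R) < c.+2%:R by rewrite ltr0n.
have hc : (2 * N%:R) ^+ 4 * 41 ^+ 18 <= e2 ^+ 16 * c.+2%:R.
  rewrite [leRHS]mulrC -ler_pdivrMr ?exprn_gt0 //; apply: (le_trans (ltW (truncnS_gt _))).
  by rewrite ler_nat.
pose x (t : {unit 'Z_c.+2}) : R := (val t : 'Z_c.+2)%:R / c.+2%:R.
pose y (t : {unit 'Z_c.+2}) : R := ((val t)^-1 : 'Z_c.+2)%:R / c.+2%:R.
have inc (z : 'Z_c.+2) : z \is a GRing.unit -> 0 < (z%:R / c.+2%:R : R) <= 1.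
  move=> zu; rewrite divr_gt0 ?ltr0n //=; last first.
    by rewrite lt0n; apply: contraTneq zu => z0; have -> : z = 0 by [apply: val_inj]; rewrite unitr0.
  by rewrite ler_pdivrMr // mul1r ler_nat ltnW // ltn_ord.
have := @weyl_count R N N0 _ x y (e2 * c.+2%:R) _ _ A A'
   (fun t => cellb n j (x t)) (fun t => cellb n k (y t)) e1 _ _ (ltW e10).
rewrite -cardsT card_units_Zp // => H.
apply: le_trans (H _ _ _ _); clear H.
- have -> : N%:R ^+ 2 * (e2 * c.+2%:R) = e1 * c.+2%:R.
    by rewrite /e2; field; rewrite lt0r_neq0.
  rewrite !natrM.
  have -> : #|A|%:R * #|A'|%:R * (totient c.+2)%:R / N%:R ^+ 2 =
     (#|A|%:R / N%:R) * (#|A'|%:R / N%:R) * (totient c.+2)%:R :> R.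
    by field; rewrite lt0r_neq0.
  move: HA1 HB1; set a := _ / N%:R; set b := _ / N%:R => HA1 HB1.
  have tc : (totient c.+2)%:R <= c.+2%:R :> R.
    rewrite ler_nat totient_count_coprime -[leqRHS]muln1 -[X in (_ <= X * _)%N]subn0 -sum_nat_const_nat.
    by apply: leq_sum => i _; case: coprime.
  have t0 : (0 : R) <= (totient c.+2)%:R by rewrite ler0n.
  have a0 : 0 <= a by rewrite divr_ge0 ?ler0n.
  have b0 : 0 <= b by rewrite divr_ge0 ?ler0n.
  have ni0 : (0 : R) < n%:R^-1 by rewrite invr_gt0.
  have ni1 : (n%:R^-1 : R) <= 1 by rewrite invf_le1 // ler1n.
  have ab : n%:R^-1 ^+ 2 - 2 * e1 <= a * b.
    have [h|h] := leP n%:R^-1 e1; first by have := mulr_ge0 a0 b0; nra.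
    have : (n%:R^-1 - e1) * (n%:R^-1 - e1) <= a * b by apply: ler_pM => //; rewrite subr_ge0 ltW.
    nra.
  have -> : e = 4 * e1 by rewrite /e1; field.
  rewrite -exprVn; have := ler_wpM2r t0 ab; nra.
- move=> p q p' q' ne; rewrite sum_ee_klo; apply: (@klo_small_int _ _ _ _ _ N) => //.
- by rewrite mulr_ge0 ?ltW.
- by move=> t; apply: HA2; apply: inc; apply: (valP t).
- by move=> t; apply: HB2; apply: inc; rewrite unitrV; apply: (valP t).
Qed.
End UnitCells.

(** * The totient sum and zeta(2) *)

Section TotientSum.
Local Open Scope nat_scope.

Definition totsum (n : nat) : nat := \sum_(1 <= c < n.+1) totient c.

(** Both sides equal the sum of phi(c) [n/c] over c: on the right, m is the sum of phi over its
    divisors, and c has [n/c] multiples up to n. *)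
Lemma sum_totsum_div n : \sum_(1 <= g < n.+1) totsum (n %/ g) = \sum_(1 <= m < n.+1) m.
Proof.
have count c : 0 < c -> \sum_(1 <= g < n.+1 | g * c <= n) 1 = n %/ c.
  move=> c0; rewrite -[RHS](subn1 (n %/ c).+1) -[RHS]muln1 -sum_nat_const_nat.
  rewrite [RHS](big_nat_widen 1 _ n.+1); last by rewrite ltnS leq_div.
  by apply: eq_bigl => g; rewrite /= ltnS leq_divRL.
transitivity (\sum_(1 <= c < n.+1) totient c * (n %/ c)).
  rewrite big_nat_cond (eq_bigr (fun g => \sum_(1 <= c < n.+1 | g * c <= n) totient c)); last first.
    move=> g /andP[/andP[g0 _] _]; rewrite /totsum (big_nat_widen 1 _ n.+1) ?ltnS ?leq_div //.
    by apply: eq_bigl => c; rewrite /= ltnS leq_divRL // mulnC.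
  rewrite -big_nat_cond (exchange_big_dep predT) //= big_nat_cond [RHS]big_nat_cond.
  apply: eq_bigr => c /andP[/andP[c0 _] _]; rewrite -(count c c0) big_distrr /=.
  by apply: eq_bigr => g _; rewrite muln1.
rewrite [RHS]big_nat_cond [RHS](eq_bigr (fun m => \sum_(1 <= c < n.+1 | c %| m) totient c)); last first.
  move=> m /andP[/andP[m0 mn] _]; rewrite -{1}(cyclic.sum_totient_dvd m).
  rewrite -(big_mkord (fun d => d %| m) totient) big_ltn_cond // dvd0n -[m == 0]negbK -lt0n m0 /=.
  rewrite (big_nat_widen 1 _ n.+1) //; apply: eq_bigl => d /=.
  by rewrite ltnS; case E: (d %| m) => //=; rewrite dvdn_leq.
rewrite -big_nat_cond (exchange_big_dep predT) //= big_nat_cond [RHS]big_nat_cond.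
apply: eq_bigr => c /andP[/andP[c0 _] _]; rewrite divn_count_dvd big_distrr big_mkcond /=.
by rewrite [RHS]big_mkcond /=; apply: eq_bigr => m _; case: (c %| m); rewrite /= ?muln1 ?muln0.
Qed.

Lemma totient_leq n : totient n <= n.
Proof.
rewrite totient_count_coprime -[leqRHS]muln1 -[X in _ <= X * _]subn0 -sum_nat_const_nat.
by apply: leq_sum => i _; case: coprime.
Qed.

Lemma totsum_leq n : totsum n <= n ^ 2.
Proof.
apply: (@leq_trans (\sum_(1 <= c < n.+1) n)); last first.
  by rewrite sum_nat_const_nat subn1 expnS expn1.
rewrite /totsum big_nat_cond [leqRHS]big_nat_cond; apply: leq_sum => c /andP[/andP[_ cn] _].
exact: leq_trans (totient_leq c) cn.
Qed.
End TotientSum.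

Section Zeta2.
Variable R : realType.
Local Open Scope ring_scope.
Local Open Scope classical_set_scope.

Definition invsq (n : nat) : R := \sum_(1 <= g < n.+1) (g%:R ^+ 2)^-1.

Lemma invsqS n : invsq n.+1 = invsq n + (n.+1%:R ^+ 2)^-1.
Proof. by rewrite /invsq big_nat_recr. Qed.

Lemma invsq_tail m n : (0 < m)%N -> (m <= n)%N -> invsq n <= invsq m + m%:R^-1 - n%:R^-1.
Proof.
move=> m0; elim: n => [|n IH]; first by rewrite leqn0 => /eqP mm; rewrite mm in m0.
rewrite leq_eqVlt => /orP[/eqP ->|]; first by rewrite addrK.
rewrite ltnS => mn; rewrite invsqS; have := IH mn.
have n0 : (0 : R) < n%:R by rewrite ltr0n (leq_trans m0).
have : (n.+1%:R ^+ 2)^-1 <= n%:R^-1 - (n.+1%:R)^-1 :> R.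
  rewrite -subr_ge0; rewrite -natr1.
  have -> : n%:R^-1 - (n%:R + 1)^-1 - ((n%:R + 1) ^+ 2)^-1 = (n%:R * (n%:R + 1) ^+ 2)^-1 :> R.
    by field; rewrite !lt0r_neq0 // addr_gt0.
  by rewrite invr_ge0 mulr_ge0 ?exprn_ge0 ?addr_ge0 // ltW.
by move: (invsq n) (_ ^- 2) (n%:R^-1) (n.+1%:R^-1) => a b c d *; lra.
Qed.

Lemma nondecreasing_invsq : {homo invsq : m n / (m <= n)%N >-> m <= n}.
Proof.
apply: homo_leq => // [x y z|n]; first exact: le_trans.
by rewrite invsqS lerDl invr_ge0 exprn_ge0.
Qed.

Lemma zeta2_bounds n : (0 < n)%N -> invsq n <= zeta 2 <= invsq n + n%:R^-1.
Proof.
move=> n0; have cv : invsq m @[m --> \oo] --> zeta 2.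
  have -> : zeta 2 = limn invsq :> R.
    rewrite /zeta; congr (limn _); apply/funext => k; rewrite /series /invsq /=.
    by rewrite big_add1 /=; apply: eq_bigr => i _; rewrite mul1r.
  apply: nondecreasing_is_cvgn; first by move=> a b; apply: nondecreasing_invsq.
  exists 2 => _ [k _ <-]; apply: (@le_trans _ _ (invsq k.+1)); first exact: nondecreasing_invsq.
  apply: (le_trans (@invsq_tail 1 k.+1 _ _)) => //.
  by rewrite /invsq big_nat1 expr1n invr1 -[2]/(1 + 1) gerDl oppr_le0 invr_ge0.
apply/andP; split.
  rewrite -(cvg_lim _ cv) //; apply: limr_ge; first by apply/cvg_ex; exists (zeta 2).
  by near=> m; apply: nondecreasing_invsq; near: m; exists n.
rewrite -(cvg_lim _ cv) //; apply: limr_le; first by apply/cvg_ex; exists (zeta 2).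
near=> m; apply: (le_trans (invsq_tail n0 _)); first by near: m; exists n.
by rewrite gerDl oppr_le0 invr_ge0.
Unshelve. all: by end_near. Qed.

Lemma zeta2_gt0 : 0 < zeta 2 :> R.
Proof.
have /andP[+ _] := zeta2_bounds (ltn0Sn 0); apply: lt_le_trans.
by rewrite /invsq big_nat1 expr1n invr1.
Qed.

(** 3/4 = 1/4 + 1/2 bounds the term g = 2 and the tail beyond it. That the terms g >= 2 sum to less
    than 1 makes [totsum_asymp_step] a contraction. *)
Lemma invsq_le n : invsq n <= 1 + 3 / 4.
Proof.
case: n => [|[|n]]; first by rewrite /invsq big_geq //; lra.
  by rewrite /invsq big_nat1 expr1n invr1; lra.
apply: (le_trans (@invsq_tail 2 _ _ _)) => //.
have : 0 <= (n.+2%:R : R)^-1 by rewrite invr_ge0.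
rewrite {1}/invsq big_nat_recr // big_nat1 /= expr1n invr1.
by move: (n.+2%:R^-1 : R) => x x0; lra.
Qed.

Lemma harmonic_le (K n : nat) : (0 < K)%N ->
  \sum_(1 <= g < n.+1) g%:R^-1 <= K%:R + n%:R / K%:R :> R.
Proof.
move=> K0; have K0R : (0 : R) < K%:R by rewrite ltr0n.
apply: (@le_trans _ _ (\sum_(1 <= g < n.+1) ((if (g <= K)%N then 1 else 0) + K%:R^-1))).
  rewrite big_nat_cond [leRHS]big_nat_cond; apply: ler_sum => g /andP[/andP[g0 _] _].
  have g0R : (0 : R) < g%:R by rewrite ltr0n.
  case: leqP => gK; first by rewrite (@le_trans _ _ 1) ?lerDl ?invr_ge0 // invf_le1 // ler1n.
  by rewrite add0r lef_pV2 ?posrE // ler_nat ltnW.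
rewrite big_split /= sumr_const_nat subn1 /= mulr_natl lerD2r -big_mkcond /=.
rewrite -(natr_sum R _ _ (fun=> 1%N)) ler_nat; apply: (@leq_trans (\sum_(1 <= i < K.+1) 1)%N).
  rewrite [leqRHS](bigID (fun i => i < n.+1)%N) /=; apply: leq_trans (leq_addr _ _).
  rewrite -big_filter -[leqRHS]big_filter (perm_big [seq i <- index_iota 1 K.+1 | (i < n.+1)%N]) //.
  apply: uniq_perm; rewrite ?filter_uniq ?iota_uniq // => i; rewrite !mem_filter !mem_index_iota.
  by rewrite !ltnS; case: (i <= K)%N; case: (i <= n)%N; rewrite ?andbT ?andbF.
by rewrite sum_nat_const_nat subn1 muln1.
Qed.

(** Let D(n) be the error of the totient sum. By [sum_totsum_div] the sum of D([n/g]) over all g is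
    at most a small multiple of n^2 plus a linear term. Isolating g = 1 leaves the terms g >= 2,
    which contribute at most E n^2 times a sum of 1/g^2 that is at most 3/4. This takes the place of
    Moebius inversion. *)
Lemma totsum_asymp_step (E C d : R) : 0 <= E -> 0 <= C -> 0 < d ->
  (forall m, `|(totsum m)%:R - (2 * zeta 2)^-1 * m%:R ^+ 2| <= E * m%:R ^+ 2 + C) ->
  exists2 C', 0 <= C' & forall m,
   `|(totsum m)%:R - (2 * zeta 2)^-1 * m%:R ^+ 2| <= (3 / 4 * E + d) * m%:R ^+ 2 + C'.
Proof.
move=> E0 C0 d0; set k := (2 * zeta 2)^-1.
pose D (m : nat) : R := (totsum m)%:R - k * m%:R ^+ 2 => HE.
have z0 := zeta2_gt0.
have k0 : 0 < k by rewrite invr_gt0 mulr_gt0.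
have z1 : 1 <= zeta 2 :> R.
  by have /andP[+ _] := zeta2_bounds (ltn0Sn 0); rewrite /invsq big_nat1 expr1n invr1.
have k1 : k <= 1 / 2.
  by rewrite /k -[1 / 2]invf_div divr1 lef_pV2 ?posrE ?mulr_gt0 //; lra.
have kz : k * zeta 2 = 1 / 2 by rewrite /k; field; exact: lt0r_neq0.
pose K := (Num.truncn (4 / d)).+1.
have K0 : (0 : R) < K%:R by rewrite ltr0n.
have Kd : K%:R^-1 <= d / 4.
  by rewrite -[d / 4]invrK lef_pV2 ?posrE ?invr_gt0 ?divr_gt0 // invf_div ltW // truncnS_gt.
pose c1 := C + 2 + K%:R.
have c10 : 0 <= c1 by rewrite /c1; lra.
exists (c1 ^+ 2 / d + c1); first by rewrite addr_ge0 // divr_ge0 ?exprn_ge0 // ltW.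
move=> n; rewrite -/(D n); case: (posnP n) => [->|n0].
  rewrite /D /totsum big_geq // expr0n mulr0 subrr normr0.
  by rewrite mulr0 add0r addr_ge0 // divr_ge0 ?exprn_ge0 // ltW.
have n0R : (0 : R) < n%:R by rewrite ltr0n.
have n1R : (1 : R) <= n%:R by rewrite ler1n.
have S1 : \sum_(1 <= g < n.+1) D (n %/ g)%N = D n + \sum_(2 <= g < n.+1) D (n %/ g)%N.
  by rewrite big_ltn // divn1.
have S2 : `|\sum_(2 <= g < n.+1) D (n %/ g)%N| <= 3 / 4 * E * n%:R ^+ 2 + C * n%:R.
  apply: (le_trans (ler_norm_sum _ _ _)).
  apply: (@le_trans _ _ (\sum_(2 <= g < n.+1) (E * n%:R ^+ 2 * (g%:R ^+ 2)^-1 + C))).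
    rewrite big_nat_cond [leRHS]big_nat_cond; apply: ler_sum => g /andP[/andP[g0 _] _].
    have g0R : (0 : R) < g%:R by rewrite ltr0n (leq_trans _ g0).
    apply: (le_trans (HE _)); rewrite lerD2r -mulrA ler_wpM2l // -expr_div_n lerXn2r ?nnegrE ?divr_ge0 //.
    by rewrite ler_pdivlMr // -natrM ler_nat leq_trunc_div.
  rewrite big_split /= sumr_const_nat; apply: lerD.
    rewrite -mulr_sumr (_ : 3 / 4 * E * n%:R ^+ 2 = E * n%:R ^+ 2 * (3 / 4)); last by ring.
    apply: ler_wpM2l; first by rewrite mulr_ge0 // exprn_ge0.
    have := invsq_le n; rewrite /invsq big_ltn // expr1n invr1; lra.
  by rewrite -[C *+ _]mulr_natr; apply: ler_wpM2l => //; rewrite ler_nat subSS leq_subr.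
have S3 : \sum_(1 <= g < n.+1) D (n %/ g)%N =
   n%:R * (n%:R + 1) / 2 - k * \sum_(1 <= g < n.+1) (n %/ g)%N%:R ^+ 2.
  rewrite /D sumrB -mulr_sumr -natr_sum sum_totsum_div; congr (_ - _).
  elim: (n) => [|j IH]; first by rewrite big_geq // mul0r mul0r.
  by rewrite big_nat_recr //= natrD IH -natr1; field.
have S4 : \sum_(1 <= g < n.+1) (n %/ g)%N%:R ^+ 2 <= n%:R ^+ 2 * zeta 2 :> R.
  have /andP[h _] := zeta2_bounds n0.
  apply: le_trans (_ : n%:R ^+ 2 * invsq n <= _); last by rewrite ler_wpM2l // exprn_ge0.
  rewrite /invsq mulr_sumr big_nat_cond [leRHS]big_nat_cond; apply: ler_sum => g /andP[/andP[g0 _] _].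
  have g0R : (0 : R) < g%:R by rewrite ltr0n.
  rewrite -expr_div_n lerXn2r ?nnegrE ?divr_ge0 //.
  by rewrite ler_pdivlMr // -natrM ler_nat leq_trunc_div.
have S5 : n%:R ^+ 2 * zeta 2 - n%:R - 2 * n%:R * (K%:R + n%:R / K%:R)
    <= \sum_(1 <= g < n.+1) (n %/ g)%N%:R ^+ 2 :> R.
  have /andP[_ h] := zeta2_bounds n0.
  have h1 : n%:R ^+ 2 * zeta 2 - n%:R <= n%:R ^+ 2 * invsq n :> R.
    rewrite lerBlDr; apply: (le_trans (ler_wpM2l (exprn_ge0 2 (ltW n0R)) h)).
    by rewrite mulrDr lerD2l expr2 -mulrA divff ?mulr1 // lt0r_neq0.
  have h2 : n%:R ^+ 2 * invsq n - 2 * n%:R * (\sum_(1 <= g < n.+1) g%:R^-1)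
      <= \sum_(1 <= g < n.+1) (n %/ g)%N%:R ^+ 2 :> R.
    rewrite /invsq !mulr_sumr -sumrB big_nat_cond [leRHS]big_nat_cond; apply: ler_sum => g /andP[/andP[g0 _] _].
    have g0R : (0 : R) < g%:R by rewrite ltr0n.
    have q1 : n%:R / g%:R - 1 <= (n %/ g)%N%:R :> R.
      rewrite lerBlDr natr1 ler_pdivrMr // -natrM ler_nat ltnW // ltn_ceil //.
    have q0 : (0 : R) <= (n %/ g)%N%:R by [].
    have q2 : 0 <= n%:R / g%:R :> R by rewrite divr_ge0.
    rewrite -expr_div_n -mulrA; move: (n%:R / g%:R) ((n %/ g)%N%:R) q0 q1 q2 => a b b0 ab a0.
    have [a1|a1] := leP a 1; nra.
  have h3 := @harmonic_le K n (ltn0Sn _).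
  have := ler_wpM2l (mulr_ge0 (ler0n R 2) (ltW n0R)) h3; lra.
have S6 : `|D n| <= `|\sum_(1 <= g < n.+1) D (n %/ g)%N| + `|\sum_(2 <= g < n.+1) D (n %/ g)%N|.
  have -> : D n = \sum_(1 <= g < n.+1) D (n %/ g)%N - \sum_(2 <= g < n.+1) D (n %/ g)%N.
    by rewrite S1 addrK.
  exact: ler_normB.
have S7 : `|\sum_(1 <= g < n.+1) D (n %/ g)%N| <= (2 + K%:R) * n%:R + n%:R ^+ 2 * (d / 4).
  rewrite S3; move: (\sum_(1 <= g < n.+1) _) S4 S5 => s S4 S5.
  have e1 : k * s <= 1 / 2 * n%:R ^+ 2.
    have := ler_wpM2l (ltW k0) S4; by rewrite mulrCA kz; lra.
  have e2 : 1 / 2 * n%:R ^+ 2 - k * (n%:R + 2 * n%:R * (K%:R + n%:R / K%:R)) <= k * s.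
    have := ler_wpM2l (ltW k0) S5; rewrite !mulrBr mulrCA kz mulrDr; lra.
  have e3 : k * (n%:R + 2 * n%:R * (K%:R + n%:R / K%:R)) <=
      1 / 2 * (n%:R + 2 * n%:R * (K%:R + n%:R / K%:R)).
    apply: ler_wpM2r => //; rewrite addr_ge0 ?mulr_ge0 ?addr_ge0 ?divr_ge0 //; exact: ltW.
  have e4 : n%:R * (n%:R / K%:R) <= n%:R ^+ 2 * (d / 4).
    rewrite expr2 -!mulrA; apply: ler_wpM2l; first exact: ltW.
    by apply: ler_wpM2l; first exact: ltW.
  rewrite ler_norml; apply/andP; split; nra.
(* Weighted arithmetic-geometric mean: a linear error is a small multiple of n^2 plus a constant. *)
have : c1 * n%:R <= d / 2 * n%:R ^+ 2 + c1 ^+ 2 / d.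
  have : 0 <= (n%:R * d - c1) ^+ 2 / d by rewrite divr_ge0 ?sqr_ge0 // ltW.
  have -> : (n%:R * d - c1) ^+ 2 / d = n%:R ^+ 2 * d - 2 * c1 * n%:R + c1 ^+ 2 / d.
    by field; rewrite lt0r_neq0.
  have : 0 <= c1 ^+ 2 / d by rewrite divr_ge0 ?sqr_ge0 // ltW.
  by move: (c1 ^+ 2 / d) => u *; lra.
have : 0 <= n%:R ^+ 2 * d by rewrite mulr_ge0 ?exprn_ge0 // ltW.
have -> : c1 * n%:R = C * n%:R + (2 + K%:R) * n%:R by rewrite /c1; ring.
move: (c1 ^+ 2 / d) => u h1 h2; apply: (le_trans S6); apply: (le_trans (lerD S7 S2)).
move: ((2 + K%:R) * n%:R) (C * n%:R) h2 => a b h2; lra.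
Qed.

Lemma totsum_asymp (e : R) : 0 < e -> exists2 C, 0 <= C & forall m,
   `|(totsum m)%:R - (2 * zeta 2)^-1 * m%:R ^+ 2| <= e * m%:R ^+ 2 + C.
Proof.
move=> e0.
have P k : exists2 C, 0 <= C & forall m,
   `|(totsum m)%:R - (2 * zeta 2)^-1 * m%:R ^+ 2| <= ((3 / 4) ^+ k + e / 2) * m%:R ^+ 2 + C.
  elim: k => [|k [C C0 IH]].
    exists 0 => // m; rewrite expr0 addr0.
    have z1 : 1 <= zeta 2 :> R.
      by have /andP[+ _] := zeta2_bounds (ltn0Sn 0); rewrite /invsq big_nat1 expr1n invr1.
    have z2 : 0 < 2 * zeta 2 :> R by lra.
    have k0 : 0 <= (2 * zeta 2)^-1 :> R by rewrite invr_ge0 ltW.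
    have k1 : (2 * zeta 2)^-1 <= 1 :> R by rewrite invf_le1 //; lra.
    have a1 : (totsum m)%:R <= m%:R ^+ 2 :> R by rewrite -natrX ler_nat totsum_leq.
    have a0 : 0 <= (totsum m)%:R :> R by [].
    have m0 : 0 <= m%:R ^+ 2 :> R by rewrite exprn_ge0.
    rewrite ler_norml; apply/andP; split; nra.
  (* The value e / 8 preserves the slack, as 3/4 (e/2) + e/8 = e/2. *)
  have [||C' C'0 H] := @totsum_asymp_step ((3 / 4) ^+ k + e / 2) C (e / 8) _ C0 _ IH.
  - by rewrite addr_ge0 ?exprn_ge0 ?divr_ge0 // ltW.
  - by rewrite divr_gt0.
  exists C' => // m; apply: (le_trans (H m)); rewrite lerD2r (exprS _ k); apply: ler_wpM2r; rewrite ?exprn_ge0 //.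
  by move: ((3 / 4) ^+ k) => a; lra.
have [k Hk] : exists k, (3 / 4) ^+ k <= e / 2 :> R.
  have /cvgrPdist_le /(_ (e / 2)) : (fun k => (3 / 4) ^+ k : R) @ \oo --> (0 : R).
    by apply: cvg_expr; rewrite ger0_norm; lra.
  case; first by rewrite divr_gt0.
  move=> k _ /(_ k (leqnn k)) /=; rewrite sub0r normrN ger0_norm ?exprn_ge0 //.
  by exists k.
have [C C0 H] := P k; exists C => // m; apply: (le_trans (H m)).
by rewrite lerD2r ler_wpM2r ?exprn_ge0 //; lra.
Qed.
End Zeta2.

(** * The value of zeta(2) *)

Section Basel.
Variable R : realType.
Local Open Scope ring_scope.
Local Open Scope classical_set_scope.

Lemma sin_le_id (x : R) : 0 <= x -> sin x <= x.
Proof.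
move=> x0; have [c _] := @MVT_segment R sin cos 0 x x0 (fun y _ => is_derive_sin y)
  (continuous_subspaceT (@continuous_sin R)).
rewrite sin0 !subr0 => ->; rewrite -[leRHS]mul1r ler_wpM2r //; exact: cos_le1.
Qed.

Lemma le_tan_id (x : R) : 0 <= x < pi / 2 -> x * cos x <= sin x.
Proof.
move=> /andP[x0 x1].
pose f (y : R) := sin y - y * cos y.
have df (y : R) : is_derive y 1 f (y * sin y).
  have h := is_deriveB (is_derive_sin y) (is_deriveM (is_derive_id y 1) (is_derive_cos y)).
  apply: is_derive_eq h _; rewrite /GRing.scale /=; ring.
have [|c + ] := @MVT_segment R f (fun y => y * sin y) 0 x x0 (fun y _ => df y).
  apply: derivable_within_continuous => y _.
  exact: (@ex_derive _ _ _ _ _ _ _ (df y)).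
rewrite in_itv /= => /andP[c0 cx]; rewrite /f sin0 mul0r !subr0 => e.
rewrite -subr_ge0 e mulr_ge0 // mulr_ge0 // sin_ge0_pi // c0 /=.
by have := pi_gt0 R; lra.
Qed.

Definition csc2 (n k : nat) : R := (sin (k.*2.+1%:R * pi / 2 ^+ n.+2) ^+ 2)^-1.

(** Halve the angle: 4 / sin^2 x = 1 / sin^2(x/2) + 1 / cos^2(x/2). The cosine terms are the sine
    terms of the second half of the next level, in reverse order. *)
Lemma sum_csc2 n : \sum_(0 <= k < 2 ^ n) csc2 n k = 2 * 4 ^+ n.
Proof.
have pi0 := pi_gt0 R.
elim: n => [|n IH].
  rewrite big_nat1 /csc2 /= mul1r expr0 mulr1.
  have h := sin2cos2 (pi / 2 ^+ 2 : R).
  have := cos_mulr2n (pi / 2 ^+ 2 : R).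
  have -> : pi / 2 ^+ 2 *+ 2 = pi / 2 :> R by rewrite -mulr_natr; field.
  rewrite cos_pihalf => h2; have -> : sin (pi / 2 ^+ 2) ^+ 2 = 1 / 2 :> R.
    by rewrite h; move: h2; rewrite -[cos _ ^+ 2 *+ 2]mulr_natr; lra.
  by rewrite invf_div divr1.
rewrite [(2 ^ _)%N]expnS mul2n -addnn (@big_cat_nat _ _ _ (2 ^ n)) //= ?leq_addr //.
rewrite [X in _ + X]big_nat_rev /= -[X in _ + \sum_(X <= _ < _) _]add0n [X in _ + X]big_addn addnK -big_split /=.
rewrite exprS mulrCA -IH mulr_sumr big_nat_cond [RHS]big_nat_cond.
apply: eq_bigr => k /andP[/andP[_ kn] _].
set x : R := k.*2.+1%:R * pi / 2 ^+ n.+2.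
have E2 : (2 ^+ n.+2 : R) = (2 ^ n.+2)%:R by rewrite natrX.
have x0 : 0 < x.
    by apply: divr_gt0; [apply: mulr_gt0; rewrite ?ltr0n|rewrite exprn_gt0 ?ltr0n].
have x1 : x < pi / 2.
  rewrite /x ltr_pdivrMr ?exprn_gt0 // mulrC -mulrA ltr_pM2l // exprS mulKf // -natrX ltr_nat.
  by rewrite expnS; lia.
have -> : csc2 n.+1 k = (sin (x / 2) ^+ 2)^-1.
  by rewrite /csc2 /x [2 ^+ n.+3]exprSr; congr ((sin _ ^+ 2)^-1); field.
have -> : csc2 n.+1 (2 ^ n + (2 ^ n + 2 ^ n) - (k + 2 ^ n).+1)%N = (cos (x / 2) ^+ 2)^-1.
  rewrite /csc2; set y := (_ - _)%N.
  have -> : (y.*2.+1)%:R = 2 ^+ n.+2 - k.*2.+1%:R :> R.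
    clear -kn; rewrite -natrX -natrB; last by rewrite !expnS; lia.
    by congr (_%:R); rewrite /y !expnS; lia.
  rewrite -cosBpihalf -cosN; congr ((cos _ ^+ 2)^-1); rewrite /x [2 ^+ n.+3]exprSr.
  have p2 : (0 : R) < 2 ^+ n.+2 by rewrite exprn_gt0.
  by move: (@pi R) (2 ^+ n.+2) p2 (k.*2.+1%:R) => p q q0 r; field; rewrite lt0r_neq0.
have sx : 0 < sin (x / 2) by rewrite sin_gt0_pi //; apply/andP; split; lra.
have cx : 0 < cos (x / 2) by rewrite cos_gt0_pihalf //; apply/andP; split; lra.
have -> : csc2 n k = (sin x ^+ 2)^-1 by [].
have -> : sin x = 2 * (cos (x / 2) * sin (x / 2)).
  by rewrite mulr_natl -sin_mulr2n; congr sin; rewrite -mulr_natr; field.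
have h := cos2Dsin2 (x / 2).
have -> : (sin (x / 2) ^+ 2)^-1 + (cos (x / 2) ^+ 2)^-1 =
   (cos (x / 2) ^+ 2 + sin (x / 2) ^+ 2) / (sin (x / 2) ^+ 2 * cos (x / 2) ^+ 2).
  by field; rewrite !lt0r_neq0.
by rewrite h; field; rewrite !lt0r_neq0.
Qed.

(** Sum cot^2 x <= 1/x^2 <= 1/sin^2 x over the angles x = (2 k + 1) pi / 2^(n+2). The outer sums are
    known from [sum_csc2] and differ by 2^n. *)
Lemma odd_invsq_bounds n :
  (@pi R) ^+ 2 / 8 - (@pi R) ^+ 2 / 2 ^+ n / 16 <= \sum_(0 <= k < 2 ^ n) (k.*2.+1%:R ^+ 2)^-1 <= (@pi R) ^+ 2 / 8.
Proof.
have pi0 := pi_gt0 R.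
have term k : (k < 2 ^ n)%N -> csc2 n k - 1 <= 16 * 4 ^+ n / (@pi R) ^+ 2 * (k.*2.+1%:R ^+ 2)^-1 <= csc2 n k.
  move=> kn; rewrite /csc2; set x : R := k.*2.+1%:R * pi / 2 ^+ n.+2.
  have x0 : 0 < x.
    by apply: divr_gt0; [apply: mulr_gt0; rewrite ?ltr0n|rewrite exprn_gt0 ?ltr0n].
  have x1 : x < pi / 2.
    rewrite /x ltr_pdivrMr ?exprn_gt0 // mulrC -mulrA ltr_pM2l // exprS mulKf // -natrX ltr_nat.
    by rewrite expnS; lia.
  have -> : 16 * 4 ^+ n / pi ^+ 2 * (k.*2.+1%:R ^+ 2)^-1 = (x ^+ 2)^-1 :> R.
    rewrite /x (_ : 4 = 2 ^+ 2 :> R); last by rewrite -natrX.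
    rewrite -exprM [(2 * n)%N]mulnC exprM !exprS expr0.
    have p2 : (0 : R) < 2 ^+ n by rewrite exprn_gt0.
    have k0 : (0 : R) < k.*2.+1%:R by rewrite ltr0n.
    move: (@pi R) pi0 (2 ^+ n) p2 (k.*2.+1%:R) k0 => p p0 q q0 r r0; field.
    by rewrite !lt0r_neq0.
  have s0 : 0 < sin x by rewrite sin_gt0_pi //; apply/andP; split; lra.
  have s1 := sin_le_id (ltW x0).
  have s2 : x * cos x <= sin x by apply: le_tan_id; rewrite x1 ltW.
  have c0 : 0 < cos x by rewrite cos_gt0_pihalf //; apply/andP; split; lra.
  have h := cos2Dsin2 x.
  apply/andP; split; last first.
    by rewrite lef_pV2 ?posrE ?exprn_gt0 // lerXn2r ?nnegrE // ltW.
  have -> : (sin x ^+ 2)^-1 - 1 = (cos x / sin x) ^+ 2.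
    rewrite expr_div_n cos2sin2.
    by field; rewrite lt0r_neq0.
  have q1 : cos x / sin x <= x^-1 by rewrite ler_pdivrMr // mulrC ler_pdivlMr // mulrC.
  have q2 : 0 <= cos x / sin x by rewrite divr_ge0 // ltW.
  by rewrite -exprVn lerXn2r ?nnegrE // invr_ge0 ltW.
set c : R := 16 * 4 ^+ n / pi ^+ 2; set S : R := \sum_(0 <= k < 2 ^ n) _.
have p4 : (0 : R) < 4 ^+ n by rewrite exprn_gt0.
have p2 : (0 : R) < 2 ^+ n by rewrite exprn_gt0.
have pp : (0 : R) < pi ^+ 2 by rewrite exprn_gt0.
have c0 : 0 < c by rewrite divr_gt0 ?mulr_gt0.
have up : c * S <= 2 * 4 ^+ n.
  rewrite -sum_csc2 mulr_sumr big_nat_cond [leRHS]big_nat_cond.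
  by apply: ler_sum => k /andP[/andP[_ kn] _]; have /andP[] := term k kn.
have lo : 2 * 4 ^+ n - 2 ^+ n <= c * S.
  rewrite -sum_csc2 -natrX -[(2 ^ n)%:R]mulr1 mulr_natl -[X in _ *+ X]subn0 -sumr_const_nat -sumrB.
  rewrite mulr_sumr big_nat_cond [leRHS]big_nat_cond.
  by apply: ler_sum => k /andP[/andP[_ kn] _]; have /andP[] := term k kn.
have e44 : (4 ^+ n : R) = 2 ^+ n * 2 ^+ n.
  by rewrite -exprMn; congr (_ ^+ _); rewrite -natrM.
apply/andP; split; rewrite -(ler_pM2l c0); [apply: le_trans lo|apply: (le_trans up)];
  rewrite le_eqVlt; apply/orP; left; apply/eqP; rewrite /c e44;
  by move: (@pi R ^+ 2) pp (2 ^+ n : R) p2 => p pp q q0; field; rewrite !lt0r_neq0.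
Qed.

Lemma invsq_double m : invsq R (m + m) = \sum_(0 <= k < m) (k.*2.+1%:R ^+ 2)^-1 + 4^-1 * invsq R m.
Proof.
elim: m => [|m IH]; first by rewrite /invsq !big_geq // mulr0 addr0.
rewrite addSn addnS !invsqS IH big_nat_recr //= mulrDr -addnn.
have -> : ((m + m).+2%:R : R) = 2 * m.+1%:R by rewrite -natrM; congr (_%:R); lia.
rewrite exprMn (_ : (2 : R) ^+ 2 = 4) ?[(4 * _)^-1]invfM; last by rewrite -natrX.
by rewrite -!addrA; congr (_ + _); rewrite addrCA; congr (_ + _); rewrite addrA.
Qed.

(** The odd terms sum to pi^2/8 and the even ones to a quarter of the whole, so zeta(2) = pi^2/8 +
    zeta(2)/4. *)
Lemma zeta2E : zeta 2 = pi ^+ 2 / 6 :> R.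
Proof.
apply/eqP; rewrite -subr_eq0 -normr_le0; apply/ler_addgt0Pl => e e0; rewrite addr0.
pose K := (Num.truncn ((2 + pi ^+ 2) / e)).+1.
have K0 : (0 : R) < K%:R by rewrite ltr0n.
have Ke : (2 + pi ^+ 2) / e < K%:R :> R by exact: truncnS_gt.
have /andP[h1 h2] := odd_invsq_bounds K.
have n0 : (0 < 2 ^ K)%N by rewrite expn_gt0.
have /andP[a1 a2] := zeta2_bounds R n0.
have nn0 : (0 < 2 ^ K + 2 ^ K)%N by rewrite addn_gt0 n0.
have /andP[b1 b2] := zeta2_bounds R nn0.
rewrite invsq_double in b1 b2.
have pe : (2 ^ K)%:R^-1 * (2 + pi ^+ 2) <= e :> R.
  rewrite mulrC ler_pdivrMr ?ltr0n // mulrC -ler_pdivrMr // (le_trans (ltW Ke)) // ler_nat.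
  by rewrite ltnW // ltn_expl.
have i0 : (0 : R) < (2 ^ K)%:R^-1 by rewrite invr_gt0 ltr0n.
have i2 : (2 ^ K + 2 ^ K)%:R^-1 <= (2 ^ K)%:R^-1 :> R.
  by rewrite lef_pV2 ?posrE ?ltr0n // ler_nat leq_addr.
rewrite -natrX in h1 h2.
move: ((2 ^ K)%:R^-1) ((2 ^ K + 2 ^ K)%:R^-1) i0 i2 pe h1 h2 a1 a2 b1 b2 => u v i0 i2 pe h1 h2 a1 a2 b1 b2.
move: (\sum_(0 <= k < _) _) (invsq _ _) h1 h2 a1 a2 b1 b2 => S I h1 h2 a1 a2 b1 b2.
have pp : (0 : R) < pi ^+ 2 by rewrite exprn_gt0 // pi_gt0.
move: (@pi R ^+ 2) pp pe h1 h2 => p pp pe h1 h2.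
have up := mulr_ge0 (ltW i0) (ltW pp).
rewrite ler_norml; apply/andP; split; lra.
Qed.
End Basel.

Lemma det2E (K : comNzRingType) (A : 'M[K]_2) :
  (\det A = A 0 0 * A 1 1 - A 0 1 * A 1 0)%R.
Proof.
rewrite (expand_det_row _ ord0) !big_ord_recl big_ord0 /cofactor !det_mx11 !mxE /=.
rewrite [A ord0 (lift _ _)](_ : _ = A 0%R 1%R); last by congr (A _ _); apply: val_inj.
rewrite [A (lift _ _) (lift (lift _ _) _)](_ : _ = A 1%R 0%R); last by congr (A _ _); apply: val_inj.
rewrite [A (lift _ _) (lift _ _)](_ : _ = A 1%R 1%R); last by congr (A _ _); apply: val_inj.
have E0 (n : nat) : n = 0%N -> ((-1) ^+ n = 1 :> K)%R by move=> ->.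
have E1 (n : nat) : n = 1%N -> ((-1) ^+ n = -1 :> K)%R by move=> ->.
by rewrite E0 // E1 // mul1r addr0 mulN1r mulrN.
Qed.

(** * Half-angle tangents *)

Section AngleTangent.
Variable R : realType.
Local Open Scope classical_set_scope.
Local Open Scope ring_scope.
Local Open Scope complex_scope.

Lemma sqr_denom_gt0 (c d E : R) : 0 < E -> (c != 0) || (d != 0) -> 0 < d ^+ 2 + c ^+ 2 * E ^+ 2.
Proof.
move=> E0 /orP[c0|d0].
  by rewrite ltr_wpDl ?sqr_ge0 //; apply: mulr_gt0; [rewrite exprn_even_gt0|rewrite exprn_gt0].
by rewrite ltr_pwDl ?exprn_even_gt0 // mulr_ge0 ?sqr_ge0.
Qed.

Lemma mobius_imag (h : 'M[R]_2) (E : R) : \det h = 1 -> 0 < E ->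
  mobius h (0 +i* E) = ((h 0 1 * h 1 1 + h 0 0 * h 1 0 * E ^+ 2) / (h 1 1 ^+ 2 + h 1 0 ^+ 2 * E ^+ 2))
     +i* (E / (h 1 1 ^+ 2 + h 1 0 ^+ 2 * E ^+ 2)).
Proof.
rewrite det2E => hd E0; rewrite /mobius; move: (h 0 0) (h 0 1) (h 1 0) (h 1 1) hd => a b c d hd.
have D0 : 0 < d ^+ 2 + c ^+ 2 * E ^+ 2.
  apply: sqr_denom_gt0 => //; apply/orP; have [c0|] := eqVneq c 0; last by left.
  right; apply/eqP => d0; move: hd; rewrite d0 c0 !mulr0 subrr => /eqP.
  by rewrite eq_sym oner_eq0.
have e1 (x y : R) : x%:C * (0 +i* E) + y%:C = y +i* (x * E).
  by apply/eqP; rewrite eq_complex /=; apply/andP; split; apply/eqP; ring.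
rewrite !e1; have nz : d +i* (c * E) != 0.
  apply/eqP => /eqP; rewrite eq_complex /= => /andP[/eqP d0].
  rewrite mulf_eq0 (gt_eqF E0) orbF => /eqP c0.
  by move: D0; rewrite d0 c0 expr0n mul0r addr0 ltxx.
apply: (canLR (mulfK nz)); apply/eqP; rewrite eq_complex /=.
apply/andP; split; apply/eqP.
  rewrite (_ : _ - _ = b + E ^+ 2 * c * (a * d - b * c - 1) / (d ^+ 2 + c ^+ 2 * E ^+ 2)).
    by rewrite hd subrr mulr0 mul0r addr0.
  by field; rewrite exprMn; exact: lt0r_neq0.
rewrite [RHS](_ : _ = a * E - E * d * (a * d - b * c - 1) / (d ^+ 2 + c ^+ 2 * E ^+ 2)).
  by rewrite hd subrr mulr0 mul0r subr0.
by field; rewrite exprMn; exact: lt0r_neq0.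
Qed.

Section Geodesic.
Variables p q : R.
Hypothesis pq1 : p ^+ 2 + q ^+ 2 = 1.

(** The rotation matrix with rows (q, -p), (p, q) fixes i; the two functions are the coordinates of
    the geodesic to which it carries the vertical one. *)
Lemma is_derive_geodesic :
  is_derive (0 : R) (1 : R) (fun s : R => q * p * (expR s ^+ 2 - 1) / (q ^+ 2 + p ^+ 2 * expR s ^+ 2)) (2 * p * q)
  /\ is_derive (0 : R) (1 : R) (fun s : R => expR s / (q ^+ 2 + p ^+ 2 * expR s ^+ 2)) (q ^+ 2 - p ^+ 2).
Proof.
have h0 := is_derive_expR (0 : R).
have h2 : is_derive (0 : R) (1 : R) (fun s => expR s ^+ 2) 2.
  apply: is_derive_eq (@is_deriveX R R expR 2 0 1 _ h0) _.
  by rewrite expR0 expr1n /GRing.scale /= !mulr1.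
have hc (k : R) := is_derive_cst k (0 : R) (1 : R).
have hD : is_derive (0 : R) (1 : R) (fun s => q ^+ 2 + p ^+ 2 * expR s ^+ 2) (2 * p ^+ 2).
  apply: is_derive_eq (is_deriveD (hc _) (is_deriveM (hc (p ^+ 2)) h2)) _.
  by rewrite /GRing.scale /=; ring.
have D1 : q ^+ 2 + p ^+ 2 * expR 0 ^+ 2 = 1 by rewrite expR0 expr1n mulr1 addrC.
have nz : q ^+ 2 + p ^+ 2 * expR 0 ^+ 2 != 0 by rewrite D1 oner_neq0.
have hV := @is_deriveV R (fun s => q ^+ 2 + p ^+ 2 * expR s ^+ 2) 0 _ 1 nz hD.
have hN : is_derive (0 : R) (1 : R) (fun s => q * p * (expR s ^+ 2 - 1)) (2 * p * q).
  apply: is_derive_eq (is_deriveM (hc (q * p)) (is_deriveB h2 (hc 1))) _.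
  by rewrite /GRing.scale /=; ring.
split.
  apply: is_derive_eq (is_deriveM hN hV) _.
  by rewrite /GRing.scale /= D1 expR0 expr1n subrr; field.
apply: is_derive_eq (is_deriveM h0 hV) _.
rewrite /GRing.scale /= D1 expR0 -[X in X - _](mulr1 (q ^+ 2)).
have -> : q ^+ 2 = 1 - p ^+ 2 by rewrite -pq1; ring.
by field.
Qed.
End Geodesic.

(** The half-angle tangent T satisfies a quadratic equation with coefficients in the coordinates r,
    y of the endpoint. The equation shows directly that T is close to r when y is small. *)
Lemma angle_tan (r y th : R) : 0 < r -> is_angle (r +i* y) th ->
  0 < tan (th / 2) /\ (r * tan (th / 2) + 1) * (tan (th / 2) - r) = y ^+ 2 * tan (th / 2).
Proof.
move=> r0 [_ [c [[h [hd hc]] ci [t t0 ct] [v1 v2]]]].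
have cE s : c s = ((h 0 1 * h 1 1 + h 0 0 * h 1 0 * expR s ^+ 2) / (h 1 1 ^+ 2 + h 1 0 ^+ 2 * expR s ^+ 2))
     +i* (expR s / (h 1 1 ^+ 2 + h 1 0 ^+ 2 * expR s ^+ 2)).
  by rewrite hc mobius_imag // expR_gt0.
move: hd; rewrite det2E => hd.
move: (h 0 0) (h 0 1) (h 1 0) (h 1 1) hd cE => a b p q hd cE.
have D0 E : 0 < E -> 0 < q ^+ 2 + p ^+ 2 * E ^+ 2.
  move=> E0; apply: sqr_denom_gt0 => //; apply/orP; have [c0|] := eqVneq p 0; last by left.
  right; apply/eqP => d0; move: hd; rewrite d0 c0 !mulr0 subrr => /eqP.
  by rewrite eq_sym oner_eq0.
have := cE 0; rewrite ci expR0 => /eqP; rewrite eq_complex /= => /andP[/eqP R0 /eqP I0].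
have pq1 : p ^+ 2 + q ^+ 2 = 1.
  have := D0 1 ltr01; rewrite expr1n mulr1 => D1.
  move: I0; rewrite expr1n mulr1 => I0.
  by rewrite addrC -[LHS]mulr1 [X in _ * X]I0 mul1r mulfV // gt_eqF.
have B0 : b * q = - (a * p).
  have := D0 1 ltr01; rewrite expr1n mulr1 => D1.
  move/esym/eqP: R0; rewrite expr1n !mulr1 mulf_eq0 invr_eq0 (gt_eqF D1) orbF.
  by rewrite addr_eq0 => /eqP.
(* A geodesic that passes through i at time 0 comes from a rotation matrix. *)
have aq : a = q.
  have e : a * (p ^+ 2 + q ^+ 2) = q * (a * q - b * p) + p * (a * p + b * q) by ring.
  by move: e; rewrite pq1 mulr1 hd B0 subrr mulr0 addr0 mulr1.
have bp : b = - p.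
  have e : b * (p ^+ 2 + q ^+ 2) = - p * (a * q - b * p) + q * (a * p + b * q) by ring.
  by move: e; rewrite pq1 mulr1 hd B0 subrr mulr0 addr0 mulr1.
have fRe : (fun s => complex.Re (c s)) = (fun s : R => q * p * (expR s ^+ 2 - 1) / (q ^+ 2 + p ^+ 2 * expR s ^+ 2)).
  by apply/funext => s; rewrite cE /= aq bp; congr (_ / _); ring.
have fIm : (fun s => complex.Im (c s)) = (fun s : R => expR s / (q ^+ 2 + p ^+ 2 * expR s ^+ 2)).
  by apply/funext => s; rewrite cE.
have [d1 d2] := is_derive_geodesic pq1.
rewrite fRe in v1; rewrite fIm in v2.
(* Comparing velocities at time 0 gives sin(th) = 2 p q and cos(th) = p^2 - q^2, so that tan(th/2) =
   q/p. *)
have S1 : sin th = 2 * p * q.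
  have := @derive_val _ _ _ _ _ _ _ v1; rewrite (@derive_val _ _ _ _ _ _ _ d1) /=.
  by move=> ->; ring.
have C1 : cos th = p ^+ 2 - q ^+ 2.
  have := @derive_val _ _ _ _ _ _ _ v2; rewrite (@derive_val _ _ _ _ _ _ _ d2) /=.
  move=> e; have -> : cos th = - (q ^+ 2 - p ^+ 2) by rewrite e; ring.
  by ring.
have := cE t; rewrite ct => /eqP; rewrite eq_complex /= aq bp => /andP[/eqP rE /eqP yE].
have E1 : 1 < expR t by rewrite expR_gt1.
move: (expR t) E1 rE yE => E E1 rE yE.
have E0 : 0 < E by apply: lt_trans E1.
have DD := D0 E E0.
have pq0 : 0 < p * q.
  have : 0 < r * (q ^+ 2 + p ^+ 2 * E ^+ 2) by rewrite mulr_gt0.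
  rewrite rE divfK ?gt_eqF // => h1.
  have : 0 < p * q * (E ^+ 2 - 1) by move: h1; nra.
  by rewrite pmulr_lgt0 // subr_gt0 exprn_egt1.
have p0 : p != 0 by apply/eqP => p0; move: pq0; rewrite p0 mul0r ltxx.
have thE : th = th / 2 + th / 2 by lra.
have cc : cos (th / 2) ^+ 2 = p ^+ 2.
  have := cosD (th / 2) (th / 2); rewrite -thE C1 -!expr2 sin2cos2.
  have -> : q ^+ 2 = 1 - p ^+ 2 by rewrite -pq1; ring.
  lra.
have ss : 2 * (sin (th / 2) * cos (th / 2)) = 2 * p * q.
  by have := sinD (th / 2) (th / 2); rewrite -thE S1 => ->; ring.
have tE : tan (th / 2) = q / p.
  have c0 : cos (th / 2) != 0 by rewrite -sqrf_eq0 cc sqrf_eq0.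
  rewrite /tan; have -> : sin (th / 2) / cos (th / 2) = (2 * (sin (th / 2) * cos (th / 2))) / (2 * cos (th / 2) ^+ 2).
    by field.
  by rewrite ss cc; field.
rewrite tE; split.
  have -> : q / p = p * q / p ^+ 2 by field.
  by rewrite divr_gt0 // exprn_even_gt0.
rewrite rE yE.
have -> : (- p * q + q * p * E ^+ 2) = p * q * (E ^+ 2 - 1) by ring.
apply/eqP; rewrite -subr_eq0; apply/eqP.
have nz : q ^+ 2 + p ^+ 2 * E ^+ 2 != 0 by rewrite gt_eqF.
rewrite [LHS](_ : _ = q / p * (E ^+ 2 / (q ^+ 2 + p ^+ 2 * E ^+ 2) ^+ 2) * ((p ^+ 2 + q ^+ 2) ^+ 2 - 1)).
  by rewrite pq1 expr1n subrr mulr0.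
have hq : q ^+ 2 = 1 - p ^+ 2 by rewrite -pq1; ring.
by field; rewrite p0 exprMn nz.
Qed.

(** [theta] picks an angle by choice with default 0, so one must be shown to exist before [is_angle]
    is known of it. *)
Lemma angle_exists (r y : R) : 0 < r -> 0 < y < 1 -> exists th, is_angle (r +i* y) th.
Proof.
move=> r0 /andP[y0 y1].
pose s := r ^+ 2 + y ^+ 2 - 1.
(* T is the positive root of the equation of [angle_tan], written as r T^2 - s T - r = 0. *)
pose T := (Num.sqrt (s ^+ 2 + 4 * r ^+ 2) + s) / (2 * r).
have q2 : Num.sqrt (s ^+ 2 + 4 * r ^+ 2) ^+ 2 = s ^+ 2 + 4 * r ^+ 2.
  by rewrite sqr_sqrtr // addr_ge0 ?sqr_ge0 // mulr_ge0 ?sqr_ge0.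
have q0 : 0 <= Num.sqrt (s ^+ 2 + 4 * r ^+ 2) := sqrtr_ge0 _.
have rr : 0 < r ^+ 2 by rewrite exprn_gt0.
have T0 : 0 < T.
  rewrite divr_gt0 ?mulr_gt0 //.
  move: (Num.sqrt _) q2 q0 => q q2 q0; nra.
have TE : (r * T + 1) * (T - r) = y ^+ 2 * T.
  have : r * T ^+ 2 - s * T - r = 0.
    rewrite /T; move: (Num.sqrt _) q2 q0 => q q2 q0.
    rewrite [LHS](_ : _ = (q ^+ 2 - (s ^+ 2 + 4 * r ^+ 2)) / (4 * r)); last by field; rewrite gt_eqF.
    by rewrite q2 subrr mul0r.
  by rewrite /s => e; apply/eqP; rewrite -subr_eq0 -e; apply/eqP; ring.
(* ln E is the time at which the geodesic of half-angle atan T reaches r + i y. *)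
pose E := (1 + r * T) / y.
have rT : 0 < r * T by rewrite mulr_gt0.
have E1 : 1 < E by rewrite ltr_pdivlMr // mul1r; lra.
have E0 : 0 < E by lra.
have Ey : E * y = 1 + r * T by rewrite divfK // gt_eqF.
pose p := cos (atan T); pose q := sin (atan T).
have p0 : 0 < p by rewrite cos_gt0_pihalf // atan_gtNpi2 atan_ltpi2.
have qE : q = T * p by rewrite -(atanK T) /tan divfK ?gt_eqF // atanK.
have pq1 : p ^+ 2 + q ^+ 2 = 1 := cos2Dsin2 _.
have D0 u : 0 < u -> 0 < q ^+ 2 + p ^+ 2 * u ^+ 2.
  by move=> u0; apply: sqr_denom_gt0 => //; rewrite gt_eqF.
have pT : p ^+ 2 * (1 + T ^+ 2) = 1 by rewrite -[RHS]pq1 qE; ring.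
exists (atan T + atan T); split.
  have := atan_gtNpi2 T; have := atan_ltpi2 T => h1 h2.
  by apply/andP; split; lra.
pose h : 'M[R]_2 := \matrix_(i, j) (if i == 0 then (if j == 0 then q else - p) else (if j == 0 then p else q)).
have hd : \det h = 1 by rewrite det2E !mxE /= -pq1; ring.
have cE u : mobius h (0 +i* expR u) = (q * p * (expR u ^+ 2 - 1) / (q ^+ 2 + p ^+ 2 * expR u ^+ 2)) +i*
     (expR u / (q ^+ 2 + p ^+ 2 * expR u ^+ 2)).
  rewrite mobius_imag ?expR_gt0 // !mxE /=; apply/eqP; rewrite eq_complex /= eqxx andbT.
  by apply/eqP; congr (_ / _); ring.
exists (fun u => mobius h (0 +i* expR u)); split.
- by exists h.
- rewrite cE expR0 !expr1n subrr mulr0 mul0r mulr1 addrC pq1 divr1 //.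
- exists (ln E); first by rewrite ln_gt0.
  rewrite cE lnK ?posrE //.
  have dE : q ^+ 2 + p ^+ 2 * E ^+ 2 = E / y.
    apply: (mulIf (lt0r_neq0 y0)); rewrite divfK ?gt_eqF //.
    apply: (mulIf (lt0r_neq0 y0)).
    rewrite [LHS](_ : _ = p ^+ 2 * (T * (y ^+ 2 * T) + (E * y) ^+ 2)); last by rewrite qE; ring.
    rewrite -TE Ey.
    rewrite [LHS](_ : _ = (p ^+ 2 * (1 + T ^+ 2)) * (1 + r * T)); last by ring.
    by rewrite pT mul1r.
  rewrite dE; apply/eqP; rewrite eq_complex /=; apply/andP; split; apply/eqP; last first.
    by rewrite invf_div mulrC divfK // gt_eqF.
  rewrite qE invf_div.
  have -> : T * p * p * (E ^+ 2 - 1) * (y / E) = p ^+ 2 * T * ((E * y) ^+ 2 - y ^+ 2) / (E * y).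
    by field; rewrite !gt_eqF.
  rewrite Ey; apply: (canLR (mulfK _)); first by rewrite gt_eqF // addr_gt0.
  rewrite [RHS](_ : _ = (p ^+ 2 * (1 + T ^+ 2)) * (r * (1 + r * T))); last by rewrite pT mul1r.
  rewrite [LHS](_ : _ = p ^+ 2 * (T * (1 + r * T) ^+ 2 - y ^+ 2 * T)); last by ring.
  by rewrite -TE; ring.
- have [d1 d2] := is_derive_geodesic pq1.
  have e1 : (fun s0 : R => complex.Re (mobius h (0 +i* expR s0))) = (fun s : R => q * p * (expR s ^+ 2 - 1) / (q ^+ 2 + p ^+ 2 * expR s ^+ 2)).
    by apply/funext => u; rewrite cE.
  have e2 : (fun s0 : R => complex.Im (mobius h (0 +i* expR s0))) = (fun s : R => expR s / (q ^+ 2 + p ^+ 2 * expR s ^+ 2)).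
    by apply/funext => u; rewrite cE.
  split; [rewrite e1; apply: is_derive_eq d1 _|rewrite e2; apply: is_derive_eq d2 _] => /=.
    by rewrite sinD -/p -/q; ring.
  by rewrite cosD -/p -/q; ring.
Qed.
End AngleTangent.

(** * Integer matrices of determinant 1 *)

Section Matrices.
Local Open Scope ring_scope.
Implicit Types g h M : 'M[int]_2.

Lemma ord2 (i : 'I_2) : i = 0 \/ i = 1.
Proof. by case: i => [[|[|//]] ?]; [left|right]; apply: val_inj. Qed.

Lemma mx2P (K : Type) (A B : 'M[K]_2) : A 0 0 = B 0 0 -> A 0 1 = B 0 1 ->
  A 1 0 = B 1 0 -> A 1 1 = B 1 1 -> A = B.
Proof.
by move=> e1 e2 e3 e4; apply/matrixP => i j; case: (ord2 i) => ->; case: (ord2 j) => ->.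
Qed.

Lemma nneg4 M : (forall i j, 0 <= M i j) <-> [/\ 0 <= M 0 0, 0 <= M 0 1, 0 <= M 1 0 & 0 <= M 1 1].
Proof.
split=> [nn|[a b c d] i j]; first by split; apply: nn.
by case: (ord2 i) => ->; case: (ord2 j) => ->.
Qed.

Lemma mul2E (A B : 'M[int]_2) i j : (A *m B) i j = A i 0 * B 0 j + A i 1 * B 1 j.
Proof.
rewrite mxE !big_ord_recl big_ord0 addr0; congr (_ * _ + _ * _).
  by congr (A _ _); apply: val_inj.
by congr (B _ _); apply: val_inj.
Qed.

Definition adj2 g : 'M[int]_2 :=
  \matrix_(i, j) (if i == 0 then (if j == 0 then g 1 1 else - g 0 1)
                  else (if j == 0 then - g 1 0 else g 0 0)).

Lemma adj2E g : (adj2 g 0 0 = g 1 1) * (adj2 g 0 1 = - g 0 1) *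
  (adj2 g 1 0 = - g 1 0) * (adj2 g 1 1 = g 0 0).
Proof. by rewrite !mxE. Qed.

Lemma det_adj2 g : \det (adj2 g) = \det g.
Proof. by rewrite !det2E !adj2E; ring. Qed.

Lemma adj2K g : adj2 (adj2 g) = g.
Proof. by apply: mx2P; rewrite !adj2E ?opprK. Qed.

Lemma one2E : ((1%:M : 'M[int]_2) 0 0 = 1) * ((1%:M : 'M[int]_2) 0 1 = 0) *
  ((1%:M : 'M[int]_2) 1 0 = 0) * ((1%:M : 'M[int]_2) 1 1 = 1).
Proof. by rewrite !mxE. Qed.

Lemma mul_adj2 g : \det g = 1 -> g *m adj2 g = 1%:M.
Proof.
rewrite det2E => d; apply: mx2P; rewrite mul2E !adj2E one2E -?d; ring.
Qed.

Lemma adj2_mul g : \det g = 1 -> adj2 g *m g = 1%:M.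
Proof.
rewrite det2E => d; apply: mx2P; rewrite mul2E !adj2E one2E -?d; ring.
Qed.

Lemma adj2M g h : adj2 (g *m h) = adj2 h *m adj2 g.
Proof. by apply: mx2P; rewrite !adj2E !mul2E !adj2E; ring. Qed.

Lemma GammaIP g : GammaI g <-> [/\ \det g = 1, 0 < g 1 0, 0 < g 1 1, 0 <= g 0 1 & 0 < g 0 0 <= g 1 0].
Proof.
have q0 (n : int) : 0 < n -> 0 < n%:Q by rewrite ltr0z.
split=> [[d nn c0 d0 [h1 /andP[h2 h3]]]|[d c0 d0 b0 /andP[a0 ac]]].
  have c1 : 0 < g 1 0 by rewrite lt_neqAle eq_sym c0 nn.
  have d1 : 0 < g 1 1 by rewrite lt_neqAle eq_sym d0 nn.
  split => //; apply/andP; split.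
    rewrite lt_neqAle nn andbT eq_sym; apply/eqP => a0; move: h2.
    by rewrite a0 mul0r ltNge h1.
  by move: h3; rewrite ler_pdivrMr ?q0 // mul1r ler_int.
split => //.
- by apply/nneg4; split; rewrite // ltW.
- by rewrite gt_eqF.
- by rewrite gt_eqF.
split; first by rewrite divr_ge0 // ?ler0z // ltW.
apply/andP; split; last by rewrite ler_pdivrMr ?q0 // mul1r ler_int.
rewrite ltr_pdivrMr ?q0 // mulrAC ltr_pdivlMr ?q0 // -!intrM ltr_int.
by move: d; rewrite det2E; move: (g 0 0) (g 0 1) (g 1 0) (g 1 1) => *; lia.
Qed.

Lemma GammaI_inj g h : GammaI g -> GammaI h -> g 1 0 = h 1 0 -> g 1 1 = h 1 1 -> g = h.
Proof.
move=> /GammaIP[dg cg dg0 bg /andP[ag acg]] /GammaIP[dh ch dh0 bh /andP[ah ach]] ec ed.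
rewrite det2E in dg; rewrite det2E in dh; rewrite -ec -ed in dh.
have e : (g 0 0 - h 0 0) * g 1 1 = (g 0 1 - h 0 1) * g 1 0.
  move: dg dh; move: (g 0 0) (g 0 1) (g 1 0) (g 1 1) (h 0 0) (h 0 1) => *; lia.
have ea : g 0 0 = h 0 0.
  have cop : coprimez (g 1 0) (g 1 1).
    apply/coprimezP; exists (- g 0 1, g 0 0) => /=; move: dg.
    by move: (g 0 0) (g 0 1) (g 1 0) (g 1 1) => *; lia.
  have : ((g 1 0)%R %| (g 0 0 - h 0 0)%R)%Z by rewrite -(Gauss_dvdzl _ cop) e dvdz_mull.
  case/dvdzP => q eq.
  have q0 : q = 0 by nia.
  by move: eq; rewrite q0 mul0r => /eqP; rewrite subr_eq0 => /eqP.
apply: mx2P => //.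
have c0 : g 1 0 != 0 by rewrite gt_eqF.
move: e; rewrite ea subrr mul0r => /esym/eqP; rewrite mulf_eq0 (negPf c0) orbF.
by rewrite subr_eq0 => /eqP.
Qed.

(** Lagrange's identity for the two rows. *)
Lemma XYZ g : \det g = 1 -> Xg g * Yg g = Zg g ^+ 2 + 1.
Proof. rewrite det2E /Xg /Yg /Zg => d.
rewrite -[X in _ = _ + X](expr1n _ 2) -[X in _ = _ + X ^+ 2]d.
by move: (g 0 0) (g 0 1) (g 1 0) (g 1 1) => *; ring. Qed.

Lemma norm_quotient g h : Xg (adj2 g *m h) + Yg (adj2 g *m h) =
  Yg g * Xg h + Xg g * Yg h - 2 * Zg g * Zg h.
Proof. by rewrite /Xg /Yg /Zg !mul2E !adj2E; ring. Qed.

Lemma Yg_gt0 g : \det g = 1 -> 0 < Yg g.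
Proof.
move=> d; have Y0 : 0 <= Yg g by rewrite addr_ge0 ?sqr_ge0.
rewrite lt_neqAle Y0 andbT eq_sym; apply/eqP => y0; have := XYZ d.
by rewrite y0 mulr0 => /eqP; rewrite eq_sym gt_eqF // ltr_wpDl ?sqr_ge0.
Qed.

Lemma finite_norm_le (k : int) : finite_set [set M | Xg M + Yg M <= k].
Proof.
have [n kn] : exists n : nat, k <= n%:Z by exists `|k|%N; lia.
pose f (t : 'I_(n + n).+1 * 'I_(n + n).+1 * ('I_(n + n).+1 * 'I_(n + n).+1)) : 'M[int]_2 :=
  \matrix_(i, j) (if i == 0 then (if j == 0 then t.1.1%:Z else t.1.2%:Z)
                  else (if j == 0 then t.2.1%:Z else t.2.2%:Z)) - const_mx n%:Z.
apply: (@sub_finite_set _ _ (f @` setT)); last by apply: finite_image; exact: finite_finset.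
move=> M /= hM.
have e (x : int) : x ^+ 2 <= n%:Z -> (absz (x + n%:Z)%R < (n + n).+1)%N /\ 0 <= x + n%:Z.
  by rewrite expr2 => h; split; nia.
have s0 := sqr_ge0 (M 0 0); have s1 := sqr_ge0 (M 0 1).
have s2 := sqr_ge0 (M 1 0); have s3 := sqr_ge0 (M 1 1).
rewrite /Xg /Yg in hM.
have [h0 p0] := e (M 0 0) ltac:(lia); have [h1 p1] := e (M 0 1) ltac:(lia).
have [h2 p2] := e (M 1 0) ltac:(lia); have [h3 p3] := e (M 1 1) ltac:(lia).
exists (Ordinal h0, Ordinal h1, (Ordinal h2, Ordinal h3)) => //.
by apply: mx2P; rewrite !mxE /=; lia.
Qed.

(* Pairs g, g M whose connecting matrix M has a negative entry: up to swapping g and g M, the upper left one. *)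
Definition leftS : set 'M[int]_2 := [set M | \det M = 1 /\ M 0 0 <= 0].
Definition baseS : set 'M[int]_2 := frakS `|` leftS.

Lemma disj_frakS_leftS M : frakS M -> ~ leftS M.
Proof.
move=> [d /nneg4[n0 n1 n2 n3] _] [_ h]; move: d n0 n1 n2 n3 h; rewrite det2E.
by move: (M 0 0) (M 0 1) (M 1 0) (M 1 1) => *; nia.
Qed.

Lemma baseS_det M : baseS M -> \det M = 1.
Proof. by case => [[]|[]]. Qed.

Lemma baseS_neq1 M : baseS M -> M <> 1%:M.
Proof. by case => [[]//|[_ h] e]; move: h; rewrite e one2E. Qed.

(** If both diagonal entries are positive, the product of the other two is a d - 1 >= 0, so these
    have the same sign, and M or its inverse has nonnegative entries. Otherwise the upper left entry
    of M or of its inverse is nonpositive. *)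
Lemma baseS_total M : \det M = 1 -> M <> 1%:M -> baseS M \/ baseS (adj2 M).
Proof.
move=> d n1.
have [h|h0] := leP (M 0 0) 0; first by left; right.
have [h|h1] := leP (M 1 1) 0; first by right; right; rewrite /leftS /= det_adj2 adj2E.
have [/andP[h h']|nn] := boolP ((0 <= M 0 1) && (0 <= M 1 0)).
  by left; left; split => //; apply/nneg4; split => //; exact: ltW.
right; left; split; first by rewrite det_adj2.
  apply/nneg4; rewrite !adj2E; move: d nn h0 h1; rewrite det2E.
  move: (M 0 0) (M 0 1) (M 1 0) (M 1 1) => *; split; nia.
by move=> e; apply: n1; rewrite -(adj2K M) e; apply: mx2P; rewrite adj2E !one2E ?oppr0.
Qed.

(** With [baseS_total], exactly one orientation of a pair lies in [baseS]. The row (c, d) and its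
    image under M are positive, which prevents the mixed cases and the case of two nonpositive upper
    left entries. *)
Lemma baseS_excl M (c d : int) : 0 < c -> 0 < d -> 0 < c * M 0 0 + d * M 1 0 ->
  0 < c * M 0 1 + d * M 1 1 -> baseS M -> ~ baseS (adj2 M).
Proof.
move=> c0 d0 A D [[dM /nneg4[n1 n2 n3 n4] ne]|[dM h]] [[dM' /nneg4[]]|[dM' h']]; rewrite ?adj2E.
- move=> m1 m2 m3 m4 _; apply: ne; move: dM n1 n2 n3 n4 m1 m2 m3 m4; rewrite det2E.
  move=> dM n1 n2 n3 n4 m1 m2 m3 m4.
  have e1 : M 0 1 = 0 by apply/eqP; rewrite eq_le n2 -oppr_ge0 m2.
  have e2 : M 1 0 = 0 by apply/eqP; rewrite eq_le n3 -oppr_ge0 m3.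
  have u (a b : int) : 0 <= a -> 0 <= b -> a * b = 1 -> a = 1.
    move=> a0 b0 /(congr1 absz); rewrite abszM => /eqP; rewrite muln_eq1 => /andP[/eqP ha _].
    by rewrite -(gez0_abs a0) ha.
  move: dM; rewrite e1 mul0r subr0 => dM.
  by apply: mx2P; rewrite one2E ?e1 ?e2 //; [exact: u n1 n4 dM|rewrite mulrC in dM; exact: u n4 n1 dM].
- move: h' dM n1 n2 n3 n4; rewrite adj2E det2E; move: (M 0 0) (M 0 1) (M 1 0) (M 1 1) A D => *; nia.
- by move: dM h; rewrite det2E; move: (M 0 0) (M 0 1) (M 1 0) (M 1 1) A D => *; nia.
- move: dM h h'; rewrite adj2E det2E.
  move: (M 0 0) (M 0 1) (M 1 0) (M 1 1) A D => a b e f A D dM h h'.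
  have : 0 < e by nia.
  have : 0 < b by nia.
  nia.
Qed.
End Matrices.

(** * Coordinates of a matrix and its half-angle tangent *)

Section Tangent.
Variable R : realType.
Local Open Scope ring_scope.
Implicit Types g h M : 'M[int]_2.

Definition XR g : R := (Xg g)%:~R.
Definition YR g : R := (Yg g)%:~R.
(** The real part of g i; the imaginary part is the inverse of [YR g]. *)
Definition rr g : R := (Zg g)%:~R / YR g.
Definition cR g : R := (g 1 0)%:~R.
Definition vv g : R := (g 1 1)%:~R / (g 1 0)%:~R.
Definition zz g : R := (g 0 0)%:~R / (g 1 0)%:~R.

Lemma GammaI_det g : GammaI g -> \det g = 1. Proof. by case/GammaIP. Qed.

Lemma cR_ge1 g : GammaI g -> 1 <= cR g.
Proof. by case/GammaIP => _ c0 _ _ _; rewrite /cR (ler_int _ 1). Qed.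

Lemma cR_gt0 g : GammaI g -> 0 < cR g.
Proof. by move=> /cR_ge1; apply: lt_le_trans. Qed.

Lemma YR_gt0 g : \det g = 1 -> 0 < YR g.
Proof. by move=> d; rewrite /YR ltr0z Yg_gt0. Qed.

Lemma vv_gt0 g : GammaI g -> 0 < vv g.
Proof. by case/GammaIP => _ c0 d0 _ _; rewrite divr_gt0 // ltr0z. Qed.

Lemma zz_bounds g : GammaI g -> 0 < zz g <= 1.
Proof.
case/GammaIP => _ c0 d0 _ /andP[a0 ac]; have cp : 0 < (g 1 0)%:~R :> R by rewrite ltr0z.
by rewrite divr_gt0 ?ltr0z //= ler_pdivrMr // mul1r ler_int.
Qed.

Lemma YR_vv g : GammaI g -> YR g = cR g ^+ 2 * (1 + vv g ^+ 2).
Proof.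
move=> gG; have := cR_gt0 gG; rewrite /YR /Yg /vv /cR intrD !intrM => c0.
by field; rewrite gt_eqF.
Qed.

Lemma rr_zz g : GammaI g -> rr g = zz g - vv g / YR g.
Proof.
move=> gG; have := cR_gt0 gG; have := YR_gt0 (GammaI_det gG).
have := GammaI_det gG; rewrite det2E => d.
have : (g 0 0)%:~R * (g 1 1)%:~R - (g 0 1)%:~R * (g 1 0)%:~R = 1 :> R.
  by rewrite -!intrM -intrB d.
rewrite /rr /zz /vv /cR /YR /Yg /Zg !intrD !intrM.
move: (g 0 0)%:~R (g 0 1)%:~R (g 1 0)%:~R (g 1 1)%:~R => a b c e D Y0 c0.
have -> : a * c + b * e = (a * (c * c + e * e) - e * (a * e - b * c)) / c by field; rewrite gt_eqF.
by rewrite D; field; rewrite !gt_eqF.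
Qed.

Lemma XR_rr g : \det g = 1 -> XR g = YR g * rr g ^+ 2 + (YR g)^-1.
Proof.
move=> d; have Y0 := YR_gt0 d.
have : XR g * YR g = (Zg g)%:~R ^+ 2 + 1 by rewrite /XR /YR -intrM XYZ // intrD !expr2 intrM.
rewrite /rr => e; apply: (mulIf (lt0r_neq0 Y0)); rewrite e.
by field; rewrite gt_eqF.
Qed.

Lemma YR_ge2 g : GammaI g -> 2 <= YR g.
Proof.
case/GammaIP => _ c0 d0 _ _; rewrite /YR (ler_int _ 2%:Z) /Yg.
by move: (g 1 0) (g 1 1) c0 d0 => c d; nia.
Qed.

Lemma rr_bounds g : GammaI g -> 0 < rr g <= 1.
Proof.
move=> gG; have Y0 := YR_gt0 (GammaI_det gG); have := gG.
case/GammaIP => dg c0 d0 b0 /andP[a0 ac].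
have z0 : 0 < Zg g.
  by rewrite /Zg; move: (g 0 0) (g 0 1) (g 1 0) (g 1 1) c0 d0 b0 a0 => *; nia.
apply/andP; split; first by rewrite /rr divr_gt0 // ltr0z.
rewrite /rr ler_pdivrMr // mul1r /YR ler_int /Zg /Yg.
move: dg; rewrite det2E; move: (g 0 0) (g 0 1) (g 1 0) (g 1 1) c0 d0 b0 a0 ac => a b c d *.
have : b <= d by nia.
nia.
Qed.

Lemma mobius_i g : \det g = 1 ->
  mobius (map_mx intr g) (0 +i* 1)%C = (rr g +i* (YR g)^-1)%C.
Proof.
move=> d; rewrite mobius_imag //; last by rewrite det_map_mx d.
rewrite !mxE expr1n !mulr1 div1r /rr /YR /Yg /Zg !intrD !intrM -!expr2.
by rewrite ![_ + (g 1 1)%:~R ^+ 2]addrC [X in (X / _)%R]addrC.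
Qed.

(** The quadratic equation reads T - r = y^2 T / (r T + 1) with y the inverse of [YR g], and T <= 2.
    So differences of tangents may be replaced by differences of [rr]. *)
Lemma tanhalf_spec g : GammaI g -> rr g < tanhalf g :> R /\ tanhalf g - rr g <= 2 / YR g ^+ 2.
Proof.
move=> gG; have /andP[r0 r1] := rr_bounds gG; have Y2 := YR_ge2 gG.
have Y0 : 0 < YR g by lra.
have : is_angle (mobius (map_mx intr g) (0 +i* 1)%C) (theta g : R).
  have [th h] : exists th : R, is_angle (mobius (map_mx intr g) (0 +i* 1)%C) th.
    rewrite mobius_i ?GammaI_det //; apply: angle_exists => //.
    by rewrite invr_gt0 Y0 invf_lt1 //; lra.
  exact: (@xgetPex _ 0 [set t | is_angle (mobius (map_mx intr g) (0 +i* 1)%C) t] (ex_intro _ th h)).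
rewrite mobius_i ?GammaI_det // => /(angle_tan r0); rewrite -/(tanhalf g) exprVn.
move: (rr g) (tanhalf g) (YR g) r0 r1 Y2 Y0 => r T Y r0 r1 Y2 Y0 [T0 e].
have rT : 0 < r * T by rewrite mulr_gt0.
have p0 : 0 < (Y ^+ 2)^-1 by rewrite invr_gt0 exprn_gt0.
have e1 : 0 < T - r.
  by rewrite -(pmulr_rgt0 _ (_ : 0 < r * T + 1)) ?e ?mulr_gt0 //; lra.
split; first by lra.
have h1 : T - r <= (Y ^+ 2)^-1 * T by rewrite -e ler_peMl //; lra.
have h2 : (Y ^+ 2)^-1 <= 1 / 4.
  rewrite div1r lef_pV2 ?posrE ?exprn_gt0 //; rewrite expr2; nra.
have T2 : T <= 2 by nra.
rewrite mulrC; apply: (le_trans h1); rewrite ler_pM2l //.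
Qed.

Lemma normg_le g (Q : R) : \det g = 1 -> 0 <= Q ->
  (normg g <= Q) = (YR g * (1 + rr g ^+ 2) + (YR g)^-1 <= Q ^+ 2).
Proof.
move=> d Q0; rewrite /normg intrD -/(XR g) -/(YR g).
have h0 : 0 <= XR g + YR g by rewrite addr_ge0 // ler0z ?addr_ge0 ?sqr_ge0.
rewrite (_ : YR g * _ + _ = XR g + YR g); last by rewrite XR_rr //; ring.
rewrite -(@ler_pXn2r _ 2%N) ?nnegrE ?sqrtr_ge0 ?sqr_sqrtr //.
Qed.

(** Both sides are twice the hyperbolic cosine of the distance between g i and h i. *)
Lemma norm_rr g h : \det g = 1 -> \det h = 1 ->
  XR (adj2 g *m h) + YR (adj2 g *m h) =
  YR g * YR h * (rr g - rr h) ^+ 2 + YR g / YR h + YR h / YR g.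
Proof.
move=> dg dh; have Yg0 := YR_gt0 dg; have Yh0 := YR_gt0 dh.
rewrite /XR /YR -intrD norm_quotient intrB intrD !intrM -/(XR g) -/(XR h) -/(YR g) -/(YR h).
rewrite !XR_rr // /rr; move: (YR g) (YR h) Yg0 Yh0 => y y' y0 y0'.
by field; rewrite !gt_eqF.
Qed.

End Tangent.

Section PairCoordinates.
Variable R : realType.
Local Open Scope ring_scope.
Implicit Types (g h M : 'M[int]_2) (v : R).

(** [a1 M v] and [a2 M v] are the entries of the row (1, v) M, and [qM] is its squared length. *)
Definition a1 M v : R := (M 0 0)%:~R + v * (M 1 0)%:~R.
Definition a2 M v : R := (M 0 1)%:~R + v * (M 1 1)%:~R.
Definition qM M v : R := a1 M v ^+ 2 + a2 M v ^+ 2.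
Definition nM M v : R := v * ((Yg M)%:~R - (Xg M)%:~R) + (1 - v ^+ 2) * (Zg M)%:~R.
(** x^2 times |[XiM]| at (x, x v); this depends on v alone because [XiM] is homogeneous of degree
    -2. *)
Definition bM M v : R := `|nM M v| / ((1 + v ^+ 2) * qM M v).

Lemma quadME M (x y : R) : quadM M x y =
  (x * (M 0 0)%:~R + y * (M 1 0)%:~R) ^+ 2 + (x * (M 0 1)%:~R + y * (M 1 1)%:~R) ^+ 2.
Proof. by rewrite /quadM /Xg /Yg /Zg !intrD !intrM -!expr2; ring. Qed.

(** Complete (x, y) to a matrix g of determinant 1 with upper row (a, b): then [XiM] is the
    difference of the real parts of g i and g M i. The choice of (a, b) is free. *)
Lemma XiM_diff M (a b x y : R) : a * y - b * x = 1 ->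
  0 < x ^+ 2 + y ^+ 2 -> 0 < quadM M x y ->
  (a * x + b * y) / (x ^+ 2 + y ^+ 2) -
  ((a * (M 0 0)%:~R + b * (M 1 0)%:~R) * (x * (M 0 0)%:~R + y * (M 1 0)%:~R) +
   (a * (M 0 1)%:~R + b * (M 1 1)%:~R) * (x * (M 0 1)%:~R + y * (M 1 1)%:~R)) / quadM M x y
  = XiM M x y.
Proof.
move=> d p0 q0; rewrite /XiM.
apply: (mulIf (lt0r_neq0 p0)); apply: (mulIf (lt0r_neq0 q0)).
rewrite [RHS](_ : _ = (a * y - b * x) * (x * y * ((Yg M)%:~R - (Xg M)%:~R) + (x ^+ 2 - y ^+ 2) * (Zg M)%:~R)).
  rewrite mulrBl mulrBl divfK ?gt_eqF // -[X in _ - X]mulrA [X in _ - X](mulrC) mulrA.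
  rewrite -[(x ^+ 2 + y ^+ 2) * _ * _]mulrA mulrC.
  rewrite [X in _ - X](_ : _ = (x ^+ 2 + y ^+ 2) * ((a * (M 0 0)%:~R + b * (M 1 0)%:~R) * (x * (M 0 0)%:~R + y * (M 1 0)%:~R) +
   (a * (M 0 1)%:~R + b * (M 1 1)%:~R) * (x * (M 0 1)%:~R + y * (M 1 1)%:~R))).
    by rewrite quadME /Xg /Yg /Zg !intrD !intrM -!expr2; ring.
  by field; rewrite gt_eqF.
rewrite d mul1r -[LHS]mulrA divfK // mulf_neq0 ?gt_eqF //.
Qed.

Lemma qM_quadM M (x v : R) : quadM M x (x * v) = x ^+ 2 * qM M v.
Proof. by rewrite quadME /qM /a1 /a2; ring. Qed.

Lemma qM_gt0 M v : \det M = 1 -> 0 < qM M v.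
Proof.
rewrite det2E => d; rewrite lt_neqAle addr_ge0 ?sqr_ge0 // andbT eq_sym.
rewrite /qM paddr_eq0 ?sqr_ge0 // !sqrf_eq0; apply/negP => /andP[/eqP h1 /eqP h2].
have : (M 0 0)%:~R * (M 1 1)%:~R - (M 0 1)%:~R * (M 1 0)%:~R = 1 :> R.
  by rewrite -!intrM -intrB d.
move: h1 h2; rewrite /a1 /a2 => /eqP; rewrite addr_eq0 => /eqP -> /eqP.
by rewrite addr_eq0 => /eqP -> /eqP; rewrite (_ : _ - _ = 0) ?[0 == 1]eq_sym ?oner_eq0 //; ring.
Qed.

Lemma sqrD1_gt0 v : 0 < 1 + v ^+ 2.
Proof. by rewrite ltr_pwDl // sqr_ge0. Qed.

Lemma XiM_bM M (x v : R) : \det M = 1 -> 0 < x -> `|XiM M x (x * v)| = bM M v / x ^+ 2.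
Proof.
move=> d x0; have q0 := qM_gt0 v d; have p0 := sqrD1_gt0 v.
have x2 : 0 < x ^+ 2 by rewrite exprn_gt0.
have -> : XiM M x (x * v) = nM M v / ((1 + v ^+ 2) * qM M v) / x ^+ 2.
  rewrite /XiM qM_quadM /nM; move: (qM M v) q0 => q q0.
  by field; rewrite !gt_eqF //= ?ltr_pwDl ?sqr_ge0 // exprMn -[X in X + _]mulr1 -mulrDr mulr_gt0.
have pq : 0 < (1 + v ^+ 2) * qM M v by rewrite mulr_gt0.
by rewrite 2!normrM !normfV (gtr0_norm x2) (gtr0_norm pq).
Qed.

Lemma bM_ge0 M v : \det M = 1 -> 0 <= bM M v.
Proof.
by move=> d; rewrite divr_ge0 // mulr_ge0 // ltW ?qM_gt0 ?sqrD1_gt0.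
Qed.

Lemma cR_mul g M : GammaI g -> (g *m M) 1 0 = g 1 0 * M 0 0 + g 1 1 * M 1 0 /\
  cR R (g *m M) = cR R g * a1 M (vv R g).
Proof.
move=> gG; have := cR_gt0 R gG; rewrite /cR mul2E => c0; split => //.
by rewrite intrD !intrM /a1 /vv; field; rewrite gt_eqF.
Qed.

Lemma dR_mul g M : GammaI g -> (((g *m M) 1 1)%:~R : R) = cR R g * a2 M (vv R g).
Proof.
move=> gG; have := cR_gt0 R gG; rewrite /cR mul2E => c0.
by rewrite intrD !intrM /a2 /vv; field; rewrite gt_eqF.
Qed.

Lemma YR_mul g M : GammaI g -> YR R (g *m M) = cR R g ^+ 2 * qM M (vv R g).
Proof.
move=> gG; rewrite /YR /Yg intrD !expr2 !intrM -/(cR R _) (cR_mul _ gG).2 dR_mul //.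
by rewrite /qM; ring.
Qed.

Lemma rr_mul g M : GammaI g -> \det M = 1 ->
  `|rr R g - rr R (g *m M)| = bM M (vv R g) / cR R g ^+ 2.
Proof.
move=> gG dM; have c0 := cR_gt0 R gG.
rewrite -(XiM_bM _ dM c0).
have e1 : cR R g * vv R g = (g 1 1)%:~R by rewrite /vv /cR mulrC divfK // gt_eqF.
rewrite e1 -(@XiM_diff _ (g 0 0)%:~R (g 0 1)%:~R).
- rewrite quadME /rr /YR /Yg /Zg /cR !mul2E !intrD !expr2 !intrM !intrD !intrM; congr (`| _ |).
- by rewrite /cR -!intrM -intrB; have := GammaI_det gG; rewrite det2E => ->.
- by have := YR_gt0 R (GammaI_det gG); rewrite /YR /Yg intrD !expr2 !intrM.
- by rewrite -e1 qM_quadM mulr_gt0 ?exprn_gt0 // qM_gt0.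
Qed.

Lemma tanhalf_diff g h : GammaI g -> GammaI h ->
  `|(tanhalf g - tanhalf h) - (rr R g - rr R h)| <= 2 / YR R g ^+ 2 + 2 / YR R h ^+ 2.
Proof.
move=> /(tanhalf_spec R)[g1 g2] /(tanhalf_spec R)[h1 h2].
rewrite ler_norml; apply/andP; split; lra.
Qed.
End PairCoordinates.

(** * Counting in finite sets *)

Section Counting.
Local Open Scope classical_set_scope.

Definition cnt (T : choiceType) (A : set T) : nat := #|` fset_set A|.

Lemma cnt_sub (T : choiceType) (A B : set T) : finite_set B -> A `<=` B -> (cnt A <= cnt B)%N.
Proof.
move=> fB AB; have fA := sub_finite_set AB fB.
by apply: fsubset_leq_card; rewrite -fset_set_sub.
Qed.

Lemma cnt0 (T : choiceType) : cnt (@set0 T) = 0%N.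
Proof. by rewrite /cnt fset_set0 cardfs0. Qed.

Lemma cntU_le (T : choiceType) (A B : set T) : finite_set A -> finite_set B ->
  (cnt (A `|` B) <= cnt A + cnt B)%N.
Proof. by move=> fA fB; rewrite /cnt fset_setU //; exact: leq_card_fsetU. Qed.

Lemma cntU (T : choiceType) (A B : set T) : finite_set A -> finite_set B ->
  (forall x, A x -> ~ B x) -> cnt (A `|` B) = (cnt A + cnt B)%N.
Proof.
move=> fA fB d; rewrite /cnt fset_setU // -[LHS]addn0 -cardfsUI; congr (_ + _)%N.
apply/esym/eqP; rewrite cardfs_eq0; apply/eqP/fsetP => x.
rewrite in_fsetI !in_fset_set // in_fset0; apply/negP => /andP[/set_mem a /set_mem b].
exact: d a b.
Qed.

Lemma cnt_cover (T : choiceType) (I : eqType) (s : seq I) (A : set T) (B : I -> set T) :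
  (forall i, i \in s -> finite_set (B i)) ->
  (forall x, A x -> exists2 i, i \in s & B i x) ->
  (cnt A <= \sum_(i <- s) cnt (B i))%N.
Proof.
elim: s A => [|i s IH] A fB cov.
  rewrite big_nil leqn0 /cnt (_ : A = set0) ?fset_set0 //.
  by apply/seteqP; split => // x /cov[].
have fBi : finite_set (B i) by apply: fB; rewrite mem_head.
have fA : finite_set A.
  apply: (@sub_finite_set _ _ (\bigcup_(j in [set` i :: s]) B j)).
    by move=> x /cov[j js Bj]; exists j.
  by apply: bigcup_finite => [|j /= js]; [exact: finite_seq|exact: fB].
rewrite big_cons; have -> : A = (A `&` B i) `|` (A `\` B i).
  by rewrite setUIDK.
apply: leq_trans (cntU_le _ _) _; first exact: finite_setIl.
  exact: finite_setD.
apply: leq_add; first by apply: cnt_sub => // x [].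
apply: IH => [j js|x [/cov[j]]]; first by apply: fB; rewrite inE js orbT.
by rewrite inE => /orP[/eqP -> //|js Bj _]; exists j.
Qed.

Lemma sum_cnt (T : choiceType) (I : eqType) (s : seq I) (A : set T) (B : I -> set T) :
  finite_set A -> uniq s -> (forall i, i \in s -> B i `<=` A) ->
  (forall i j x, i \in s -> j \in s -> B i x -> B j x -> i = j) ->
  (\sum_(i <- s) cnt (B i) <= cnt A)%N.
Proof.
elim: s A => [|i s IH] A fA us sub dis; first by rewrite big_nil.
move: us; rewrite /= => /andP[nis us].
have iS : i \in i :: s by rewrite mem_head.
have jS j : j \in s -> j \in i :: s by rewrite inE => ->; rewrite orbT.
have fBi : finite_set (B i) by apply: sub_finite_set (sub i iS) fA.
rewrite big_cons; have -> : A = B i `|` (A `\` B i).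
  by rewrite setDUK //; apply: sub.
rewrite cntU //; last first.
  - by move=> x Bx [].
  - exact: finite_setD.
rewrite leq_add2l; apply: IH => //; first exact: finite_setD.
  move=> j js x Bj; split; first exact: sub (jS j js) x Bj.
  by move=> Bi; move: nis; rewrite (dis i j x iS (jS j js) Bi Bj) js.
by move=> j k x js ks; apply: dis; apply: jS.
Qed.

Lemma cnt_inj (T U : choiceType) (f : T -> U) (A : set T) (B : set U) : finite_set A ->
  finite_set B -> (forall x y, A x -> A y -> f x = f y -> x = y) ->
  (forall x, A x -> B (f x)) -> (cnt A <= cnt B)%N.
Proof.
move=> fA fB inj AB; have inj' : {in fset_set A &, injective f}.
  by move=> x y; rewrite !in_fset_set // => /set_mem Ax /set_mem Ay; exact: inj.
rewrite /cnt -(card_in_imfset imfset_key inj').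
apply: fsubset_leq_card; apply/fsubsetP => y /imfsetP[x /=].
by rewrite !in_fset_set // => /set_mem Ax ->; apply/mem_set/AB.
Qed.

Lemma card_le_cnt (T : finType) (U : choiceType) (f : T -> U) (P : pred T) (B : set U) :
  finite_set B -> {in P &, injective f} -> (forall x, P x -> B (f x)) -> (#|P| <= cnt B)%N.
Proof.
move=> fB inj PB; apply: (@leq_trans (cnt [set` P])); last first.
  by apply: (cnt_inj (f := f)).
rewrite /cnt; suff -> : fset_set [set` P] = [fset x in P]%fset by rewrite card_finset.
apply/fsetP => x; rewrite in_fset_set ?finite_finset // !inE /=.
by apply/idP/idP => [/set_mem|h]; [|apply/mem_set].
Qed.

Lemma cnt_le_card (T : finType) (U : choiceType) (f : U -> T) (P : pred T) (B : set U) :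
  finite_set B -> (forall x y, B x -> B y -> f x = f y -> x = y) -> (forall x, B x -> P (f x)) ->
  (cnt B <= #|P|)%N.
Proof.
move=> fB inj PB; apply: (@leq_trans (cnt [set` P])).
  apply: (cnt_inj (f := f)) => //.
rewrite /cnt; suff -> : fset_set [set` P] = [fset x in P]%fset by rewrite card_finset.
apply/fsetP => x; rewrite in_fset_set ?finite_finset // !inE /=.
by apply/idP/idP => [/set_mem|h]; [|apply/mem_set].
Qed.
End Counting.

(** * Equidistribution of the coordinates of matrices *)

Section Cells.
Variable R : realType.
Local Open Scope classical_set_scope.
Local Open Scope ring_scope.
Implicit Types (g : 'M[int]_2) (Q : R).

Lemma finite_GammaI (N : nat) : finite_set [set g | GammaI g /\ g 1 0 <= N%:Z /\ g 1 1 <= N%:Z].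
Proof.
apply: (sub_finite_set _ (finite_norm_le (4 * N%:Z ^+ 2))) => g /= [/GammaIP[d c0 d0 b0 /andP[a0 ac]] [cN dN]].
move: d; rewrite /Xg /Yg det2E; move: (g 0 0) (g 0 1) (g 1 0) (g 1 1) c0 d0 b0 a0 ac cN dN => a b c d c0 d0 b0 a0 ac cN dN D.
have bd : b <= d by nia.
have e (x y : int) : 0 <= x -> x <= y -> x ^+ 2 <= y ^+ 2 by move=> x0 xy; rewrite !expr2; nia.
have := e a N%:Z ltac:(lia) ltac:(lia); have := e b N%:Z ltac:(lia) ltac:(lia).
have := e c N%:Z ltac:(lia) ltac:(lia); have := e d N%:Z ltac:(lia) ltac:(lia).
lia.
Qed.

Lemma finite_GammaI_real (B V : R) : finite_set [set g | GammaI g /\ cR R g <= B /\ vv R g <= V].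
Proof.
pose N := (Num.truncn (Num.max B 0)).+1; pose N' := (Num.truncn (Num.max (B * V) 0)).+1.
apply: (sub_finite_set _ (finite_GammaI (maxn N N'))) => g /= [gG [cB vV]]; split => //.
have c0 := cR_gt0 R gG; have v0 := vv_gt0 R gG.
have e (x : int) (y : R) (n : nat) : x%:~R <= y -> leq (Num.truncn (Num.max y 0)).+1 n -> x <= n%:Z.
  move=> xy yn; rewrite -(ler_int R); apply: (le_trans xy).
  apply: (@le_trans _ _ ((Num.truncn (Num.max y 0)).+1%:R)).
    by apply: (@le_trans _ _ (Num.max y 0)); [rewrite le_max lexx|apply: ltW; exact: truncnS_gt].
  by rewrite -[_%:~R]/(n%:R) ler_nat.
split; first by apply: e cB _; rewrite leq_maxl.
apply: (e _ (B * V)); last by rewrite leq_maxr.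
have -> : (g 1 1)%:~R = cR R g * vv R g by rewrite /vv /cR mulrC divfK // gt_eqF.
by apply: ler_pM => //; exact: ltW.
Qed.

(* Since |g|^2 = c^2(1+(d/c)^2)(1+(a/c)^2) up to lower order, the norm bound is asymptotically w(1+v^2)(1+z^2) <= 1 in these coordinates. *)
Definition PQ Q g : R * R * R := (vv R g, zz R g, (cR R g / Q) ^+ 2).

Definition cell (n j k l : nat) : set (R * R * R) :=
  [set p | [&& cellb n j p.1.1, cellb n k p.1.2 & cellb n l p.2]].

(** The matrix with entries a, c, d; its entry b = (a d - 1)/c is exact when a d = 1 modulo c. *)
Definition mkg (c d a : nat) : 'M[int]_2 :=
  \matrix_(i, j) (if i == 0 then (if j == 0 then a%:Z else ((a * d).-1 %/ c)%N%:Z)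
                  else (if j == 0 then c%:Z else d%:Z)).

Lemma mkgE c d a : ((mkg c d a 0 0 = a) * (mkg c d a 1 0 = c) * (mkg c d a 1 1 = d))%type.
Proof. by rewrite !mxE. Qed.

Lemma mkg_GammaI c d a : (0 < a <= c)%N -> (0 < d)%N -> a * d = 1 %[mod c] -> GammaI (mkg c d a).
Proof.
move=> /andP[a0 ac] d0 E; have c0 : (0 < c)%N by apply: leq_trans ac.
apply/GammaIP; split; rewrite ?mxE //=; last first.
  by rewrite ltz_nat lez_nat a0.
have ad : (0 < a * d)%N by rewrite muln_gt0 a0.
have dv : (c %| (a * d).-1)%N.
  by rewrite -subn1 -eqn_mod_dvd //; apply/eqP.
rewrite det2E !mxE /= -!PoszM (divnK dv) -subn1 -subzn // subKr //.
Qed.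

(** The entry d may exceed c. Its residue modulo c is a unit with inverse a, and subtracting the
    integer part of j/n from v = d/c brings the cell of v into (0, 1]. *)
Lemma unit_cells_count (n j k : nat) (e : R) : (0 < n)%N -> (k < n)%N -> 0 < e ->
  exists c0, forall c, (c0 <= c.+2)%N ->
  (totient c.+2)%:R / n%:R ^+ 2 - e * c.+2%:R <=
  (cnt [set g | [/\ GammaI g, g 1 0 = c.+2, cellb n j (vv R g) & cellb n k (zz R g)]])%:R :> R.
Proof.
move=> n0 kn e0; have [c0 H] := unit_cells n0 e0; exists c0 => c cc.
have j0n : (j %% n < n)%N by rewrite ltn_mod.
apply: le_trans (H c cc _ _ j0n kn) _; rewrite ler_nat.
pose f (t : {unit 'Z_c.+2}) : 'M[int]_2 :=
  mkg c.+2 ((val t : 'Z_c.+2) + c.+2 * (j %/ n))%N (((val t)^-1)%R : 'Z_c.+2).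
have n0' : 0 < n%:R :> R by rewrite ltr0n.
have up (t : 'Z_c.+2) : t \is a GRing.unit -> (0 < t)%N.
  rewrite lt0n; apply: contraL => /eqP t0; suff -> : t = 0 by rewrite unitr0.
  exact: val_inj.
have vE (t : {unit 'Z_c.+2}) : vv R (f t) = (val t : 'Z_c.+2)%:R / c.+2%:R + (j %/ n)%N%:R.
  rewrite /vv /f !mkgE -!pmulrn natrD natrM; field.
  by rewrite gt_eqF // ltr_pwDl.
have zE (t : {unit 'Z_c.+2}) : zz R (f t) = (((val t)^-1)%R : 'Z_c.+2)%:R / c.+2%:R.
  by rewrite /zz /f !mkgE.
apply: (card_le_cnt (f := f)).
- apply: (sub_finite_set _ (finite_GammaI_real c.+2%:R (j.+1%:R / n%:R))) => g /= [gG gc /andP[_ vj] _].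
  by rewrite /cR gc ler_pdivlMr.
- move=> t t' _ _ /matrixP/(_ 1 1); rewrite /f !mkgE => /eqP.
  by rewrite eqz_nat eqn_add2r => /eqP tt; apply: val_inj; apply: val_inj.
- move=> t /= /andP[h1 h2]; split.
  + have tu : (val t : 'Z_c.+2) \is a GRing.unit := valP t.
    apply: mkg_GammaI.
    * by rewrite up ?unitrV //= ltnW.
    * by rewrite addn_gt0 up.
    * rewrite mulnDr mulnCA addnC mulnC modnMDl.
      exact: (congr1 (@nat_of_ord _) (mulVr tu)).
  + by rewrite /f mkgE.
  + rewrite vE /cellb mulrDl; move: h1; rewrite /cellb => /andP[h1 h1'].
    have -> : j%:R = (j %% n)%N%:R + (j %/ n)%N%:R * n%:R :> R by rewrite -natrM -natrD addnC -divn_eq.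
    have -> : j.+1%:R = (j %% n).+1%:R + (j %/ n)%N%:R * n%:R :> R by rewrite -natrM -natrD addSn addnC -divn_eq.
    by rewrite ltrD2r lerD2r h1.
  + by rewrite zE.
Qed.
(** Moduli below the threshold c1 of [unit_cells_count] are given up, at the constant cost
    [totsum c1]. *)
Lemma totsum_le_tail (N1 N2 c1 : nat) :
  (totsum N2 <= totsum N1 + totsum c1 + \sum_(maxn N1.+1 c1 <= c < N2.+1) totient c)%N.
Proof.
rewrite /totsum; have [h|h] := leqP (maxn N1.+1 c1) N2.+1; last first.
  have sub (a b : nat) : (a <= b)%N -> (\sum_(1 <= c < a.+1) totient c <= \sum_(1 <= c < b.+1) totient c)%N.
    by move=> ab; rewrite (@big_cat_nat _ _ _ a.+1 1 b.+1) //= leq_addr.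
  rewrite (leq_trans _ (leq_addr _ _)) //; move: h; rewrite leq_max => /orP[h|h].
    by apply: leq_trans (sub _ N1 _) (leq_addr _ _); apply: ltnW.
  by apply: leq_trans (sub _ c1 _) (leq_addl _ _); apply: ltnW; apply: ltnW.
rewrite (@big_cat_nat _ _ _ (maxn N1.+1 c1) 1 N2.+1) //=; last by rewrite leq_max.
rewrite leq_add2r; have [h1|h1] := leqP N1.+1 c1; last by rewrite leq_addr.
case: c1 h1 {h} => // c1 h1.
by rewrite (leq_trans _ (leq_addl _ _)) // [leqRHS]big_nat_recr //= leq_addr.
Qed.

Lemma sqr_floor_ge (s m : R) : 0 <= s -> 0 <= m -> s < m + 1 -> s ^+ 2 - 2 * s <= m ^+ 2.
Proof. by move=> s0 m0 sm; rewrite !expr2; have [h|h] := lerP s 1; nra. Qed.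

(** The cell of c^2/Q^2 is a range N1 < c <= N2. Summing phi(c)/n^2 over it gives about (2
    zeta(2))^-1 (N2^2 - N1^2)/n^2, and N2^2 - N1^2 is about Q^2/n. *)
Lemma cell_count (n j k l : nat) (e : R) : (0 < n)%N -> (k < n)%N -> 0 < e ->
  exists Q0, forall Q, Q0 <= Q ->
  ((2 * zeta 2)^-1 / n%:R ^+ 3 - e) * Q ^+ 2 <=
  (cnt [set g | GammaI g /\ cell n j k l (PQ Q g)])%:R :> R.
Proof.
move=> n0 kn e0; pose K : R := l.+1%:R; pose z : R := (2 * zeta 2)^-1.
have K1 : 1 <= K by rewrite ler1n.
have z0 : 0 < z by rewrite invr_gt0 mulr_gt0 ?zeta2_gt0.
(* As A <= K Q^2, this makes e1 A at most e Q^2 / 6. *)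
pose e1 := e / (6 * K).
have e10 : 0 < e1 by rewrite divr_gt0 // mulr_gt0 //; lra.
have [c0 Hc] := unit_cells_count j n0 kn e10; have [C C0 HC] := totsum_asymp e10.
pose c1 := maxn c0 2; pose D := 2 * C + (totsum c1)%:R.
have D0 : 0 <= D by rewrite addr_ge0 // mulr_ge0.
pose Q0 := 2 * (2 * z * K + D) / e + 1.
have zK : 0 < z * K by rewrite mulr_gt0 //; lra.
have Q00 : 1 <= Q0 by rewrite lerDr divr_ge0 ?mulr_ge0 ?addr_ge0 //; lra.
exists Q0 => Q QQ; have Q1 : 1 <= Q by lra.
have Q2 : (2 * z * K + D) * Q <= e / 2 * Q ^+ 2.
  have h : 2 * (2 * z * K + D) <= e * Q.
    by rewrite -ler_pdivrMl // mulrC; apply: le_trans QQ; rewrite /Q0 lerDl.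
  by rewrite expr2 mulrA ler_pM2r; lra.
have n0' : 0 < n%:R :> R by rewrite ltr0n.
have n1 : 1 <= n%:R :> R by rewrite ler1n.
pose A := Q ^+ 2 * (K / n%:R); pose B := Q ^+ 2 * (l%:R / n%:R).
have A0 : 0 <= A by rewrite mulr_ge0 ?sqr_ge0 // divr_ge0 //; lra.
have B0 : 0 <= B by rewrite mulr_ge0 ?sqr_ge0 // divr_ge0.
have AB : A - B = Q ^+ 2 / n%:R by rewrite /A /B /K -natr1; field; rewrite gt_eqF.
have Qn0 : 0 <= Q ^+ 2 / n%:R by rewrite divr_ge0 ?sqr_ge0.
have AK : A <= Q ^+ 2 * K.
  by rewrite ler_pM2l ?exprn_gt0 //; [rewrite ler_pdivrMr // ler_peMr //|]; lra.
have sA : Num.sqrt A <= Q * K.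
  rewrite -(@ler_pXn2r _ 2%N) ?nnegrE ?sqrtr_ge0 ?mulr_ge0 ?sqr_sqrtr //; try by clear -Q1 K1; lra.
  apply: (le_trans AK); rewrite exprMn ler_pM2l ?exprn_gt0 //; last by clear -Q1; lra.
  by rewrite expr2 ler_peMr; clear -K1; lra.
pose N2 := Num.truncn (Num.sqrt A); pose N1 := Num.truncn (Num.sqrt B).
have N2a : N2%:R <= Num.sqrt A by rewrite truncn_le // sqrtr_ge0.
have N2b : Num.sqrt A < N2%:R + 1 by rewrite natr1 truncnS_gt.
have N1a : N1%:R <= Num.sqrt B by rewrite truncn_le // sqrtr_ge0.
have N2le : N2%:R ^+ 2 <= A.
  by rewrite -[leRHS]sqr_sqrtr // ler_pXn2r ?nnegrE ?ler0n ?sqrtr_ge0.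
have N1le : N1%:R ^+ 2 <= B.
  by rewrite -[leRHS]sqr_sqrtr // ler_pXn2r ?nnegrE ?ler0n ?sqrtr_ge0.
have N2ge : A - 2 * Num.sqrt A <= N2%:R ^+ 2.
  have := ler0n R N2; have := sqrtr_ge0 A; rewrite -[X in X - _]sqr_sqrtr //.
  by move=> s0 m0; exact: sqr_floor_ge.
pose s := index_iota (maxn N1.+1 c1) N2.+1.
pose Ac (c : nat) := [set g | [/\ GammaI g, g 1 0 = c, cellb n j (vv R g) & cellb n k (zz R g)]].
have step1 : (\sum_(c <- s) cnt (Ac c) <= cnt [set g | GammaI g /\ cell n j k l (PQ Q g)])%N.
  apply: sum_cnt.
  - apply: (sub_finite_set _ (finite_GammaI_real (Num.sqrt A) (j.+1%:R / n%:R))) => g /= [gG /and3P[/andP[_ h1] _ /andP[_ h2]]].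
    split => //; split; last by rewrite ler_pdivlMr.
    rewrite -(@ler_pXn2r _ 2%N) ?nnegrE ?sqrtr_ge0 ?(ltW (cR_gt0 R gG)) // sqr_sqrtr //.
    move: h2; rewrite /PQ /= expr_div_n => h2; rewrite /A mulrA ler_pdivlMr //.
    have Q2p : 0 < Q ^+ 2 by rewrite exprn_gt0 //; clear -Q1; lra.
    by rewrite -ler_pdivrMl // mulrA [_^-1 * _]mulrC.
  - exact: iota_uniq.
  - move=> c; rewrite mem_index_iota geq_max => /andP[/andP[h1 _] h2] g [gG gc hj hk]; split => //.
    apply/and3P; split => //; rewrite /PQ /= /cellb /cR gc expr_div_n.
    have Q2p : 0 < Q ^+ 2 by rewrite exprn_gt0 //; clear -Q1; lra.
    have cS (x : R) : 0 <= x -> x = Q ^+ 2 * (x / Q ^+ 2) by move=> _; rewrite mulrC divfK // gt_eqF.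
    apply/andP; split.
      rewrite -ltr_pdivrMr // ltr_pdivlMr // mulrC -/B -[B]sqr_sqrtr // ltr_pXn2r ?nnegrE ?sqrtr_ge0 ?ler0n //.
      by apply: lt_le_trans (truncnS_gt _) _; rewrite ler_nat.
    rewrite -ler_pdivlMr // ler_pdivrMr // mulrC -/A -[A]sqr_sqrtr // ler_pXn2r ?nnegrE ?sqrtr_ge0 ?ler0n //.
    by apply: le_trans N2a; rewrite ler_nat -ltnS.
  - by move=> c c' g _ _ [_ h _ _] [_ h' _ _]; move: h; rewrite h' => -[].
apply: le_trans (_ : (\sum_(c <- s) cnt (Ac c))%N%:R <= _); last by rewrite ler_nat.
have step2 : (\sum_(c <- s) totient c)%N%:R / n%:R ^+ 2 - e1 * A <= (\sum_(c <- s) cnt (Ac c))%N%:R.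
  apply: (@le_trans _ _ (\sum_(c <- s) ((totient c)%:R / n%:R ^+ 2 - e1 * N2%:R))).
    rewrite big_split /= -mulr_suml -natr_sum lerD2l sumrN lerN2.
    rewrite [X in X <= _](_ : _ = e1 * N2%:R * (size s)%:R); last by rewrite /s sumr_const_nat size_iota [RHS]mulr_natr.
    rewrite size_iota -mulrA ler_pM2l //.
    apply: le_trans N2le; rewrite expr2 ler_wpM2l // ler_nat leq_subLR -add1n.
    by rewrite leq_add2r leq_max.
  rewrite natr_sum !big_seq; apply: ler_sum => c; rewrite mem_index_iota !geq_max => /andP[/and3P[_ h1 h2] h3].
  case: c h1 h2 h3 => [|[|c]] // h1 _ h3; apply: le_trans (Hc c h1).
  by rewrite lerD2l lerN2 ler_pM2l // ler_nat -ltnS.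
apply: le_trans step2; have := totsum_le_tail N1 N2 c1; rewrite -(ler_nat R) !natrD.
have := HC N1; have := HC N2; rewrite -/z !ler_norml => /andP[t1 _] /andP[_ t2] t3.
set S := (\sum_(c <- s) totient c)%N%:R in t3 *.
have e1K : e1 * K = e / 6 by rewrite /e1; field; clear -K1; lra.
have n2 : 0 < (n%:R ^+ 2)^-1 :> R by rewrite invr_gt0 exprn_gt0.
have n2' : (n%:R ^+ 2)^-1 <= 1 :> R by rewrite invf_le1 ?exprn_gt0 // exprn_ege1.
have SS : z * (Q ^+ 2 / n%:R) - (2 * z * K * Q + D + e / 3 * Q ^+ 2) <= S.
  have ea : e1 * A <= e / 6 * Q ^+ 2.
    by rewrite -e1K [leRHS]mulrAC -mulrA ler_pM2l // mulrC (mulrC _ K) mulrC.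
  have eb : e1 * B <= e1 * A by rewrite ler_pM2l //; clear -AB Qn0; lra.
  have en : e1 * N2%:R ^+ 2 <= e1 * A by rewrite ler_pM2l.
  have en' : e1 * N1%:R ^+ 2 <= e1 * B by rewrite ler_pM2l.
  have zn : z * N1%:R ^+ 2 <= z * B by rewrite ler_pM2l.
  have zn' : z * (A - 2 * (Q * K)) <= z * N2%:R ^+ 2.
    by rewrite ler_pM2l //; apply: le_trans N2ge; rewrite lerD2l lerN2 ler_pM2l.
  rewrite -AB; move: t1 t2 t3 zn zn' en en' ea eb; rewrite /D; clear.
  move: (N1%:R ^+ 2) (N2%:R ^+ 2) => u1 u2; nra.
have E0 : 0 <= 2 * z * K * Q + D + e / 3 * Q ^+ 2.
  have zQ : 0 <= 2 * z * K * Q by clear -zK Q1; have := mulr_ge0 (ltW zK) (le_trans ler01 Q1); lra.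
  by rewrite !addr_ge0 // mulr_ge0 ?sqr_ge0 // divr_ge0 // ltW.
have n3 : (z / n%:R ^+ 3) * Q ^+ 2 = z * (Q ^+ 2 / n%:R) * (n%:R ^+ 2)^-1.
  by field; rewrite gt_eqF.
have h1 : (z * (Q ^+ 2 / n%:R) - (2 * z * K * Q + D + e / 3 * Q ^+ 2)) * (n%:R ^+ 2)^-1 <= S * (n%:R ^+ 2)^-1.
  by rewrite ler_pM2r.
have h2 : (2 * z * K * Q + D + e / 3 * Q ^+ 2) * (n%:R ^+ 2)^-1 <= 2 * z * K * Q + D + e / 3 * Q ^+ 2.
  by rewrite ler_piMr.
have h3 : e1 * A <= e / 6 * Q ^+ 2.
  by rewrite -e1K [leRHS]mulrAC -mulrA ler_pM2l // mulrC (mulrC _ K) mulrC.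
have h4 : D <= D * Q by rewrite ler_peMr.
rewrite mulrBl n3; move: h1; rewrite mulrBl; move: Q2 h2 h3 h4; clear.
move: (_ * (n%:R ^+ 2)^-1) (S * _) (z * (Q ^+ 2 / n%:R) * _) => x1 x2 x3; nra.
Qed.
End Cells.

Section TotalCounts.
Variable R : realType.
Local Open Scope classical_set_scope.
Local Open Scope ring_scope.
Implicit Types (g : 'M[int]_2) (Q : R).

Lemma coord_nat g : GammaI g -> g 1 0 = (absz (g 1 0)%R)%:Z /\ g 1 1 = (absz (g 1 1)%R)%:Z.
Proof. by case/GammaIP => _ c0 d0 _ _; rewrite !gez0_abs // ltW. Qed.

(** For each c the entries d <= (V + 1) c prime to c number (V + 1) phi(c). *)
Lemma total_count (V N : nat) :
  leq (cnt [set g | [/\ GammaI g, g 1 0 <= N%:Z & vv R g <= V.+1%:R]]) (V.+1 * totsum N).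
Proof.
pose B (c : nat) := [set g | [/\ GammaI g, g 1 0 = c%:Z & vv R g <= V.+1%:R]].
have fB c : finite_set (B c).
  apply: (sub_finite_set _ (@finite_GammaI_real R c%:R V.+1%:R)) => g /= [gG gc gv].
  by split; rewrite // /cR gc.
apply: leq_trans (cnt_cover (s := index_iota 1 N.+1) (B := B) _ _) _ => //.
  move=> g [gG gN gv]; have [e1 e2] := coord_nat gG; exists (absz (g 1 0)%R); last by split.
  rewrite mem_index_iota ltnS; apply/andP; split; last by rewrite -lez_nat -e1.
  by rewrite -ltz_nat -e1; case/GammaIP: gG.
rewrite /totsum big_distrr /= big_nat [leqRHS]big_nat; apply: leq_sum => -[//|c] _.
(* The quotient is that of d - 1, so that d = (V + 1) c falls into the last block. *)
pose f g : 'I_V.+1 * 'I_c.+1 := (inord ((absz (g 1 1)%R).-1 %/ c.+1), inord ((absz (g 1 1)%R) %% c.+1)).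
apply: (@leq_trans #|[pred p : 'I_V.+1 * 'I_c.+1 | coprime c.+1 p.2]|).
apply: (cnt_le_card (f := f)); first exact: fB.
- move=> g h [gG gc gv] [hG hc hv] [] /(congr1 (@nat_of_ord _)) E1 /(congr1 (@nat_of_ord _)) E2.
  apply: GammaI_inj => //; first by rewrite gc hc.
  have [_ ed] := coord_nat gG; have [_ ed'] := coord_nat hG; rewrite ed ed'.
  have q (k : 'M[int]_2) : B c.+1 k -> (0 < absz (k 1 1)%R)%N /\ ((absz (k 1 1)%R).-1 %/ c.+1 < V.+1)%N.
    move=> [kG kc kv]; have [_ ekd] := coord_nat kG.
    have k0 : (0 < absz (k 1 1)%R)%N by rewrite -ltz_nat -ekd; case/GammaIP: kG.
    split => //; rewrite ltn_divLR // prednK //; move: kv.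
    by rewrite /vv kc ekd -!pmulrn ler_pdivrMr ?ltr0n // -natrM ler_nat.
  have [g0 gq] := q g (And3 gG gc gv); have [h0 hq] := q h (And3 hG hc hv).
  rewrite !inordK // in E1; rewrite !inordK ?ltn_mod // in E2.
  move: g0 h0 E1 E2; case: (absz (g 1 1)) => // x; case: (absz (h 1 1)) => // y _ _ /= E1 E2.
  congr (Posz _.+1); rewrite (divn_eq x c.+1) (divn_eq y c.+1) E1; congr (_ + _)%N.
  by apply/eqP; rewrite -(eqn_modDl 1) !add1n E2.
- move=> g [gG gc gv] /=; rewrite inordK ?ltn_mod // coprime_modr.
  have := GammaI_det gG; rewrite det2E gc; have [_ ->] := coord_nat gG => d.
  rewrite -[coprime _ _]/(coprimez c.+1 (absz (g 1 1)%R)); apply/coprimezP.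
  by exists (- g 0 1, g 0 0) => /=; move: d; move: (g 0 0) (g 0 1) => a b; lia.
rewrite (@eq_card _ _ [predX 'I_V.+1 & [pred r : 'I_c.+1 | coprime c.+1 r]]); last by move=> [q r]; rewrite !inE.
rewrite cardX card_ord totient_count_coprime big_mkord -sum1_card big_mkcond /=.
by rewrite leq_mul2l; apply/orP; right; apply: leq_sum => i _; case: ifP; rewrite inE => ->.
Qed.

(** The lower row determines the matrix; coprimality is ignored. This crude bound serves for thin
    regions and for finiteness. *)
Lemma corner_count (N N' : nat) :
  leq (cnt [set g | GammaI g /\ g 1 0 <= N%:Z /\ g 1 1 <= N'%:Z]) (N.+1 * N'.+1).
Proof.
pose f g : 'I_N.+1 * 'I_N'.+1 := (inord (absz (g 1 0)%R), inord (absz (g 1 1)%R)).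
apply: leq_trans (cnt_le_card (f := f) (P := predT) _ _ _) _ => //; last first.
- by rewrite card_prod !card_ord.
- move=> g h [gG [gc gd]] [hG [hc hd]] [] /(congr1 (@nat_of_ord _)) E1 /(congr1 (@nat_of_ord _)) E2.
  have [e1 e2] := coord_nat gG; have [e1' e2'] := coord_nat hG.
  move: E1 E2; rewrite !inordK ?ltnS -?lez_nat -?e1 -?e2 -?e1' -?e2' // => E1 E2.
  by apply: GammaI_inj => //; [rewrite e1 E1 -e1'|rewrite e2 E2 -e2'].
apply: (sub_finite_set _ (finite_GammaI (maxn N N'))) => g [gG [gc gd]]; split => //.
split; [apply: (le_trans gc)|apply: (le_trans gd)]; rewrite lez_nat; [exact: leq_maxl|exact: leq_maxr].
Qed.
End TotalCounts.

(** * Counting in open sets and in their complements *)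

Section Portmanteau.
Variable R : realType.
Local Open Scope classical_set_scope.
Local Open Scope ring_scope.
Implicit Types (g : 'M[int]_2) (Q : R) (U : set (R * R * R)).

Local Notation mu := (@lebesgue_measure R).
Local Notation RL := (measurableTypeR R).
Definition mu3 : {measure set (RL * RL * RL) -> \bar R}%E := ((mu \x mu) \x mu)%E.
Local Notation meas1 := (@measurable _ RL).
Local Notation meas3 := (@measurable _ (RL * RL * RL)%type).

Lemma mu3X A B C : meas1 A -> meas1 B -> meas1 C ->
  (mu3 ((A `*` B) `*` C) = mu A * mu B * mu C)%E.
Proof.
move=> mA mB mC; transitivity ((mu \x mu)%E (A `*` B) * mu C)%E.
  by apply: product_measure1E => //; exact: measurableX.
by congr (_ * _)%E; exact: product_measure1E.
Qed.

Lemma mu3_le A B : meas3 A -> meas3 B -> A `<=` B -> (mu3 A <= mu3 B)%E.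
Proof. by move=> mA mB AB; apply: (@le_measure _ _ _ mu3) => //; exact: mem_set. Qed.

Lemma mu3U_le A B : meas3 A -> meas3 B -> (mu3 (A `|` B) <= mu3 A + mu3 B)%E.
Proof. exact: measureU2. Qed.

Lemma cellbE n j : (0 < n)%N ->
  [set t | cellb n j t] = `](j%:R / n%:R : R), (j.+1%:R / n%:R)]%classic.
Proof.
move=> n0; have n0' : 0 < n%:R :> R by rewrite ltr0n.
by apply/seteqP; split => t /=; rewrite in_itv /= /cellb ltr_pdivrMr // ler_pdivlMr.
Qed.

Lemma cellE n j k l : cell n j k l =
  ([set t : R | cellb n j t] `*` [set t : R | cellb n k t]) `*` [set t : R | cellb n l t].
Proof.
apply/seteqP; split => p /=; first by case/and3P.
by move=> [[a b] c]; apply/and3P.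
Qed.

Lemma mu_cellb n j : (0 < n)%N -> mu [set t | cellb n j t] = (n%:R^-1)%:E.
Proof.
move=> n0; have n0' : 0 < n%:R :> R by rewrite ltr0n.
rewrite cellbE // lebesgue_measure_itv /= lte_fin ltr_pM2r ?invr_gt0 // ltr_nat ltnSn.
by rewrite -EFinD -mulrBl -natr1 [_ + 1]addrC addrK div1r.
Qed.

Lemma measurable_cellb n j : (0 < n)%N -> meas1 [set t : R | cellb n j t].
Proof. by move=> n0; rewrite cellbE //; exact: measurable_itv. Qed.

Lemma measurable_cell n j k l : (0 < n)%N -> meas3 (@cell R n j k l).
Proof. by move=> n0; rewrite cellE; do 2 ?[apply: measurableX]; exact: measurable_cellb. Qed.

Lemma mu3_cell n j k l : (0 < n)%N -> mu3 (cell n j k l) = (n%:R^-1 ^+ 3)%:E.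
Proof.
move=> n0; rewrite cellE mu3X; try exact: measurable_cellb.
by rewrite !mu_cellb // -!EFinM; congr (_ %:E); rewrite exprS expr2 mulrA.
Qed.

Lemma cellb_exists n (t : R) : (0 < n)%N -> 0 < t -> exists j, cellb n j t.
Proof.
move=> n0 t0; have x0 : 0 < t * n%:R by rewrite mulr_gt0 ?ltr0n.
have [m h1 h2] : exists2 m : nat, m%:R < t * n%:R & t * n%:R <= m.+1%:R.
  have xt : exists m : nat, t * n%:R <= m%:R.
    by exists (Num.truncn (t * n%:R)).+1; apply: ltW; exact: truncnS_gt.
  case: (ex_minnP xt) => -[|m] hm min; first by move: hm; rewrite leNgt x0.
  by exists m => //; rewrite ltNge; apply/negP => /min; rewrite ltnn.
by exists m; apply/andP.
Qed.

Lemma cellb_uniq n j k (t : R) : cellb n j t -> cellb n k t -> j = k.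
Proof.
move=> /andP[a b] /andP[c d]; apply/eqP; rewrite eqn_leq -(ltnS j) -(ltnS k) -2!(ltr_nat R).
by rewrite (lt_le_trans a d) (lt_le_trans c b).
Qed.

Lemma cellb_half n j' (t : R) : cellb n.*2 j' t -> cellb n j'./2 t.
Proof.
rewrite /cellb -muln2 natrM mulrA => /andP[a b]; apply/andP; split.
  rewrite -(ltr_pM2r (_ : 0 < 2)) //; apply: le_lt_trans a; rewrite -natrM ler_nat muln2.
  by rewrite -{2}(odd_double_half j') leq_addl.
rewrite -(ler_pM2r (_ : 0 < 2)) //; apply: (le_trans b); rewrite -natrM ler_nat muln2.
by rewrite -{1}(odd_double_half j') doubleS; case: (odd j').
Qed.

Lemma cellb_close n j (s t : R) : (0 < n)%N -> cellb n j s -> cellb n j t -> `|s - t| < n%:R^-1.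
Proof.
move=> n0 /andP[a b] /andP[c d]; have n0' : 0 < n%:R :> R by rewrite ltr0n.
rewrite -(ltr_pM2r n0') mulVf ?gt_eqF // -[X in _ * X]gtr0_norm // -normrM mulrBl.
move: a b c d; rewrite -natr1 ltr_norml => a b c d; apply/andP; split; lra.
Qed.

Definition cells_in n U : set (R * R * R) :=
  [set p | exists j k l, cell n j k l p /\ cell n j k l `<=` U].

(** Doubling n refines the grid, so along the powers of 2 the inner approximations increase. *)
Lemma cells_in_double n U : cells_in n U `<=` cells_in n.*2 U.
Proof.
move=> p [j [k [l [/and3P[a b c] sub]]]].
have [n00|n0] := posnP n.
  by rewrite n00 double0 -n00; exists j, k, l; split => //; apply/and3P.
have n20 : (0 < n.*2)%N by rewrite double_gt0.
have pos (t : R) i : cellb n i t -> 0 < t.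
  by move=> /andP[h _]; rewrite -(pmulr_lgt0 _ (_ : 0 < n%:R :> R)) ?ltr0n // (le_lt_trans _ h).
have [j' ja] := cellb_exists n20 (pos _ _ a); have [k' kb] := cellb_exists n20 (pos _ _ b).
have [l' lc] := cellb_exists n20 (pos _ _ c); exists j', k', l'; split; first by apply/and3P.
move=> q /and3P[qa qb qc]; apply: sub; apply/and3P; split.
- by rewrite (cellb_uniq a (cellb_half ja)) cellb_half.
- by rewrite (cellb_uniq b (cellb_half kb)) cellb_half.
- by rewrite (cellb_uniq c (cellb_half lc)) cellb_half.
Qed.

Definition octant : set (R * R * R) := [set p | [/\ 0 < p.1.1, 0 < p.1.2 & 0 < p.2]].

Lemma cells_in_open U : open U -> U `<=` octant -> \bigcup_m cells_in (2 ^ m) U = U.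
Proof.
move=> oU Up; apply/seteqP; split=> [p [m _ [j [k [l [a]]]]]|p Upp]; first exact.
have /nbhs_ballP[e /= e0 be] : nbhs p U by exact: open_nbhs_nbhs.
have [m hm] : exists m : nat, (2 ^ m)%N%:R^-1 < e.
  exists (Num.truncn e^-1).+1; rewrite invf_plt ?posrE ?ltr0n ?expn_gt0 //.
  apply: lt_trans (truncnS_gt _) _; rewrite ltr_nat; exact: ltn_expl.
have n0 : (0 < 2 ^ m)%N by rewrite expn_gt0.
have [v0 z0 w0] := Up p Upp.
have [j ja] := cellb_exists n0 v0; have [k kb] := cellb_exists n0 z0.
have [l lc] := cellb_exists n0 w0; exists m => //; exists j, k, l; split; first by apply/and3P.
move=> q /and3P[qa qb qc]; apply: be; split; first split.
- by rewrite /ball /= (lt_trans (cellb_close n0 ja qa)).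
- by rewrite /ball /= (lt_trans (cellb_close n0 kb qb)).
- by rewrite /ball /= (lt_trans (cellb_close n0 lc qc)).
Qed.

Lemma measurable_cells_in n U : (0 < n)%N -> meas3 (cells_in n U).
Proof.
move=> n0; rewrite (_ : cells_in n U = \bigcup_(t in [set t : nat * nat * nat | cell n t.1.1 t.1.2 t.2 `<=` U]) cell n t.1.1 t.1.2 t.2).
  rewrite bigcup_mkcond; apply: countable_bigcupT_measurable; first exact: countableP.
  by move=> t; case: ifP => _; [exact: measurable_cell|exact: measurable0].
apply/seteqP; split=> [p [j [k [l [a b]]]]|p [[[j k] l] /= a b]]; first by exists (j, k, l).
by exists j, k, l.
Qed.

Lemma measurable_open_octant U : open U -> U `<=` octant -> meas3 U.
Proof.
move=> oU Up; rewrite -(cells_in_open oU Up); apply: bigcup_measurable => m _.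
by apply: measurable_cells_in; rewrite expn_gt0.
Qed.

Definition boxS (V : nat) : set (R * R * R) :=
  [set p | [/\ 0 < p.1.1 < V%:R, 0 < p.1.2 < 1 & 0 < p.2 < 1]].

Definition inner_cells n V U : seq ('I_(V * n) * 'I_n * 'I_n) :=
  seq.filter (fun t : 'I_(V * n) * 'I_n * 'I_n => `[< cell n t.1.1 t.1.2 t.2 `<=` U >]) (enum {: 'I_(V * n) * 'I_n * 'I_n}).

Lemma mu3_cells_in n (V : nat) U : (0 < n)%N -> U `<=` boxS V ->
  (mu3 (cells_in n U) <= ((size (inner_cells n V U))%:R * n%:R^-1 ^+ 3)%:E)%E.
Proof.
move=> n0 Ub; have n0' : 0 < n%:R :> R by rewrite ltr0n.
have sub : cells_in n U `<=` \big[setU/set0]_(t <- inner_cells n V U) cell n t.1.1 t.1.2 t.2.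
  move=> p [j [k [l [pc cU]]]]; have := Ub p (cU p pc); move: (pc) => /and3P[a b c].
  move=> [/andP[_ v1] /andP[_ z1] /andP[_ w1]].
  have lt (t : R) (N i : nat) : cellb n i t -> t < N%:R -> (i < N * n)%N.
    move=> /andP[h _] tN; rewrite -(ltr_nat R) natrM; apply: (lt_trans h).
    by rewrite ltr_pM2r.
  have hj := lt _ _ _ a v1; have hk := lt _ 1%N _ b z1; have hl := lt _ 1%N _ c w1.
  rewrite mul1n in hk; rewrite mul1n in hl.
  rewrite -bigcup_seq; exists (Ordinal hj, Ordinal hk, Ordinal hl) => //=.
  by rewrite mem_filter mem_enum andbT; apply/asboolP.
have mB (r : seq ('I_(V * n) * 'I_n * 'I_n)) : meas3 (\big[setU/set0]_(t <- r) @cell R n t.1.1 t.1.2 t.2).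
  by apply: bigsetU_measurable => t _; exact: measurable_cell.
apply: (@le_trans _ _ (mu3 (\big[setU/set0]_(t <- inner_cells n V U) cell n t.1.1 t.1.2 t.2))).
  by apply: mu3_le => //; exact: measurable_cells_in.
elim: (inner_cells n V U) => [|t r IH]; first by rewrite big_nil measure0 mul0r.
rewrite big_cons; apply: le_trans (mu3U_le (measurable_cell _ _ _ n0) (mB r)) _.
rewrite mu3_cell // (_ : ((size (t :: r))%:R * _)%:E = ((n%:R^-1 ^+ 3)%:E + ((size r)%:R * n%:R^-1 ^+ 3)%:E)%E).
  exact: leeD (lexx _) IH.
by rewrite -EFinD [size _]/= -[X in (X * _)%:E]natr1 mulrDl mul1r addrC.
Qed.

Lemma boxS_octant V : boxS V `<=` octant.
Proof. by move=> p [/andP[a _] /andP[b _] /andP[c _]]. Qed.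

Lemma mu3_boxS V : (mu3 (boxS V) <= V%:R%:E)%E.
Proof.
have -> : boxS V = (`]0, V%:R[ `*` `]0, 1[) `*` `]0, 1[.
  apply/seteqP; split => -[[v z] w] /=; rewrite !in_itv /=; first by case.
  by move=> [[]].
rewrite mu3X; try exact: measurable_itv.
rewrite !lebesgue_measure_itv /= !lte_fin ltr01; case: ifP => _.
  by rewrite -!EFinB -!EFinM lee_fin !subr0 !mulr1.
by rewrite !mul0e lee_fin.
Qed.

Lemma cell_counts n (T : Type) (s : seq T) (f : T -> nat * nat * nat) (e : R) : (0 < n)%N ->
  (forall t, (f t).1.2 < n)%N -> 0 < e ->
  exists Q0, forall Q, Q0 <= Q ->
  ((2 * zeta 2)^-1 / n%:R ^+ 3 - e) * Q ^+ 2 * (size s)%:R <=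
  (\sum_(t <- s) cnt [set g | GammaI g /\ cell n (f t).1.1 (f t).1.2 (f t).2 (PQ Q g)])%N%:R.
Proof.
move=> n0 fn e0; elim: s => [|t s [Q0 IH]].
  by exists 0 => Q _; rewrite big_nil mulr0.
have [Q1 H] := cell_count (f t).1.1 (f t).2 n0 (fn t) e0.
exists (Num.max Q0 Q1) => Q; rewrite ge_max => /andP[q0 q1].
by rewrite big_cons natrD [size _]/= -[X in _ * X]natr1 mulrDr mulr1 addrC lerD ?H ?IH.
Qed.

Lemma finite_PQ_box V Q : 0 < Q -> finite_set [set g | GammaI g /\ boxS V (PQ Q g)].
Proof.
move=> Q0; apply: (sub_finite_set _ (finite_GammaI_real Q V%:R)) => g [gG [/andP[_ h1] _ /andP[_ h2]]].
split => //; split; last exact: ltW.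
move: h2; rewrite /PQ /= expr_div_n ltr_pdivrMr ?exprn_gt0 // mul1r => h2.
by rewrite -(@ler_pXn2r _ 2%N) ?nnegrE ?(ltW (cR_gt0 R gG)) ?(ltW Q0) // ltW.
Qed.

(** An open set is exhausted by dyadic cells, so finitely many of them carry almost all of its
    measure, and each is counted from below. *)
Lemma open_count (V : nat) U (e : R) : open U -> U `<=` boxS V -> 0 < e ->
  exists Q0, forall Q, Q0 <= Q ->
  ((2 * zeta 2)^-1 * fine (mu3 U) - e) * Q ^+ 2 <= (cnt [set g | GammaI g /\ U (PQ Q g)])%:R.
Proof.
move=> oU Ub e0; pose z : R := (2 * zeta 2)^-1.
have z0 : 0 < z by rewrite invr_gt0 mulr_gt0 ?zeta2_gt0.
have Uo : U `<=` octant by apply: subset_trans Ub _; exact: boxS_octant.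
have mU := measurable_open_octant oU Uo.
have mbox : meas3 (boxS V).
  rewrite (_ : boxS V = (`]0, V%:R[ `*` `]0, 1[) `*` `]0, 1[).
    by apply: measurableX; [apply: measurableX|]; exact: measurable_itv.
  by apply/seteqP; split => -[[v' z'] w] /=; rewrite !in_itv /=; [case|move=> [[]]].
have Ufin : mu3 U \is a fin_num.
  rewrite ge0_fin_numE ?measure_ge0 //; apply: le_lt_trans (ltry V%:R).
  by apply: le_trans (mu3_boxS V); exact: mu3_le.
pose e1 := e / (2 * z); have e10 : 0 < e1 by rewrite divr_gt0 // mulr_gt0.
have pn m : (0 < 2 ^ m)%N by rewrite expn_gt0.
have [m Hm] : exists m, fine (mu3 U) - e1 <= (size (inner_cells (2 ^ m) V U))%:R * (2 ^ m)%N%:R^-1 ^+ 3.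
  have cv : (mu3 \o (fun m => cells_in (2 ^ m) U)) m @[m --> \oo] --> mu3 U.
    rewrite -[in X in _ --> X](cells_in_open oU Uo); apply: nondecreasing_cvg_mu.
    - by move=> m; exact: measurable_cells_in.
    - by rewrite cells_in_open.
    - apply/nondecreasing_seqP => m; rewrite subsetEset expnS mul2n; exact: cells_in_double.
  have : ((fine (mu3 U) - e1)%:E < mu3 U)%E by rewrite -[ltRHS]fineK // lte_fin ltrBlDr ltrDl.
  move=> h; have [m _ Hm] := cv _ (open_ereal_gt_ereal h).
  exists m; rewrite -lee_fin.
  by apply: le_trans (mu3_cells_in (pn m) Ub); apply: ltW; exact: (Hm m (leqnn m)).
set s := inner_cells _ _ _ in Hm; pose e2 := e / (2 * (size s).+1%:R).
have e20 : 0 < e2 by rewrite divr_gt0 // mulr_gt0.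
pose f (t : 'I_(V * 2 ^ m) * 'I_(2 ^ m) * 'I_(2 ^ m)) : nat * nat * nat := (t.1.1 : nat, t.1.2 : nat, t.2 : nat).
have [|Q0 HQ] := @cell_counts (2 ^ m) _ s f e2 (pn m) _ e20; first by move=> t; exact: ltn_ord.
exists (Num.max Q0 1) => Q; rewrite ge_max => /andP[QQ Q1]; have Qp : 0 < Q by lra.
apply: (@le_trans _ _ (\sum_(t <- s) cnt [set g | GammaI g /\ cell (2 ^ m) (f t).1.1 (f t).1.2 (f t).2 (PQ Q g)])%N%:R); last first.
  rewrite ler_nat; apply: sum_cnt.
  - by apply: (sub_finite_set _ (finite_PQ_box V Qp)) => g [gG /Ub].
  - by rewrite filter_uniq // enum_uniq.
  - by move=> t; rewrite mem_filter => /andP[/asboolP tU _] g [gG /tU].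
  - move=> [[j k] l] [[j' k'] l'] g _ _ [_ /and3P[a b c]] [_ /and3P[a' b' c']].
    by congr (_, _, _); apply: val_inj; [exact: cellb_uniq a a'|exact: cellb_uniq b b'|exact: cellb_uniq c c'].
apply: le_trans (HQ Q QQ); rewrite mulrAC ler_pM2r ?exprn_gt0 //.
have h1 : e2 * (size s)%:R <= e / 2.
  by rewrite /e2 mulrAC ler_pdivrMr ?mulr_gt0 // mulrA divfK ?pnatr_eq0 // ler_pM2l // ler_nat.
have h2 : z * (fine (mu3 U) - e1) <= z * ((size s)%:R * (2 ^ m)%N%:R^-1 ^+ 3) by rewrite ler_pM2l.
have h3 : z * e1 = e / 2 by rewrite /e1; field; rewrite gt_eqF.
move: h2; rewrite mulrBr h3 -/z exprVn mulrBl => h2.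
rewrite (_ : z / _ * _ = z * ((size s)%:R / (2 ^ m)%N%:R ^+ 3)); first lra.
by rewrite -!mulrA; congr (_ * _); rewrite mulrC.
Qed.

(** The matrices with c <= Q and d/c <= V + 1 number at most about (2 zeta(2))^-1 (V + 1) Q^2, the
    density times the volume of the box. Subtracting the lower bound for U bounds the complement
    from above. *)
Lemma closed_count (V : nat) U (e : R) : open U -> U `<=` boxS V.+1 -> 0 < e ->
  exists Q0, forall Q, Q0 <= Q ->
  (cnt [set g | [/\ GammaI g, cR R g <= Q, vv R g <= V.+1%:R & ~ U (PQ Q g)]])%:R <=
  ((2 * zeta 2)^-1 * (V.+1%:R - fine (mu3 U)) + e) * Q ^+ 2.
Proof.
move=> oU Ub e0; pose z : R := (2 * zeta 2)^-1.
have e20 : 0 < e / 3 by rewrite divr_gt0.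
have [Q0 HU] := open_count oU Ub e20.
have e30 : 0 < e / 3 / V.+1%:R by rewrite !divr_gt0.
have [C C0 HC] := totsum_asymp e30.
pose Q1 := Num.max 1 (3 * V.+1%:R * C / e).
exists (Num.max Q0 Q1) => Q; rewrite !ge_max => /and3P[q0 q1 q2]; have Qp : 0 < Q by lra.
pose A := [set g | GammaI g /\ U (PQ Q g)].
pose B := [set g | [/\ GammaI g, cR R g <= Q, vv R g <= V.+1%:R & ~ U (PQ Q g)]].
pose T := [set g | [/\ GammaI g, g 1 0 <= (Num.truncn Q)%:Z & vv R g <= V.+1%:R]].
have fT : finite_set T.
  apply: (sub_finite_set _ (@finite_GammaI_real R (Num.truncn Q)%:R V.+1%:R)) => g [gG gc gv].
  by split => //; split => //; rewrite /cR -[leRHS]/((Num.truncn Q)%:Z%:~R) ler_int.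
have AT : A `<=` T.
  move=> g [gG gU]; have [/andP[_ h1] _ /andP[_ h2]] := Ub _ gU; split => //; last exact: ltW.
  move: h2; rewrite /PQ /= expr_div_n ltr_pdivrMr ?exprn_gt0 // mul1r => h2.
  have cQ : cR R g < Q by rewrite -(@ltr_pXn2r _ 2%N) ?nnegrE ?(ltW (cR_gt0 R gG)) ?(ltW Qp).
  have [e1 _] := coord_nat gG; rewrite e1 lez_nat truncn_ge_nat ?(ltW Qp) //.
  by move: cQ; rewrite /cR e1 => /ltW.
have BT : B `<=` T.
  move=> g [gG gQ gv _]; split => //.
  have [e1 _] := coord_nat gG; rewrite e1 lez_nat truncn_ge_nat ?(ltW Qp) //.
  by move: gQ; rewrite /cR e1.
have : (cnt B + cnt A <= V.+1 * totsum (Num.truncn Q))%N.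
  apply: leq_trans (total_count R V (Num.truncn Q)); rewrite -cntU.
  - by apply: cnt_sub => // g [/BT|/AT].
  - exact: sub_finite_set BT fT.
  - exact: sub_finite_set AT fT.
  - by move=> g [_ _ _ nU] [_ /nU].
rewrite -(ler_nat R) natrD natrM => h.
have := HU Q q0; rewrite -/A -/z => hA.
have := HC (Num.truncn Q); rewrite -/z ler_norml => /andP[_ hC].
have tQ : (Num.truncn Q)%:R ^+ 2 <= Q ^+ 2.
  by rewrite ler_pXn2r ?nnegrE ?ler0n ?(ltW Qp) // truncn_le // ltW.
have z0 : 0 < z by rewrite invr_gt0 mulr_gt0 ?zeta2_gt0.
have V0 : 0 < V.+1%:R :> R by [].
have h1 : V.+1%:R * (totsum (Num.truncn Q))%:R <= V.+1%:R * ((z + e / 3 / V.+1%:R) * Q ^+ 2 + C).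
  rewrite ler_pM2l //; have := ler_wpM2l (ltW (addr_gt0 z0 e30)) tQ.
  by move: hC; move: (e / 3 / _) => t; lra.
have h2 : V.+1%:R * C <= e / 3 * Q ^+ 2.
  have : V.+1%:R * C <= e / 3 * Q by move: q2; rewrite ler_pdivrMr //; lra.
  by move=> /le_trans; apply; rewrite ler_pM2l // expr2 ler_peMr // ltW.
have h3 : V.+1%:R * ((z + e / 3 / V.+1%:R) * Q ^+ 2 + C) = (z * V.+1%:R + e / 3) * Q ^+ 2 + V.+1%:R * C.
  by field; rewrite gt_eqF.
move: h1; rewrite h3 => h1; move: hA h h1 h2; rewrite -/z -/B.
move: (cnt A)%:R (cnt B)%:R (V.+1%:R * (totsum _)%:R) (Q ^+ 2) (V.+1%:R * C) => a b t q c.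
move: (fine (mu3 U)) => m; nra.
Qed.
End Portmanteau.

(** * Regions of pairs with a fixed connecting matrix *)

Section PairLimit.
Variable R : realType.
Local Open Scope classical_set_scope.
Local Open Scope ring_scope.
Implicit Types (g M : 'M[int]_2) (Q v : R) (p : R * R * R).

Local Notation mu := (@lebesgue_measure R).
Local Notation RL := (measurableTypeR R).
Local Notation meas3 := (@measurable _ (RL * RL * RL)%type).
Local Notation mu3 := (@mu3 R).

Lemma continuous_v : continuous (fun p => p.1.1).
Proof. move=> p; apply: (@cvg_comp _ _ _ (fun q : R * R * R => q.1) (fun q : R * R => q.1)); [exact: cvg_fst|exact: cvg_fst]. Qed.

Lemma continuous_z : continuous (fun p => p.1.2).
Proof. move=> p; apply: (@cvg_comp _ _ _ (fun q : R * R * R => q.1) (fun q : R * R => q.2)); [exact: cvg_fst|exact: cvg_snd]. Qed.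

Lemma continuous_w : continuous (fun p => p.2).
Proof. by move=> p; exact: cvg_snd. Qed.

Lemma contC (k : R) : continuous (fun _ : R * R * R => k).
Proof. by move=> p; exact: cvg_cst. Qed.
Lemma contD (f h : R * R * R -> R) : continuous f -> continuous h -> continuous (fun p => f p + h p).
Proof. by move=> cf ch p; apply: cvgD; [exact: cf|exact: ch]. Qed.
Lemma contN (f : R * R * R -> R) : continuous f -> continuous (fun p => - f p).
Proof. by move=> cf p; apply: cvgN; exact: cf. Qed.
Lemma contM (f h : R * R * R -> R) : continuous f -> continuous h -> continuous (fun p => f p * h p).
Proof. by move=> cf ch p; apply: cvgM; [exact: cf|exact: ch]. Qed.
Lemma contA (f : R * R * R -> R) : continuous f -> continuous (fun p => `|f p|).
Proof. by move=> cf p; apply: cvg_norm; exact: cf. Qed.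
Lemma contX2 (f : R * R * R -> R) : continuous f -> continuous (fun p => f p ^+ 2).
Proof. by move=> cf; exact: contM. Qed.

Ltac cont := repeat lazymatch goal with
  | |- continuous (fun p => @?f p + @?h p) => apply: (contD (f := f) (h := h))
  | |- continuous (fun p => @?f p * @?h p) => apply: (contM (f := f) (h := h))
  | |- continuous (fun p => - @?f p) => apply: (contN (f := f))
  | |- continuous (fun p => `|@?f p|) => apply: (contA (f := f))
  | |- continuous (fun p => @?f p ^+ 2) => apply: (contX2 (f := f))
  | |- continuous (fun p => p.1.1) => exact: continuous_v
  | |- continuous (fun p => p.1.2) => exact: continuous_z
  | |- continuous (fun p => p.2) => exact: continuous_w
  | |- _ => exact: contC
  end.

Lemma continuous_a1 M : continuous (fun p => a1 M p.1.1).
Proof. rewrite /a1; cont. Qed.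
Lemma continuous_a2 M : continuous (fun p => a2 M p.1.1).
Proof. rewrite /a2; cont. Qed.
Lemma continuous_qM M : continuous (fun p => qM M p.1.1).
Proof. rewrite /qM /a1 /a2; cont. Qed.
Lemma continuous_nM M : continuous (fun p => `|nM M p.1.1|).
Proof. rewrite /nM; cont. Qed.

Lemma open_lt_continuous (f h : R * R * R -> R) : continuous f -> continuous h -> open [set p | f p < h p].
Proof.
move=> cf ch; rewrite (_ : [set p | _] = (fun p => h p - f p) @^-1` [set y | 0 < y]).
  by apply: open_comp; [move=> p _; apply: cvgB; [exact: ch|exact: cf]|exact: open_gt].
by apply/seteqP; split => p /=; rewrite subr_gt0.
Qed.

Lemma continuous_heightg : continuous (fun p => p.2 * (1 + p.1.1 ^+ 2) * (1 + p.1.2 ^+ 2)).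
Proof. cont. Qed.

Lemma continuous_heighth M : continuous (fun p => p.2 * qM M p.1.1 * (1 + p.1.2 ^+ 2)).
Proof. rewrite /qM /a1 /a2; cont. Qed.

Lemma continuous_bw M (x : R) : continuous (fun p => x * p.2 * ((1 + p.1.1 ^+ 2) * qM M p.1.1)).
Proof. rewrite /qM /a1 /a2; cont. Qed.

Lemma bM_lt M v (y : R) : \det M = 1 -> (bM M v < y) = (`|nM M v| < y * ((1 + v ^+ 2) * qM M v)).
Proof. by move=> d; rewrite /bM ltr_pdivrMr // mulr_gt0 ?qM_gt0 ?sqrD1_gt0. Qed.

Lemma bM_gt M v (y : R) : \det M = 1 -> (y < bM M v) = (y * ((1 + v ^+ 2) * qM M v) < `|nM M v|).
Proof. by move=> d; rewrite /bM ltr_pdivlMr // mulr_gt0 ?qM_gt0 ?sqrD1_gt0. Qed.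

Definition hg p : R := p.2 * (1 + p.1.1 ^+ 2) * (1 + p.1.2 ^+ 2).
Definition hh M p : R := p.2 * qM M p.1.1 * (1 + p.1.2 ^+ 2).

Lemma open_bM_lt M (x : R) : \det M = 1 -> open [set p : R * R * R | bM M p.1.1 < x * p.2].
Proof.
move=> d; rewrite (_ : [set p | _] = [set p | `|nM M p.1.1| < x * p.2 * ((1 + p.1.1 ^+ 2) * qM M p.1.1)]).
  by apply: open_lt_continuous; [exact: continuous_nM|exact: continuous_bw].
by apply/seteqP; split => p /=; rewrite bM_lt.
Qed.

Lemma open_bM_gt M (x : R) : \det M = 1 -> open [set p : R * R * R | x * p.2 < bM M p.1.1].
Proof.
move=> d; rewrite (_ : [set p | _] = [set p | x * p.2 * ((1 + p.1.1 ^+ 2) * qM M p.1.1) < `|nM M p.1.1|]).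
  by apply: open_lt_continuous; [exact: continuous_bw|exact: continuous_nM].
by apply/seteqP; split => p /=; rewrite bM_gt.
Qed.

(** The limit region cut off at v < V, with margins k that absorb the lower-order terms of heights,
    entries and tangents. *)
Definition innerM M (xi k : R) V : set (R * R * R) :=
  (boxS V `&` [set p | k < p.1.2] `&` [set p | p.1.2 < 1 - k] `&` [set p | k < p.2]) `&`
  ([set p | k < a1 M p.1.1] `&` [set p | 0 < a2 M p.1.1]) `&`
  ([set p | bM M p.1.1 < (xi - k) * p.2] `&` [set p | hg p < 1 - k] `&` [set p | hh M p < 1 - k]).

(** Points that fail a condition of the limit region, by a margin where the condition is only
    asymptotic. The signs of [a1] and [a2] are exact: they are those of the lower row of g M. *)
Definition violM M (xi k : R) V : set (R * R * R) :=
  boxS V `&` [set p | k < p.2] `&`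
  (([set p | a1 M p.1.1 < 0] `|` [set p | a2 M p.1.1 < 0]) `|`
   [set p | (xi + k) * p.2 < bM M p.1.1] `|` [set p | 1 + k < hg p] `|` [set p | 1 + k < hh M p]).

Lemma open_boxS V : open (boxS V : set (R * R * R)).
Proof.
rewrite (_ : boxS V = [set p | 0 < p.1.1] `&` [set p | p.1.1 < V%:R] `&` [set p | 0 < p.1.2] `&`
   [set p | p.1.2 < 1] `&` [set p | 0 < p.2] `&` [set p | p.2 < 1]).
  by do 5 ?apply: openI; apply: open_lt_continuous; first [exact: contC|exact: continuous_v|exact: continuous_z|exact: continuous_w].
apply/seteqP; split => p; first by move=> [/andP[? ?] /andP[? ?] /andP[? ?]].
by move=> [[[[[a b] c] d] e] f]; split; apply/andP.
Qed.

Lemma open_z_gt (k : R) : open [set p : R * R * R | k < p.1.2].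
Proof. by apply: open_lt_continuous; [exact: contC|exact: continuous_z]. Qed.
Lemma open_z_lt (k : R) : open [set p : R * R * R | p.1.2 < k].
Proof. by apply: open_lt_continuous; [exact: continuous_z|exact: contC]. Qed.
Lemma open_w_gt (k : R) : open [set p : R * R * R | k < p.2].
Proof. by apply: open_lt_continuous; [exact: contC|exact: continuous_w]. Qed.
Lemma open_a1_gt M (k : R) : open [set p : R * R * R | k < a1 M p.1.1].
Proof. by apply: open_lt_continuous; [exact: contC|exact: continuous_a1]. Qed.
Lemma open_a2_gt M (k : R) : open [set p : R * R * R | k < a2 M p.1.1].
Proof. by apply: open_lt_continuous; [exact: contC|exact: continuous_a2]. Qed.
Lemma open_a1_lt M (k : R) : open [set p : R * R * R | a1 M p.1.1 < k].
Proof. by apply: open_lt_continuous; [exact: continuous_a1|exact: contC]. Qed.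
Lemma open_a2_lt M (k : R) : open [set p : R * R * R | a2 M p.1.1 < k].
Proof. by apply: open_lt_continuous; [exact: continuous_a2|exact: contC]. Qed.
Lemma open_hg_lt (k : R) : open [set p : R * R * R | hg p < k].
Proof. by apply: open_lt_continuous; [exact: continuous_heightg|exact: contC]. Qed.
Lemma open_hh_lt M (k : R) : open [set p : R * R * R | hh M p < k].
Proof. by apply: open_lt_continuous; [exact: continuous_heighth|exact: contC]. Qed.
Lemma open_hg_gt (k : R) : open [set p : R * R * R | k < hg p].
Proof. by apply: open_lt_continuous; [exact: contC|exact: continuous_heightg]. Qed.
Lemma open_hh_gt M (k : R) : open [set p : R * R * R | k < hh M p].
Proof. by apply: open_lt_continuous; [exact: contC|exact: continuous_heighth]. Qed.

Lemma open_innerM M xi k V : \det M = 1 -> open (innerM M xi k V).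
Proof.
move=> d; apply: openI; [apply: openI|apply: openI; [apply: openI|exact: open_hh_lt]].
- apply: openI; [apply: openI|exact: open_w_gt]; last exact: open_z_lt.
  by apply: openI; [exact: open_boxS|exact: open_z_gt].
- by apply: openI; [exact: open_a1_gt|exact: open_a2_gt].
- exact: open_bM_lt.
- exact: open_hg_lt.
Qed.

Lemma open_violM M xi k V : \det M = 1 -> open (violM M xi k V).
Proof.
move=> d; apply: openI; first by apply: openI; [exact: open_boxS|exact: open_w_gt].
apply: openU; last exact: open_hh_gt.
apply: openU; last exact: open_hg_gt.
apply: openU; last exact: open_bM_gt.
by apply: openU; [exact: open_a1_lt|exact: open_a2_lt].
Qed.
End PairLimit.

Section PairRegion.
Variable R : realType.
Local Open Scope classical_set_scope.
Local Open Scope ring_scope.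
Implicit Types (g M : 'M[int]_2) (Q v : R) (p : R * R * R).

Local Notation mu := (@lebesgue_measure R).
Local Notation RL := (measurableTypeR R).
Local Notation meas3 := (@measurable _ (RL * RL * RL)%type).
Local Notation mu3 := (@mu3 R).

Definition pairM M Q (th : R) g : Prop :=
  [/\ GammaI g, GammaI (g *m M), normg g <= Q /\ normg (g *m M) <= Q &
      `|tanhalf (g *m M) - tanhalf g| <= th].

Lemma det_mul M g : \det M = 1 -> GammaI g -> \det (g *m M) = 1.
Proof. by move=> d gG; rewrite det_mulmx d mulr1; exact: GammaI_det. Qed.

(** Let (c', d') be the lower row of g M and a' its upper left entry. Then a' c = a c' - m with m =
    [M 1 0], so the last hypothesis says 0 < a' <= c'. *)
Lemma GammaI_mul M g : \det M = 1 -> GammaI g -> 0 < (g *m M) 1 0 -> 0 < (g *m M) 1 1 ->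
  0 < g 0 0 * (g *m M) 1 0 - M 1 0 <= g 1 0 * (g *m M) 1 0 -> GammaI (g *m M).
Proof.
move=> dM gG c0 d0 h; have dg := GammaI_det gG.
have e : (g *m M) 0 0 * g 1 0 = g 0 0 * (g *m M) 1 0 - M 1 0.
  move: dg; rewrite !mul2E det2E; move: (g 0 0) (g 0 1) (g 1 0) (g 1 1) (M 0 0) (M 1 0) => a b c d x y dg.
  have -> : a * (c * x + d * y) - y = a * (c * x + d * y) - y * (a * d - b * c) by rewrite dg mulr1.
  by ring.
have dgM0 := det_mul dM gG; have := dgM0; rewrite det2E => dgM.
case/GammaIP: gG => _ gc0 _ _ _.
apply/GammaIP; split => //.
  move: dgM c0 d0 e h; move: ((g *m M) 0 0) ((g *m M) 0 1) ((g *m M) 1 0) ((g *m M) 1 1) (M 1 0) (g 0 0) (g 1 0) gc0.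
  move=> a b c d m x y; nia.
move: e h; move: ((g *m M) 0 0) ((g *m M) 1 0) (M 1 0) (g 0 0) (g 1 0) gc0 c0 => a c m x y *.
by apply/andP; split; nia.
Qed.

Lemma sqr_lower (z d r : R) : 0 <= z -> z - d <= r -> 0 <= r -> z ^+ 2 - 2 * z * d <= r ^+ 2.
Proof. by move=> z0 h r0; rewrite !expr2; have [h'|h'] := lerP 0 (z - d); nra. Qed.

Lemma cRPQ Q g : 0 < Q -> cR R g ^+ 2 = (PQ Q g).2 * Q ^+ 2.
Proof. by move=> Q0; rewrite /PQ /= expr_div_n divfK // gt_eqF // exprn_gt0. Qed.

Lemma rr_le_zz g : GammaI g -> rr R g <= zz R g.
Proof.
move=> gG; rewrite rr_zz // lerBlDr lerDl divr_ge0 ?ltW ?vv_gt0 ?YR_gt0 //.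
exact: GammaI_det.
Qed.

Lemma inv_sqr_le (Y y : R) : 0 < y -> y <= Y -> 2 / Y ^+ 2 <= 2 / y ^+ 2.
Proof.
move=> y0 yY; have Y0 : 0 < Y by lra.
by rewrite ler_pM2l // lef_pV2 ?posrE ?exprn_gt0 // ler_pXn2r ?nnegrE ?(ltW y0) ?(ltW Y0).
Qed.

Lemma ler_mul1Dsqr (x v : R) : 0 <= x -> x <= x * (1 + v ^+ 2).
Proof. by move=> x0; rewrite mulrDr mulr1 lerDl mulr_ge0 ?sqr_ge0. Qed.

Lemma pair_dr (b w x Q2 : R) : 0 < w -> 0 < Q2 -> b <= x * w -> b / (w * Q2) <= x / Q2.
Proof. by move=> w0 q0 h; rewrite invfM mulrA ler_pM2r ?invr_gt0 // ler_pdivrMr. Qed.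

(** Replacing tangents by [rr] costs O(1/Y^2), which is negligible on the scale 1/Q^2 once both
    values of Y are of order Q^2. *)
Lemma inv_sqr_tail (k q Y Y' Q2 : R) : 0 < k -> 0 < q -> q <= k -> 0 < Q2 -> 8 / (k * q ^+ 2) <= Q2 ->
  k * Q2 <= Y -> q * Q2 <= Y' -> 2 / Y ^+ 2 + 2 / Y' ^+ 2 <= k / 2 / Q2.
Proof.
move=> k0 q0 qk Q20 K Yk Y'k.
have a : q * Q2 <= Y by apply: le_trans Yk; rewrite ler_pM2r.
have p0 : 0 < q * Q2 by rewrite mulr_gt0.
have := inv_sqr_le p0 a; have := inv_sqr_le p0 Y'k.
suff : 4 / (q * Q2) ^+ 2 <= k / 2 / Q2 by lra.
move: K; rewrite ler_pdivrMr ?mulr_gt0 ?exprn_gt0 // => K.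
rewrite ler_pdivlMr // ler_pdivlMr // -mulrA mulrAC ler_pdivrMr ?exprn_gt0 //.
rewrite (_ : k * (q * Q2) ^+ 2 = Q2 * (k * q ^+ 2) * Q2); last by ring.
by have := ler_wpM2r (ltW Q20) K; lra.
Qed.

Lemma height_le (Y r z u Q2 k : R) : 0 < r -> r <= z -> 0 < u -> Y = Q2 * u -> u * (1 + z ^+ 2) < 1 - k ->
  2 <= Y -> 0 < Q2 -> 1 <= k * Q2 -> Y * (1 + r ^+ 2) + Y^-1 <= Q2.
Proof.
move=> r0 rz u0 YE h Y2 Q20 kQ.
have Yi : Y^-1 <= 1 by rewrite invf_le1; lra.
have r2 : r ^+ 2 <= z ^+ 2 by rewrite ler_pXn2r ?nnegrE //; lra.
have h1 : Y * (1 + r ^+ 2) <= Y * (1 + z ^+ 2) by rewrite ler_pM2l; lra.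
have h2 : Y * (1 + z ^+ 2) <= Q2 * (1 - k) by rewrite YE -mulrA ler_pM2l // ltW.
by move: h1 h2; rewrite mulrBr mulr1 [Q2 * k]mulrC; lra.
Qed.

Lemma height_le_near (Y r z u Q2 k x : R) : 0 < r -> r <= z + x / Q2 -> 0 <= x -> x <= Q2 ->
  0 < z <= 1 -> 0 < u -> Y = Q2 * u -> u * (1 + z ^+ 2) < 1 - k -> 0 < k ->
  2 <= Y -> 0 < Q2 -> 3 * x + 1 <= k * Q2 -> Y * (1 + r ^+ 2) + Y^-1 <= Q2.
Proof.
move=> r0 rz x0 xQ /andP[z0 z1] u0 YE h k0 Y2 Q20 kQ.
have Yi : Y^-1 <= 1 by rewrite invf_le1; lra.
pose e := x / Q2; have e0 : 0 <= e by rewrite divr_ge0 // ltW.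
have e1 : e <= 1 by rewrite ler_pdivrMr // mul1r.
have r2 : r ^+ 2 <= z ^+ 2 + 3 * e.
  apply: (@le_trans _ _ ((z + e) ^+ 2)); first by rewrite ler_pXn2r ?nnegrE ?(ltW r0) //; rewrite addr_ge0 // ltW.
  by rewrite !expr2; nra.
have h2 : Y * (1 + z ^+ 2) <= Q2 * (1 - k) by rewrite YE -mulrA ler_pM2l // ltW.
have YQ : Y * e <= x.
  have u1 : u <= 1 by have := sqr_ge0 z; nra.
  rewrite YE mulrAC [Q2 * e]mulrC divfK ?gt_eqF // ; nra.
have h1 : Y * (1 + r ^+ 2) <= Y * (1 + z ^+ 2) + 3 * (Y * e).
  rewrite (_ : _ + 3 * _ = Y * (1 + z ^+ 2 + 3 * e)); last by ring.
  by rewrite ler_pM2l; lra.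
by move: h1 h2; rewrite mulrBr mulr1 [Q2 * k]mulrC; lra.
Qed.

Lemma GammaI_near M g (k Q2 w z a m : R) : 0 < k -> w * Q2 * a = m -> 0 < Q2 ->
  (`|(M 1 0)%:~R : R| + 1) / k ^+ 3 <= Q2 -> k < z -> z < 1 - k -> k < w -> k < a ->
  0 < z * m - (M 1 0)%:~R <= m.
Proof.
move=> k0 mE Q0; rewrite ler_pdivrMr ?exprn_gt0 // => K kz zk kw ka.
have : - `|(M 1 0)%:~R : R| <= (M 1 0)%:~R <= `|(M 1 0)%:~R : R| by rewrite -ler_norml.
move: (`|(M 1 0)%:~R : R|) ((M 1 0)%:~R : R) K => n t K /andP[t1 t2].
have m0 : k ^+ 2 * Q2 <= m.
  rewrite -mE expr2 [k * k * _]mulrAC; apply: ler_pM => //; rewrite ?mulr_ge0 ?ler_pM2r // ltW //.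
have km : k ^+ 3 * Q2 <= k * m by rewrite exprS -mulrA ler_pM2l.
have m0' : 0 < m by apply: lt_le_trans m0; rewrite mulr_gt0 // exprn_gt0.
have zm : k * m <= z * m by rewrite ler_pM2r // ltW.
have zm' : z * m <= (1 - k) * m by rewrite ler_pM2r // ltW.
by move: zm'; rewrite mulrBl mul1r => zm'; apply/andP; split; lra.
Qed.

(** Half of the margin k in the angle condition pays for replacing tangents by [rr]; the other half
    leaves room for th below xi / Q^2. *)
Lemma inner_pairM M (xi k : R) (V : nat) : \det M = 1 -> 0 < k -> 0 <= xi ->
  exists K, forall Q th g, 0 < Q -> K <= Q ^+ 2 -> xi - k / 2 <= Q ^+ 2 * th ->
  GammaI g -> innerM M xi k V (PQ Q g) -> pairM M Q th g.
Proof.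
move=> dM k0 xi0; pose m : R := `|(M 1 0)%:~R|.
exists (Num.max (Num.max ((m + 1) / k ^+ 3) (8 / (k * (k ^+ 3) ^+ 2))) ((3 * xi + 1) / k + xi)).
move=> Q th g Q0; rewrite !ge_max => /andP[/andP[K1 K2] K3] hth gG.
have Q2 : 0 < Q ^+ 2 by rewrite exprn_gt0.
have c2 := cRPQ g Q0; have c0 := cR_gt0 R gG; have v0 := vv_gt0 R gG; have z01 := zz_bounds R gG.
have YE := YR_vv R gG; have rz := rr_le_zz gG; have /andP[r0 _] := rr_bounds R gG.
have Y2 := YR_ge2 R gG; have Y'E := YR_mul R M gG; have rE := @rr_mul R g M gG dM.
have [_ cE] := @cR_mul R g M gG; have dE := @dR_mul R g M gG.
have tE := @tanhalf_diff R g (g *m M) gG.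
have pE : PQ Q g = (vv R g, zz R g, (PQ Q g).2) by [].
have gc : (g 1 0)%:~R = cR R g by [].
have az : (g 0 0)%:~R = zz R g * cR R g by rewrite /zz /cR divfK // gt_eqF.
set w := (PQ Q g).2 in c2 pE *; rewrite pE /innerM /hg /hh /=.
move: (vv R g) (zz R g) (cR R g) v0 YE Y'E rE cE dE z01 rz az c2 c0 gc => v z c v0 YE Y'E rE cE dE z01 rz az c2 c0 gc.
move=> [[[[[_ kz] zk] kw] [ka a2p]] [[hb h1] h2]].
have q0 := qM_gt0 v dM.
have kq : k ^+ 2 <= qM M v.
  by rewrite /qM ler_wpDr ?sqr_ge0 // ler_pXn2r ?nnegrE ?(ltW k0) ?(ltW ka) // ltW // (lt_trans k0).
have k1 : k < 1 by clear -kz zk k0; lra.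
have w0 : 0 < w by clear -k0 kw; lra.
have K3' : (3 * xi + 1) / k <= Q ^+ 2 by clear -K3 xi0; lra.
have xi0k : 0 <= (3 * xi + 1) / k by rewrite divr_ge0 ?(ltW k0) //; clear -xi0; lra.
have xQ : xi <= Q ^+ 2 by clear -K3 xi0k; lra.
move: K3'; rewrite ler_pdivrMr // [Q ^+ 2 * k]mulrC => K3'.
have gMG : GammaI (g *m M).
  have a1p : 0 < a1 M v by clear -ka k0; lra.
  apply: GammaI_mul => //.
  - by rewrite -(ltr0z R) -/(cR R _) cE mulr_gt0.
  - by rewrite -(ltr0z R) dE mulr_gt0.
  have := @GammaI_near M g k (Q ^+ 2) w z (a1 M v) (c * cR R (g *m M)) k0 _ Q2 K1 kz zk kw ka.
  rewrite -c2 cE expr2 -!mulrA => /(_ erefl); rewrite -cE.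
  rewrite mulrA -az /cR => h.
  by rewrite -(ltr0z R) -(ler_int R) intrB !intrM gc.
have /andP[r'0 _] := rr_bounds R gMG; have Y'2 := YR_ge2 R gMG.
have Yk : k * Q ^+ 2 <= YR R g.
  rewrite YE c2; apply: (@le_trans _ _ (w * Q ^+ 2)); first by rewrite ler_pM2r // ltW.
  by apply: ler_mul1Dsqr; rewrite mulr_ge0 // ltW.
have Y'k : k ^+ 3 * Q ^+ 2 <= YR R (g *m M).
  rewrite Y'E c2 (_ : k ^+ 3 * Q ^+ 2 = k * Q ^+ 2 * k ^+ 2); last by ring.
  by apply: ler_pM => //; rewrite ?sqr_ge0 ?mulr_ge0 ?ler_pM2r ?(ltW k0) ?(ltW Q2) // ltW.
have k3 : k ^+ 3 <= k by rewrite exprS ler_piMr ?(ltW k0) // exprn_ile1 // ltW.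
have dr : `|rr R g - rr R (g *m M)| <= (xi - k) / Q ^+ 2 by rewrite rE c2; apply: pair_dr => //; exact: ltW.
have tail := inv_sqr_tail k0 (exprn_gt0 3 k0) k3 Q2 K2 Yk Y'k.
have sum_th : (xi - k) / Q ^+ 2 + k / 2 / Q ^+ 2 <= th.
  by rewrite -mulrDl ler_pdivrMr // mulrC; clear -hth; lra.
split => //; last first.
  rewrite distrC; have := tE gMG.
  have := ler_normD (tanhalf g - tanhalf (g *m M) - (rr R g - rr R (g *m M))) (rr R g - rr R (g *m M)).
  by rewrite subrK; clear -tail dr sum_th; lra.
split; rewrite normg_le ?det_mul ?(ltW Q0) //; try exact: GammaI_det.
  apply: (@height_le _ _ z (w * (1 + v ^+ 2)) _ k) => //.
  - by rewrite mulr_gt0 // sqrD1_gt0.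
  - by rewrite YE c2; ring.
  - by clear -K3' xi0; lra.
apply: (@height_le_near _ _ z (w * qM M v) _ k xi) => //.
- have : rr R (g *m M) <= rr R g + `|rr R g - rr R (g *m M)| by have := ler_norm (rr R (g *m M) - rr R g); rewrite distrC; clear; lra.
  have : (xi - k) / Q ^+ 2 <= xi / Q ^+ 2 by rewrite ler_pM2r ?invr_gt0 //; clear -k0; lra.
  by clear -rz dr; lra.
- by rewrite mulr_gt0.
- by rewrite Y'E c2; ring.
Qed.

(** The row (1, v) is at most as long as its image under M times the norm of the inverse of M, and
    for determinant 1 the inverse has the norm of M. *)
Lemma qM_lower M v : \det M = 1 -> 1 + v ^+ 2 <= (XR R M + YR R M) * qM M v.
Proof.
rewrite det2E => d; have : (M 0 0)%:~R * (M 1 1)%:~R - (M 0 1)%:~R * (M 1 0)%:~R = 1 :> R.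
  by rewrite -!intrM -intrB d.
rewrite /XR /YR /Xg /Yg /qM /a1 /a2 !intrD !expr2 !intrM.
move: ((M 0 0)%:~R : R) ((M 0 1)%:~R : R) ((M 1 0)%:~R : R) ((M 1 1)%:~R : R) => a b e f h.
rewrite -subr_ge0 (_ : _ - _ = (e * (a + v * e) + f * (b + v * f)) ^+ 2 + (a * (a + v * e) + b * (b + v * f)) ^+ 2).
  by rewrite addr_ge0 ?sqr_ge0.
have e1 : f * (a + v * e) - e * (b + v * f) = 1 by rewrite -h; ring.
have e2 : a * (b + v * f) - b * (a + v * e) = v by rewrite -[RHS]mulr1 -h; ring.
rewrite [1 + v * v](_ : _ = (f * (a + v * e) - e * (b + v * f)) ^+ 2 + (a * (b + v * f) - b * (a + v * e)) ^+ 2).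
  by ring.
by rewrite e1 e2 expr1n expr2.
Qed.

Lemma height_gt (Y r z d Q2 k C : R) : 0 < z <= 1 -> 0 < r -> z - d <= r -> 0 < Y -> Y * d <= C -> 0 <= Y * d ->
  (1 + k) * Q2 < Y * (1 + z ^+ 2) -> 2 * C <= k * Q2 -> Y * (1 + r ^+ 2) + Y^-1 <= Q2 -> False.
Proof.
move=> /andP[z0 z1] r0 zr Y0 YC Yd0 h kQ.
have h1 := sqr_lower (ltW z0) zr (ltW r0).
have h2 : Y * (z ^+ 2 - 2 * z * d) <= Y * r ^+ 2 by rewrite ler_pM2l.
have h3 : z * (Y * d) <= Y * d by rewrite ler_piMl.
have Yi : 0 < Y^-1 by rewrite invr_gt0.
move: h h2; rewrite !mulrDr !mulr1 mulrN (_ : Y * (2 * z * d) = 2 * (z * (Y * d))); last by ring.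
by rewrite mulrDl mul1r; lra.
Qed.

(** Since w > k, the level of g is of order Q^2, and by [qM_lower] so is that of g M. The neglected
    terms are then too small to repair a violation by k. *)
Lemma viol_pairM M (xi k : R) (V : nat) : \det M = 1 -> 0 < k -> 0 <= xi ->
  exists K, forall Q th g, 0 < Q -> K <= Q ^+ 2 -> Q ^+ 2 * th <= xi + k / 2 ->
  pairM M Q th g -> violM M xi k V (PQ Q g) -> False.
Proof.
move=> dM k0 xi0; pose N : R := XR R M + YR R M; pose q := k / N.
pose C := V%:R / k + xi + k.
exists (Num.max (8 / (k * q ^+ 2)) (2 * (V%:R + C) / k)).
move=> Q th g Q0; rewrite !ge_max => /andP[K1 K2] hth [gG gMG [nm nm'] tt].
have Q2 : 0 < Q ^+ 2 by rewrite exprn_gt0.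
have N1 : 1 <= N.
  have := qM_lower 0 dM; rewrite -/N expr0n addr0 /qM /a1 /a2 !mul0r !addr0 => h.
  have YM := YR_gt0 R dM; have XM : 0 <= XR R M by rewrite /XR ler0z addr_ge0 ?sqr_ge0.
  have XM' : XR R M = (M 0 0)%:~R ^+ 2 + (M 0 1)%:~R ^+ 2 by rewrite /XR /Xg intrD !expr2 !intrM.
  have : 1 <= YR R M by rewrite /YR (ler_int R 1) -gtz0_ge1 -(ltr0z R).
  by rewrite /N; lra.
have N0 : 0 < N by lra.
have q0 : 0 < q by rewrite divr_gt0.
have qk : q <= k by rewrite ler_pdivrMr // ler_peMr // ltW.
have c2 := cRPQ g Q0; have c0 := cR_gt0 R gG; have v0 := vv_gt0 R gG; have z01 := zz_bounds R gG.
have YE := YR_vv R gG; have rzE := rr_zz R gG; have /andP[r0 _] := rr_bounds R gG.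
have Y2 := YR_ge2 R gG; have Y'E := YR_mul R M gG; have rE := @rr_mul R g M gG dM.
have [_ cE] := @cR_mul R g M gG; have dE := @dR_mul R g M gG.
have tE := @tanhalf_diff R g (g *m M) gG gMG.
have /andP[r'0 _] := rr_bounds R gMG; have Y'2 := YR_ge2 R gMG.
have c'0 := cR_gt0 R gMG.
have d'0 : 0 < ((g *m M) 1 1)%:~R :> R by case/GammaIP: gMG => *; rewrite ltr0z.
move: nm nm'; rewrite !normg_le ?det_mul ?(ltW Q0) //; try exact: GammaI_det.
move=> nm nm'.
have pE : PQ Q g = (vv R g, zz R g, (PQ Q g).2) by [].
set w := (PQ Q g).2 in c2 pE *; rewrite pE /violM /hg /hh /boxS /=.
have qN := qM_lower (vv R g) dM; have qM0 := qM_gt0 (vv R g) dM.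
move: (vv R g) (zz R g) (cR R g) v0 YE Y'E rE cE dE z01 rzE c2 c0 qN qM0 => v z c v0 YE Y'E rE cE dE z01 rzE c2 c0 qN qM0.
move=> [[[/andP[_ vV] _ _] kw] viol].
have w0 : 0 < w by clear -k0 kw; lra.
have Yk : k * Q ^+ 2 <= YR R g.
  rewrite YE c2; apply: (@le_trans _ _ (w * Q ^+ 2)); first by rewrite ler_pM2r // ltW.
  by apply: ler_mul1Dsqr; rewrite mulr_ge0 // ltW.
have Y'k : q * Q ^+ 2 <= YR R (g *m M).
  have qNN : N^-1 <= qM M v.
    by rewrite -div1r ler_pdivrMr // mulrC; apply: le_trans qN; rewrite lerDl sqr_ge0.
  rewrite Y'E c2 (_ : q * Q ^+ 2 = k * Q ^+ 2 * N^-1); last by rewrite /q; ring.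
  by apply: ler_pM => //; rewrite ?invr_ge0 ?(ltW N0) ?mulr_ge0 ?ler_pM2r ?(ltW k0) ?(ltW Q2) // ltW.
have tail := inv_sqr_tail k0 q0 qk Q2 K1 Yk Y'k.
have V0 : 0 <= V%:R / k by rewrite divr_ge0 // ltW.
have C0 : 0 <= C by rewrite /C; clear -V0 xi0 k0; lra.
have K2' : 2 * (V%:R + C) <= k * Q ^+ 2 by move: K2; rewrite ler_pdivrMr // [Q ^+ 2 * k]mulrC.
have dr : `|rr R g - rr R (g *m M)| <= (xi + k) / Q ^+ 2.
  have h1 : th + k / 2 / Q ^+ 2 <= (xi + k) / Q ^+ 2.
    by rewrite -lerBrDr -mulrBl ler_pdivlMr // mulrC; clear -hth; lra.
  rewrite distrC in tt.
  have := ler_normB (tanhalf g - tanhalf (g *m M)) (tanhalf g - tanhalf (g *m M) - (rr R g - rr R (g *m M))).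
  by rewrite opprB addrC subrK; clear -tail h1 tt tE; lra.
have Y0 : 0 < YR R g by clear -Y2; lra.
have Y'0 : 0 < YR R (g *m M) by clear -Y'2; lra.
case: viol => [[[[h|h]|h]|h]|h].
- by move: c'0; rewrite cE pmulr_rgt0 // ltNge (ltW h).
- by move: d'0; rewrite dE pmulr_rgt0 // ltNge (ltW h).
- move: dr; rewrite rE c2 invfM mulrA ler_pM2r ?invr_gt0 // ler_pdivrMr //.
  by rewrite leNgt h.
- apply: (@height_gt (YR R g) (rr R g) z (v / YR R g) (Q ^+ 2) k V%:R) => //.
  + by rewrite rzE.
  + by rewrite mulrC divfK ?gt_eqF // ltW.
  + by rewrite mulrC divfK ?gt_eqF // ltW.
  + by rewrite YE c2 mulrC; move: h; rewrite -(ltr_pM2r Q2); congr (_ < _); ring.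
  + by clear -K2' C0; lra.
apply: (@height_gt (YR R (g *m M)) (rr R (g *m M)) z (C / Q ^+ 2) (Q ^+ 2) k C) => //.
- have e1 : v / YR R g <= V%:R / k / Q ^+ 2.
    rewrite -mulrA -invfM ler_pdivrMr // mulrAC ler_pdivlMr ?mulr_gt0 //.
    by apply: ler_pM => //; rewrite ?mulr_ge0 ?(ltW v0) ?(ltW k0) ?(ltW Q2) // ltW.
  have e2 : C / Q ^+ 2 = V%:R / k / Q ^+ 2 + (xi + k) / Q ^+ 2 by rewrite /C; ring.
  by have := ler_norm (rr R g - rr R (g *m M)); rewrite e2; clear -e1 rzE dr; lra.
- have Y'Q : YR R (g *m M) <= Q ^+ 2.
    have i0 : 0 < (YR R (g *m M))^-1 by rewrite invr_gt0.
    have : 0 <= YR R (g *m M) * rr R (g *m M) ^+ 2 by rewrite mulr_ge0 ?sqr_ge0 // ltW.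
    by move: nm'; rewrite mulrDr mulr1; clear -i0; lra.
  by rewrite mulrA ler_pdivrMr // [_ * C]mulrC; exact: ler_wpM2l.
- by rewrite mulr_ge0 ?divr_ge0 // ltW.
- by rewrite Y'E c2 mulrC; move: h; rewrite -(ltr_pM2r Q2); congr (_ < _); ring.
- by have : 0 <= V%:R :> R by []; clear -K2' C0; lra.
Qed.
End PairRegion.

(** * Volumes of the pair regions and the count for a fixed matrix *)

Section PairMeasure.
Variable R : realType.
Local Open Scope classical_set_scope.
Local Open Scope ring_scope.
Implicit Types (g M : 'M[int]_2) (Q v : R) (p : R * R * R).

Local Notation mu := (@lebesgue_measure R).
Local Notation RL := (measurableTypeR R).
Local Notation meas3 := (@measurable _ (RL * RL * RL)%type).
Local Notation mu3 := (@mu3 R).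

Lemma open_octant : open (@octant R).
Proof.
rewrite (_ : @octant R = [set p | 0 < p.1.1] `&` [set p | 0 < p.1.2] `&` [set p | 0 < p.2]).
  apply: openI; [apply: openI|exact: open_w_gt]; last exact: open_z_gt.
  by apply: open_lt_continuous; [exact: contC|exact: continuous_v].
by apply/seteqP; split => p; [case|case=> -[]].
Qed.

Lemma meas3_octantI (U : set (R * R * R)) : open U -> meas3 (@octant R `&` U).
Proof. by move=> oU; apply: measurable_open_octant; [apply: openI => //; exact: open_octant|exact: subIsetl]. Qed.

Lemma meas3_octant_eq (f h : R * R * R -> R) :
  open [set p | f p < h p] -> open [set p | h p < f p] -> meas3 (@octant R `&` [set p | f p = h p]).
Proof.
move=> o_lt o_gt; rewrite (_ : _ `&` _ = @octant R `\` (@octant R `&` ([set p | f p < h p] `|` [set p | h p < f p]))).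
  apply: measurableD; first by apply: measurable_open_octant; [exact: open_octant|].
  by apply: meas3_octantI; exact: openU.
apply/seteqP; split=> p [op /= e]; split => //; first by move=> [_ []] /=; rewrite e ltxx.
by case: (ltgtP (f p) (h p)) => // h0; case: e; split => //; [left|right].
Qed.

(** Every section in w is empty or a single point. *)
Lemma mu3_graph (A : set (R * R * R)) : meas3 A -> (forall v z w w', A (v, z, w) -> A (v, z, w') -> w = w') ->
  mu3 A = 0%E.
Proof.
move=> mA uA; rewrite -[LHS]/(\int[(mu \x mu)%E]_x (mu \o xsection A) x)%E.
apply: integral0_eq => -[v z] _ /=.
have [[w Aw]|nA] := pselect (exists w, A (v, z, w)).
  rewrite (_ : xsection A (v, z) = [set w]) ?lebesgue_measure_set1 //.
  apply/seteqP; split=> w'; rewrite /xsection /=; first by move=> /set_mem /(uA v z w w' Aw) ->.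
  by move=> ->; exact: mem_set.
rewrite (_ : xsection A (v, z) = set0) ?measure0 //.
by apply/seteqP; split=> w' //=; rewrite /xsection /= => /set_mem Aw; apply: nA; exists w'.
Qed.

Lemma mu3_v (A : set (R * R * R)) (v0 : R) : meas3 A -> A `<=` [set p | p.1.1 = v0] -> mu3 A = 0%E.
Proof.
move=> mA sub; apply/eqP; rewrite eq_le measure_ge0 andbT.
have m1 : @measurable _ RL [set v0] by exact: measurable_set1.
have := @mu3X R [set v0] setT setT m1 measurableT measurableT.
rewrite lebesgue_measure_set1 !mul0e => <-; apply: mu3_le => //.
  by do 2?[apply: measurableX => //].
by move=> p /sub /= h; split.
Qed.

Lemma mu3_z (A : set (R * R * R)) (z0 : R) : meas3 A -> A `<=` [set p | p.1.2 = z0] -> mu3 A = 0%E.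
Proof.
move=> mA sub; apply/eqP; rewrite eq_le measure_ge0 andbT.
have m1 : @measurable _ RL [set z0] by exact: measurable_set1.
have := @mu3X R setT [set z0] setT measurableT m1 measurableT.
rewrite lebesgue_measure_set1 mule0 mul0e => <-; apply: mu3_le => //.
  by do 2?[apply: measurableX => //].
by move=> p /sub /= h; split.
Qed.

(* Limit region, in the coordinates PQ, of the pairs (g, g M): bM M v / (Q^2 w) is the limiting difference of half-angle tangents. *)
Definition WM M (xi : R) : set (R * R * R) :=
  [set p | [/\ 0 < p.1.1, 0 < p.1.2 <= 1 & 0 < p.2] /\
           [/\ 0 < a1 M p.1.1, 0 < a2 M p.1.1, bM M p.1.1 <= xi * p.2, hg p <= 1 & hh M p <= 1]].

Lemma measurable_WM M xi : \det M = 1 -> meas3 (WM M xi).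
Proof.
move=> d; pose O' := [set p : R * R * R | 1 < p.1.2] `|` [set p | xi * p.2 < bM M p.1.1] `|` [set p | 1 < hg p] `|` [set p | 1 < hh M p].
rewrite (_ : WM M xi = (@octant R `&` ([set p : R * R * R | 0 < a1 M p.1.1] `&` [set p | 0 < a2 M p.1.1])) `\` (@octant R `&` O')).
  apply: measurableD; apply: meas3_octantI.
    by apply: openI; [exact: open_a1_gt|exact: open_a2_gt].
  apply: openU; last exact: open_hh_gt.
  apply: openU; last exact: open_hg_gt.
  by apply: openU; [exact: open_z_gt|exact: open_bM_gt].
apply/seteqP; split=> p.
  move=> [[v0 /andP[z0 z1] w0] [A1 A2 B H1 H2]]; split; first by split.
  by move=> [_ [[[|]|]|]] /=; rewrite ltNge ?z1 ?B ?H1 ?H2.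
move=> [[[v0 z0 w0] [A1 A2]] nO].
have nO' : ~ O' p by move=> h; apply: nO.
split; split => //.
- by rewrite z0 leNgt; apply/negP => h; apply: nO'; left; left; left.
- by rewrite leNgt; apply/negP => h; apply: nO'; left; left; right.
- by rewrite leNgt; apply/negP => h; apply: nO'; left; right.
- by rewrite leNgt; apply/negP => h; apply: nO'; right.
Qed.

Lemma w_lt_hg p : 0 < p.2 -> p.2 <= hg p.
Proof.
move=> w0; rewrite /hg; apply: (le_trans (ler_mul1Dsqr p.1.1 (ltW w0))).
by apply: ler_mul1Dsqr; rewrite mulr_ge0 ?(ltW w0) // addr_ge0 ?sqr_ge0.
Qed.

Definition innerN M (xi : R) (n : nat) := innerM M xi n.+1%:R^-1 n.+1.

Lemma innerN_homo M xi : {homo innerN M xi : n m / (n <= m)%N >-> (n <= m)%O}.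
Proof.
apply/nondecreasing_seqP => n; rewrite subsetEset => p.
have h : n.+2%:R^-1 <= n.+1%:R^-1 :> R by rewrite lef_pV2 ?posrE // ler_nat.
have V : n.+1%:R <= n.+2%:R :> R by rewrite ler_nat.
rewrite /innerN /innerM; move: h V; move: (n.+2%:R^-1 : R) (n.+1%:R^-1 : R) => x y xy V.
move=> [[[[[[/andP[? b1] b2 b3] ?] ?] ?] [? ?]] [[? ?] ?]].
have w0 : 0 < p.2 by case/andP: b3.
have e : (xi - y) * p.2 <= (xi - x) * p.2 by rewrite ler_pM2r // lerD2l lerN2.
split; [split; [split; [split; [split|]|]|split]|split; [split|]] => //=; try (by apply: le_lt_trans xy _).
- by split => //; apply/andP; split => //; apply: lt_le_trans V.
- by apply: (@lt_le_trans _ _ (1 - y)) => //; rewrite lerD2l lerN2.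
- exact: (@lt_le_trans _ _ ((xi - y) * p.2)).
- by apply: (@lt_le_trans _ _ (1 - y)) => //; rewrite lerD2l lerN2.
- by apply: (@lt_le_trans _ _ (1 - y)) => //; rewrite lerD2l lerN2.
Qed.

Lemma natSinv_near (x : R) : 0 < x -> \forall n \near \oo, n.+1%:R^-1 < x.
Proof. by move=> x0; exact: (near_infty_natSinv_lt (PosNum x0)). Qed.

(** A point missed by all the shrunk regions satisfies one of four equalities, each of which defines
    a null set. *)
Lemma WM_inner M xi : \det M = 1 -> WM M xi `<=` (\bigcup_n innerN M xi n) `|`
  ((@octant R `&` [set p | p.1.2 = 1]) `|` (@octant R `&` [set p | bM M p.1.1 = xi * p.2]) `|`
   (@octant R `&` [set p | hg p = 1]) `|` (@octant R `&` [set p | hh M p = 1])).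
Proof.
move=> d p [[v0 /andP[z0 z1] w0] [A1 A2 B H1 H2]].
have op : octant p by split.
have [e|nz] := eqVneq p.1.2 1; first by right; left; left; left.
have [e|nb] := eqVneq (bM M p.1.1) (xi * p.2); first by right; left; left; right.
have [e|ng] := eqVneq (hg p) 1; first by right; left; right.
have [e|nh] := eqVneq (hh M p) 1; first by right; right.
left; have {nz}z1' : p.1.2 < 1 by rewrite lt_neqAle nz.
have {nb}B' : 0 < xi - bM M p.1.1 / p.2 by rewrite subr_gt0 ltr_pdivrMr // lt_neqAle nb.
have {ng}H1' : hg p < 1 by rewrite lt_neqAle ng.
have {nh}H2' : hh M p < 1 by rewrite lt_neqAle nh.
have s1 : 0 < 1 - p.1.2 by rewrite subr_gt0.
have s2 : 0 < 1 - hg p by rewrite subr_gt0.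
have s3 : 0 < 1 - hh M p by rewrite subr_gt0.
near \oo => n; exists n => //.
have k1 : n.+1%:R^-1 < p.1.2 by near: n; exact: natSinv_near.
have k2 : n.+1%:R^-1 < 1 - p.1.2 by near: n; exact: natSinv_near.
have k3 : n.+1%:R^-1 < p.2 by near: n; exact: natSinv_near.
have k4 : n.+1%:R^-1 < a1 M p.1.1 by near: n; exact: natSinv_near.
have k5 : n.+1%:R^-1 < xi - bM M p.1.1 / p.2 by near: n; exact: natSinv_near.
have k6 : n.+1%:R^-1 < 1 - hg p by near: n; exact: natSinv_near.
have k7 : n.+1%:R^-1 < 1 - hh M p by near: n; exact: natSinv_near.
have k8 : n.+1%:R^-1 < p.1.1^-1 by near: n; apply: natSinv_near; rewrite invr_gt0.
have w1 : p.2 < 1 by apply: le_lt_trans H1'; exact: w_lt_hg.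
have k8' : p.1.1 < n.+1%:R by rewrite -ltf_pV2 ?posrE.
have k5' : bM M p.1.1 < (xi - n.+1%:R^-1) * p.2 by rewrite -ltr_pdivrMr // ltrBrDr -ltrBrDl.
have k2' : p.1.2 < 1 - n.+1%:R^-1 by rewrite ltrBrDr -ltrBrDl.
have k6' : hg p < 1 - n.+1%:R^-1 by rewrite ltrBrDr -ltrBrDl.
have k7' : hh M p < 1 - n.+1%:R^-1 by rewrite ltrBrDr -ltrBrDl.
split; [split; [split; [split; [split|]|]|split]|split; [split|]] => //=.
by split; apply/andP; split.
Unshelve. all: by end_near. Qed.

Lemma inner_WM M xi n : innerN M xi n `<=` WM M xi.
Proof.
move=> p [[[[[[/andP[? b1] /andP[? b2] /andP[? b3]] ?] ?] ?] [h1 h2]] [[h3 h4] h5]].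
have k0 : 0 <= n.+1%:R^-1 :> R by rewrite invr_ge0.
split; split => //.
- by apply/andP; split => //; exact: ltW.
- by apply: le_lt_trans h1.
- by apply: (le_trans (ltW h3)); rewrite ler_pM2r // lerBlDr lerDl.
- by apply: (le_trans (ltW h4)); rewrite lerBlDr lerDl.
- by apply: (le_trans (ltW h5)); rewrite lerBlDr lerDl.
Qed.

Lemma measurable_innerN M xi n : \det M = 1 -> meas3 (innerN M xi n).
Proof.
move=> d; apply: measurable_open_octant; first exact: open_innerM.
by move=> p [[[[[/boxS_octant]]]]].
Qed.

Lemma mu3_null_setU (A B : set (R * R * R)) : meas3 A -> meas3 B -> mu3 A = 0%E -> mu3 B = 0%E -> mu3 (A `|` B) = 0%E.
Proof.
move=> mA mB A0 B0; apply/eqP; rewrite eq_le measure_ge0 andbT.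
by apply: le_trans (mu3U_le mA mB) _; rewrite A0 B0 adde0.
Qed.

Lemma mu3_WM_inner M xi : \det M = 1 -> 0 < xi -> mu3 (WM M xi) = mu3 (\bigcup_n innerN M xi n).
Proof.
move=> d x0; have mI : meas3 (\bigcup_n innerN M xi n) by apply: bigcup_measurable => n _; exact: measurable_innerN.
have mW := measurable_WM xi d.
apply/eqP; rewrite eq_le; apply/andP; split; last first.
  by apply: mu3_le => // p [n _]; exact: inner_WM.
have m1 : meas3 (@octant R `&` [set p | p.1.2 = 1]) by apply: meas3_octant_eq; [exact: open_z_lt|exact: open_z_gt].
have m2 : meas3 (@octant R `&` [set p | bM M p.1.1 = xi * p.2]) by apply: meas3_octant_eq; [exact: open_bM_lt|exact: open_bM_gt].
have m3 : meas3 (@octant R `&` [set p | hg p = 1]) by apply: meas3_octant_eq; [exact: open_hg_lt|exact: open_hg_gt].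
have m4 : meas3 (@octant R `&` [set p | hh M p = 1]) by apply: meas3_octant_eq; [exact: open_hh_lt|exact: open_hh_gt].
have n1 : mu3 (@octant R `&` [set p | p.1.2 = 1]) = 0%E by apply: (@mu3_z _ 1) => // p [].
have n3 : mu3 (@octant R `&` [set p | hg p = 1]) = 0%E.
  apply: mu3_graph => // v z w w' [_]; rewrite /hg /= => h1 [_ h2].
  have p0 : 0 < (1 + v ^+ 2) * (1 + z ^+ 2) by rewrite mulr_gt0 // sqrD1_gt0.
  by apply: (mulIf (lt0r_neq0 p0)); rewrite !mulrA h1 h2.
have n4 : mu3 (@octant R `&` [set p | hh M p = 1]) = 0%E.
  apply: mu3_graph => // v z w w' [_]; rewrite /hh /= => h1 [_ h2].
  have p0 : 0 < (qM M v) * (1 + z ^+ 2) by rewrite mulr_gt0 ?qM_gt0 // sqrD1_gt0.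
  by apply: (mulIf (lt0r_neq0 p0)); rewrite !mulrA h1 h2.
have n2 : mu3 (@octant R `&` [set p | bM M p.1.1 = xi * p.2]) = 0%E.
  apply: mu3_graph => // v z w w' [_] /= h1 [_ /= h2].
  by apply: (mulfI (lt0r_neq0 x0)); rewrite -h1 -h2.
have m12 := measurableU _ _ m1 m2; have m123 := measurableU _ _ m12 m3; have m1234 := measurableU _ _ m123 m4.
have n12 := mu3_null_setU m1 m2 n1 n2; have n123 := mu3_null_setU m12 m3 n12 n3.
have n1234 := mu3_null_setU m123 m4 n123 n4.
apply: (@le_trans _ _ (mu3 (\bigcup_n innerN M xi n `|`
  ((@octant R `&` [set p | p.1.2 = 1]) `|` (@octant R `&` [set p | bM M p.1.1 = xi * p.2]) `|`
   (@octant R `&` [set p | hg p = 1]) `|` (@octant R `&` [set p | hh M p = 1]))))).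
  apply: mu3_le => //; [exact: measurableU|exact: WM_inner].
by apply: le_trans (mu3U_le mI m1234) _; rewrite n1234 adde0.
Qed.

Lemma cvg_innerN M xi : \det M = 1 -> 0 < xi -> mu3 (innerN M xi n) @[n --> \oo] --> mu3 (WM M xi).
Proof.
move=> d x0; rewrite mu3_WM_inner //; apply: nondecreasing_cvg_mu => //.
- by move=> n; exact: measurable_innerN.
- by apply: bigcup_measurable => n _; exact: measurable_innerN.
- exact: innerN_homo.
Qed.

Definition violN M (xi : R) (V n : nat) := violM M xi n.+1%:R^-1 V.+1.

Lemma violN_homo M xi V : {homo violN M xi V : n m / (n <= m)%N >-> (n <= m)%O}.
Proof.
apply/nondecreasing_seqP => n; rewrite subsetEset => p.
have h : n.+2%:R^-1 <= n.+1%:R^-1 :> R by rewrite lef_pV2 ?posrE // ler_nat.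
rewrite /violN /violM; move: h; move: (n.+2%:R^-1 : R) (n.+1%:R^-1 : R) => x y xy.
move=> [[[b1 b2 b3] kw] vi].
have w0 : 0 < p.2 by case/andP: b3.
have e : (xi + x) * p.2 <= (xi + y) * p.2 by rewrite ler_pM2r // lerD2l.
split; first by split => //=; apply: le_lt_trans kw.
move: vi => [[[[]|]|]|]; [move=> h; left; left; left; left; exact: h|move=> h; left; left; left; right; exact: h| | |] => /= h.
- by left; left; right; exact: (le_lt_trans e).
- by left; right; apply: le_lt_trans h; rewrite lerD2l.
- by right; apply: le_lt_trans h; rewrite lerD2l.
Qed.

Lemma measurable_violN M xi V n : \det M = 1 -> meas3 (violN M xi V n).
Proof.
move=> d; apply: measurable_open_octant; first exact: open_violM.
by move=> p [[/boxS_octant]].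
Qed.

(** A covering is enough here: it bounds the volume of the box without the violations by that of the
    limit region, as needed for an upper bound on the count. *)
Lemma boxS_viol M xi V : \det M = 1 -> boxS V.+1 `<=` (\bigcup_n violN M xi V n) `|`
  (WM M xi `|` ((@octant R `&` [set p | a1 M p.1.1 = 0]) `|` (@octant R `&` [set p | a2 M p.1.1 = 0]))).
Proof.
move=> d p [/andP[v0 vV] /andP[z0 z1] /andP[w0 w1]].
have op : octant p by split.
have bp : boxS V.+1 p by split; apply/andP.
have vn : (\forall n \near \oo, violN M xi V n p) -> (\bigcup_n violN M xi V n) p.
  by move=> [n _ h]; exists n => //; apply: h => /=.
have [A1|A1|A1] := ltgtP (a1 M p.1.1) 0; last by right; right; left.
  left; apply: vn; near=> n; split; first by split => //=; near: n; exact: natSinv_near.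
  by left; left; left; left.
have [A2|A2|A2] := ltgtP (a2 M p.1.1) 0; last by right; right; right.
  left; apply: vn; near=> n; split; first by split => //=; near: n; exact: natSinv_near.
  by left; left; left; right.
have [B|B] := leP (bM M p.1.1) (xi * p.2); last first.
  left; apply: vn; near=> n; split; first by split => //=; near: n; exact: natSinv_near.
  left; left; right => /=; rewrite mulrDl -ltrBrDl -ltr_pdivlMr //; near: n; apply: natSinv_near.
  by rewrite divr_gt0 // subr_gt0.
have [H1|H1] := leP (hg p) 1; last first.
  left; apply: vn; near=> n; split; first by split => //=; near: n; exact: natSinv_near.
  by left; right => /=; rewrite -ltrBrDl; near: n; apply: natSinv_near; rewrite subr_gt0.
have [H2|H2] := leP (hh M p) 1; last first.
  left; apply: vn; near=> n; split; first by split => //=; near: n; exact: natSinv_near.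
  by right => /=; rewrite -ltrBrDl; near: n; apply: natSinv_near; rewrite subr_gt0.
right; left; split; split => //; rewrite z0 /=; exact: ltW.
Unshelve. all: by end_near. Qed.

Lemma mu3_a1 M : \det M = 1 -> meas3 (@octant R `&` [set p | a1 M p.1.1 = 0]) /\
  mu3 (@octant R `&` [set p | a1 M p.1.1 = 0]) = 0%E.
Proof.
rewrite det2E => d; have m1 : meas3 (@octant R `&` [set p | a1 M p.1.1 = 0]) by apply: meas3_octant_eq; [exact: open_a1_lt|exact: open_a1_gt].
split => //; apply: (@mu3_v _ (- (M 0 0)%:~R / (M 1 0)%:~R)) => // p [_ /=]; rewrite /a1 => h.
have [m0|m0] := eqVneq ((M 1 0)%:~R : R) 0.
  move: h; rewrite m0 mulr0 addr0 => m00; move/eqP: d; rewrite -(eqr_int R) intrB !intrM m0 m00.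
  by rewrite mul0r mulr0 subr0 eq_sym oner_eq0.
by apply: (mulIf m0); rewrite divfK //; apply/eqP; rewrite -addr_eq0 addrC h.
Qed.

Lemma mu3_a2 M : \det M = 1 -> meas3 (@octant R `&` [set p | a2 M p.1.1 = 0]) /\
  mu3 (@octant R `&` [set p | a2 M p.1.1 = 0]) = 0%E.
Proof.
rewrite det2E => d; have m1 : meas3 (@octant R `&` [set p | a2 M p.1.1 = 0]) by apply: meas3_octant_eq; [exact: open_a2_lt|exact: open_a2_gt].
split => //; apply: (@mu3_v _ (- (M 0 1)%:~R / (M 1 1)%:~R)) => // p [_ /=]; rewrite /a2 => h.
have [m0|m0] := eqVneq ((M 1 1)%:~R : R) 0.
  move: h; rewrite m0 mulr0 addr0 => m00; move/eqP: d; rewrite -(eqr_int R) intrB !intrM m0 m00.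
  by rewrite mul0r mulr0 subr0 eq_sym oner_eq0.
by apply: (mulIf m0); rewrite divfK //; apply/eqP; rewrite -addr_eq0 addrC h.
Qed.

Lemma mu3_boxSE V : mu3 (boxS V.+1) = V.+1%:R%:E.
Proof.
have -> : boxS V.+1 = (`](0 : R), V.+1%:R[ `*` `](0 : R), 1[) `*` `](0 : R), 1[.
  apply/seteqP; split => -[[v z] w] /=; rewrite !in_itv /=; first by case.
  by move=> [[]].
rewrite mu3X; try exact: measurable_itv.
by rewrite !lebesgue_measure_itv /= !lte_fin ltr01 ltr0Sn -!EFinB -!EFinM !subr0 !mulr1.
Qed.

Lemma boxS_le M xi V : \det M = 1 -> (V.+1%:R%:E <= mu3 (\bigcup_n violN M xi V n) + mu3 (WM M xi))%E.
Proof.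
move=> d; have mV : meas3 (\bigcup_n violN M xi V n) by apply: bigcup_measurable => n _; exact: measurable_violN.
have mW := measurable_WM xi d; have [m1 n1] := mu3_a1 d; have [m2 n2] := mu3_a2 d.
have m12 := measurableU _ _ m1 m2; have mW12 := measurableU _ _ mW m12.
rewrite -mu3_boxSE; apply: le_trans (mu3_le _ _ (@boxS_viol M xi V d)) _.
- by apply: measurable_open_octant; [exact: open_boxS|exact: boxS_octant].
- exact: measurableU.
apply: le_trans (mu3U_le mV mW12) _; apply: leeD => //.
by apply: le_trans (mu3U_le mW m12) _; rewrite (mu3_null_setU m1 m2 n1 n2) adde0.
Qed.

Lemma cd_le (c v Q : R) : 0 < c -> 0 < v -> 0 <= Q -> c ^+ 2 * (1 + v ^+ 2) <= Q ^+ 2 -> c <= Q /\ c * v <= Q.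
Proof.
move=> c0 v0 Q0; rewrite mulrDr mulr1 -exprMn => h.
have cv0 : 0 <= c * v by rewrite mulr_ge0 // ltW.
split; rewrite -(@ler_pXn2r _ 2%N) ?nnegrE ?(ltW c0) //.
  by apply: le_trans h; rewrite lerDl sqr_ge0.
by apply: le_trans h; rewrite lerDr sqr_ge0.
Qed.

Lemma normg_cd g Q : GammaI g -> 0 <= Q -> normg g <= Q ->
  cR R g <= Q /\ cR R g * vv R g <= Q.
Proof.
move=> gG Q0; rewrite normg_le ?GammaI_det // => h.
have Y0 := YR_gt0 R (GammaI_det gG); have c0 := cR_gt0 R gG; have v0 := vv_gt0 R gG.
have YQ : YR R g <= Q ^+ 2.
  have i0 : 0 < (YR R g)^-1 by rewrite invr_gt0.
  have : 0 <= YR R g * rr R g ^+ 2 by rewrite mulr_ge0 ?sqr_ge0 // ltW.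
  by move: h; rewrite mulrDr mulr1; lra.
by move: YQ; rewrite YR_vv //; exact: cd_le.
Qed.

Lemma int_le_truncn (x : int) Q : 0 <= Q -> 0 <= x -> x%:~R <= Q -> x <= (Num.truncn Q)%:Z.
Proof.
by case: x => // n Q0 _ h; rewrite lez_nat truncn_ge_nat.
Qed.

Lemma truncn_cd g Q Q' : GammaI g -> 0 <= Q -> 0 <= Q' -> cR R g <= Q -> cR R g * vv R g <= Q' ->
  g 1 0 <= (Num.truncn Q)%:Z /\ g 1 1 <= (Num.truncn Q')%:Z.
Proof.
move=> gG Q0 Q'0 h1 h2; have c0 := cR_gt0 R gG; have /GammaIP[_ cc dd _ _] := gG.
split; apply: int_le_truncn => //; try exact: ltW.
by move: h2; rewrite /vv /cR mulrC divfK // gt_eqF.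
Qed.

Lemma truncn1_le Q : 0 <= Q -> (Num.truncn Q).+1%:R <= Q + 1.
Proof. by move=> Q0; rewrite -natr1 lerD2r truncn_le. Qed.

Lemma finite_normQ Q : 0 <= Q -> finite_set [set g | GammaI g /\ normg g <= Q].
Proof.
move=> Q0; apply: (sub_finite_set _ (finite_GammaI (Num.truncn Q))) => g [gG gQ].
by have [h1 h2] := normg_cd gG Q0 gQ; have := truncn_cd gG Q0 Q0 h1 h2.
Qed.

Lemma cnt_corner (A : set 'M[int]_2) Q Q' : 0 <= Q -> 0 <= Q' ->
  (forall g, A g -> [/\ GammaI g, cR R g <= Q & cR R g * vv R g <= Q']) ->
  (cnt A)%:R <= (Q + 1) * (Q' + 1).
Proof.
move=> Q0 Q'0 h; apply: (@le_trans _ _ ((Num.truncn Q).+1 * (Num.truncn Q').+1)%N%:R); last first.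
  by rewrite natrM; apply: ler_pM => //; exact: truncn1_le.
rewrite ler_nat; apply: leq_trans (corner_count _ _); apply: cnt_sub.
  apply: (sub_finite_set _ (finite_GammaI (maxn (Num.truncn Q) (Num.truncn Q')))) => g [gG [gc gd]]; split => //.
  split; [apply: (le_trans gc)|apply: (le_trans gd)]; rewrite lez_nat; [exact: leq_maxl|exact: leq_maxr].
by move=> g /h[gG h1 h2]; split => //; exact: truncn_cd.
Qed.

Lemma finite_pairM M Q th : 0 <= Q -> finite_set [set g | pairM M Q th g].
Proof. by move=> Q0; apply: (sub_finite_set _ (finite_normQ Q0)) => g [gG _ [h _] _]. Qed.

(** Finiteness comes from counting. Matrices in an inner region have c and d at most Q, hence number
    at most 4 Q^2 up to rounding, while [open_count] makes their number at least proportional to the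
    volume. *)
Lemma mu3_WM_fin M xi : \det M = 1 -> 0 < xi -> mu3 (WM M xi) \is a fin_num.
Proof.
move=> d x0; rewrite ge0_fin_numE ?measure_ge0 //; pose z : R := (2 * zeta 2)^-1.
have z0 : 0 < z by rewrite invr_gt0 mulr_gt0 ?zeta2_gt0.
suff H n : (mu3 (innerN M xi n) <= (5 / z)%:E)%E.
  apply: le_lt_trans (ltry (5 / z)); have cv := @cvg_innerN M xi d x0.
  rewrite -(cvg_lim _ cv) //; apply: lime_le; first by apply/cvg_ex; exists (mu3 (WM M xi)).
  by near=> n; exact: H.
have oI := @open_innerM R M xi n.+1%:R^-1 n.+1 d.
have Ib : innerN M xi n `<=` boxS n.+1 by move=> p [[[[[]]]]].
have fI : mu3 (innerN M xi n) \is a fin_num.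
  rewrite ge0_fin_numE ?measure_ge0 //; apply: le_lt_trans (ltry n.+1%:R).
  rewrite -mu3_boxSE; apply: mu3_le => //; first exact: measurable_innerN.
  by apply: measurable_open_octant; [exact: open_boxS|exact: boxS_octant].
have [Q0 HQ] := open_count oI Ib (@ltr01 R).
pose Q := Num.max Q0 1; have Q1 : 1 <= Q by rewrite le_max lexx orbT.
have Qp : 0 < Q by lra.
have := HQ Q; rewrite le_max lexx => /(_ isT); rewrite -/z => h.
have h2 : (cnt [set g | GammaI g /\ innerM M xi n.+1%:R^-1 n.+1 (PQ Q g)])%:R <= (Q + 1) * (Q + 1).
  apply: cnt_corner; rewrite ?(ltW Qp) // => g [gG] /inner_WM[[_ _ w0] [_ _ _ hg1 _]].
  have hh1 : (PQ Q g).2 * (1 + vv R g ^+ 2) <= 1.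
    apply: le_trans hg1; rewrite /hg; apply: ler_mul1Dsqr.
    by rewrite mulr_ge0 ?(ltW w0) // addr_ge0 ?sqr_ge0.
  have c0 := cR_gt0 R gG; have v0 := vv_gt0 R gG.
  have : cR R g ^+ 2 * (1 + vv R g ^+ 2) <= Q ^+ 2.
    by rewrite (cRPQ g Qp) mulrAC -[leRHS]mul1r ler_pM2r // exprn_gt0.
  by move=> /(cd_le c0 v0 (ltW Qp))[].
have Q2 : 0 < Q ^+ 2 by rewrite exprn_gt0.
have h3 : (z * fine (mu3 (innerN M xi n)) - 1) * Q ^+ 2 <= 4 * Q ^+ 2.
  by apply: (le_trans h); apply: (le_trans h2); rewrite expr2; clear -Q1; nra.
move: h3; rewrite ler_pM2r // => h3.
by rewrite -(fineK fI) lee_fin ler_pdivlMr // mulrC; lra.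
Unshelve. all: by end_near. Qed.

(** Q^2 th may deviate from xi by dl, because th will be a multiple of 1/B_Q, and B_Q / Q^2 is known
    only in the limit. *)
Lemma limM_lower M xi e : \det M = 1 -> 0 < xi -> 0 < e ->
  exists2 dl, 0 < dl & exists Q0, forall Q th, Q0 <= Q -> xi - dl <= Q ^+ 2 * th ->
  ((2 * zeta 2)^-1 * fine (mu3 (WM M xi)) - e) * Q ^+ 2 <= (cnt [set g | pairM M Q th g])%:R.
Proof.
move=> d x0 e0; pose z : R := (2 * zeta 2)^-1.
have z0 : 0 < z by rewrite invr_gt0 mulr_gt0 ?zeta2_gt0.
have e1 : 0 < e / 2 / z by rewrite !divr_gt0.
have fW := mu3_WM_fin d x0.
have [n Hn] : exists n, fine (mu3 (WM M xi)) - e / 2 / z <= fine (mu3 (innerN M xi n)).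
  have h : ((fine (mu3 (WM M xi)) - e / 2 / z)%:E < mu3 (WM M xi))%E by rewrite -[ltRHS]fineK // lte_fin ltrBlDr ltrDl.
  have [n _ Hn] := cvg_innerN d x0 (open_ereal_gt_ereal h); exists n.
  have fI : mu3 (innerN M xi n) \is a fin_num.
    rewrite ge0_fin_numE ?measure_ge0 //; apply: le_lt_trans (_ : (mu3 (WM M xi) < +oo)%E).
      by apply: mu3_le; [exact: measurable_innerN|exact: measurable_WM|exact: inner_WM].
    by rewrite -ge0_fin_numE ?measure_ge0.
  by rewrite -lee_fin (fineK fI); apply: ltW; exact: (Hn n (leqnn n)).
have k0 : 0 < n.+1%:R^-1 :> R by rewrite invr_gt0.
have k2 : 0 < n.+1%:R^-1 / 2 :> R by rewrite divr_gt0.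
exists (n.+1%:R^-1 / 2) => //.
have Ib : innerN M xi n `<=` boxS n.+1 by move=> p [[[[[]]]]].
have e2 : 0 < e / 2 by rewrite divr_gt0.
have [Q1 HQ] := open_count (@open_innerM R M xi n.+1%:R^-1 n.+1 d) Ib e2.
have [K HK] := inner_pairM n.+1 d k0 (ltW x0).
exists (Num.max (Num.max Q1 1) K) => Q th; rewrite !ge_max => /andP[/andP[q1 q2] q3] hth.
have Qp : 0 < Q by clear -q2; lra.
apply: le_trans (_ : (cnt [set g | GammaI g /\ innerM M xi n.+1%:R^-1 n.+1 (PQ Q g)])%:R <= _); last first.
  rewrite ler_nat; apply: cnt_sub; first exact: finite_pairM (ltW Qp).
  move=> g [gG gI]; apply: (HK Q th g) => //.
  by apply: (le_trans q3); rewrite expr2 ler_peMr // ltW.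
apply: le_trans (HQ Q q1); rewrite ler_pM2r ?exprn_gt0 // -/z.
have : z * (fine (mu3 (WM M xi)) - e / 2 / z) <= z * fine (mu3 (innerN M xi n)) by rewrite ler_pM2l.
by rewrite mulrBr [z * (_ / z)]mulrC divfK ?gt_eqF // /innerN; clear; lra.
Qed.

(** Matrices with v > V + 1 are outside the box of [closed_count]. They have c <= Q / (V + 1) and d
    <= Q, so they number O(Q^2 / V) and V is taken large. *)
Lemma limM_upper M xi e : \det M = 1 -> 0 < xi -> 0 < e ->
  exists2 dl, 0 < dl & exists Q0, forall Q th, Q0 <= Q -> Q ^+ 2 * th <= xi + dl ->
  (cnt [set g | pairM M Q th g])%:R <= ((2 * zeta 2)^-1 * fine (mu3 (WM M xi)) + e) * Q ^+ 2.
Proof.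
move=> d x0 e0; pose z : R := (2 * zeta 2)^-1.
have z0 : 0 < z by rewrite invr_gt0 mulr_gt0 ?zeta2_gt0.
have e1 : 0 < e / 3 / z by rewrite !divr_gt0.
have e3 : 0 < e / 3 by rewrite divr_gt0.
have fW := mu3_WM_fin d x0.
have [V HV] : exists V : nat, V.+1%:R^-1 <= e / 6 :> R.
  have [V _ HV] := natSinv_near (divr_gt0 e0 (ltr0n R 6)); exists V; apply: ltW; exact: (HV V (leqnn V)).
have fV (A : set (R * R * R)) : meas3 A -> A `<=` boxS V.+1 -> mu3 A \is a fin_num.
  move=> mA Ab; rewrite ge0_fin_numE ?measure_ge0 //; apply: le_lt_trans (ltry V.+1%:R).
  rewrite -mu3_boxSE; apply: mu3_le => //.
  by apply: measurable_open_octant; [exact: open_boxS|exact: boxS_octant].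
have mU : meas3 (\bigcup_n violN M xi V n) by apply: bigcup_measurable => n _; exact: measurable_violN.
have Ub n : violN M xi V n `<=` boxS V.+1 by move=> p [[]].
have fU : mu3 (\bigcup_n violN M xi V n) \is a fin_num by apply: fV => // p [n _ /Ub].
have [n Hn] : exists n, V.+1%:R - fine (mu3 (violN M xi V n)) <= fine (mu3 (WM M xi)) + e / 3 / z.
  have cv : mu3 (violN M xi V n) @[n --> \oo] --> mu3 (\bigcup_n violN M xi V n).
    apply: nondecreasing_cvg_mu => //; first by move=> n; exact: measurable_violN.
    exact: violN_homo.
  have h : ((fine (mu3 (\bigcup_n violN M xi V n)) - e / 3 / z)%:E < mu3 (\bigcup_n violN M xi V n))%E.
    by rewrite -[ltRHS]fineK // lte_fin ltrBlDr ltrDl.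
  have [n _ Hn] := cv _ (open_ereal_gt_ereal h); exists n.
  have fn := fV _ (measurable_violN xi V n d) (Ub n).
  have := Hn n (leqnn n); rewrite /= -(fineK fn) lte_fin => h1.
  have := @boxS_le M xi V d; rewrite -(fineK fU) -(fineK fW) -EFinD lee_fin; clear -h1; lra.
have k0 : 0 < n.+1%:R^-1 :> R by rewrite invr_gt0.
have k2 : 0 < n.+1%:R^-1 / 2 :> R by rewrite divr_gt0.
exists (n.+1%:R^-1 / 2) => //.
have [Q1 HQ] := closed_count (@open_violM R M xi n.+1%:R^-1 V.+1 d) (Ub n) e3.
have [K HK] := viol_pairM V.+1 d k0 (ltW x0).
exists (Num.max (Num.max Q1 (Num.max 2 (3 * 6 / e))) K) => Q th; rewrite !ge_max.
move=> /andP[/andP[q1 /andP[q2 q4]] q3] hth.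
have Qp : 0 < Q by clear -q2; lra.
have V0 : 0 < V.+1%:R :> R by [].
pose A := [set g | [/\ GammaI g, cR R g <= Q, vv R g <= V.+1%:R & ~ violM M xi n.+1%:R^-1 V.+1 (PQ Q g)]].
pose B := [set g | [/\ GammaI g, normg g <= Q & V.+1%:R < vv R g]].
have fA : finite_set A by apply: (sub_finite_set _ (finite_GammaI_real Q V.+1%:R)) => g [].
have fB : finite_set B by apply: (sub_finite_set _ (finite_normQ (ltW Qp))) => g [].
have Q2 : 0 < Q ^+ 2 by rewrite exprn_gt0.
have hB : (cnt B)%:R <= e / 3 * Q ^+ 2.
  have QV : 0 <= Q / V.+1%:R by rewrite divr_ge0 // ltW.
  apply: (@le_trans _ _ ((Q / V.+1%:R + 1) * (Q + 1))).
    apply: cnt_corner; rewrite ?(ltW Qp) // => g [gG gQ gv].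
    have [h1 h2] := normg_cd gG (ltW Qp) gQ; split => //.
    by rewrite ler_pdivlMr //; apply: le_trans h2; rewrite ler_pM2l ?cR_gt0 // ltW.
  have hQ : Q / V.+1%:R <= Q * (e / 6) by rewrite ler_pM2l.
  have q4' : 18 <= e * Q by move: q4; rewrite ler_pdivrMr // mulrC; clear; lra.
  apply: (@le_trans _ _ ((Q * (e / 6) + 1) * (Q + 1))).
    by rewrite ler_pM2r; [rewrite lerD2r|clear -Qp; lra].
  have QQ0 : 0 <= Q * e by rewrite mulr_ge0 // ltW.
  have i1 : 2 * (Q * e) <= Q * (Q * e) by rewrite ler_wpM2r.
  have i2 : 18 * Q <= e * Q * Q by rewrite ler_pM2r.
  by move: i1 i2 q2; clear; rewrite expr2; lra.
apply: (@le_trans _ _ (cnt A + cnt B)%N%:R).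
  rewrite ler_nat; apply: leq_trans (cntU_le fA fB); apply: cnt_sub; first by rewrite finite_setU.
  move=> g pg; have [gG _ [gQ _] _] := pg; have [c1 _] := normg_cd gG (ltW Qp) gQ.
  have [gv|gv] := leP (vv R g) V.+1%:R; [left|right]; split => //.
  apply: (HK Q th g) => //.
  by apply: (le_trans q3); rewrite expr2 ler_peMr //; clear -q2; lra.
rewrite natrD; have := HQ Q q1; rewrite -/z -/A => hA.
have h3 : z * (V.+1%:R - fine (mu3 (violN M xi V n))) <= z * (fine (mu3 (WM M xi)) + e / 3 / z) by rewrite ler_pM2l.
rewrite [z * (fine (mu3 (WM _ _)) + _)]mulrDr [z * (e / 3 / z)]mulrC divfK ?gt_eqF // in h3.
have : z * (V.+1%:R - fine (mu3 (violN M xi V n))) * Q ^+ 2 <= (z * fine (mu3 (WM M xi)) + e / 3) * Q ^+ 2 by rewrite ler_pM2r.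
move: hA hB; rewrite !mulrDl /violN; clear; move: (cnt A)%:R (cnt B)%:R => a b; lra.
Qed.
End PairMeasure.

(** * Pairs of small level *)

Section Tail.
Variable R : realType.
Local Open Scope classical_set_scope.
Local Open Scope ring_scope.
Implicit Types (g h M : 'M[int]_2) (Q th k : R).

Lemma cnt_fiber (T : choiceType) (A : set (T * T)) (G : set T) (m : nat) : finite_set A -> finite_set G ->
  (forall p, A p -> G p.1) -> (forall u, G u -> (cnt [set v | A (u, v)] <= m)%N) ->
  (cnt A <= cnt G * m)%N.
Proof.
move=> fA fG AG Am; pose B u := [set p | A p /\ p.1 = u].
have fB u : finite_set (B u) by apply: (sub_finite_set _ fA) => p [].
apply: leq_trans (cnt_cover (s := enum_fset (fset_set G)) (B := B) _ _) _ => //.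
  by move=> p Ap; exists p.1 => //; rewrite in_fset_set //; apply/mem_set; exact: AG.
apply: (@leq_trans (\sum_(u <- enum_fset (fset_set G)) m)).
  rewrite big_seq [leqRHS]big_seq; apply: leq_sum => u; rewrite in_fset_set // => /set_mem Gu.
  have fAu : finite_set [set v | A (u, v)].
    by apply: (sub_finite_set _ (finite_image snd fA)) => v Av; exists (u, v).
  apply: leq_trans (Am u Gu); apply: (cnt_inj (f := snd)) => //.
    by move=> [a b] [a' b'] [_ /= ->] [_ /= ->] /= ->.
  by move=> [a b] [Aab /= <-].
by rewrite big_const_seq count_predT iter_addn_0 mulnC.
Qed.

Definition lev Q (L : nat) : set 'M[int]_2 :=
  [set h | GammaI h /\ Q ^+ 2 / 2 ^+ L.+1 < YR R h <= Q ^+ 2 / 2 ^+ L].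

Lemma diff_rr_le g h th : GammaI g -> GammaI h -> `|tanhalf h - tanhalf g| <= th ->
  `|rr R g - rr R h| <= th + 2 / YR R g ^+ 2 + 2 / YR R h ^+ 2.
Proof.
move=> gG hG; rewrite distrC => t1; have := tanhalf_diff R gG hG.
have := ler_normB (tanhalf g - tanhalf h) (tanhalf g - tanhalf h - (rr R g - rr R h)).
by rewrite opprB addrC subrK; lra.
Qed.

Lemma ratio_bound (Y Y' y B : R) : 0 < y -> 0 < B -> y / B < Y -> Y <= y -> y / B < Y' -> Y' <= y -> Y / Y' <= B.
Proof.
move=> y0 B0 h1 h2 h3 h4; have Y'0 : 0 < Y' by apply: lt_trans h3; rewrite divr_gt0.
by rewrite ler_pdivrMr // (le_trans h2) // mulrC -ler_pdivrMr // ltW.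
Qed.

Lemma norm_bound g h (y B D : R) : GammaI g -> GammaI h -> 0 < y -> 0 < B ->
  y / B < YR R g <= y -> y / B < YR R h <= y -> y * `|rr R g - rr R h| <= D ->
  XR R (adj2 g *m h) + YR R (adj2 g *m h) <= D ^+ 2 + B + B.
Proof.
move=> gG hG y0 B0 /andP[h1 h2] /andP[h3 h4] hD; rewrite norm_rr ?GammaI_det //.
have Y0 := YR_gt0 R (GammaI_det gG); have Y'0 := YR_gt0 R (GammaI_det hG).
rewrite lerD ?(ratio_bound y0 B0) // lerD ?(ratio_bound y0 B0) //.
have D0 : 0 <= D by apply: le_trans hD; rewrite mulr_ge0 // ltW.
apply: (@le_trans _ _ ((y * `|rr R g - rr R h|) ^+ 2)); last by rewrite ler_pXn2r ?nnegrE // mulr_ge0 // ltW.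
rewrite exprMn real_normK ?num_real // ler_wpM2r ?sqr_ge0 // expr2.
by apply: ler_pM => //; exact: ltW.
Qed.

Lemma int_norm_le M (B : R) : 0 <= B -> XR R M + YR R M <= B -> Xg M + Yg M <= (Num.truncn B)%:Z.
Proof.
move=> B0; rewrite /XR /YR -intrD; apply: int_le_truncn => //.
by rewrite /Xg /Yg !addr_ge0 ?sqr_ge0.
Qed.

Lemma adj2_inj g h h' : \det g = 1 -> adj2 g *m h = adj2 g *m h' -> h = h'.
Proof. by move=> d e; rewrite -[h]mul1mx -[h']mul1mx -(mul_adj2 d) -!mulmxA e. Qed.

(** The norm bound is that of [norm_bound] with D = 2 k + 8 and B = 2, the values that arise in
    [lev_fiber]. *)
Definition levK k : nat := cnt [set M : 'M[int]_2 | Xg M + Yg M <= (Num.truncn ((2 * k + 8) ^+ 2 + 2 + 2))%:Z].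

Lemma finite_lev Q L : finite_set (lev Q L).
Proof.
pose y := Num.max 1 (Q ^+ 2 / 2 ^+ L).
apply: (sub_finite_set _ (finite_GammaI_real y y)) => g [gG /andP[_ h]].
have y1 : 1 <= y by rewrite le_max lexx.
have hy : YR R g <= y ^+ 2.
  by apply: (le_trans h); apply: (@le_trans _ _ y); [rewrite le_max lexx orbT|rewrite expr2 ler_peMr //; lra].
have [|h1 h2] := cd_le (cR_gt0 R gG) (vv_gt0 R gG) (le_trans ler01 y1) _; first by rewrite -YR_vv.
split => //; split => //; apply: le_trans h2; rewrite ler_peMl ?cR_ge1 // ltW // vv_gt0 //.
Qed.

(** Two members h, h1 of one level close to g are within 2 th of each other, so the matrix
    connecting them has norm bounded in terms of k alone. The bound therefore depends neither on g
    nor on the level. *)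
Lemma lev_fiber k Q L g th : 0 <= k -> 0 < Q -> Q ^+ 2 * th <= k -> GammaI g ->
  leq (cnt [set h | lev Q L h /\ `|tanhalf h - tanhalf g| <= th]) (levK k).
Proof.
move=> k0 Q0 thk gG; set A := [set h | _].
have [[h1 [[h1G l1] t1]]|nA] := pselect (exists h, A h); last first.
  by rewrite (_ : A = set0) ?cnt0 //; apply/seteqP; split => // h Ah; apply: nA; exists h.
apply: (cnt_inj (f := fun h => adj2 h1 *m h)).
- by apply: (sub_finite_set _ (finite_lev Q L)) => h [].
- exact: finite_norm_le.
- by move=> h h' _ _; apply: adj2_inj; exact: GammaI_det.
move=> h [[hG l] t] /=; apply: int_norm_le; first by rewrite !addr_ge0 ?sqr_ge0.
have Q2 : 0 < Q ^+ 2 by rewrite exprn_gt0.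
pose y := Q ^+ 2 / 2 ^+ L; have y0 : 0 < y by rewrite divr_gt0 ?exprn_gt0.
have yE : Q ^+ 2 / 2 ^+ L.+1 = y / 2 by rewrite /y [2 ^+ L.+1]exprSr invfM mulrA.
move: l l1; rewrite yE -/y => l l1.
apply: (norm_bound h1G hG y0 _ l1 l) => //.
have tt : `|tanhalf h - tanhalf h1 : R| <= 2 * th.
  have := ler_normB (tanhalf h - tanhalf g : R) (tanhalf h1 - tanhalf g).
  rewrite (_ : tanhalf h - tanhalf g - (tanhalf h1 - tanhalf g) = tanhalf h - tanhalf h1); last by ring.
  by lra.
have dr := diff_rr_le h1G hG tt.
have y2 : 2 <= y by case/andP: l => _; apply: le_trans; exact: YR_ge2.
have i1 (Y : R) : y / 2 < Y -> 2 / Y ^+ 2 <= 8 / y ^+ 2.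
  move=> hY; have Y0 : 0 < Y by lra.
  rewrite (_ : 8 / y ^+ 2 = 2 / (y / 2) ^+ 2); last by field; rewrite gt_eqF.
  by apply: inv_sqr_le; [lra|exact: ltW].
have i2 := i1 _ (andP l).1; have i3 := i1 _ (andP l1).1.
have yQ : y * (2 * th) <= 2 * k.
  have t0 : 0 <= th by apply: le_trans (normr_ge0 _) t.
  rewrite mulrCA ler_pM2l //; apply: le_trans thk; rewrite ler_wpM2r //.
  by rewrite ler_pdivrMr ?exprn_gt0 // ler_peMr ?(ltW Q2) // exprn_ege1 // ler1n.
have y3 : y * (16 / y ^+ 2) <= 8.
  rewrite (_ : y * _ = 16 / y); last by field; rewrite gt_eqF.
  by rewrite ler_pdivrMr //; lra.
have : y * `|rr R h1 - rr R h| <= y * (2 * th + 16 / y ^+ 2).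
  rewrite ler_pM2l //; move: dr i2 i3; rewrite [16 / _](_ : _ = 8 / y ^+ 2 + 8 / y ^+ 2); last by rewrite -mulrDl; congr (_ / _); lra.
  by lra.
by rewrite mulrDr; lra.
Qed.

(** [YR R g >= 2] bounds the level index, which makes the sums over levels finite. *)
Lemma lev_exists Q g : GammaI g -> 0 < Q -> YR R g <= Q ^+ 2 ->
  exists2 L, lev Q L g & forall N, Q ^+ 2 <= 2 ^+ N -> (L < N)%N.
Proof.
move=> gG Q0 Yle; have Y2 := YR_ge2 R gG; have Q2 : 0 < Q ^+ 2 by rewrite exprn_gt0.
have p2 n : 0 < 2 ^+ n :> R by rewrite exprn_gt0.
have ex : exists L, Q ^+ 2 / 2 ^+ L.+1 < YR R g.
  exists (Num.truncn (Q ^+ 2)); rewrite ltr_pdivrMr //.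
  have h1 : Q ^+ 2 < 2 ^+ (Num.truncn (Q ^+ 2)).+1.
    by apply: lt_trans (truncnS_gt _) _; rewrite -natrX ltr_nat ltn_expl.
  by apply: (lt_le_trans h1); rewrite ler_peMl ?(ltW (p2 _)) //; lra.
case: (ex_minnP ex) => L hL min.
have hL' : YR R g <= Q ^+ 2 / 2 ^+ L.
  case: L hL min => [|L] hL min; first by rewrite expr0 divr1.
  by rewrite leNgt; apply/negP => /min; rewrite ltnn.
exists L; first by split => //; rewrite hL hL'.
move=> N hN; rewrite ltnNge; apply/negP => NL.
have : Q ^+ 2 / 2 ^+ L <= 1 by rewrite ler_pdivrMr // mul1r (le_trans hN) // ler_eXn2l // ltr1n.
by lra.
Qed.

Lemma cnt_low (L : nat) Q : 0 < Q ->
  (cnt [set g | GammaI g /\ YR R g <= Q ^+ 2 / 2 ^+ L])%:R <= 4 * (Q ^+ 2 / 2 ^+ L).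
Proof.
move=> Q0; set A := [set g | _]; pose y := Q ^+ 2 / 2 ^+ L.
have y0 : 0 <= y by rewrite divr_ge0 ?sqr_ge0 // exprn_ge0.
have [[g [gG gy]]|nA] := pselect (exists g, A g); last first.
  have -> : A = set0 by apply/seteqP; split => // h Ah; apply: nA; exists h.
  by rewrite cnt0 mulr_ge0.
have y2 : 2 <= y by apply: le_trans gy; exact: YR_ge2.
pose s := Num.sqrt y; have s2 : s ^+ 2 = y by rewrite sqr_sqrtr.
have s0 : 0 <= s by exact: sqrtr_ge0.
have s1 : 1 <= s by rewrite -(@ler_pXn2r _ 2%N) ?nnegrE // expr1n s2; lra.
apply: (@le_trans _ _ ((s + 1) * (s + 1))).
  apply: cnt_corner => // h [hG hy].
  have [|h1 h2] := cd_le (cR_gt0 R hG) (vv_gt0 R hG) s0; first by rewrite -YR_vv // s2.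
  by split.
by rewrite -/y -s2 expr2; nra.
Qed.

(** The sum telescopes: (2 L + 4)/2^L drops by (L + 1)/2^L from L to L + 1. *)
Lemma sum_lev (L0 n : nat) : \sum_(L <- iota L0 n) (L.+1%:R / 2 ^+ L : R) <= (2 * L0%:R + 4) / 2 ^+ L0.
Proof.
suff -> : \sum_(L <- iota L0 n) (L.+1%:R / 2 ^+ L : R) = (2 * L0%:R + 4) / 2 ^+ L0 - (2 * (L0 + n)%:R + 4) / 2 ^+ (L0 + n).
  by rewrite gerBl divr_ge0 ?exprn_ge0 // addr_ge0 // mulr_ge0.
elim: n => [|n IH]; first by rewrite addn0 subrr big_nil.
rewrite -addn1 iotaD big_cat big_seq1 /= IH addn1 addnS exprS -[(L0 + n).+1%:R]natr1.
have p0 : 2 ^+ (L0 + n) != 0 :> R by rewrite expf_neq0.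
rewrite -addrA; congr (_ + _); move: (2 ^+ (L0 + n)) ((L0 + n)%:R : R) p0 => x y p0.
by field.
Qed.

Definition pairsS Q th : set ('M[int]_2 * 'M[int]_2) :=
  [set p | [/\ GammaI p.1 /\ GammaI p.2, normg p.1 <= Q /\ normg p.2 <= Q & `|tanhalf p.2 - tanhalf p.1| <= th]].

Lemma finite_pairsS Q th : 0 <= Q -> finite_set (pairsS Q th).
Proof.
move=> Q0; have f := finite_normQ Q0; apply: (sub_finite_set _ (finite_setX f f)).
by move=> p [[g1 g2] [n1 n2] _]; split.
Qed.

Lemma normg_YR g Q : GammaI g -> 0 <= Q -> normg g <= Q -> YR R g <= Q ^+ 2.
Proof.
move=> gG Q0; rewrite normg_le ?GammaI_det // => h; have Y0 := YR_gt0 R (GammaI_det gG).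
have i0 : 0 < (YR R g)^-1 by rewrite invr_gt0.
have : 0 <= YR R g * rr R g ^+ 2 by rewrite mulr_ge0 ?sqr_ge0 // ltW.
by move: h; rewrite mulrDr mulr1; lra.
Qed.

Definition lowS Q th (L0 : nat) : set ('M[int]_2 * 'M[int]_2) :=
  [set p | pairsS Q th p /\ (YR R p.1 <= Q ^+ 2 / 2 ^+ L0 \/ YR R p.2 <= Q ^+ 2 / 2 ^+ L0)].

(** The member of larger level index is chosen first, in O(Q^2 / 2^L) ways; each of the L + 1 levels
    up to L then contains boundedly many partners. *)
Lemma cnt_levs k Q th L : 0 <= k -> 0 < Q -> Q ^+ 2 * th <= k ->
  (cnt [set p | [/\ pairsS Q th p, lev Q L p.1 & exists2 L', (L' <= L)%N & lev Q L' p.2]])%:R <=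
  L.+1%:R / 2 ^+ L * (4 * (levK k)%:R * Q ^+ 2).
Proof.
move=> k0 Q0 thk; set A := [set p | _].
have fA : finite_set A by apply: (sub_finite_set _ (finite_pairsS th (ltW Q0))) => p [].
have h1 : (cnt A <= cnt (lev Q L) * (L.+1 * levK k))%N.
  apply: cnt_fiber => //; [exact: finite_lev|by move=> p []|move=> g lg].
  have gG : GammaI g by case: lg.
  apply: leq_trans (cnt_cover (s := iota 0 L.+1)
     (B := fun L' => [set h | lev Q L' h /\ `|tanhalf h - tanhalf g| <= th]) _ _) _.
  - by move=> L' _; apply: (sub_finite_set _ (finite_lev Q L')) => h [].
  - move=> h [[_ _ t] _ [L' LL lh]]; exists L' => //; rewrite mem_iota add0n ltnS //.
  apply: (@leq_trans (\sum_(L' <- iota 0 L.+1) levK k)).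
    by apply: leq_sum => L' _; exact: lev_fiber.
  by rewrite big_const_seq count_predT iter_addn_0 size_iota mulnC.
have h2 : (cnt (lev Q L))%:R <= 4 * (Q ^+ 2 / 2 ^+ L).
  apply: le_trans (cnt_low L Q0); rewrite ler_nat; apply: cnt_sub; last by move=> g [gG /andP[_ h]].
  have s0 : 0 <= Num.sqrt (Q ^+ 2 / 2 ^+ L) by exact: sqrtr_ge0.
  apply: (sub_finite_set _ (finite_GammaI_real (Num.sqrt (Q ^+ 2 / 2 ^+ L)) (Num.sqrt (Q ^+ 2 / 2 ^+ L)))) => h [hG hy].
  have [|a b] := cd_le (cR_gt0 R hG) (vv_gt0 R hG) s0.
    by rewrite -YR_vv // sqr_sqrtr // divr_ge0 ?sqr_ge0 // exprn_ge0.
  by split => //; split => //; apply: le_trans b; rewrite ler_peMl ?cR_ge1 // ltW // vv_gt0.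
apply: (@le_trans _ _ (cnt (lev Q L) * (L.+1 * levK k))%N%:R); first by rewrite ler_nat.
rewrite !natrM; apply: (@le_trans _ _ (4 * (Q ^+ 2 / 2 ^+ L) * (L.+1%:R * (levK k)%:R))).
  by rewrite ler_wpM2r // mulr_ge0.
by rewrite le_eqVlt; apply/orP; left; apply/eqP; ring.
Qed.

(** A pair is charged to the larger of its two level indices, which is at least L0. The factor 2
    accounts for which member attains it. *)
Lemma lowS_count k Q th (L0 : nat) : 0 <= k -> 0 < Q -> Q ^+ 2 * th <= k ->
  (cnt (lowS Q th L0))%:R <= 2 * ((2 * L0%:R + 4) / 2 ^+ L0 * (4 * (levK k)%:R * Q ^+ 2)).
Proof.
move=> k0 Q0 thk; have fP := finite_pairsS th (ltW Q0).
pose A L := [set p | [/\ pairsS Q th p, lev Q L p.1 & exists2 L', (L' <= L)%N & lev Q L' p.2]].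
pose B L := [set p | A L (p.2, p.1)].
have fA L : finite_set (A L) by apply: (sub_finite_set _ fP) => p [].
have swapP p : pairsS Q th p -> pairsS Q th (p.2, p.1).
  by move=> [[a b] [c e] f]; split => //=; rewrite distrC.
have fB L : finite_set (B L) by apply: (sub_finite_set _ fP) => -[g h] [/swapP].
have [N hN] : exists N, Q ^+ 2 <= 2 ^+ N.
  exists (Num.truncn (Q ^+ 2)).+1; apply: ltW; apply: lt_trans (truncnS_gt _) _.
  by rewrite -natrX ltr_nat ltn_expl.
have BA L : (cnt (B L) <= cnt (A L))%N.
  apply: (cnt_inj (f := fun p => (p.2, p.1))) => //.
  by move=> [a b] [a' b'] _ _ [-> ->].
have cov p : lowS Q th L0 p -> exists2 L, L \in iota L0 N & (A L `|` B L) p.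
  move=> [pp low]; have [[gG hG] [ng nh] t] := pp.
  have [L lL LN] := lev_exists gG Q0 (normg_YR gG (ltW Q0) ng).
  have [L' lL' LN'] := lev_exists hG Q0 (normg_YR hG (ltW Q0) nh).
  have low1 g l : lev Q l g -> YR R g <= Q ^+ 2 / 2 ^+ L0 -> (L0 <= l)%N.
    move=> [_ /andP[h1 _]] h2; rewrite -ltnS -(@ltr_eXn2l R 2) ?ltr1n //.
    have := lt_le_trans h1 h2; rewrite ltr_pM2l ?exprn_gt0 // ltf_pV2 ?posrE ?exprn_gt0 //.
  have mem l : (L0 <= l)%N -> (l < N)%N -> l \in iota L0 N.
    by move=> a b; rewrite mem_iota a (leq_trans b) // leq_addl.
  have [LL|LL] := leqP L' L.
    exists L; last by left; split => //; exists L'.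
    apply: mem; last exact: LN.
    by case: low => [/(low1 _ _ lL) //|/(low1 _ _ lL') h]; apply: leq_trans LL.
  exists L'; last by right; split => //; [exact: swapP|exists L => //; exact: ltnW].
  apply: mem; last exact: LN'.
  by case: low => [/(low1 _ _ lL) h|/(low1 _ _ lL') //]; apply: leq_trans (ltnW LL).
have h1 : (cnt (lowS Q th L0) <= \sum_(L <- iota L0 N) cnt (A L `|` B L))%N.
  by apply: cnt_cover => // L _; rewrite finite_setU.
have h2 : (\sum_(L <- iota L0 N) cnt (A L `|` B L) <= \sum_(L <- iota L0 N) 2 * cnt (A L))%N.
  apply: leq_sum => L _; rewrite mul2n -addnn; apply: leq_trans (cntU_le (fA L) (fB L)) _.
  by rewrite leq_add2l.
apply: (@le_trans _ _ (\sum_(L <- iota L0 N) 2 * cnt (A L))%N%:R); first by rewrite ler_nat (leq_trans h1).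
rewrite natr_sum; apply: (@le_trans _ _ (\sum_(L <- iota L0 N) 2 * (L.+1%:R / 2 ^+ L * (4 * (levK k)%:R * Q ^+ 2)))).
  by apply: ler_sum => L _; rewrite natrM ler_pM2l //; exact: cnt_levs.
rewrite -mulr_sumr -mulr_suml ler_pM2l // ler_wpM2r ?sum_lev //.
by rewrite mulr_ge0 ?sqr_ge0 // mulr_ge0.
Qed.
End Tail.

(** * Summation over the connecting matrices *)

Section BasePairs.
Variable R : realType.
Local Open Scope classical_set_scope.
Local Open Scope ring_scope.
Implicit Types (g h M : 'M[int]_2) (Q th k xi : R).

Local Notation mu := (@lebesgue_measure R).
Local Notation RL := (measurableTypeR R).
Local Notation meas3 := (@measurable _ (RL * RL * RL)%type).
Local Notation mu3 := (@mu3 R).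
Local Notation zc := ((2 * zeta 2)^-1 : R).

Definition baseP Q th : set ('M[int]_2 * 'M[int]_2) :=
  [set p | pairsS Q th p /\ baseS (adj2 p.1 *m p.2)].

Definition baseseq (J : seq 'M[int]_2) := uniq J /\ forall M, M \in J -> baseS M.

Lemma pairM_pairsS M Q th g : pairM M Q th g -> pairsS Q th (g, g *m M).
Proof. by move=> [gG hG [n1 n2] t]. Qed.

Lemma base_lower (J : seq 'M[int]_2) Q th : baseseq J -> 0 <= Q ->
  (\sum_(M <- J) cnt [set g | pairM M Q th g] <= cnt (baseP Q th))%N.
Proof.
move=> [uJ bJ] Q0; have fP := finite_pairsS th Q0.
have fB : finite_set (baseP Q th) by apply: (sub_finite_set _ fP) => p [].
pose B M := [set p | baseP Q th p /\ adj2 p.1 *m p.2 = M].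
have fBM M : finite_set (B M) by apply: (sub_finite_set _ fB) => p [].
apply: leq_trans (sum_cnt (s := J) (B := B) fB uJ _ _).
- rewrite !big_seq; apply: leq_sum => M MJ.
  apply: (cnt_inj (f := fun g => (g, g *m M))) => //; first exact: finite_pairM.
    by move=> g g' _ _ [].
  move=> g pg; have [gG _ _ _] := pg.
  have e : adj2 g *m (g *m M) = M by rewrite mulmxA adj2_mul ?mul1mx // GammaI_det.
  by split; [split; [exact: pairM_pairsS|rewrite /= e; exact: bJ]|].
- by move=> M _ p [].
- by move=> M M' p _ _ [_ <-] [_ <-].
Qed.

Lemma level_small (c e : R) : 0 <= c -> 0 < e -> exists L0 : nat, 2 * ((2 * L0%:R + 4) / 2 ^+ L0 * c) <= e.
Proof.
move=> c0 e0; have e1 : 0 < e / (8 * c + 1) by rewrite divr_gt0 // ltr_wpDl // mulr_ge0.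
have [m _ Hm] := natSinv_near e1; have := Hm m (leqnn m) => hm.
(* For L0 = 2 m the quotient is at most 4/(m + 1), because 2^m >= m + 1. *)
exists (m + m)%N; have h1 : (2 * (m + m)%:R + 4) / 2 ^+ (m + m) <= 4 * m.+1%:R^-1 :> R.
  rewrite ler_pdivrMr ?exprn_gt0 // exprD.
  have p : m.+1%:R <= 2 ^+ m :> R by rewrite -natrX ler_nat ltn_expl.
  have m0 : 0 < m.+1%:R :> R by [].
  have : m.+1%:R * m.+1%:R <= 2 ^+ m * 2 ^+ m :> R by apply: ler_pM => //; exact: ltW.
  move=> h; apply: (@le_trans _ _ (4 * m.+1%:R^-1 * (m.+1%:R * m.+1%:R))); last by rewrite ler_wpM2l // mulr_ge0 // invr_ge0.
  rewrite (_ : 4 * _ * _ = 4 * m.+1%:R); last by field; rewrite gt_eqF.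
  by rewrite natrD -natr1; lra.
apply: (@le_trans _ _ (2 * (4 * m.+1%:R^-1 * c))); first by rewrite ler_pM2l // ler_wpM2r.
have h2 : m.+1%:R^-1 * (8 * c) <= e / (8 * c + 1) * (8 * c) by rewrite ler_wpM2r ?mulr_ge0 // ltW.
have h3 : e / (8 * c + 1) * (8 * c) <= e.
  have c1 : 0 < 8 * c + 1 by rewrite ltr_wpDl // mulr_ge0.
  rewrite mulrAC ler_pdivrMr // ler_pM2l //; lra.
by move: (le_trans h2 h3); clear; move: (m.+1%:R^-1 : R) => x; lra.
Qed.

(** If neither member of a pair is of low level, both levels lie within a factor 2^L0 of Q^2, and
    the connecting matrix has norm at most BB. This singles out a finite J that serves all Q and
    th. *)
Lemma base_upper k (e : R) : 0 <= k -> 0 < e -> exists2 J, baseseq J &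
  forall Q th, 1 <= Q -> Q ^+ 2 * th <= k ->
  (cnt (baseP Q th))%:R <= (\sum_(M <- J) cnt [set g | pairM M Q th g])%N%:R + e * Q ^+ 2.
Proof.
move=> k0 e0; have c0 : 0 <= 4 * (levK k)%:R :> R by rewrite mulr_ge0.
have [L0 hL0] := level_small c0 e0.
(* The second term bounds Q^2 times the tangent corrections, which is 4 (2^L0)^2 / Q^2. *)
pose D := k + 4 * (2 ^+ L0) ^+ 2; pose BB := D ^+ 2 + 2 ^+ L0 + 2 ^+ L0.
have p2 : 0 < 2 ^+ L0 :> R by rewrite exprn_gt0.
have D0 : 0 <= D by rewrite addr_ge0 // mulr_ge0 ?sqr_ge0.
have BB0 : 0 <= BB by rewrite !addr_ge0 ?sqr_ge0 // ltW.
pose S := [set M | Xg M + Yg M <= (Num.truncn BB)%:Z].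
have fS : finite_set S by exact: finite_norm_le.
pose J := seq.filter (fun M => `[< baseS M >]) (enum_fset (fset_set S)).
exists J.
  split; first by rewrite filter_uniq // fset_uniq.
  by move=> M; rewrite mem_filter => /andP[/asboolP].
move=> Q th Q1 thk; have Qp : 0 < Q by lra.
have Q2 : 0 < Q ^+ 2 by rewrite exprn_gt0.
have fP := finite_pairsS th (ltW Qp).
have fB : finite_set (baseP Q th) by apply: (sub_finite_set _ fP) => p [].
have fL : finite_set (lowS Q th L0) by apply: (sub_finite_set _ fP) => p [].
pose B M := [set p | baseP Q th p /\ adj2 p.1 *m p.2 = M].
have fBM M : finite_set (B M) by apply: (sub_finite_set _ fB) => p [].
have h1 : (cnt (baseP Q th `\` lowS Q th L0) <= \sum_(M <- J) cnt (B M))%N.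
  apply: cnt_cover => // -[g h] [[pp bp] nl]; exists (adj2 g *m h) => //.
  rewrite mem_filter; apply/andP; split; first exact/asboolP.
  rewrite in_fset_set //; apply/mem_set; apply: int_norm_le => //.
  have [[gG hG] [ng nh] t] := pp; move: gG hG ng nh t => /= gG hG ng nh t.
  have nlg : Q ^+ 2 / 2 ^+ L0 < YR R g by rewrite ltNge; apply/negP => hh; apply: nl; split => //; left.
  have nlh : Q ^+ 2 / 2 ^+ L0 < YR R h by rewrite ltNge; apply/negP => hh; apply: nl; split => //; right.
  apply: (norm_bound gG hG Q2 p2).
  - by rewrite nlg normg_YR // ltW.
  - by rewrite nlh normg_YR // ltW.
  have y0 : 0 < Q ^+ 2 / 2 ^+ L0 by rewrite divr_gt0.
  have := diff_rr_le gG hG t; have := inv_sqr_le y0 (ltW nlg); have := inv_sqr_le y0 (ltW nlh).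
  move=> i1 i2 i3.
  have i4 : `|rr R g - rr R h| <= th + 4 / (Q ^+ 2 / 2 ^+ L0) ^+ 2.
    by move: i1 i2 i3; rewrite [4 / _](_ : _ = 2 / (Q ^+ 2 / 2 ^+ L0) ^+ 2 + 2 / (Q ^+ 2 / 2 ^+ L0) ^+ 2); [clear; lra|rewrite -mulrDl; congr (_ / _); lra].
  have : Q ^+ 2 * `|rr R g - rr R h| <= Q ^+ 2 * (th + 4 / (Q ^+ 2 / 2 ^+ L0) ^+ 2) by rewrite ler_pM2l.
  move=> /le_trans; apply; rewrite mulrDr /D lerD //.
  rewrite (_ : Q ^+ 2 * _ = 4 * (2 ^+ L0) ^+ 2 / Q ^+ 2); last by field; rewrite !gt_eqF.
  rewrite ler_pdivrMr // ler_peMr ?mulr_ge0 ?sqr_ge0 // exprn_ege1 //.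
have h2 : (\sum_(M <- J) cnt (B M) <= \sum_(M <- J) cnt [set g | pairM M Q th g])%N.
  apply: leq_sum => M _; apply: (cnt_inj (f := fst)) => //; first by apply: finite_pairM; exact: ltW.
    move=> [g h] [g' h'] [[[[gG _] _ _] _] /= E] [_ /= E'] /= gg; rewrite -gg in E' *.
    by congr (_, _); apply: (@adj2_inj g); [exact: GammaI_det|rewrite E].
  move=> [g h] [[[[gG hG] nn t] _] /= E].
  have -> : g = (g, h).1 by []; rewrite /=.
  by rewrite /pairM -E mulmxA mul_adj2 ?mul1mx ?GammaI_det.
have h3 : (cnt (baseP Q th) <= cnt (baseP Q th `\` lowS Q th L0) + cnt (lowS Q th L0))%N.
  apply: leq_trans (cntU_le _ _) => //; last exact: finite_setD.
  apply: cnt_sub; first by rewrite finite_setU; split => //; exact: finite_setD.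
  by move=> p bp; have [|nl] := pselect (lowS Q th L0 p); [right|left].
have := lowS_count L0 k0 Qp thk => h4.
have h5 : 2 * ((2 * L0%:R + 4) / 2 ^+ L0 * (4 * (levK k)%:R * Q ^+ 2)) <= e * Q ^+ 2.
  by rewrite [X in 2 * X]mulrA [2 * _]mulrA ler_pM2r.
apply: (@le_trans _ _ (\sum_(M <- J) cnt [set g | pairM M Q th g] + cnt (lowS Q th L0))%N%:R).
  by rewrite ler_nat (leq_trans h3) // leq_add2r (leq_trans h1).
by rewrite natrD lerD2l; apply: (le_trans h4).
Qed.

Definition wM M xi : R := fine (mu3 (WM M xi)).

Lemma wM_ge0 M xi : 0 <= wM M xi.
Proof. by rewrite fine_ge0 ?measure_ge0. Qed.

Lemma sum_limM (J : seq 'M[int]_2) xi (e : R) : (forall M, M \in J -> \det M = 1) -> 0 < xi -> 0 < e ->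
  exists2 dl, 0 < dl & exists Q0, forall Q th, Q0 <= Q -> `|Q ^+ 2 * th - xi| <= dl ->
  `| (\sum_(M <- J) cnt [set g | pairM M Q th g])%N%:R - zc * (\sum_(M <- J) wM M xi) * Q ^+ 2| <= e * Q ^+ 2.
Proof.
move=> dJ x0; elim: J dJ e => [|M J IH] dJ e e0.
  exists 1 => //; exists 0 => Q th _ _; rewrite !big_nil mulr0 mul0r subrr normr0 mulr_ge0 ?sqr_ge0 //.
  exact: ltW.
have dM : \det M = 1 by apply: dJ; rewrite mem_head.
have e2 : 0 < e / 2 by rewrite divr_gt0.
have [|d1 d10 [Q1 H1]] := IH _ (e / 2) e2; first by move=> M' h; apply: dJ; rewrite inE h orbT.
have [d2 d20 [Q2 H2]] := limM_lower dM x0 e2.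
have [d3 d30 [Q3 H3]] := limM_upper dM x0 e2.
exists (Num.min d1 (Num.min d2 d3)); first by rewrite !lt_min d10 d20.
exists (Num.max Q1 (Num.max Q2 Q3)) => Q th; rewrite !ge_max !le_min => /and3P[q1 q2 q3] /and3P[t1 t2 t3].
rewrite !big_cons; have := H1 Q th q1 t1.
have := H2 Q th q2; rewrite -/(wM M xi) => /(_ _)H2'.
have := H3 Q th q3; rewrite -/(wM M xi) => H3'.
have {}H2' : (zc * wM M xi - e / 2) * Q ^+ 2 <= (cnt [set g | pairM M Q th g])%:R.
  by apply: H2'; move: t2; rewrite ler_norml => /andP[+ _]; lra.
have {}H3' : (cnt [set g | pairM M Q th g])%:R <= (zc * wM M xi + e / 2) * Q ^+ 2.
  by apply: H3'; move: t3; rewrite ler_norml => /andP[_ +]; lra.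
move: H2' H3'; rewrite natrD mulrDr !ler_norml; clear.
move: (cnt _)%:R (\sum_(M <- J) cnt _)%N%:R (Q ^+ 2) (zc * wM M xi) (zc * _) => a b q x y.
rewrite !mulrDl; move=> h1 h2 /andP[h3 h4]; apply/andP; split; lra.
Qed.

Lemma zc_gt0 : 0 < zc. Proof. by rewrite invr_gt0 mulr_gt0 ?zeta2_gt0. Qed.

Lemma baseseq_det J M : baseseq J -> M \in J -> \det M = 1.
Proof. by move=> [_ h] /h /baseS_det. Qed.

(** No volume is estimated. At one large Q the counts for J and for J' approximate their volumes,
    the counts for J' are at most that of all base pairs, and [base_upper] bounds the latter by the
    counts for J. The same J serves every xi < k. *)
Lemma wM_tail k (e : R) : 0 < k -> 0 < e -> exists2 J, baseseq J &
  forall xi J', 0 < xi -> xi < k -> baseseq J' -> \sum_(M <- J') wM M xi <= \sum_(M <- J) wM M xi + e.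
Proof.
move=> k0 e0; have z0 := zc_gt0; pose e1 := zc * e / 3.
have e10 : 0 < e1 by rewrite divr_gt0 // mulr_gt0.
have [J bJ HJ] := base_upper (ltW k0) e10; exists J => // xi J' x0 xk bJ'.
have [d1 d10 [Q1 H1]] := sum_limM (fun M => @baseseq_det J M bJ) x0 e10.
have [d2 d20 [Q2 H2]] := sum_limM (fun M => @baseseq_det J' M bJ') x0 e10.
pose Q := Num.max 1 (Num.max Q1 Q2); pose th := xi / Q ^+ 2.
have /and3P[q0 q1 q2] : [&& 1 <= Q, Q1 <= Q & Q2 <= Q] by rewrite !le_max !lexx !orbT.
have Q0 : 0 < Q by lra.
have Q20 : 0 < Q ^+ 2 by rewrite exprn_gt0.
have tE : Q ^+ 2 * th = xi by rewrite mulrC divfK // gt_eqF.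
have := H1 Q th q1; have := H2 Q th q2; rewrite tE subrr normr0 => /(_ (ltW d20)) h2 /(_ (ltW d10)) h1.
have := HJ Q th q0; rewrite tE => /(_ (ltW xk)) h3.
have := base_lower th bJ' (ltW Q0); rewrite -(ler_nat R) => h4.
rewrite -(ler_pM2l z0) -(ler_pM2r Q20).
move: h1 h2 h3 h4; rewrite !ler_norml /e1; clear.
set a := (\sum_(M <- J) cnt _)%N%:R; set b := (\sum_(M <- J') cnt _)%N%:R; set c := (cnt _)%:R.
set x := \sum_(M <- J) wM M xi; set y := \sum_(M <- J') wM M xi; move: a b c x y => a b c x y.
move: (zc) (Q ^+ 2) => z q /andP[h1 h1'] /andP[h2 h2'] h3 h4; nra.
Qed.
End BasePairs.

Section BaseLimit.
Variable R : realType.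
Local Open Scope classical_set_scope.
Local Open Scope ring_scope.
Implicit Types (g h M : 'M[int]_2) (Q th k xi : R).

Local Notation mu := (@lebesgue_measure R).
Local Notation RL := (measurableTypeR R).
Local Notation meas3 := (@measurable _ (RL * RL * RL)%type).
Local Notation mu3 := (@mu3 R).
Local Notation zc := ((2 * zeta 2)^-1 : R).

Lemma esum_seq_le (T : choiceType) (S : set T) (f : T -> \bar R) (J : seq T) : uniq J ->
  (forall x, x \in J -> S x) -> (\sum_(x <- J) f x <= \esum_(x in S) f x)%E.
Proof.
move=> uJ JS; rewrite (fsbig_seq _ _ uJ); apply: ereal_sup_ubound => /=.
by exists [set` J].
Qed.

Lemma esum_le_seq (T : choiceType) (S : set T) (f : T -> \bar R) (y : \bar R) :
  (forall J, uniq J -> (forall x, x \in J -> S x) -> (\sum_(x <- J) f x <= y)%E) -> (\esum_(x in S) f x <= y)%E.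
Proof.
move=> h; apply: ge_ereal_sup => _ [A [fA AS] <-].
rewrite fsbig_finite //; apply: h; first exact: fset_uniq.
by move=> x; rewrite in_fset_set // => /set_mem; exact: AS.
Qed.

Definition Fs xi : R := fine (\esum_(M in baseS) mu3 (WM M xi)).

Lemma sum_wM (J : seq 'M[int]_2) xi : (forall M, M \in J -> \det M = 1) -> 0 < xi ->
  (\sum_(M <- J) mu3 (WM M xi))%E = (\sum_(M <- J) wM M xi)%:E.
Proof.
move=> dJ x0; rewrite -sumEFin !big_seq; apply: eq_bigr => M MJ.
by rewrite fineK // mu3_WM_fin // dJ.
Qed.

Lemma esum_fin xi : 0 < xi -> (\esum_(M in baseS) mu3 (WM M xi))%E \is a fin_num.
Proof.
move=> x0; have k0 : 0 < xi + 1 by lra.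
have [J bJ HJ] := wM_tail k0 (@ltr01 R).
rewrite ge0_fin_numE; last by apply: esum_ge0 => M _; exact: measure_ge0.
apply: le_lt_trans (ltry (\sum_(M <- J) wM M xi + 1)).
apply: esum_le_seq => J' uJ' sJ'; have bJ' : baseseq J' by [].
rewrite sum_wM //; last by move=> M /sJ' /baseS_det.
by rewrite lee_fin HJ //; lra.
Qed.

Lemma Fs_ge J xi : baseseq J -> 0 < xi -> \sum_(M <- J) wM M xi <= Fs xi.
Proof.
move=> bJ x0; rewrite -lee_fin fineK ?esum_fin // -sum_wM //; last by move=> M; exact: baseseq_det.
by case: bJ => uJ sJ; exact: esum_seq_le.
Qed.

Lemma Fs_le xi (y : R) : 0 < xi -> (forall J, baseseq J -> \sum_(M <- J) wM M xi <= y) -> Fs xi <= y.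
Proof.
move=> x0 h; rewrite -lee_fin fineK ?esum_fin //; apply: esum_le_seq => J uJ sJ.
rewrite sum_wM //; last by move=> M /sJ /baseS_det.
by rewrite lee_fin; exact: h.
Qed.

Lemma Fs_tail k (e : R) : 0 < k -> 0 < e -> exists2 J, baseseq J &
  forall xi, 0 < xi -> xi < k -> Fs xi <= \sum_(M <- J) wM M xi + e.
Proof.
move=> k0 e0; have [J bJ HJ] := wM_tail k0 e0; exists J => // xi x0 xk.
by apply: Fs_le => // J'; exact: HJ.
Qed.

Lemma baseP_limit xi (e : R) : 0 < xi -> 0 < e ->
  exists2 dl, 0 < dl & exists Q0, forall Q th, Q0 <= Q -> `|Q ^+ 2 * th - xi| <= dl ->
  `|(cnt (baseP Q th))%:R - zc * Fs xi * Q ^+ 2| <= e * Q ^+ 2.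
Proof.
move=> x0 e0; have z0 := zc_gt0 R; have k0 : 0 < xi + 1 by lra.
have e3 : 0 < e / 3 by rewrite divr_gt0.
have ez : 0 < e / 3 / zc by rewrite divr_gt0.
have [J1 bJ1 H1] := base_upper (ltW k0) e3.
have [J2 bJ2 H2] := Fs_tail k0 ez.
have [d1 d10 [Q1 L1]] := sum_limM (fun M => @baseseq_det J1 M bJ1) x0 e3.
have [d2 d20 [Q2 L2]] := sum_limM (fun M => @baseseq_det J2 M bJ2) x0 e3.
exists (Num.min 1 (Num.min d1 d2)); first by rewrite !lt_min ltr01 d10.
exists (Num.max 1 (Num.max Q1 Q2)) => Q th; rewrite !ge_max !le_min => /and3P[q0 q1 q2] /and3P[t0 t1 t2].
have Q0 : 0 < Q by lra.
have Q20 : 0 < Q ^+ 2 by rewrite exprn_gt0.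
have := L1 Q th q1 t1; have := L2 Q th q2 t2.
have := H1 Q th q0; have -> : Q ^+ 2 * th <= xi + 1 by move: t0; rewrite ler_norml => /andP[_]; lra.
move=> /(_ isT); have := base_lower th bJ2 (ltW Q0); rewrite -(ler_nat R).
have F2 := Fs_ge bJ1 x0; have F1 := H2 xi x0 ltac:(lra).
rewrite -(ler_pM2l z0) mulrDr [zc * (e / 3 / zc)]mulrC divfK ?gt_eqF // in F1.
rewrite -(ler_pM2l z0) in F2.
have := ler_wpM2r (ltW Q20) F1; have := ler_wpM2r (ltW Q20) F2.
rewrite !ler_norml; clear.
set a := (\sum_(M <- J1) cnt _)%N%:R; set b := (\sum_(M <- J2) cnt _)%N%:R; set c := (cnt _)%:R.
set x := zc * \sum_(M <- J1) wM M xi; set y := zc * \sum_(M <- J2) wM M xi; set f := zc * Fs xi.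
move: a b c x y f => a b c x y f; rewrite mulrDl.
move=> h1 h2 h3 h4 /andP[h5 h6] /andP[h7 h8]; apply/andP; split; lra.
Qed.

(** If Z = 0 then X Y = 1, so both rows are unit vectors, and positivity of the row (1, v) M leaves
    only the identity. *)
Lemma Zg_neq0 M (v : R) : baseS M -> 0 < v -> 0 < a1 M v -> 0 < a2 M v -> Zg M != 0.
Proof.
move=> bM v0 A1 A2; apply/eqP => Z0; have d := baseS_det bM; have n1 := baseS_neq1 bM.
have XY := XYZ d; rewrite Z0 expr0n add0r in XY.
have X0 : 0 <= Xg M by rewrite addr_ge0 ?sqr_ge0.
have Y0 : 0 <= Yg M by rewrite addr_ge0 ?sqr_ge0.
have X1 : Xg M = 1.
  move: XY => /(congr1 absz); rewrite abszM => /eqP; rewrite muln_eq1 => /andP[/eqP h _].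
  by rewrite -(gez0_abs X0) h.
have Y1 : Yg M = 1 by rewrite X1 mul1r in XY.
have c1 (a b : int) : a ^+ 2 + b ^+ 2 = 1 -> [\/ a = 1 /\ b = 0, a = -1 /\ b = 0, a = 0 /\ b = 1 | a = 0 /\ b = -1].
  rewrite !expr2 => h; have ha : -1 <= a <= 1 by apply/andP; split; nia.
  have [ea|[ea|ea]] : a = -1 \/ a = 0 \/ a = 1 by move: ha; lia.
  - by subst a; constructor 2; split => //; nia.
  - subst a; have [eb|eb] : b = 1 \/ b = -1 by have : -1 <= b <= 1 by [apply/andP; split; nia]; nia.
      by constructor 3.
    by constructor 4.
  - by subst a; constructor 1; split => //; nia.
move: A1 A2 d; rewrite det2E /a1 /a2.
case: (c1 _ _ X1) => -[e1 e2]; case: (c1 _ _ Y1) => -[e3 e4]; rewrite e1 e2 e3 e4 //= => A1 A2 _; try lra.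
by apply: n1; apply: mx2P; rewrite one2E.
Qed.

Lemma WM_homo M xi xi' : xi <= xi' -> WM M xi `<=` WM M xi'.
Proof.
move=> h p [[v0 z0 w0] [A1 A2 B H1 H2]]; split => //; split => //.
by apply: (le_trans B); rewrite ler_pM2r.
Qed.

Lemma wM_homo M xi xi' : \det M = 1 -> 0 < xi -> xi <= xi' -> wM M xi <= wM M xi'.
Proof.
move=> d x0 h; have x0' : 0 < xi' by apply: lt_le_trans h.
rewrite /wM fine_le ?mu3_WM_fin //; apply: mu3_le; [exact: measurable_WM|exact: measurable_WM|exact: WM_homo].
Qed.

(** The leading and constant coefficients of the quadratic [nM M] are opposite, so the product of
    its roots is -1. *)
Lemma nM_root_uniq M (v v' : R) : Zg M != 0 -> 0 < v -> 0 < v' -> nM M v = 0 -> nM M v' = 0 -> v = v'.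
Proof.
move=> Z0 v0 v'0; have : (Zg M)%:~R != 0 :> R by rewrite intr_eq0.
rewrite /nM; move: ((Yg M)%:~R - (Xg M)%:~R : R) ((Zg M)%:~R : R) => D Z Zn h h'.
have e : (v' - v) * (Z * (1 + v * v')) = v' * (v * D + (1 - v ^+ 2) * Z) - v * (v' * D + (1 - v' ^+ 2) * Z) by ring.
move: e; rewrite h h' !mulr0 subrr => /eqP; rewrite !mulf_eq0 (negPf Zn) /= subr_eq0.
have : 0 < 1 + v * v' by rewrite addr_gt0 // mulr_gt0.
by move=> /lt0r_neq0/negPf ->; rewrite orbF => /eqP.
Qed.

(** As xi decreases to 0, only points with [nM M v = 0] remain, and these share a single v. *)
Lemma WM_zero M : baseS M -> mu3 (\bigcap_n WM M n.+1%:R^-1) = 0%E.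
Proof.
move=> bS; have d := baseS_det bS.
have mI : meas3 (\bigcap_n WM M n.+1%:R^-1) by apply: bigcap_measurable => [|n _]; [exists 0%N|exact: measurable_WM].
have [[p Ip]|nI] := pselect (exists p : R * R * R, (\bigcap_n WM M n.+1%:R^-1) p); last first.
  by rewrite (_ : \bigcap_n _ = set0) ?measure0 //; apply/seteqP; split => // p Ip; apply: nI; exists p.
have n0 (q : R * R * R) : (\bigcap_n WM M n.+1%:R^-1) q -> nM M q.1.1 = 0 /\ 0 < q.1.1 /\ Zg M != 0.
  move=> Iq; have [[v0 _ w0] [A1 A2 _ _ _]] := Iq 0%N I; split; last by split => //; exact: Zg_neq0 bS v0 A1 A2.
  have b0 : bM M q.1.1 <= 0.
    rewrite leNgt; apply/negP => b0; have b1 : 0 < bM M q.1.1 / q.2 by rewrite divr_gt0.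
    have [n _ Hn] := natSinv_near b1; have [_ [_ _ B _ _]] := Iq n I.
    by have := Hn n (leqnn n); rewrite ltr_pdivlMr // ltNge B.
  have : bM M q.1.1 = 0 by apply/eqP; rewrite eq_le b0 bM_ge0.
  move=> /eqP; rewrite /bM mulf_eq0 invr_eq0 mulf_eq0 (gt_eqF (sqrD1_gt0 _)) (gt_eqF (qM_gt0 _ d)).
  by rewrite !orbF normr_eq0 => /eqP.
apply: (@mu3_v _ _ p.1.1) => // q Iq /=; have [a [b c]] := n0 q Iq; have [a' [b' _]] := n0 p Ip.
exact: nM_root_uniq a a'.
Qed.

Lemma wM_small M (e : R) : baseS M -> 0 < e -> exists2 dl, 0 < dl & forall xi, 0 < xi -> xi <= dl -> wM M xi <= e.
Proof.
move=> bM e0; have d := baseS_det bM.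
have k0 n : 0 < n.+1%:R^-1 :> R by rewrite invr_gt0.
have cv : mu3 (WM M n.+1%:R^-1) @[n --> \oo] --> mu3 (\bigcap_n WM M n.+1%:R^-1).
  apply: nonincreasing_cvg_mu.
  - by rewrite -ge0_fin_numE ?measure_ge0 // mu3_WM_fin.
  - by move=> n; exact: measurable_WM.
  - by apply: bigcap_measurable => [|n _]; [exists 0%N|exact: measurable_WM].
  - apply/nonincreasing_seqP => n; rewrite subsetEset; apply: WM_homo.
    by rewrite lef_pV2 ?posrE // ler_nat.
have h : (mu3 (\bigcap_n WM M n.+1%:R^-1) < e%:E)%E by rewrite WM_zero // lte_fin.
have [n _ Hn] := cv _ (open_ereal_lt_ereal h).
exists n.+1%:R^-1 => // xi x0 xn; apply: (le_trans (wM_homo d x0 xn)).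
by rewrite -lee_fin fineK ?mu3_WM_fin //; apply: ltW; exact: (Hn n (leqnn n)).
Qed.

Lemma sum_wM_small J (e : R) : baseseq J -> 0 < e -> exists2 dl, 0 < dl &
  forall xi, 0 < xi -> xi <= dl -> \sum_(M <- J) wM M xi <= e.
Proof.
move=> [_]; elim: J e => [|M J IH] e bJ e0; first by exists 1 => // xi _ _; rewrite big_nil ltW.
have e2 : 0 < e / 2 by rewrite divr_gt0.
have [|d1 d10 H1] := IH (e / 2) _ e2; first by move=> M' h; apply: bJ; rewrite inE h orbT.
have [d2 d20 H2] := wM_small (bJ M (mem_head _ _)) e2.
exists (Num.min d1 d2); first by rewrite lt_min d10.
move=> xi x0; rewrite le_min big_cons => /andP[h1 h2].
have := H1 xi x0 h1; have := H2 xi x0 h2; lra.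
Qed.

(** This will make pairs with equal tangents negligible and lets the total volume be extended by 0
    to xi = 0. *)
Lemma Fs_small (e : R) : 0 < e -> exists2 dl, 0 < dl & forall xi, 0 < xi -> xi <= dl -> Fs xi <= e.
Proof.
move=> e0; have e2 : 0 < e / 2 by rewrite divr_gt0.
have [J bJ HJ] := Fs_tail (@ltr01 R) e2; have [d d0 H] := sum_wM_small bJ e2.
exists (Num.min d (1 / 2)); first by rewrite lt_min d0 divr_gt0.
move=> xi x0; rewrite le_min => /andP[h1 h2].
by have := HJ xi x0 ltac:(lra); have := H xi x0 h1; lra.
Qed.

Definition posP Q th : set ('M[int]_2 * 'M[int]_2) :=
  [set p | [/\ GammaI p.1 /\ GammaI p.2, normg p.1 <= Q /\ normg p.2 <= Q, p.2 <> p.1 &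
     0 <= (tanhalf p.2 : R) - tanhalf p.1 <= th]].

Lemma pairsQ_posP Q xi : pairsQ Q xi = posP Q (xi / (BQ Q)%:R).
Proof. by apply/seteqP; split => -[g h]. Qed.

Lemma posP_pairsS Q th : posP Q th `<=` pairsS Q th.
Proof. by move=> p [a b _ /andP[h1 h2]]; split => //; rewrite ger0_norm. Qed.

Lemma baseS_swap g h : GammaI g -> GammaI h -> baseS (adj2 g *m h) -> baseS (adj2 h *m g) -> False.
Proof.
move=> gG hG b1 b2; have dg := GammaI_det gG.
have e : adj2 h *m g = adj2 (adj2 g *m h) by rewrite adj2M adj2K.
rewrite e in b2; have gh : g *m (adj2 g *m h) = h by rewrite mulmxA mul_adj2 ?mul1mx.
have /GammaIP[_ c0 d0 _ _] := gG; have /GammaIP[_ c0' d0' _ _] := hG.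
by apply: (baseS_excl c0 d0 _ _ b1 b2); rewrite -mul2E gh.
Qed.

Lemma base_neq g h : GammaI g -> baseS (adj2 g *m h) -> h <> g.
Proof. by move=> gG /baseS_neq1 n e; apply: n; rewrite e adj2_mul ?GammaI_det. Qed.

(** Orient each base pair by increasing tangent; by [baseS_swap] no two base pairs become equal. *)
Lemma pairs_lower Q th : 0 <= Q -> (cnt (baseP Q th) <= cnt (posP Q th))%N.
Proof.
move=> Q0; have fP := finite_pairsS th Q0.
pose f (p : 'M[int]_2 * 'M[int]_2) := if tanhalf p.1 <= tanhalf p.2 :> R then p else (p.2, p.1).
apply: (cnt_inj (f := f)).
- by apply: (sub_finite_set _ fP) => p [].
- exact: sub_finite_set (@posP_pairsS _ _) fP.
- move=> [g h] [g' h'] [[[/= gG hG] _ _] /= b] [[[/= gG' hG'] _ _] /= b']; rewrite /f /=.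
  case: ifP => _; case: ifP => _ [] e1 e2; subst => //.
  + by case: (baseS_swap gG hG b b').
  + by case: (baseS_swap gG hG b b').
move=> [g h] [[[/= gG hG] [n1 n2] t] /= b]; rewrite /f /=; have nn := base_neq gG b.
case: ifP => [le|/negbT]; first by split => //=; rewrite subr_ge0 le (le_trans (ler_norm _)).
rewrite -ltNge => lt; split => //=; first by move=> e; apply: nn.
by rewrite subr_ge0 (ltW lt) /= (le_trans (ler_norm _)) // distrC.
Qed.

(** A pair with strictly increasing tangents is sent to its base orientation. Pairs with equal
    tangents occur in both orders; they are counted by base pairs at distance 0, taken twice. *)
Lemma pairs_upper Q th : 0 <= Q -> 0 <= th ->
  (cnt (posP Q th) <= cnt (baseP Q th) + 2 * cnt (baseP Q 0))%N.
Proof.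
move=> Q0 t0; have fP := finite_pairsS th Q0.
have fb th' : finite_set (baseP Q th') by apply: (sub_finite_set _ (finite_pairsS th' Q0)) => p [].
have fp : finite_set (posP Q th) := sub_finite_set (@posP_pairsS _ _) fP.
pose P1 := posP Q th `&` [set p | tanhalf p.1 < tanhalf p.2 :> R].
pose E := posP Q th `&` [set p | tanhalf p.2 = tanhalf p.1 :> R].
have fP1 : finite_set P1 by apply: (sub_finite_set _ fp) => p [].
have fE : finite_set E by apply: (sub_finite_set _ fp) => p [].
have total g h : GammaI g -> GammaI h -> h <> g -> baseS (adj2 g *m h) \/ baseS (adj2 h *m g).
  move=> gG hG ne; rewrite -(adj2K g) -adj2M adj2K; apply: baseS_total.
    by rewrite det_mulmx det_adj2 (GammaI_det gG) (GammaI_det hG) mulr1.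
  move=> e; apply: ne; rewrite -[h]mul1mx -(mul_adj2 (GammaI_det gG)) -mulmxA e mulmx1 //.
apply: (@leq_trans (cnt P1 + cnt E)).
  apply: leq_trans (cntU_le fP1 fE); apply: cnt_sub; first by rewrite finite_setU.
  move=> p pp; have [_ _ _ /andP[h _]] := pp; rewrite subr_ge0 le_eqVlt in h.
  by case/orP: h => [/eqP h|h]; [right|left].
apply: leq_add.
  pose f (p : 'M[int]_2 * 'M[int]_2) := if `[< baseS (adj2 p.1 *m p.2) >] then p else (p.2, p.1).
  apply: (cnt_inj (f := f)) => //.
    move=> [g h] [g' h'] [_ /= l1] [_ /= l2]; rewrite /f /=.
    by case: ifP => _; case: ifP => _ [] e1 e2; subst => //; move: (lt_trans l1 l2); rewrite ltxx.
  move=> [g h] [[[/= gG hG] [n1 n2] ne /andP[h1 h2]] /= l]; rewrite /f /=.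
  case: ifP => [/asboolP b|/asboolP nb]; first by split => //; split => //=; rewrite ger0_norm.
  split; last by case: (total g h gG hG ne).
  by split => //=; rewrite distrC ger0_norm.
pose B0 := [set p | baseP Q 0 (p.2, p.1)].
have fB0 : finite_set B0.
  apply: (sub_finite_set _ (finite_pairsS 0 Q0)) => -[g h] [[[a b] [c e] t] _]; split => //=.
  by rewrite distrC.
apply: (@leq_trans (cnt (baseP Q 0 `|` B0))).
  apply: cnt_sub; first by rewrite finite_setU.
  move=> [g h] [[[/= gG hG] [n1 n2] ne _] /= e].
  by case: (total g h gG hG ne) => b; [left|right]; split => //; split => //=; rewrite e subrr normr0.
apply: leq_trans (cntU_le (fb 0) fB0) _; rewrite mul2n -addnn leq_add2l.
by apply: (cnt_inj (f := fun p => (p.2, p.1))) => // -[a b] [a' b'] _ _ [-> ->].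
Qed.
End BaseLimit.

(** * Dependence on the threshold *)

Section ProductSections.
Local Open Scope classical_set_scope.
Local Open Scope ring_scope.
Local Open Scope ereal_scope.
Context d1 d2 (T1 : measurableType d1) (T2 : measurableType d2) (R : realType).
Variables (m1 : {measure set T1 -> \bar R}) (m2 : {sigma_finite_measure set T2 -> \bar R}).
Variables (A B C : set (T1 * T2)) (k : R).
Hypotheses (k0 : (0 <= k)%R) (mA : measurable A) (mB : measurable B) (mC : measurable C).

Let mA' := measurable_fun_xsection m2 mA.
Let mB' := measurable_fun_xsection m2 mB.
Let mC' := measurable_fun_xsection m2 mC.

Let section_int : (m1 \x m2) B + k%:E * (m1 \x m2) C =
  \int[m1]_p (m2 (xsection B p) + k%:E * m2 (xsection C p)).
Proof.
have mk : measurable_fun setT (fun p => k%:E * m2 (xsection C p)) by exact: measurable_funeM.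
rewrite ge0_integralD //; first by rewrite ge0_integralZl_EFin.
by move=> p _; rewrite mule_ge0 ?lee_fin.
Qed.

Lemma prod_section_le : (forall p, m2 (xsection A p) <= m2 (xsection B p) + k%:E * m2 (xsection C p)) ->
  (m1 \x m2) A <= (m1 \x m2) B + k%:E * (m1 \x m2) C.
Proof.
move=> h; rewrite section_int; apply: ge0_le_integral => //; last by move=> p _; exact: h.
by apply: emeasurable_funD => //; exact: measurable_funeM.
Qed.

Lemma prod_section_ge : (forall p, m2 (xsection B p) + k%:E * m2 (xsection C p) <= m2 (xsection A p)) ->
  (m1 \x m2) B + k%:E * (m1 \x m2) C <= (m1 \x m2) A.
Proof.
move=> h; rewrite section_int; apply: ge0_le_integral => //.
  by move=> p _; rewrite adde_ge0 // mule_ge0 ?lee_fin.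
by apply: emeasurable_funD => //; exact: measurable_funeM.
Qed.
End ProductSections.

Section Sections.
Variable R : realType.
Local Open Scope classical_set_scope.
Local Open Scope ring_scope.
Implicit Types (M : 'M[int]_2) (v z w xi : R).

Local Notation mu := (@lebesgue_measure R).
Local Notation RL := (measurableTypeR R).
Local Notation meas3 := (@measurable _ (RL * RL * RL)%type).
Local Notation mu3 := (@mu3 R).

Lemma le_mu (A B : set RL) : @measurable _ RL A -> @measurable _ RL B -> A `<=` B -> (mu A <= mu B)%E.
Proof. by move=> mA mB AB; apply: (@le_measure _ _ _ mu) => //; exact: mem_set. Qed.

Definition secm (A : set (RL * RL * RL)) : (RL * RL)%type -> \bar R := fun p => mu (xsection A p).

Lemma mu3_section_le (A B C : set (RL * RL * RL)) (k : R) : 0 <= k -> meas3 A -> meas3 B -> meas3 C ->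
  (forall p, (secm A p <= secm B p + k%:E * secm C p)%E) -> (mu3 A <= mu3 B + k%:E * mu3 C)%E.
Proof. by move=> k0 mA mB mC h; exact: (@prod_section_le _ _ _ _ _ (mu \x mu)%E mu A B C k). Qed.

Lemma mu3_section_ge (A B C : set (RL * RL * RL)) (k : R) : 0 <= k -> meas3 A -> meas3 B -> meas3 C ->
  (forall p, (secm B p + k%:E * secm C p <= secm A p)%E) -> (mu3 B + k%:E * mu3 C <= mu3 A)%E.
Proof. by move=> k0 mA mB mC h; exact: (@prod_section_ge _ _ _ _ _ (mu \x mu)%E mu A B C k). Qed.

Definition mM M v : R := Num.max (1 + v ^+ 2) (qM M v).

Lemma mM_gt0 M v : 0 < mM M v.
Proof. by rewrite lt_max sqrD1_gt0. Qed.

Definition domM M v z := [&& 0 < v, 0 < a1 M v, 0 < a2 M v, 0 < z & z <= 1].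

Lemma WM_itv M xi v z w : WM M xi (v, z, w) <->
  domM M v z /\ [/\ 0 < w, bM M v <= xi * w & w * (mM M v * (1 + z ^+ 2)) <= 1].
Proof.
have z1 := sqrD1_gt0 z; rewrite /WM /domM /hg /hh /=; split.
  move=> [[v0 /andP[z0 z1'] w0] [A1 A2 B H1 H2]]; split; first by apply/and5P.
  split => //; rewrite mulrA -ler_pdivlMr // /mM; have [|] := leP (1 + v ^+ 2) (qM M v) => _; rewrite ler_pdivlMr //.
move=> [/and5P[v0 A1 A2 z0 z1'] [w0 B h]]; split; split => //; first by apply/andP.
  apply: le_trans h; rewrite mulrA ler_pM2r // ler_pM2l // /mM le_max lexx //.
by apply: le_trans h; rewrite mulrA ler_pM2r // ler_pM2l // /mM le_max lexx orbT.
Qed.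

Definition lenW M xi v z : R := if domM M v z then Num.max 0 ((mM M v * (1 + z ^+ 2))^-1 - bM M v / xi) else 0.

Lemma secm_WM M xi v z : \det M = 1 -> 0 < xi -> secm (WM M xi) (v, z) = (lenW M xi v z)%:E.
Proof.
move=> d x0; rewrite /secm /lenW; case: ifP => dm; last first.
  rewrite (_ : xsection _ _ = set0) ?measure0 //; apply/seteqP; split => // w /=.
  by rewrite /xsection /= => /set_mem/WM_itv[]; rewrite dm.
have m0 : 0 < mM M v * (1 + z ^+ 2) by rewrite mulr_gt0 ?mM_gt0 ?sqrD1_gt0.
have b0 := bM_ge0 v d; have bx : 0 <= bM M v / xi by rewrite divr_ge0 // ltW.
have mX : @measurable _ RL (xsection (WM M xi) (v, z)) by apply: measurable_xsection; exact: measurable_WM.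
set c := (mM M v * (1 + z ^+ 2))^-1; set a := bM M v / xi.
have sub1 : `]a, c]%classic `<=` xsection (WM M xi) (v, z).
  move=> w; rewrite /= in_itv /= => /andP[h1 h2]; apply/mem_set/WM_itv; split => //.
  have w1 : 0 < w by apply: le_lt_trans h1.
  split => //; first by rewrite mulrC -ler_pdivrMr // ltW.
  by rewrite -ler_pdivlMr // mul1r.
have sub2 : xsection (WM M xi) (v, z) `<=` `[a, c]%classic.
  move=> w /set_mem/WM_itv[_ [w0 B h]]; rewrite /= in_itv /=; apply/andP; split.
    by rewrite ler_pdivrMr // mulrC.
  by rewrite /c -[_^-1]mul1r ler_pdivlMr.
have e1 : (mu `]a, c]%classic = (Num.max 0 (c - a))%:E)%E.
  rewrite lebesgue_measure_itv /= lte_fin; have [h|h] := ltP a c.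
    by rewrite -EFinB max_r // subr_ge0 ltW.
  by rewrite max_l // subr_le0.
have e2 : (mu `[a, c]%classic = (Num.max 0 (c - a))%:E)%E.
  rewrite lebesgue_measure_itv /= lte_fin; have [h|h] := ltP a c.
    by rewrite -EFinB max_r // subr_ge0 ltW.
  by rewrite max_l // subr_le0.
apply/eqP; rewrite eq_le -{1}e2 -e1; apply/andP; split; apply: le_mu => //; exact: measurable_itv.
Qed.

(* The derivative in xi of the volume of WM M xi is that of Pset M xi divided by xi^2. *)
Definition Pset M (t : R) : set (R * R * R) :=
  [set p | domM M p.1.1 p.1.2 /\ [/\ 0 < p.2, p.2 <= bM M p.1.1 & mM M p.1.1 * bM M p.1.1 * (1 + p.1.2 ^+ 2) <= t]].

Lemma secm_Pset M t v z : \det M = 1 ->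
  secm (Pset M t) (v, z) = (if domM M v z && (mM M v * bM M v * (1 + z ^+ 2) <= t) then bM M v else 0)%:E.
Proof.
move=> d; rewrite /secm; case: ifP => [/andP[dm h]|h]; last first.
  rewrite (_ : xsection _ _ = set0) ?measure0 //; apply/seteqP; split => // w /=.
  by rewrite /xsection /= => /set_mem[/= a [b c e]]; move: h; rewrite a e.
rewrite (_ : xsection _ _ = `]0, bM M v]%classic).
  rewrite lebesgue_measure_itv /= lte_fin; have := bM_ge0 v d; rewrite le_eqVlt => /orP[/eqP <-|b0]; first by rewrite ltxx.
  by rewrite b0 -EFinB subr0.
apply/seteqP; split => w; rewrite /xsection /= in_itv /=; first by move=> /set_mem[_ [/= -> ->]].
by move=> /andP[a b]; apply/mem_set.
Qed.

(** For fixed (v, z) the length max(0, c - b/xi) has slope -b in 1/xi as long as b/xi <= c, and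
    slope 0 otherwise. Evaluating the condition at either end gives the two bounds. *)
Lemma lenW_diff M (x1 x2 v z : R) : \det M = 1 -> 0 < x1 -> x1 <= x2 ->
  lenW M x1 v z + (x1^-1 - x2^-1) * (if domM M v z && (mM M v * bM M v * (1 + z ^+ 2) <= x1) then bM M v else 0)
    <= lenW M x2 v z /\
  lenW M x2 v z <=
  lenW M x1 v z + (x1^-1 - x2^-1) * (if domM M v z && (mM M v * bM M v * (1 + z ^+ 2) <= x2) then bM M v else 0).
Proof.
move=> d x10 x12; have x20 : 0 < x2 by apply: lt_le_trans x12.
rewrite /lenW; case: ifP => dm /=; last by rewrite mulr0 addr0.
have m0 : 0 < mM M v * (1 + z ^+ 2) by rewrite mulr_gt0 ?mM_gt0 ?sqrD1_gt0.
have b0 := bM_ge0 v d; have i12 : 0 <= x1^-1 - x2^-1 by rewrite subr_ge0 lef_pV2 ?posrE.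
have e (x : R) : 0 < x -> (mM M v * bM M v * (1 + z ^+ 2) <= x) = (bM M v / x <= (mM M v * (1 + z ^+ 2))^-1).
  by move=> xp; rewrite (ler_pdivrMr _ _ xp) mulrC ler_pdivlMl //; congr (_ <= _); ring.
rewrite !e //; move: (mM M v * _)^-1 => c; move: (bM M v) b0 => b b0.
have h : b / x2 <= b / x1 by rewrite ler_wpM2l // lef_pV2 ?posrE.
rewrite !maxEle !subr_ge0.
have -> : (x1^-1 - x2^-1) * (if b / x1 <= c then b else 0) = if b / x1 <= c then b / x1 - b / x2 else 0.
  by case: ifP => _; rewrite ?mulr0 // mulrC mulrBr.
have -> : (x1^-1 - x2^-1) * (if b / x2 <= c then b else 0) = if b / x2 <= c then b / x1 - b / x2 else 0.
  by case: ifP => _; rewrite ?mulr0 // mulrC mulrBr.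
have [h1|h1] := leP (b / x1) c; have [h2|h2] := leP (b / x2) c; split; lra.
Qed.

Lemma continuous_mM M : continuous (fun p : R * R * R => mM M p.1.1).
Proof.
have c1 : continuous (fun p : R * R * R => 1 + p.1.1 ^+ 2).
  by apply: (@contD _ (fun=> 1) (fun p : R * R * R => p.1.1 ^+ 2)); [exact: contC|apply: contX2; exact: continuous_v].
have c2 := @continuous_qM R M.
rewrite (_ : (fun p => _) = (fun p : R * R * R => (1 + p.1.1 ^+ 2 + qM M p.1.1 + `|1 + p.1.1 ^+ 2 + - qM M p.1.1|) * 2^-1)).
  apply: contM; last exact: contC.
  by apply: contD; [exact: contD|apply: contA; apply: contD => //; exact: contN].
by apply/funext => p; rewrite /mM maxr_absE.
Qed.

Lemma continuous_bM M : \det M = 1 -> continuous (fun p : R * R * R => bM M p.1.1).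
Proof.
move=> d; rewrite /bM; apply: contM; first exact: continuous_nM.
move=> p; apply: cvgV; first by rewrite gt_eqF // mulr_gt0 ?qM_gt0 ?sqrD1_gt0.
apply: (@contM _ (fun p : R * R * R => 1 + p.1.1 ^+ 2) (fun p => qM M p.1.1)).
  by apply: (@contD _ (fun=> 1) (fun p : R * R * R => p.1.1 ^+ 2)); [exact: contC|apply: contX2; exact: continuous_v].
exact: continuous_qM.
Qed.

Definition hM M (p : R * R * R) : R := mM M p.1.1 * bM M p.1.1 * (1 + p.1.2 ^+ 2).

Lemma continuous_hM M : \det M = 1 -> continuous (hM M).
Proof.
move=> d; rewrite /hM; apply: (@contM _ (fun p : R * R * R => mM M p.1.1 * bM M p.1.1) (fun p => 1 + p.1.2 ^+ 2)).
  by apply: contM; [exact: continuous_mM|exact: continuous_bM].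
by apply: (@contD _ (fun=> 1) (fun p : R * R * R => p.1.2 ^+ 2)); [exact: contC|apply: contX2; exact: continuous_z].
Qed.

Lemma measurable_Pset M t : \det M = 1 -> meas3 (Pset M t).
Proof.
move=> d; pose O' := [set p : R * R * R | 1 < p.1.2] `|` [set p | bM M p.1.1 < p.2] `|` [set p | t < hM M p].
rewrite (_ : Pset M t = (@octant R `&` ([set p : R * R * R | 0 < a1 M p.1.1] `&` [set p | 0 < a2 M p.1.1])) `\` (@octant R `&` O')).
  apply: measurableD; apply: meas3_octantI.
    by apply: openI; [exact: open_a1_gt|exact: open_a2_gt].
  apply: openU; last by apply: open_lt_continuous; [exact: contC|exact: continuous_hM].
  by apply: openU; [exact: open_z_gt|apply: open_lt_continuous; [exact: continuous_bM|exact: continuous_w]].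
apply/seteqP; split=> p.
  move=> [/and5P[v0 A1 A2 z0 z1] [w0 B H]]; split; first by split.
  by move=> [_ [[|]|]] /=; rewrite ltNge ?z1 ?B /hM ?H.
move=> [[[v0 z0 w0] [A1 A2]] nO].
have nO' : ~ O' p by move=> h; apply: nO.
split; first by apply/and5P; split => //; rewrite leNgt; apply/negP => h; apply: nO'; left; left.
split => //; first by rewrite leNgt; apply/negP => h; apply: nO'; left; right.
by rewrite leNgt; apply/negP => h; apply: nO'; right.
Qed.

Lemma wM_diff_ge M (x1 x2 : R) : \det M = 1 -> 0 < x1 -> x1 <= x2 ->
  (mu3 (WM M x1) + (x1^-1 - x2^-1)%:E * mu3 (Pset M x1) <= mu3 (WM M x2))%E.
Proof.
move=> d x10 x12; have x20 : 0 < x2 by apply: lt_le_trans x12.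
have i12 : 0 <= x1^-1 - x2^-1 by rewrite subr_ge0 lef_pV2 ?posrE.
apply: mu3_section_ge => //; try (by exact: measurable_WM); first exact: measurable_Pset.
move=> [v z]; rewrite !secm_WM // secm_Pset // -EFinM -EFinD lee_fin.
by have [] := lenW_diff v z d x10 x12.
Qed.

Lemma wM_diff_le M (x1 x2 : R) : \det M = 1 -> 0 < x1 -> x1 <= x2 ->
  (mu3 (WM M x2) <= mu3 (WM M x1) + (x1^-1 - x2^-1)%:E * mu3 (Pset M x2))%E.
Proof.
move=> d x10 x12; have x20 : 0 < x2 by apply: lt_le_trans x12.
have i12 : 0 <= x1^-1 - x2^-1 by rewrite subr_ge0 lef_pV2 ?posrE.
apply: mu3_section_le => //; try (by exact: measurable_WM); first exact: measurable_Pset.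
move=> [v z]; rewrite !secm_WM // secm_Pset // -EFinM -EFinD lee_fin.
by have [] := lenW_diff v z d x10 x12.
Qed.
End Sections.

Section ProductIntegral.
Local Open Scope classical_set_scope.
Local Open Scope ring_scope.
Local Open Scope ereal_scope.
Lemma ge0_integral_prod d1 d2 (T1 : measurableType d1) (T2 : measurableType d2) (R : realType)
  (m1 : {sigma_finite_measure set T1 -> \bar R}) (m2 : {sigma_finite_measure set T2 -> \bar R})
  (f : T1 -> \bar R) (g : T2 -> \bar R) :
  measurable_fun setT f -> measurable_fun setT g -> (forall x, 0 <= f x)%E -> (forall y, 0 <= g y)%E ->
  (\int[m1 \x m2]_p (f p.1 * g p.2) = \int[m1]_x f x * \int[m2]_y g y)%E.
Proof.
move=> mf mg f0 g0; rewrite (@fubini_tonelli1 _ _ _ _ _ m1 m2 (fun p => (f p.1 * g p.2)%E)) /fubini_F /=.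
- rewrite -ge0_integralZr //; last exact: integral_ge0.
  by apply: eq_integral => x _; rewrite ge0_integralZl.
- apply: emeasurable_funM; first exact: measurableT_comp.
  exact: measurableT_comp.
- by move=> p; rewrite mule_ge0.
Qed.

End ProductIntegral.

(** * The asymptotics of B_Q *)

Section UnitVolume.
Variable R : realType.
Local Open Scope classical_set_scope.
Local Open Scope ring_scope.
Local Notation mu := (@lebesgue_measure R).
Local Notation RL := (measurableTypeR R).
Local Notation mu3 := (@mu3 R).

Let fv : R -> \bar R := (EFin \o (fun x : R => (oneDsqr x)^-1)) \_ `]0, +oo[.
Let fz : R -> \bar R := (EFin \o (fun x : R => (oneDsqr x)^-1)) \_ `]0, 1].

Lemma measurable_oneDsqrV (A : set R) : measurable A -> measurable_fun A (EFin \o (fun x : R => (oneDsqr x)^-1)).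
Proof.
move=> mA; apply/measurable_EFinP; apply: (@measurable_funTS _ _ _ _ A).
by apply: continuous_measurable_fun => x; exact: continuous_oneDsqrV.
Qed.

Lemma integral_fv : (\int[mu]_x fv x = (pi / 2)%:E)%E.
Proof.
rewrite -integral_mkcond integral_itv_obnd_cbnd ?integral0y_oneDsqr //.
by apply: measurable_oneDsqrV; exact: measurable_itv.
Qed.

Let oneDsqrV_ge0 (x : R) : (0 <= ((oneDsqr x)^-1)%:E)%E.
Proof. by rewrite lee_fin invr_ge0 addr_ge0 ?sqr_ge0. Qed.

Lemma integral_fz : (\int[mu]_x fz x = (pi / 4)%:E)%E.
Proof.
rewrite -integral_mkcond integral_itv_obnd_cbnd; last by apply: measurable_oneDsqrV; exact: measurable_itv.
have := @integral0_oneDsqr R 1 ler01; rewrite atan1 /Rintegral => <-; rewrite fineK //.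
rewrite ge0_fin_numE; last by apply: integral_ge0 => x _; exact: oneDsqrV_ge0.
apply: (@le_lt_trans _ _ (\int[mu]_(x in `[0%R, 1%R]) 1)%E).
  apply: ge0_le_integral => //.
  - by apply: measurable_oneDsqrV; exact: measurable_itv.
  - by move=> x _; rewrite lee_fin oneDsqrV_le1.
have e : (mu `[0%R, 1%R]%classic = 1)%E by rewrite lebesgue_measure_itv /= lte_fin ltr01 oppr0 adde0.
rewrite integral_cst; last exact: measurable_itv.
by rewrite mul1e; apply: le_lt_trans (ltry 1); rewrite -[X in (_ <= X)%E]e; exact: lexx.
Qed.

(** For M = 1 only w (1 + v^2)(1 + z^2) <= 1 remains, so the volume is the product of the integrals
    of 1/(1 + v^2) over v > 0 and of 1/(1 + z^2) over (0, 1]. *)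
Lemma mu3_WM1 (xi : R) : 0 < xi -> mu3 (WM 1%:M xi) = (pi ^+ 2 / 8)%:E.
Proof.
move=> x0.
have -> : (pi ^+ 2 / 8 = pi / 2 * (pi / 4) :> R) by field.
rewrite EFinM -integral_fv -integral_fz.
rewrite -(@ge0_integral_prod _ _ RL RL R mu mu fv fz).
- rewrite -[LHS]/(\int[(mu \x mu)%E]_p secm (WM 1%:M xi) p)%E; apply: eq_integral => -[v z] _.
  have d1 : \det (1%:M : 'M[int]_2) = 1 by rewrite det1.
  have [X Y Z] : [/\ Xg 1%:M = 1, Yg 1%:M = 1 & Zg 1%:M = 0] by rewrite /Xg /Yg /Zg !mxE.
  have b0 : bM 1%:M v = 0 by rewrite /bM /nM X Y Z subrr !mulr0 addr0 normr0 mul0r.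
  have A1 : a1 1%:M v = 1 by rewrite /a1 !mxE /= mulr0 addr0.
  have A2 : a2 1%:M v = v by rewrite /a2 !mxE /= mulr1 add0r.
  rewrite secm_WM // /lenW /domM b0 mul0r subr0 /mM /qM A1 A2 expr1n maxxx ltr01.
  rewrite /= /fv /fz !patchE /= !mem_setE !in_itv /= andbT.
  have [v0|v0] := ltP 0 v; last by rewrite mul0e.
  have [z0|z0] := ltP 0 z; last by rewrite mule0.
  have [z1|z1] := leP z 1; last by rewrite mule0.
  rewrite max_r; first by rewrite -EFinM /oneDsqr invfM.
  by rewrite invr_ge0 mulr_ge0 // addr_ge0 ?sqr_ge0.
- by apply/(measurable_restrictT _ _).1; [exact: measurable_itv|apply: measurable_oneDsqrV; exact: measurable_itv].
- by apply/(measurable_restrictT _ _).1; [exact: measurable_itv|apply: measurable_oneDsqrV; exact: measurable_itv].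
- by move=> x; apply: erestrict_ge0 => y _; exact: oneDsqrV_ge0.
- by move=> x; apply: erestrict_ge0 => y _; exact: oneDsqrV_ge0.
Qed.

(** For M = 1 a pair (g, g M) is a single matrix, so the limit theorem for pairs also counts B_Q. *)
Lemma BQ_pairM (Q th : R) : 0 <= th -> BQ Q = cnt [set g | pairM 1%:M Q th g].
Proof.
move=> t0; rewrite /BQ /cnt; congr (#|` fset_set _|); apply/seteqP; split => g /=; rewrite /pairM mulmx1 subrr normr0.
  by move=> [a b]; split.
by move=> [a _ [b _] _].
Qed.

Let quotient_pi (p : R) : p != 0 -> (2 * (p ^+ 2 / 6))^-1 * (p ^+ 2 / 8) = 3 / 8.
Proof. by move=> p0; field. Qed.

Lemma BQ_limit (e : R) : 0 < e -> exists Q0 : R, forall Q, Q0 <= Q -> `|(BQ Q)%:R - 3 / 8 * Q ^+ 2| <= e * Q ^+ 2.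
Proof.
move=> e0.
have d1 M : M \in [:: 1%:M : 'M[int]_2] -> \det M = 1 by rewrite inE => /eqP ->; rewrite det1.
have [dl dl0 [Q0 H]] := sum_limM d1 (@ltr01 R) e0.
exists (Num.max 1 Q0) => Q; rewrite ge_max => /andP[q1 q0].
have Qp : 0 < Q ^+ 2 by rewrite exprn_gt0 //; lra.
have := H Q (Q ^+ 2)^-1 q0; rewrite divff ?gt_eqF // subrr normr0 => /(_ (ltW dl0)).
rewrite !big_seq1 -BQ_pairM ?invr_ge0 ?(ltW Qp) // /wM mu3_WM1 //= zeta2E.
suff -> : (2 * (pi ^+ 2 / 6))^-1 * (pi ^+ 2 / 8) = 3 / 8 :> R by [].
by rewrite quotient_pi // gt_eqF // pi_gt0.
Qed.
End UnitVolume.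

(** * The limit of the pair correlation *)

Section PairLimit.
Variable R : realType.
Local Open Scope classical_set_scope.
Local Open Scope ring_scope.
Implicit Types (Q th xi e : R).
Local Notation zc := ((2 * zeta 2)^-1 : R).
Local Notation Fs := (@Fs R).

Lemma baseP_homo Q th th' : 0 <= Q -> th <= th' -> (cnt (baseP Q th) <= cnt (baseP Q th'))%N.
Proof.
move=> Q0 h; apply: cnt_sub; first by apply: (sub_finite_set _ (finite_pairsS th' Q0)) => p [].
by move=> p [[a b t] c]; split => //; split => //; apply: le_trans h.
Qed.

(** Pairs at distance 0 are among those at distance xi / Q^2 for every xi > 0, and the limit of the
    latter count is small with xi. *)
Lemma baseP0_small e : 0 < e -> exists Q0, forall Q, Q0 <= Q -> (cnt (baseP Q 0))%:R <= e * Q ^+ 2.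
Proof.
move=> e0; have z0 := zc_gt0 R; have e2 : 0 < e / 2 by rewrite divr_gt0.
have [xi x0 Hx] := Fs_small (divr_gt0 e2 z0).
have [dl dl0 [Q0 H]] := baseP_limit x0 e2.
exists (Num.max 1 Q0) => Q; rewrite ge_max => /andP[q1 q0].
have Qp : 0 < Q by lra.
have Q2 : 0 < Q ^+ 2 by rewrite exprn_gt0.
have := H Q (xi / Q ^+ 2) q0; rewrite mulrC divfK ?gt_eqF // subrr normr0 => /(_ (ltW dl0)).
have := @baseP_homo Q 0 (xi / Q ^+ 2) (ltW Qp); rewrite divr_ge0 ?(ltW x0) ?(ltW Q2) // => /(_ isT).
rewrite -(ler_nat R); have := Hx xi x0 (lexx _); rewrite ler_pdivlMr // => /(ler_wpM2r (ltW Q2)).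
rewrite [Fs xi / _]mulrC ler_norml; move: (cnt _)%:R (cnt _)%:R => a b; set d := _ * Fs xi * Q ^+ 2.
by move: d => d h1 h2 /andP[h3 h4]; lra.
Qed.

Lemma posP_limit xi e : 0 < xi -> 0 < e ->
  exists2 dl, 0 < dl & exists Q0, forall Q th, Q0 <= Q -> 0 <= th -> `|Q ^+ 2 * th - xi| <= dl ->
  `|(cnt (posP Q th))%:R - zc * Fs xi * Q ^+ 2| <= e * Q ^+ 2.
Proof.
move=> x0 e0; have e3 : 0 < e / 3 by rewrite divr_gt0.
have [dl dl0 [Q0 H]] := baseP_limit x0 e3; have [Q1 H1] := baseP0_small e3.
exists dl => //; exists (Num.max 0 (Num.max Q0 Q1)) => Q th; rewrite !ge_max => /and3P[q q0 q1] t0 /(H _ _ q0).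
have := H1 Q q1; have := pairs_lower th q; have := pairs_upper q t0.
rewrite -!(ler_nat R) natrD natrM; set a := (cnt (posP _ _))%:R; set b := (cnt (baseP Q th))%:R; set c := (cnt (baseP Q 0))%:R; set d := _ * Fs xi * Q ^+ 2.
move: a b c d (Q ^+ 2) => a b c d f; rewrite !ler_norml => h1 h2 h3 /andP[h4 h5]; apply/andP; split; lra.
Qed.

Lemma posP0_small e : 0 < e -> exists Q0, forall Q, Q0 <= Q -> (cnt (posP Q 0))%:R <= e * Q ^+ 2.
Proof.
move=> e0; have e3 : 0 < e / 3 by rewrite divr_gt0.
have [Q1 H1] := baseP0_small e3; exists (Num.max 0 Q1) => Q; rewrite ge_max => /andP[q q1].
have := H1 Q q1; have := pairs_upper q (lexx 0); rewrite -(ler_nat R) natrD natrM; lra.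
Qed.

Lemma quotient_dist (N b c e q : R) : 0 < q -> 0 <= c -> e <= 1 / 8 -> `|N - c * q| <= e * q ->
  `|b - 3 / 8 * q| <= e * q -> `|N / b - 8 / 3 * c| <= 4 * e * (1 + 8 / 3 * c).
Proof.
move=> q0 c0 e8 hN hb; have e0 : 0 <= e.
  by rewrite -(pmulr_lge0 e q0); exact: le_trans (normr_ge0 _) hN.
have b4 : q / 4 <= b.
  by have := ler_wpM2r (ltW q0) e8; move: hb; rewrite ler_norml => /andP[]; lra.
have b0 : 0 < b by lra.
rewrite (_ : N / b - _ = (N - 8 / 3 * c * b) / b); last by field; rewrite gt_eqF.
rewrite normrM normfV (gtr0_norm b0) ler_pdivrMr //.
apply: (@le_trans _ _ (4 * e * (1 + 8 / 3 * c) * (q / 4))); last first.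
  by rewrite ler_wpM2l // mulr_ge0 ?mulr_ge0 //; lra.
rewrite (_ : N - _ = (N - c * q) - 8 / 3 * c * (b - 3 / 8 * q)); last by field.
apply: le_trans (ler_normB _ _) _; rewrite normrM ger0_norm ?mulr_ge0 //.
have : 8 / 3 * c * `|b - 3 / 8 * q| <= 8 / 3 * c * (e * q) by rewrite ler_wpM2l // mulr_ge0.
move: hN; move: `|_| `|_| => x y; lra.
Qed.

(** The argument carries 8/3 because xi / B_Q is asymptotic to (8/3) xi / Q^2; the value 0 at xi = 0
    is the limit of [RQ Q 0]. *)
Definition R2 xi : R := if 0 < xi then 8 / 3 * (zc * Fs (8 / 3 * xi)) else 0.

Lemma Fs_ge0 xi : 0 <= Fs xi.
Proof. by rewrite fine_ge0 // esum_ge0 // => M _; exact: measure_ge0. Qed.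

Lemma RQ_cvg xi : 0 <= xi -> RQ Q xi @[Q --> +oo] --> R2 xi.
Proof.
move=> x0.
suff H e : 0 < e -> exists Q0, forall Q, Q0 <= Q -> `|RQ Q xi - R2 xi| <= e.
  apply/cvgrPdist_le => e e0; have [Q0 H0] := H e e0.
  near=> Q; rewrite distrC; apply: H0; near: Q; exact: (nbhs_pinfty_ge (num_real Q0)).
move=> e0; have z0 := zc_gt0 R.
pose c := if 0 < xi then zc * Fs (8 / 3 * xi) else 0.
have c0 : 0 <= c by rewrite /c; case: ifP => // _; rewrite mulr_ge0 ?Fs_ge0 // ltW.
have -> : R2 xi = 8 / 3 * c by rewrite /R2 /c; case: ifP => // _; rewrite mulr0.
have k0 : 0 < 4 * (1 + 8 / 3 * c) by rewrite mulr_gt0 //; lra.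
pose e1 := Num.min (1 / 8) (e / (4 * (1 + 8 / 3 * c))).
have e10 : 0 < e1 by rewrite lt_min !divr_gt0.
have e18 : e1 <= 1 / 8 by rewrite ge_min lexx.
have e1e : 4 * e1 * (1 + 8 / 3 * c) <= e.
  have : e1 <= e / (4 * (1 + 8 / 3 * c)) by rewrite ge_min lexx orbT.
  by rewrite ler_pdivlMr // mulrCA mulrA.
suff [Q0 H] : exists Q0, forall Q, Q0 <= Q -> `|(cnt (posP Q (xi / (BQ Q)%:R)))%:R - c * Q ^+ 2| <= e1 * Q ^+ 2.
  have [Q1 H1] := BQ_limit e10; exists (Num.max 1 (Num.max Q0 Q1)) => Q; rewrite !ge_max => /and3P[q1 q q'].
  have Q2 : 0 < Q ^+ 2 by rewrite exprn_gt0 //; lra.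
  apply: le_trans e1e; apply: (quotient_dist Q2 c0 e18); last exact: H1.
  by have := H Q q; rewrite -pairsQ_posP.
have [x0'|x0'] := ltP 0 xi; last first.
  have -> : xi = 0 by apply/eqP; rewrite eq_le x0 x0'.
  have [Q0 H] := posP0_small e10; exists Q0 => Q q.
  have -> : c = 0 by rewrite /c ltNge x0'.
  by rewrite !mul0r subr0 ger0_norm //; exact: H.
have y0 : 0 < 8 / 3 * xi by rewrite mulr_gt0.
have [dl dl0 [Q0 H]] := posP_limit y0 e10.
(* Since B_Q >= Q^2/4, an error e2 Q^2 in B_Q changes Q^2 xi / B_Q by at most 4 (8/3) xi e2, hence
   the constant 32/3. *)
pose e2 := Num.min (1 / 8) (dl / (32 / 3 * xi)).
have xx : 0 < 32 / 3 * xi by rewrite mulr_gt0.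
have e20 : 0 < e2 by rewrite lt_min !divr_gt0.
have [Q1 H1] := BQ_limit e20.
exists (Num.max 1 (Num.max Q0 Q1)) => Q; rewrite !ge_max => /and3P[q1 q q'].
have Q2 : 0 < Q ^+ 2 by rewrite exprn_gt0 //; lra.
rewrite /c x0'; apply: H => //; first by rewrite divr_ge0.
have e28 : e2 <= 1 / 8 by rewrite ge_min lexx.
have e2d : e2 * (32 / 3 * xi) <= dl by rewrite -ler_pdivlMr // ge_min lexx orbT.
have := H1 Q q'; move: (BQ Q)%:R (Q ^+ 2) Q2 => b s s0 hb.
have b4 : s / 4 <= b.
  by have := ler_wpM2r (ltW s0) e28; move: hb; rewrite ler_norml => /andP[]; lra.
have b0 : 0 < b by lra.
rewrite (_ : s * (xi / b) - _ = (- (8 / 3) * xi * (b - 3 / 8 * s)) / b); last by field; rewrite gt_eqF.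
rewrite normrM normfV (gtr0_norm b0) ler_pdivrMr // normrM mulNr normrN [ `|8 / 3 * xi|]ger0_norm ?mulr_ge0 //.
apply: (@le_trans _ _ (e2 * (32 / 3 * xi) * b)); last by rewrite ler_wpM2r // ltW.
apply: (@le_trans _ _ (8 / 3 * xi * (e2 * s))); first by rewrite ler_wpM2l // mulr_ge0.
have : 8 / 3 * xi * e2 * s <= 8 / 3 * xi * e2 * (4 * b) by rewrite ler_wpM2l //; [rewrite !mulr_ge0 // ltW|lra].
lra.
Unshelve. all: by end_near. Qed.
End PairLimit.

(** * The volumes that govern the derivative, summed over the connecting matrices *)

Section PsSums.
Variable R : realType.
Local Open Scope classical_set_scope.
Local Open Scope ring_scope.
Implicit Types (M : 'M[int]_2) (v z w xi t e : R).
Local Notation mu := (@lebesgue_measure R).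
Local Notation RL := (measurableTypeR R).
Local Notation meas3 := (@measurable _ (RL * RL * RL)%type).
Local Notation mu3 := (@mu3 R).
Local Notation wM := (@wM R).
Local Notation Fs := (@Fs R).

Lemma esumZl (T : choiceType) (S : set T) (a : T -> \bar R) (k : R) : 0 <= k -> (forall x, (0 <= a x)%E) ->
  (\esum_(x in S) (k%:E * a x) = k%:E * \esum_(x in S) a x)%E.
Proof.
move=> k0 a0; have ka0 x : (0 <= k%:E * a x)%E by rewrite mule_ge0 ?lee_fin.
apply/eqP; rewrite eq_le; apply/andP; split.
  apply: esum_le_seq => J uJ JS; rewrite -ge0_sume_distrr //.
  by rewrite lee_wpmul2l ?lee_fin //; exact: esum_seq_le.
have [->|kn0] := eqVneq k 0; first by rewrite mul0e esum_ge0 // => x _; rewrite mul0e.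
have kp : 0 < k by rewrite lt_def kn0.
rewrite muleC -lee_pdivlMr //; apply: esum_le_seq => J uJ JS.
rewrite lee_pdivlMr // muleC ge0_sume_distrr //; exact: esum_seq_le.
Qed.

Definition pM M t : R := fine (mu3 (Pset M t)).

Lemma Pset_homo M t t' : t <= t' -> Pset M t `<=` Pset M t'.
Proof. by move=> tt p [a [b c h]]; split => //; split => //; apply: le_trans tt. Qed.

(** Compare the thresholds t and 2 t, for which 1/t - 1/(2 t) = 1/(2 t). Through this bound the
    volumes of [Pset] inherit summability from those of [WM]. *)
Lemma mu3_Pset_le M t : \det M = 1 -> 0 < t -> (mu3 (Pset M t) <= (2 * t)%:E * mu3 (WM M (2 * t)))%E.
Proof.
move=> d t0; have t2 : 0 < 2 * t by rewrite mulr_gt0.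
have := wM_diff_ge (x1 := t) (x2 := 2 * t) d t0 ltac:(lra).
have -> : t^-1 - (2 * t)^-1 = (2 * t)^-1 by field; rewrite gt_eqF.
move=> h; rewrite muleC -lee_pdivrMr // muleC; apply: le_trans h.
by rewrite leeDr ?measure_ge0.
Qed.

Lemma Pset_fin M t : \det M = 1 -> 0 < t -> mu3 (Pset M t) \is a fin_num.
Proof.
move=> d t0; rewrite ge0_fin_numE ?measure_ge0 //; apply: le_lt_trans (mu3_Pset_le d t0) _.
by rewrite -(fineK (mu3_WM_fin d _)) ?mulr_gt0 // -EFinM ltry.
Qed.

Lemma pME M t : \det M = 1 -> 0 < t -> mu3 (Pset M t) = (pM M t)%:E.
Proof. by move=> d t0; rewrite /pM fineK ?Pset_fin. Qed.

Lemma wME M xi : \det M = 1 -> 0 < xi -> mu3 (WM M xi) = (wM M xi)%:E.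
Proof. by move=> d x0; rewrite [RHS]fineK ?mu3_WM_fin. Qed.

Lemma pM_ge0 M t : 0 <= pM M t. Proof. by rewrite fine_ge0 ?measure_ge0. Qed.

Lemma pM_homo M t t' : \det M = 1 -> 0 < t -> t <= t' -> pM M t <= pM M t'.
Proof.
move=> d t0 tt; have t0' : 0 < t' by apply: lt_le_trans tt.
rewrite -lee_fin -(pME d t0) -(pME d t0'); apply: mu3_le; try exact: measurable_Pset.
exact: Pset_homo.
Qed.

Lemma pM_le M t : \det M = 1 -> 0 < t -> pM M t <= 2 * t * wM M (2 * t).
Proof.
move=> d t0; have t2 : 0 < 2 * t by rewrite mulr_gt0.
by rewrite -lee_fin EFinM -(pME d t0) -(wME d t2); exact: mu3_Pset_le.
Qed.

Definition Ps t : R := fine (\esum_(M in baseS) mu3 (Pset M t)).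

Lemma FsE xi : 0 < xi -> (\esum_(M in baseS) mu3 (WM M xi))%E = (Fs xi)%:E.
Proof. by move=> x0; rewrite [RHS]fineK ?esum_fin. Qed.

Lemma sum_pM (J : seq 'M[int]_2) t : (forall M, M \in J -> \det M = 1) -> 0 < t ->
  (\sum_(M <- J) mu3 (Pset M t))%E = (\sum_(M <- J) pM M t)%:E.
Proof.
move=> dJ x0; rewrite -sumEFin !big_seq; apply: eq_bigr => M MJ.
by rewrite fineK // Pset_fin // dJ.
Qed.

Lemma Ps_fin t : 0 < t -> (\esum_(M in baseS) mu3 (Pset M t))%E \is a fin_num.
Proof.
move=> t0; have t2 : 0 < 2 * t by rewrite mulr_gt0.
rewrite ge0_fin_numE; last by apply: esum_ge0 => M _; exact: measure_ge0.
apply: (@le_lt_trans _ _ (\esum_(M in baseS) ((2 * t)%:E * mu3 (WM M (2 * t))))%E).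
  by apply: le_esum => M /baseS_det d; exact: mu3_Pset_le.
rewrite esumZl ?(ltW t2) // -(fineK (esum_fin t2)) -EFinM ltry //.
Qed.

Lemma PsE t : 0 < t -> (\esum_(M in baseS) mu3 (Pset M t))%E = (Ps t)%:E.
Proof. by move=> t0; rewrite /Ps fineK ?Ps_fin. Qed.

Lemma Ps_ge J t : baseseq J -> 0 < t -> \sum_(M <- J) pM M t <= Ps t.
Proof.
move=> bJ x0; rewrite -lee_fin fineK ?Ps_fin // -sum_pM //; last by move=> M; exact: baseseq_det.
by case: bJ => uJ sJ; exact: esum_seq_le.
Qed.

Lemma Ps_le t (y : R) : 0 < t -> (forall J, baseseq J -> \sum_(M <- J) pM M t <= y) -> Ps t <= y.
Proof.
move=> x0 h; rewrite -lee_fin fineK ?Ps_fin //; apply: esum_le_seq => J uJ sJ.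
rewrite sum_pM //; last by move=> M /sJ /baseS_det.
by rewrite lee_fin; exact: h.
Qed.

Lemma Ps_ge0 t : 0 <= Ps t.
Proof. by rewrite fine_ge0 // esum_ge0 // => M _; exact: measure_ge0. Qed.

Let le_EFin (A B C D : \bar R) (a b c d k : R) : A = a%:E -> B = b%:E -> C = c%:E -> D = d%:E ->
  (A + k%:E * C <= B)%E -> (B <= A + k%:E * D)%E -> a + k * c <= b /\ b <= a + k * d.
Proof. by move=> -> -> -> ->; rewrite -!EFinM -!EFinD !lee_fin. Qed.

Lemma Fs_diff (x1 x2 : R) : 0 < x1 -> x1 <= x2 ->
  Fs x1 + (x1^-1 - x2^-1) * Ps x1 <= Fs x2 /\ Fs x2 <= Fs x1 + (x1^-1 - x2^-1) * Ps x2.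
Proof.
move=> x10 x12; have x20 : 0 < x2 by apply: lt_le_trans x12.
have i12 : 0 <= x1^-1 - x2^-1 by rewrite subr_ge0 lef_pV2 ?posrE.
have p0 M : (0 <= (x1^-1 - x2^-1)%:E * mu3 (Pset M x1))%E by rewrite mule_ge0 ?lee_fin ?measure_ge0.
have p0' M : (0 <= (x1^-1 - x2^-1)%:E * mu3 (Pset M x2))%E by rewrite mule_ge0 ?lee_fin ?measure_ge0.
have h1 : ((\esum_(M in baseS) mu3 (WM M x1)) + (x1^-1 - x2^-1)%:E * (\esum_(M in baseS) mu3 (Pset M x1)) <=
  \esum_(M in baseS) mu3 (WM M x2))%E.
  rewrite -esumZl // -esumD // ; by apply: le_esum => M /baseS_det d; exact: wM_diff_ge.
have h2 : (\esum_(M in baseS) mu3 (WM M x2) <=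
  (\esum_(M in baseS) mu3 (WM M x1)) + (x1^-1 - x2^-1)%:E * (\esum_(M in baseS) mu3 (Pset M x2)))%E.
  rewrite -esumZl // -esumD //; by apply: le_esum => M /baseS_det d; exact: wM_diff_le.
exact: (le_EFin (FsE x10) (FsE x20) (PsE x10) (PsE x20) h1 h2).
Qed.

(** A finite family J' splits into its part in J and a part disjoint from J. On the latter [pM_le]
    applies, and the tail of the volumes at 2 t < 2 k is at most e / (2 k). *)
Lemma Ps_tail k e : 0 < k -> 0 < e -> exists2 J, baseseq J &
  forall t, 0 < t -> t < k -> Ps t <= \sum_(M <- J) pM M t + e.
Proof.
move=> k0 e0; have k2 : 0 < 2 * k by rewrite mulr_gt0.
have [J bJ HJ] := wM_tail k2 (divr_gt0 e0 k2); exists J => // t t0 tk.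
apply: Ps_le => // J' bJ'; pose J2 := [seq M <- J' | M \notin J].
have bJJ : baseseq (J ++ J2).
  case: bJ bJ' => uJ sJ [uJ' sJ']; split; last first.
    by move=> M; rewrite mem_cat mem_filter => /orP[/sJ//|/andP[_ /sJ']].
  rewrite cat_uniq uJ filter_uniq // andbT; apply/hasPn => M; rewrite mem_filter => /andP[h _]; exact: h.
have t2 : 0 < 2 * t by rewrite mulr_gt0.
have t2k : 2 * t < 2 * k by rewrite ltr_pM2l.
have := HJ (2 * t) _ t2 t2k bJJ; rewrite big_cat /= lerD2l => h2.
have p2 : \sum_(M <- J2) pM M t <= e.
  apply: (@le_trans _ _ (\sum_(M <- J2) 2 * t * wM M (2 * t))).
    rewrite big_seq [leRHS]big_seq; apply: ler_sum => M; rewrite mem_filter => /andP[_ MJ].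
    by apply: pM_le => //; exact: (baseseq_det bJ').
  rewrite -mulr_sumr; apply: (@le_trans _ _ (2 * t * (e / (2 * k)))); first by rewrite ler_wpM2l // ltW.
  rewrite mulrCA -[leRHS]mulr1 ler_wpM2l ?(ltW e0) // ler_pdivrMr // mul1r; lra.
rewrite (bigID (fun M => M \in J)) /=; apply: lerD; last by rewrite -big_filter.
rewrite -big_filter; case: bJ bJ' => uJ sJ [uJ' _].
rewrite (perm_big [seq M <- J | M \in J']); last first.
  apply: uniq_perm; rewrite ?filter_uniq // => M; rewrite !mem_filter andbC //.
rewrite big_filter [leRHS](bigID (fun M => M \in J')) /= lerDl.
by apply: sumr_ge0 => M _; exact: pM_ge0.
Qed.

(** Here z is a function of v, so by Fubini the set is null whatever its extent in w. *)
Lemma mu3_zgraph (A : set (RL * RL * RL)) : meas3 A ->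
  (forall v z z' w w', A (v, z, w) -> A (v, z', w') -> z = z') -> mu3 A = 0%E.
Proof.
move=> mA uA; rewrite -[LHS]/(\int[(mu \x mu)%E]_x (mu \o xsection A) x)%E.
rewrite (@fubini_tonelli1 _ _ _ _ _ mu mu (mu \o xsection A)).
- apply: integral0_eq => v _; rewrite /fubini_F.
  have [[z [w Aw]]|nA] := pselect (exists z w, A (v, z, w)); last first.
    apply: integral0_eq => z _ /=; rewrite (_ : xsection _ _ = set0) ?measure0 //.
    by apply/seteqP; split => // w /set_mem h; apply: nA; exists z, w.
  rewrite (_ : (fun y => _) = (fun y => (mu \o xsection A) (v, y)) \_ [set z]).
    rewrite -integral_mkcond; exact: integral_set1.
  apply/funext => y; rewrite patchE; case: ifPn => // /negP ny /=.
  rewrite (_ : xsection _ _ = set0) ?measure0 //; apply/seteqP; split => // w' /set_mem h.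
  by apply: ny; apply/mem_set; apply: uA h Aw.
- exact: measurable_fun_xsection.
- by move=> p; exact: measure_ge0.
Qed.

Lemma hM_uniq M t v z z' w w' : \det M = 1 -> Pset M t (v, z, w) -> Pset M t (v, z', w') ->
  hM M (v, z, w) = hM M (v, z', w') -> z = z'.
Proof.
move=> d [/and5P[_ _ _ z0 _] [/= w0 wb _]] [/and5P[_ _ _ z0' _] _]; rewrite /hM /=.
have h : 0 < mM M v * bM M v by rewrite mulr_gt0 ?mM_gt0 // (lt_le_trans w0).
move=> /(mulfI (lt0r_neq0 h)) /addrI /eqP; rewrite eqf_sqr => /orP[/eqP //|/eqP e].
by move: z0; rewrite e oppr_gt0 ltNge (ltW z0').
Qed.

(** The regions decrease to [Pset M t] as the threshold decreases to t, because the inequality with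
    t is not strict. *)
Lemma pM_right M t e : \det M = 1 -> 0 < t -> 0 < e -> exists2 dl, 0 < dl & pM M (t + dl) <= pM M t + e.
Proof.
move=> d t0 e0; have k0 n : 0 < n.+1%:R^-1 :> R by rewrite invr_gt0.
have tk n : 0 < t + n.+1%:R^-1 by rewrite addr_gt0.
have I : \bigcap_n Pset M (t + n.+1%:R^-1) = Pset M t.
  apply/seteqP; split => [p h|p h n _]; last by apply: Pset_homo h; rewrite lerDl ltW.
  have [a [b c _]] := h 0%N I; split => //; split => //; rewrite leNgt; apply/negP => h'.
  have h0 : 0 < mM M p.1.1 * bM M p.1.1 * (1 + p.1.2 ^+ 2) - t by rewrite subr_gt0.
  have [n _ Hn] := natSinv_near h0; have [_ [_ _ H]] := h n I.
  by have := Hn n (leqnn n); rewrite /= ltrBrDl => /(le_lt_trans H); rewrite ltxx.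
have cv : mu3 (Pset M (t + n.+1%:R^-1)) @[n --> \oo] --> mu3 (\bigcap_n Pset M (t + n.+1%:R^-1)).
  apply: nonincreasing_cvg_mu.
  - by rewrite -ge0_fin_numE ?measure_ge0 // Pset_fin.
  - by move=> n; exact: measurable_Pset.
  - by rewrite I; exact: measurable_Pset.
  - apply/nonincreasing_seqP => n; rewrite subsetEset; apply: Pset_homo.
    by rewrite lerD2l lef_pV2 ?posrE // ler_nat.
rewrite I in cv; have h : (mu3 (Pset M t) < (pM M t + e)%:E)%E.
  by rewrite EFinD fineK ?Pset_fin // lteDl ?Pset_fin // lte_fin.
have [n _ Hn] := cv _ (open_ereal_lt_ereal h); exists n.+1%:R^-1 => //.
by rewrite -lee_fin fineK ?Pset_fin //; apply: ltW; exact: (Hn n (leqnn n)).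
Qed.

(** A jump from the left would be the measure of the set where [hM M] equals t; that equation fixes
    z for given v, so the set is null. *)
Lemma pM_left M t e : \det M = 1 -> 0 < t -> 0 < e -> exists2 dl, 0 < dl < t & pM M t - e <= pM M (t - dl).
Proof.
(* The shift n + 2 keeps t - k n positive for every n. *)
move=> d t0 e0; pose k n : R := t * n.+2%:R^-1.
have k0 n : 0 < k n by rewrite mulr_gt0 // invr_gt0.
have kt n : k n < t by rewrite gtr_pMr // invf_lt1 // ltr1n.
have tk n : 0 < t - k n by rewrite subr_gt0.
have mB : meas3 (\bigcup_n Pset M (t - k n)) by apply: bigcup_measurable => n _; exact: measurable_Pset.
have mP : meas3 (Pset M t) by exact: measurable_Pset.
pose N := Pset M t `\` \bigcup_n Pset M (t - k n).
have mN : meas3 N by exact: measurableD.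
have N0 : mu3 N = 0%E.
  apply: mu3_zgraph mN _ => v z z' w w' [h n] [h' n'].
  have E p : Pset M t p -> ~ (\bigcup_n Pset M (t - k n)) p -> hM M p = t.
    move=> [a [b c H]] np; apply/eqP; rewrite eq_le H /= leNgt; apply/negP => lt'.
    apply: np; have h0 : 0 < (t - hM M p) / t by rewrite divr_gt0 // subr_gt0.
    have [m _ Hm] := natSinv_near h0; exists m => //; split => //; split => //.
    have := Hm m.+1 (leqnSn m); rewrite /= ltr_pdivlMr // mulrC -/(k m) -/(hM M p); move: (hM M p) (k m) => x y; clear; lra.
  by apply: (hM_uniq d h h'); rewrite (E _ h n) (E _ h' n').
have cv : mu3 (Pset M (t - k n)) @[n --> \oo] --> mu3 (\bigcup_n Pset M (t - k n)).
  apply: nondecreasing_cvg_mu => //; first by move=> n; exact: measurable_Pset.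
  apply/nondecreasing_seqP => n; rewrite subsetEset; apply: Pset_homo.
  by rewrite lerD2l lerN2 ler_wpM2l ?(ltW t0) // lef_pV2 ?posrE // ler_nat.
have h : ((pM M t - e)%:E < mu3 (\bigcup_n Pset M (t - k n)))%E.
  apply: (@lt_le_trans _ _ (mu3 (Pset M t))).
    by rewrite -[X in (_ < X)%E](fineK (Pset_fin d t0)) lte_fin -/(pM M t) gtrBl.
  rewrite -[leRHS]adde0 -N0; apply: le_trans (mu3U_le mB mN); apply: mu3_le => //.
    exact: measurableU.
  by move=> p h; have [b|b] := pselect ((\bigcup_n Pset M (t - k n)) p); [left|right].
have [n _ Hn] := cv _ (open_ereal_gt_ereal h); exists (k n); first by rewrite k0 kt.
by rewrite -lee_fin fineK ?Pset_fin //; apply: ltW; exact: (Hn n (leqnn n)).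
Qed.

Lemma pM_cont M t e : \det M = 1 -> 0 < t -> 0 < e -> exists2 dl, 0 < dl &
  forall s, `|s - t| <= dl -> 0 < s /\ `|pM M s - pM M t| <= e.
Proof.
move=> d t0 e0; have [d1 d10 H1] := pM_right d t0 e0; have [d2 /andP[d20 d2t] H2] := pM_left d t0 e0.
exists (Num.min d1 d2); first by rewrite lt_min d10.
move=> s; rewrite ler_norml le_min lerNl le_min => /andP[/andP[_ h1] /andP[h2 _]].
have s0 : 0 < s by clear -h1 d2t; lra.
have td : 0 < t - d2 by rewrite subr_gt0.
have l1 : s <= t + d1 by clear -h2; lra.
have l2 : t - d2 <= s by clear -h1; lra.
have a1 := pM_homo d s0 l1; have a2 := pM_homo d td l2.
split => //; move: (pM M s) (pM M t) (pM M (t + d1)) (pM M (t - d2)) H1 H2 a1 a2; clear.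
by move=> a b c f *; rewrite ler_norml; apply/andP; split; lra.
Qed.

Lemma sum_pM_cont J t e : baseseq J -> 0 < t -> 0 < e -> exists2 dl, 0 < dl &
  forall s, `|s - t| <= dl -> `|\sum_(M <- J) pM M s - \sum_(M <- J) pM M t| <= e.
Proof.
move=> [_]; elim: J e => [|M J IH] e bJ t0 e0; first by exists 1 => // s _; rewrite !big_nil subrr normr0 ltW.
have e2 : 0 < e / 2 by rewrite divr_gt0.
have [|d1 d10 H1] := IH (e / 2) _ t0 e2; first by move=> M' h; apply: bJ; rewrite inE h orbT.
have [d2 d20 H2] := pM_cont (baseS_det (bJ M (mem_head _ _))) t0 e2.
exists (Num.min d1 d2); first by rewrite lt_min d10.
move=> s; rewrite le_min !big_cons => /andP[/H1 h1 /H2[_ h2]].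
rewrite opprD addrACA; apply: le_trans (ler_normD _ _) _.
by rewrite (splitr e); exact: lerD.
Qed.

Lemma Ps_cont t e : 0 < t -> 0 < e -> exists2 dl, 0 < dl < t & forall s, `|s - t| <= dl -> `|Ps s - Ps t| <= e.
Proof.
move=> t0 e0; have e3 : 0 < e / 3 by rewrite divr_gt0.
have [J bJ HJ] := Ps_tail (mulr_gt0 (ltr0n _ 2) t0) e3.
have [dl dl0 H] := sum_pM_cont bJ t0 e3.
exists (Num.min dl (t / 2)); first by rewrite lt_min dl0 divr_gt0 // gt_min; apply/orP; right; lra.
move=> s; rewrite le_min => /andP[/H h h2].
have [s0 st] : 0 < s /\ s < 2 * t by move: h2 t0; clear; rewrite ler_norml => /andP[]; split; lra.
have a := HJ s s0 st; have b := HJ t t0 ltac:(clear -t0; lra); have a' := Ps_ge bJ s0; have b' := Ps_ge bJ t0.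
move: (Ps s) (Ps t) (\sum_(M <- J) pM M s) (\sum_(M <- J) pM M t) h a b a' b'; clear.
by move=> x y z w; rewrite !ler_norml => /andP[h1 h3] *; apply/andP; split; lra.
Qed.
End PsSums.

(** * An explicit integral over a band of v *)

Section BandIntegral.
Variable R : realType.
Local Open Scope classical_set_scope.
Local Open Scope ring_scope.
Local Notation mu := (@lebesgue_measure R).
Local Notation RL := (measurableTypeR R).
Variables X Y Z : R.
Hypotheses (X0 : 0 < X) (Y0 : 0 < Y) (Z0 : 0 < Z) (XY : X * Y = Z ^+ 2 + 1).

(** For X, Y, Z the forms [Xg], [Yg], [Zg] of a nonnegative M, n and q are [nM] and [qM], the
    absolute value of g is [bM], and G is a primitive of g. S tau is the square root that occurs in
    the ends of the band |n v| <= tau (1 + v^2). *)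
Let n v : R := v * (Y - X) + (1 - v ^+ 2) * Z.
Let q v : R := X + v ^+ 2 * Y + 2 * v * Z.
Let P := (X + Y) / 2.
Let d := (Y - X) / 2.
Let g v : R := n v / ((1 + v ^+ 2) * q v).
Let G v : R := 2^-1 * (ln (q v) - ln (1 + v ^+ 2)).
Let S (tau : R) := Num.sqrt (d ^+ 2 + Z ^+ 2 - tau ^+ 2).

Lemma band_q_gt0 v : 0 < q v.
Proof.
rewrite -(pmulr_lgt0 _ Y0) (_ : q v * Y = (Y * v + Z) ^+ 2 + 1); first by rewrite ltr_wpDl ?sqr_ge0.
have -> : q v * Y = X * Y + Y ^+ 2 * v ^+ 2 + 2 * v * Y * Z by rewrite /q; ring.
by rewrite XY; ring.
Qed.

Let p_gt0 (v : R) : 0 < 1 + v ^+ 2. Proof. by rewrite ltr_pwDl ?sqr_ge0. Qed.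

Lemma is_derive_band (v : R) : is_derive v (1 : R) G (g v).
Proof.
have q0 := band_q_gt0 v; have p0 := p_gt0 v.
have hid := is_derive_id v (1 : R); have hc (k : R) := is_derive_cst k v (1 : R).
have h2 : is_derive v (1 : R) (fun v : R => v ^+ 2) (2 * v).
  apply: is_derive_eq (@is_deriveX R R id 2 v 1 _ hid) _.
  by rewrite /GRing.scale /=; ring.
have hq : is_derive v (1 : R) q (2 * v * Y + 2 * Z).
  apply: is_derive_eq (is_deriveD (is_deriveD (hc X) (is_deriveM h2 (hc Y))) (is_deriveM (is_deriveM (hc 2) hid) (hc Z))) _.
  by rewrite /GRing.scale /=; ring.
have hp : is_derive v (1 : R) (fun v : R => 1 + v ^+ 2) (2 * v).
  by apply: is_derive_eq (is_deriveD (hc 1) h2) _; rewrite add0r.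
have lq := is_derive1_comp (is_derive1_ln q0) hq.
have lp := @is_derive1_comp R (@ln R) (fun v : R => 1 + v ^+ 2) v _ _ (is_derive1_ln p0) hp.
apply: is_derive_eq (is_deriveM (hc (2^-1)) (is_deriveB lq lp)) _.
rewrite /GRing.scale /= mulr0 addr0 /g.
have e1 : q v != 0 by rewrite gt_eqF.
have e2 : 1 + v ^+ 2 != 0 by rewrite gt_eqF.
transitivity (2^-1 * ((1 + v ^+ 2) * (2 * v * Y + 2 * Z) - q v * (2 * v)) / ((1 + v ^+ 2) * q v)).
  by move: (q v) e1 => w e1; field; rewrite e1.
by congr (_ / _); rewrite /n /q; field.
Qed.

Lemma continuous_band_abs : continuous (fun v => `|g v|).
Proof.
move=> v; apply: continuous_comp; last exact: norm_continuous.
apply: cvgM; last apply: cvgV.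
- by apply: cvgD; [apply: cvgM; [exact: cvg_id|exact: cvg_cst]|apply: cvgM; [apply: cvgB; [exact: cvg_cst|exact: exprn_continuous]|exact: cvg_cst]].
- by rewrite mulf_neq0 // gt_eqF // ?band_q_gt0.
apply: cvgM; first by apply: cvgD; [exact: cvg_cst|exact: exprn_continuous].
by apply: cvgD; [apply: cvgD; [exact: cvg_cst|apply: cvgM; [exact: exprn_continuous|exact: cvg_cst]]|apply: cvgM; [apply: cvgM; [exact: cvg_cst|exact: cvg_id]|exact: cvg_cst]].
Qed.

Let G_cont : continuous G.
Proof. by move=> v; apply: differentiable_continuous; apply/derivable1_diffP; exact: (@ex_derive _ _ _ _ _ _ _ (is_derive_band v)). Qed.

Lemma band_FTC (s : bool) (a b : R) : a <= b -> (forall v, a <= v <= b -> `|g v| = (-1) ^+ s * g v) ->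
  (\int[mu]_(v in `[a, b]) (`|g v|)%:E = ((-1) ^+ s * (G b - G a))%:E)%E.
Proof.
rewrite le_eqVlt => /predU1P[-> _|ab h].
  by rewrite set_itv1 integral_set1 subrr mulr0.
have D (v : R) : is_derive v (1 : R) (fun v => (-1) ^+ s * G v) ((-1) ^+ s * g v).
  apply: is_derive_eq (is_deriveM (is_derive_cst ((-1) ^+ s : R) v (1 : R)) (is_derive_band v)) _.
  by rewrite /GRing.scale /= mulr0 addr0.
have C : continuous (fun v => (-1) ^+ s * G v).
  by move=> v; apply: cvgM; [exact: cvg_cst|exact: G_cont].
rewrite (@continuous_FTC2 _ _ (fun v => (-1) ^+ s * G v)) //; first by rewrite -EFinB -mulrBr.
- by apply: continuous_in_subspaceT => x _; exact: continuous_band_abs.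
- split; first by move=> x _; exact: (@ex_derive _ _ _ _ _ _ _ (D x)).
    by apply: cvg_at_right_filter; exact: C.
  by apply: cvg_at_left_filter; exact: C.
move=> x; rewrite in_itv /= => /andP[h1 h2]; rewrite derive1E (@derive_val _ _ _ _ _ _ _ (D x)) h //.
by rewrite !ltW.
Qed.

Let S_bounds (tau : R) : 0 <= tau -> tau < Z ->
  S tau ^+ 2 = d ^+ 2 + Z ^+ 2 - tau ^+ 2 /\ `|d| < S tau.
Proof.
move=> t0 tZ.
have r0 : d ^+ 2 < d ^+ 2 + Z ^+ 2 - tau ^+ 2 by rewrite -addrA ltrDl subr_gt0 ltr_pXn2r ?nnegrE // ltW.
have r1 := le_lt_trans (sqr_ge0 d) r0.
by split; [rewrite sqr_sqrtr // ltW|rewrite -sqrtr_sqr ltr_sqrt].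
Qed.

(** Multiplied by Z + tau, the inequality becomes the nonnegativity of the product of v (Z + tau) -
    (d + S tau) and v (Z + tau) - (d - S tau). The second factor is positive since |d| < S tau. *)
Lemma band_lo (tau v : R) : 0 <= tau -> tau < Z -> 0 < v ->
  (n v <= tau * (1 + v ^+ 2)) = ((d + S tau) / (Z + tau) <= v).
Proof.
move=> t0 tZ v0; have zt : 0 < Z + tau by rewrite ltr_pwDl.
have [S2 Sd] := S_bounds t0 tZ.
have : 0 < v * (Z + tau) - (d - S tau) by move: Sd; rewrite ltr_norml => /andP[_ ?]; have := mulr_gt0 v0 zt; lra.
rewrite ler_pdivrMr // -subr_ge0 -[RHS]subr_ge0 => h.
rewrite -[RHS](pmulr_rge0 _ h) -[LHS](pmulr_rge0 _ zt); congr (0 <= _).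
have nE : n v = 2 * d * v + (1 - v ^+ 2) * Z by rewrite /n /d; field.
rewrite nE; move: S2; move: (S tau) => s S2; ring: S2.
Qed.

Lemma band_hi (tau v : R) : 0 <= tau -> tau < Z -> 0 < v ->
  (- (tau * (1 + v ^+ 2)) <= n v) = (v <= (d + S tau) / (Z - tau)).
Proof.
move=> t0 tZ v0; have zt : 0 < Z - tau by rewrite subr_gt0.
have [S2 Sd] := S_bounds t0 tZ.
have : 0 < v * (Z - tau) - (d - S tau) by move: Sd; rewrite ltr_norml => /andP[_ ?]; have := mulr_gt0 v0 zt; lra.
rewrite ler_pdivlMr // -subr_ge0 -[RHS]subr_ge0 => h.
rewrite -[RHS](pmulr_rge0 _ h) -[LHS](pmulr_rge0 _ zt); congr (0 <= _).
have nE : n v = 2 * d * v + (1 - v ^+ 2) * Z by rewrite /n /d; field.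
rewrite nE; move: S2; move: (S tau) => s S2; ring: S2.
Qed.
Let P0 : 0 < P. Proof. by rewrite divr_gt0 // addr_gt0. Qed.

(** The two ends of the band, with w = Z + tau and w = Z - tau, and the zero of n, with tau = 0 and
    w = Z, are treated together. At such u one has q u = (P + S tau)(1 + u^2), so G agrees at both
    ends. *)
Lemma band_root (tau w u : R) : 0 <= tau -> tau < Z -> w != 0 -> w * (2 * Z - w) = Z ^+ 2 - tau ^+ 2 ->
  u * w = d + S tau -> G u = 2^-1 * ln (P + S tau).
Proof.
move=> t0 tZ w0 ww uw; have [S2 Sd] := S_bounds t0 tZ.
have S0 : 0 <= S tau by exact: sqrtr_ge0.
have PS : 0 < P + S tau by rewrite ltr_wpDr.
have h : u ^+ 2 * w - 2 * u * d = 2 * Z - w.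
  apply: (mulfI w0); rewrite ww.
  have e : S tau = u * w - d by rewrite uw addrAC subrr add0r.
  have : Z ^+ 2 - tau ^+ 2 = S tau ^+ 2 - d ^+ 2 by rewrite S2; ring.
  by move=> ->; rewrite e; ring.
have qE : q u = (P + S tau) * (1 + u ^+ 2).
  have e : S tau = u * w - d by rewrite uw addrAC subrr add0r.
  have : q u - (P + S tau) * (1 + u ^+ 2) = u * (2 * Z - w - (u ^+ 2 * w - 2 * u * d)).
    by rewrite e /q /P /d; field.
  by rewrite h subrr mulr0 => /eqP; rewrite subr_eq0 => /eqP.
by rewrite /G qE lnM ?posrE // addrK.
Qed.

(** n changes sign once in the band [v1, v2], at v0, so the integral is 2 G(v0) - G(v1) - G(v2). *)
Lemma band_integral (tau : R) : 0 < tau -> tau < Z ->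
  (\int[mu]_v (if (0 < v) && (`|n v| <= tau * (1 + v ^+ 2)) then `|g v| else 0)%:E =
   (ln (P + S 0) - ln (P + S tau))%:E)%E.
Proof.
move=> t0 tZ; have t0' := ltW t0.
have [S2 Sd] := S_bounds t0' tZ; have [S02 Sd0] := S_bounds (lexx 0) Z0.
have zp : 0 < Z + tau by rewrite addr_gt0.
have zm : 0 < Z - tau by rewrite subr_gt0.
have s0 : 0 < d + S tau by move: Sd; rewrite ltr_norml => /andP[]; lra.
have s00 : 0 < d + S 0 by move: Sd0; rewrite ltr_norml => /andP[]; lra.
pose v1 := (d + S tau) / (Z + tau); pose v2 := (d + S tau) / (Z - tau); pose v0 := (d + S 0) / Z.
have p1 : 0 < v1 by rewrite divr_gt0.
have p0 : 0 < v0 by rewrite divr_gt0.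
have lo0 v : 0 < v -> (n v <= 0) = (v0 <= v).
  by move=> vp; have := band_lo (lexx 0) Z0 vp; rewrite mul0r addr0.
have hi0 v : 0 < v -> (0 <= n v) = (v <= v0).
  by move=> vp; have := band_hi (lexx 0) Z0 vp; rewrite mul0r oppr0 addr0.
have n0 : n v0 = 0 by apply/eqP; rewrite eq_le lo0 // hi0 // lexx.
have v10 : v1 <= v0 by rewrite -band_lo // n0 mulr_ge0 // ltW.
have v02 : v0 <= v2 by rewrite -band_hi // n0 oppr_le0 mulr_ge0 // ltW.
have G1 : G v1 = 2^-1 * ln (P + S tau).
  by apply: (@band_root _ (Z + tau)); rewrite ?divfK ?gt_eqF //; ring.
have G2 : G v2 = 2^-1 * ln (P + S tau).
  by apply: (@band_root _ (Z - tau)); rewrite ?divfK ?gt_eqF //; ring.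
have G0 : G v0 = 2^-1 * ln (P + S 0).
  by apply: (@band_root _ Z); rewrite ?divfK ?gt_eqF //; ring.
have mg (A : set R) : measurable A -> measurable_fun A (fun v => (`|g v|)%:E).
  move=> mA; apply/measurable_EFinP; apply: (@measurable_funTS _ _ _ _ A).
  by apply: continuous_measurable_fun; exact: continuous_band_abs.
rewrite (_ : (fun v => _) = (fun v => (`|g v|)%:E) \_ `[v1, v2]); last first.
  apply/funext => v; rewrite patchE mem_setE in_itv /=.
  have [vp|vn] /= := ltP 0 v.
    by rewrite ler_norml band_lo // band_hi // andbC; case: ifP.
  by rewrite leNgt (le_lt_trans vn p1).
rewrite -integral_mkcond.
have -> : `[v1, v2]%classic = `[v1, v0]%classic `|` `]v0, v2]%classic.
  apply/seteqP; split => v /=; rewrite !in_itv /=.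
    by move=> /andP[a b]; have [h|h] := leP v v0; [left; rewrite a|right; rewrite b].
  by move=> [/andP[a b]|/andP[a b]]; [rewrite a (le_trans b)|rewrite b andbT (le_trans v10) // ltW].
rewrite ge0_integral_setU //=; last 2 first.
- by apply: mg; apply: measurableU; exact: measurable_itv.
- by apply/disj_setPS => v [] /=; rewrite !in_itv /= => /andP[_ h] /andP[h' _]; move: (lt_le_trans h' h); rewrite ltxx.
rewrite integral_itv_obnd_cbnd; last by apply: mg; exact: measurable_itv.
have gs v : 0 < v -> 0 < (1 + v ^+ 2) * q v by move=> _; rewrite mulr_gt0 ?band_q_gt0.
rewrite (@band_FTC false) //; last first.
  move=> v /andP[a b]; have vp : 0 < v by apply: lt_le_trans a.
  by rewrite expr0 mul1r ger0_norm // divr_ge0 ?hi0 // ltW ?gs.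
rewrite (@band_FTC true) //; last first.
  move=> v /andP[a b]; have vp : 0 < v by apply: lt_le_trans a.
  by rewrite expr1 mulN1r ler0_norm // mulr_le0_ge0 ?lo0 // invr_ge0 ltW ?gs.
rewrite -EFinD; congr (_%:E); rewrite expr0 expr1 G0 G1 G2.
by move: (ln _) (ln _) => a b; field.
Qed.

(** As a function of tau^2, S is the square root of an affine function, hence concave, and so is
    ln(P + S). The claim is this concavity between 0 and tau^2, at the point lam^2 tau^2. *)
Lemma band_scale (lam tau : R) : 0 < lam -> lam <= 1 -> 0 < tau -> tau < Z ->
  ln (P + S 0) - ln (P + S (lam * tau)) <= lam ^+ 2 * (ln (P + S 0) - ln (P + S tau)).
Proof.
move=> l0 l1 t0 tZ; have t0' := ltW t0; have [S2 _] := S_bounds t0' tZ; have [S02 _] := S_bounds (lexx 0) Z0.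
have lt0 : 0 <= lam * tau by rewrite mulr_ge0 // ltW.
have ltZ : lam * tau < Z by apply: le_lt_trans tZ; rewrite ler_piMl.
have [Sl _] := S_bounds lt0 ltZ.
have u1 : lam ^+ 2 <= 1 by rewrite expr_le1 // ltW.
have u0 : 0 <= lam ^+ 2 by rewrite sqr_ge0.
have a0 : 0 <= S 0 by exact: sqrtr_ge0.
have b0 : 0 <= S tau by exact: sqrtr_ge0.
have c0 : 0 <= S (lam * tau) by exact: sqrtr_ge0.
have hS : (1 - lam ^+ 2) * S 0 + lam ^+ 2 * S tau <= S (lam * tau).
  rewrite -(@ler_pXn2r _ 2) ?nnegrE //; last by rewrite addr_ge0 // mulr_ge0 // subr_ge0.
  have : 0 <= lam ^+ 2 * (1 - lam ^+ 2) * (S 0 - S tau) ^+ 2 by rewrite mulr_ge0 ?sqr_ge0 // mulr_ge0 // subr_ge0.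
  rewrite Sl; suff <- : lam ^+ 2 * (S tau) ^+ 2 + (1 - lam ^+ 2) * (S 0) ^+ 2 = d ^+ 2 + Z ^+ 2 - (lam * tau) ^+ 2.
    move=> h; rewrite -subr_ge0; apply: (le_trans h); rewrite le_eqVlt; apply/orP; left; apply/eqP; ring.
  by rewrite S2 S02; ring.
set A := P + S 0; set B := P + S tau; set C := P + S (lam * tau).
have A0 : 0 < A by rewrite ltr_wpDr.
have B0 : 0 < B by rewrite ltr_wpDr.
have C0 : 0 < C by rewrite ltr_wpDr.
have hC : (1 - lam ^+ 2) * A + lam ^+ 2 * B <= C.
  by rewrite /A /B /C; move: hS; move: (lam ^+ 2) (S 0) (S tau) (S _) => u x y z; lra.
have lnq x : 0 < x -> ln x - ln C <= x / C - 1.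
  move=> x0; rewrite -ln_div ?posrE //; have xc : 0 < x / C by rewrite divr_gt0.
  have := @le_ln1Dx R (x / C - 1); rewrite [1 + _]addrC subrK; apply; lra.
have hA := lnq A A0; have hB := lnq B B0.
have k1 : 0 <= 1 - lam ^+ 2 by rewrite subr_ge0.
have k2 := lerD (ler_wpM2l k1 hA) (ler_wpM2l u0 hB).
have k3 : (1 - lam ^+ 2) * (A / C - 1) + lam ^+ 2 * (B / C - 1) <= 0.
  rewrite (_ : _ + _ = ((1 - lam ^+ 2) * A + lam ^+ 2 * B) / C - 1); last by field; rewrite gt_eqF.
  by rewrite subr_le0 ler_pdivrMr // mul1r.
by move: (le_trans k2 k3); move: (lam ^+ 2) (ln A) (ln B) (ln C) => u a b c; lra.
Qed.
Lemma band_integral_scale (lam tau : R) : 0 < lam -> lam <= 1 -> 0 < tau -> tau < Z ->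
  (\int[mu]_v (if (0 < v) && (`|n v| <= lam * tau * (1 + v ^+ 2)) then `|g v| else 0)%:E <=
   (lam ^+ 2)%:E * \int[mu]_v (if (0 < v) && (`|n v| <= tau * (1 + v ^+ 2)) then `|g v| else 0)%:E)%E.
Proof.
move=> l0 l1 t0 tZ; have ltZ : lam * tau < Z by apply: le_lt_trans tZ; rewrite ler_piMl // ltW.
by rewrite !band_integral ?mulr_gt0 // -EFinM lee_fin band_scale.
Qed.
End BandIntegral.

Section IteratedSections.
Local Open Scope classical_set_scope.
Local Open Scope ring_scope.
Local Open Scope ereal_scope.
Context d1 d2 d3 (T1 : measurableType d1) (T2 : measurableType d2) (T3 : measurableType d3) (R : realType).
Variables (m1 : {sigma_finite_measure set T1 -> \bar R}) (m2 : {sigma_finite_measure set T2 -> \bar R})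
  (m3 : {sigma_finite_measure set T3 -> \bar R}).

Lemma prod3_section_le (A B : set (T1 * T2 * T3)) (k : R) : (0 <= k)%R -> measurable A -> measurable B ->
  (forall y, \int[m1]_x m3 (xsection A (x, y)) <= k%:E * \int[m1]_x m3 (xsection B (x, y))) ->
  ((m1 \x m2) \x m3) A <= k%:E * ((m1 \x m2) \x m3) B.
Proof.
move=> k0 mA mB h; have mA' := measurable_fun_xsection m3 mA; have mB' := measurable_fun_xsection m3 mB.
rewrite -[X in X <= _]/(\int[m1 \x m2]_p (m3 \o xsection A) p) -[X in _ <= _ * X]/(\int[m1 \x m2]_p (m3 \o xsection B) p).
rewrite !(@fubini_tonelli2 _ _ _ _ _ m1 m2) // -ge0_integralZl_EFin //.
- apply: ge0_le_integral => //.
  + by move=> y _; apply: integral_ge0.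
  + exact: measurable_fun_fubini_tonelli_G.
  + by apply: measurable_funeM; exact: measurable_fun_fubini_tonelli_G.
  + by move=> y _; exact: h.
- by move=> y _; apply: integral_ge0.
- exact: measurable_fun_fubini_tonelli_G.
Qed.
End IteratedSections.

Section PsetScaling.
Variable R : realType.
Local Open Scope classical_set_scope.
Local Open Scope ring_scope.
Implicit Types (M : 'M[int]_2) (v z w xi t e : R).
Local Notation mu := (@lebesgue_measure R).
Local Notation RL := (measurableTypeR R).
Local Notation meas3 := (@measurable _ (RL * RL * RL)%type).
Local Notation mu3 := (@mu3 R).

(** Multiplying [nM] by v [a1] gives the identity [key], whose three terms are nonnegative because
    [M 0 0] <= 0. Replacing 1 + v^2 and [qM] by their maximum [mM] reduces the claim to [main]; this
    follows from the arithmetic-geometric mean if [M 0 0] <= -1, and from the explicit shape of M if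
    [M 0 0] = 0. *)
Lemma leftS_mb_ge1 M v : leftS M -> 0 < v -> 0 < a1 M v -> 0 < a2 M v -> 1 <= mM M v * bM M v.
Proof.
move=> [d m0] v0 A1 A2; have q0 := qM_gt0 v d; have p0 := sqrD1_gt0 v.
have d' : (M 0 0)%:~R * (M 1 1)%:~R - (M 0 1)%:~R * (M 1 0)%:~R = 1 :> R.
  by rewrite -!intrM -intrB -det2E d.
have qE : qM M v = a1 M v ^+ 2 + a2 M v ^+ 2 by [].
have key : v * a1 M v * nM M v = a1 M v * qM M v - (M 0 0)%:~R * (1 + v ^+ 2) * qM M v + v * a2 M v * (1 + v ^+ 2).
  have -> : v * a2 M v * (1 + v ^+ 2) = v * a2 M v * (1 + v ^+ 2) * ((M 0 0)%:~R * (M 1 1)%:~R - (M 0 1)%:~R * (M 1 0)%:~R).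
    by rewrite d' mulr1.
  rewrite /nM qE /a1 /a2 /Xg /Yg /Zg !intrD !intrM ?rmorphXn /=.
  by move: (M 0 0)%:~R (M 0 1)%:~R (M 1 0)%:~R (M 1 1)%:~R => a b c e; ring.
have m00 : (M 0 0)%:~R <= 0 :> R by rewrite lerz0.
have va : 0 < v * a1 M v by rewrite mulr_gt0.
have mp : 1 + v ^+ 2 <= mM M v by rewrite le_max lexx.
have mq : qM M v <= mM M v by rewrite le_max lexx orbT.
have main : v * a1 M v <= a1 M v + v * a2 M v - (M 0 0)%:~R * mM M v.
  have [e|ne] := eqVneq (M 0 0) 0.
    have A1' : 0 < v * (M 1 0)%:~R by move: A1; rewrite /a1 e add0r.
    have c0 : 0 < M 1 0 by move: A1'; rewrite pmulr_rgt0 // ltr0z.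
    have bc : - (M 0 1 * M 1 0) = 1 by move: d; rewrite det2E e mul0r sub0r.
    have [c1 b1] : M 1 0 = 1 /\ M 0 1 = -1.
      move: bc c0; move: (M 0 1) (M 1 0) => b c; clear => bc c0.
      have b1 : b <= -1 by nia.
      have c1 : c <= 1 by nia.
      have c2 : c = 1 by lia.
      by move: bc; rewrite c2 mulr1 => bc; split; lia.
    have A2' : 1 < v * (M 1 1)%:~R by move: A2; rewrite /a2 b1 addrC subr_gt0.
    have e1 : 1 <= (M 1 1)%:~R :> R.
      have : 0 < v * (M 1 1)%:~R by apply: lt_trans A2'.
      by rewrite pmulr_rgt0 // ltr0z ler1z; move: (M 1 1) => k; clear; lia.
    rewrite /a1 /a2 e c1 b1 mul0r subr0 add0r mulr1 mulrDr mulrN1 addrA subrr add0r.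
    by rewrite ler_wpM2l ?(ltW v0) // ler_peMr // ltW.
  have n1 : (M 0 0)%:~R <= -1 :> R by rewrite -(intrN R 1) ler_int; move: m0 ne; move: (M 0 0) => a; clear; lia.
  have hm : v * a1 M v <= mM M v.
    have : 2 * (v * a1 M v) <= (1 + v ^+ 2) + qM M v.
      rewrite qE; have := sqr_ge0 (v - a1 M v); have := sqr_ge0 (a2 M v); move: (a1 M v) (a2 M v) => a b; clear; nra.
    by move: mp mq; move: (mM M v) (qM M v) => a b; clear; lra.
  have mM0 := mM_gt0 M v.
  have : mM M v <= - (M 0 0)%:~R * mM M v by rewrite ler_peMl ?(ltW mM0) // lerNr.
  by have := mulr_gt0 v0 A2; move: hm A1; rewrite mulNr; move: (mM M v) (_ * mM M v) (v * a1 M v) (a1 M v) (v * a2 M v) => ?????; clear; lra.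
have n0 : 0 < nM M v.
  rewrite -(pmulr_rgt0 _ va) key.
  have : 0 <= - (M 0 0)%:~R * (1 + v ^+ 2) * qM M v by rewrite !mulr_ge0 ?oppr_ge0 // ltW.
  have := mulr_gt0 A1 q0; have := mulr_gt0 (mulr_gt0 v0 A2) p0; rewrite !mulNr.
  by move: (_ * qM M v) (_ * qM M v) (_ * (1 + v ^+ 2)) => ???; clear; lra.
rewrite /bM gtr0_norm // mulrA ler_pdivlMr ?mul1r; last by rewrite mulr_gt0.
rewrite -(ler_pM2l va).
rewrite (_ : v * a1 M v * (mM M v * nM M v) = mM M v * (v * a1 M v * nM M v)); last by ring.
rewrite key; have pq : 0 < (1 + v ^+ 2) * qM M v by rewrite mulr_gt0.
apply: (@le_trans _ _ ((1 + v ^+ 2) * qM M v * (a1 M v + v * a2 M v - (M 0 0)%:~R * mM M v))).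
  by rewrite mulrC ler_wpM2l // ltW.
have h1 : 0 <= (mM M v - (1 + v ^+ 2)) * (a1 M v * qM M v) by rewrite mulr_ge0 ?subr_ge0 // mulr_ge0 ?ltW.
have h2 : 0 <= (mM M v - qM M v) * (v * a2 M v * (1 + v ^+ 2)) by rewrite mulr_ge0 ?subr_ge0 // !mulr_ge0 ?ltW.
rewrite -subr_ge0; apply: le_trans (addr_ge0 h1 h2) _; rewrite le_eqVlt; apply/orP; left; apply/eqP.
by move: (mM M v) (qM M v) (a1 M v) (a2 M v) => a b c e; ring.
Qed.

Lemma Pset_leftS M t : leftS M -> t < 1 -> Pset M t = set0.
Proof.
move=> lM t1; apply/seteqP; split => // p [/and5P[v0 A1 A2 _ _] [_ _ h]].
have := leftS_mb_ge1 lM v0 A1 A2 => m1.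
have : 1 <= mM M p.1.1 * bM M p.1.1 * (1 + p.1.2 ^+ 2).
  by apply: (le_trans m1); rewrite ler_peMr ?(le_trans ler01 m1) // lerDl sqr_ge0.
by move=> /le_lt_trans/(_ (le_lt_trans h t1)); rewrite ltxx.
Qed.

Lemma frakS_entries M : frakS M -> [/\ 1 <= M 0 0, 0 <= M 0 1, 0 <= M 1 0, 1 <= M 1 1 & 1 <= Zg M].
Proof.
move=> [d nn n1]; have /nneg4[a0 b0 c0 e0] := nn; have := d; rewrite det2E => d'.
have n1' : ~ [/\ M 0 0 = 1, M 0 1 = 0, M 1 0 = 0 & M 1 1 = 1].
  by move=> [e1 e2 e3 e4]; apply: n1; apply/matrixP => i j; rewrite !mxE; case: (ord2 i) => ->; case: (ord2 j) => ->.
rewrite /Zg; move: a0 b0 c0 e0 d' n1'; move: (M 0 0) (M 0 1) (M 1 0) (M 1 1) => a b c e; clear => a0 b0 c0 e0 d n1.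
have a1 : 1 <= a by nia.
have e1 : 1 <= e by nia.
split => //; have [b1|b1] : b = 0 \/ 1 <= b by lia.
- have [c1|c1] : c = 0 \/ 1 <= c by lia.
    by exfalso; apply: n1; subst; split => //; nia.
  by nia.
- by nia.
Qed.

Lemma frakS_pos M v : frakS M -> 0 < v -> [/\ 0 < a1 M v, 0 < a2 M v & mM M v = qM M v].
Proof.
move=> fM v0; have [a0 b0 c0 e0 _] := frakS_entries fM.
have h1 : 1 <= a1 M v by rewrite /a1 (@le_trans _ _ (M 0 0)%:~R) ?ler1z // lerDl mulr_ge0 ?ler0z // ltW.
have h2 : v <= a2 M v by rewrite /a2 (@le_trans _ _ (v * (M 1 1)%:~R)) ?ler_peMr ?ler1z ?(ltW v0) // lerDr ler0z.
have h3 : 0 < a2 M v by apply: lt_le_trans h2.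
split => //; first by apply: lt_le_trans h1.
rewrite /mM max_r // /qM lerD //; first by rewrite -[1](expr1n _ 2) ler_pXn2r ?nnegrE // (le_trans _ h1).
by rewrite ler_pXn2r ?nnegrE // ltW.
Qed.

(** The integrand of [band_integral]; for tau = t/(1 + z^2) it is the length of the section of
    [Pset M t] at (v, z). *)
Definition bandF M (tau v : R) : R :=
  if (0 < v) && (`|v * ((Yg M)%:~R - (Xg M)%:~R) + (1 - v ^+ 2) * (Zg M)%:~R| <= tau * (1 + v ^+ 2))
  then `|(v * ((Yg M)%:~R - (Xg M)%:~R) + (1 - v ^+ 2) * (Zg M)%:~R) /
     ((1 + v ^+ 2) * ((Xg M)%:~R + v ^+ 2 * (Yg M)%:~R + 2 * v * (Zg M)%:~R))| else 0.

Lemma secm_frakS M t v z : frakS M -> 0 < z <= 1 -> secm (Pset M t) (v, z) = (bandF M (t / (1 + z ^+ 2)) v)%:E.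
Proof.
move=> fM /andP[z0 z1]; have [d _ _] := fM; rewrite /bandF secm_Pset // /domM z0 z1 andbT.
have [v0|v0] //= := ltP 0 v; have [-> -> ->] /= := frakS_pos fM v0.
have q0 := qM_gt0 v d; have p0 := sqrD1_gt0 v; have s0 := sqrD1_gt0 z.
have qE : qM M v = (Xg M)%:~R + v ^+ 2 * (Yg M)%:~R + 2 * v * (Zg M)%:~R.
  rewrite /qM /a1 /a2 /Xg /Yg /Zg !intrD !intrM ?rmorphXn /=.
  by move: (M 0 0)%:~R (M 0 1)%:~R (M 1 0)%:~R (M 1 1)%:~R => a b c e; ring.
rewrite -qE normrM normfV (gtr0_norm (mulr_gt0 p0 q0)) -/(nM M v) -/(bM M v).
congr ((if _ then _ else _)%:E).
rewrite -[in RHS]ler_pdivrMr // [in RHS]ler_pdivlMr //; congr (_ * _ <= _).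
by rewrite /bM; field; rewrite !gt_eqF.
Qed.

(** The band estimate applies for each fixed z: tau = t/(1 + z^2) <= t < 1 <= [Zg M]. *)
Lemma Pset_frakS_scale M (lam t : R) : frakS M -> 0 < lam -> lam <= 1 -> 0 < t -> t < 1 ->
  (mu3 (Pset M (lam * t)) <= (lam ^+ 2)%:E * mu3 (Pset M t))%E.
Proof.
move=> fM l0 l1 t0 t1; have [d _ _] := fM.
apply: (@prod3_section_le _ _ _ _ _ _ R mu mu mu); rewrite ?sqr_ge0 //; try exact: measurable_Pset.
move=> z; have [z01|z01] := boolP (0 < z <= 1); last first.
  rewrite integral0_eq; first by rewrite mule_ge0 ?lee_fin ?sqr_ge0 // integral_ge0.
  by move=> v _; apply: etrans (secm_Pset _ _ _ d) _; rewrite /domM (negPf z01) !andbF.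
have [a0 b0 c0 e0 Z1] := frakS_entries fM.
have I t' : (\int[mu]_v mu (xsection (Pset M t') (v, z)) = \int[mu]_v (bandF M (t' / (1 + z ^+ 2)) v)%:E)%E.
  by apply: eq_integral => v _; exact: (secm_frakS t' v fM z01).
rewrite !I -mulrA.
have s0 := sqrD1_gt0 z.
apply: band_integral_scale => //.
- by rewrite ltr0z /Xg; move: a0 b0; move: (M 0 0) (M 0 1) => a b; clear; nia.
- by rewrite ltr0z /Yg; move: c0 e0; move: (M 1 0) (M 1 1) => a b; clear; nia.
- by rewrite ltr0z; move: Z1; move: (Zg M) => a; clear; lia.
- by rewrite -intrM XYZ // intrD rmorphXn.
- by rewrite divr_gt0.
have Z1' : 1 <= (Zg M)%:~R :> R by rewrite ler1z.
apply: lt_le_trans Z1'; rewrite ltr_pdivrMr // mul1r; apply: (lt_le_trans t1).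
by rewrite lerDl sqr_ge0.
Qed.

Lemma Ps_scale (lam t : R) : 0 < lam -> lam <= 1 -> 0 < t -> t < 1 -> Ps (lam * t) <= lam ^+ 2 * Ps t.
Proof.
move=> l0 l1 t0 t1; have lt0 : 0 < lam * t by rewrite mulr_gt0.
have h : (\esum_(M in baseS) mu3 (Pset M (lam * t)) <= (lam ^+ 2)%:E * \esum_(M in baseS) mu3 (Pset M t))%E.
  rewrite -esumZl ?sqr_ge0 //; apply: le_esum => M [fM|lM]; first exact: Pset_frakS_scale.
  have lt1 : lam * t < 1 by apply: le_lt_trans t1; rewrite ler_piMl // ltW.
  by rewrite (Pset_leftS lM lt1) measure0 mule_ge0 ?lee_fin ?sqr_ge0.
by move: h; rewrite (PsE lt0) (PsE t0) -EFinM lee_fin.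
Qed.

(** The derivative of [Fs]. By [Ps_scale] it is nondecreasing on (0, 1). *)
Definition gP t : R := Ps t / t ^+ 2.

Lemma gP_ge0 t : 0 <= gP t.
Proof. by rewrite divr_ge0 ?Ps_ge0 ?sqr_ge0. Qed.

Lemma gP_homo s t : 0 < s -> s <= t -> t < 1 -> gP s <= gP t.
Proof.
move=> s0 st t1; have t0 : 0 < t by apply: lt_le_trans st.
have l1 : s / t <= 1 by rewrite ler_pdivrMr // mul1r.
have := Ps_scale (divr_gt0 s0 t0) l1 t0 t1; rewrite divfK ?gt_eqF // => h.
rewrite /gP ler_pdivrMr ?exprn_gt0 //; apply: (le_trans h).
by rewrite le_eqVlt; apply/orP; left; apply/eqP; field; rewrite gt_eqF.
Qed.

(** A nonnegative function that is nondecreasing on (0, 1) tends at 0 to its infimum there. *)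
Lemma gP_limit0 : exists c : R, forall e, 0 < e -> exists2 dl, 0 < dl & forall t, 0 < t -> t <= dl -> `|gP t - c| <= e.
Proof.
pose E := [set gP t | t in [set t : R | 0 < t < 1]].
have E0 : has_inf E.
  split; first by exists (gP (1 / 2)); exists (1 / 2) => //=; apply/andP; split; lra.
  by exists 0 => _ [t _ <-]; exact: gP_ge0.
exists (inf E) => e e0; have [_ [t /andP[t0 t1] <-] h] := inf_adherent e0 E0.
exists t => // s s0 st; have s1 := le_lt_trans st t1.
have h1 : inf E <= gP s by apply: (ge_inf (proj2 E0)); exists s => //=; rewrite s0.
have h2 := gP_homo s0 st t1.
rewrite ger0_norm ?subr_ge0 // lerBlDr addrC; exact: le_trans h2 (ltW h).
Qed.
End PsetScaling.

(** * Continuous differentiability of the limit *)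

Section Smoothness.
Variable R : realType.
Local Open Scope classical_set_scope.
Local Open Scope ring_scope.
Implicit Types (x y t e : R).
Local Notation zc := ((2 * zeta 2)^-1 : R).

Local Opaque Fs Ps.

Lemma near_dist (t d : R) : 0 < d -> \forall s \near t, `|s - t| <= d.
Proof. by move=> d0; apply/nbhs_normP; exists d => // s /=; rewrite distrC => /ltW. Qed.

Lemma is_derive_eps (f : R -> R) x (l : R) :
  (forall e, 0 < e -> exists2 dl, 0 < dl & forall y, y != x -> `|y - x| <= dl -> `|(f y - f x) / (y - x) - l| <= e) ->
  is_derive x 1 f l.
Proof.
move=> H.
have C : h^-1 *: ((f \o shift x) (h *: 1) - f x) @[h --> 0^'] --> l.
  apply/cvgrPdist_le => e e0; have [dl dl0 Hd] := H e e0.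
  near=> h; have h0 : h != 0 by near: h; exact: nbhs_dnbhs_neq.
  rewrite distrC /GRing.scale /= mulr1 mulrC.
  have := Hd (h + x); rewrite addrK -subr_eq0 addrK; apply => //.
  by near: h; apply: dnbhs0_le.
split; first by apply/cvg_ex; exists l.
exact: cvg_lim C.
Unshelve. all: by end_near. Qed.

(** Since (y - x)/(x y) = 1/x - 1/y, [Fs_diff] places the left product between the values of [Ps] at
    x and y. *)
Lemma Fs_quotient x y : 0 < x -> 0 < y -> y != x -> `|(Fs y - Fs x) / (y - x) * (x * y) - Ps x| <= `|Ps y - Ps x|.
Proof.
move=> x0 y0 xy.
have gen (a b : R) : 0 < a -> a < b -> Ps a <= (Fs b - Fs a) / (b - a) * (a * b) <= Ps b.
  move=> a0 ab; have b0 := lt_trans a0 ab; have ba : 0 < b - a by rewrite subr_gt0.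
  have ab0 : 0 < a * b by rewrite mulr_gt0.
  have [] := Fs_diff a0 (ltW ab).
  have -> : a^-1 - b^-1 = (b - a) / (a * b) by field; rewrite !gt_eqF.
  move: (Fs a) (Fs b) (Ps a) (Ps b) => Fa Fb Pa Pb h1 h2.
  rewrite mulrAC ler_pdivlMr // ler_pdivrMr // -!(ler_pdivrMr _ _ ab0) -!(ler_pdivlMr _ _ ab0).
  apply/andP; split; [rewrite -lerBrDl in h1|rewrite -lerBlDl in h2].
    by apply: le_trans h1; rewrite le_eqVlt; apply/orP; left; apply/eqP; ring.
  by apply: (le_trans h2); rewrite le_eqVlt; apply/orP; left; apply/eqP; ring.
have [h|h|e] := ltgtP x y; last by rewrite e eqxx in xy.
  have /andP[h1 h2] := gen x y x0 h; move: h1 h2; move: (_ / _ * _) (Ps x) (Ps y) => q a b h1 h2.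
  by rewrite !ger0_norm; lra.
have /andP[] := gen y x y0 h.
have -> : (Fs x - Fs y) / (x - y) * (y * x) = (Fs y - Fs x) / (y - x) * (x * y).
  by move: (Fs x) (Fs y) => a b; rewrite -(opprB b a) -(opprB y x) invrN mulrNN (mulrC x y).
move: (_ / _ * _) (Ps x) (Ps y) => q a b h1 h2.
by rewrite !ler0_norm; lra.
Qed.

Lemma Fs_derive_eps x e : 0 < x -> 0 < e -> exists2 dl, 0 < dl < x &
  forall y, y != x -> `|y - x| <= dl -> `|(Fs y - Fs x) / (y - x) - gP x| <= e.
Proof.
move=> x0 e0; have x20 : 0 < x ^+ 2 by rewrite exprn_gt0.
have x30 : 0 < x ^+ 3 by rewrite exprn_gt0.
have P0 : 0 < Ps x + 1 by have := Ps_ge0 x; lra.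
have eta0 : 0 < e * x ^+ 2 / 4 by rewrite divr_gt0 // mulr_gt0.
have [d1 /andP[d10 d1x] H] := Ps_cont x0 eta0.
(* d2 controls the effect of replacing 1/(x y) by 1/x^2. *)
pose d2 := e * x ^+ 3 / (4 * (Ps x + 1)).
have d20 : 0 < d2 by rewrite divr_gt0 // mulr_gt0.
exists (Num.min d1 (Num.min d2 (x / 2))).
  by rewrite !lt_min d10 d20 divr_gt0 //= gt_min d1x.
move=> y yx; rewrite !le_min => /and3P[/H h1 h2 h3].
have y0 : x / 2 <= y by move: h3; rewrite ler_norml => /andP[]; lra.
have yp : 0 < y by apply: lt_le_trans y0; rewrite divr_gt0.
have xy0 : 0 < x * y by rewrite mulr_gt0.
have := Fs_quotient x0 yp yx; rewrite /gP; move: ((Fs y - Fs x) / (y - x)) => q hq.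
have hP : Ps x * d2 <= e * x ^+ 3 / 4.
  rewrite /d2 mulrA ler_pdivrMr ?mulr_gt0 //.
  have : 0 <= e * x ^+ 3 by rewrite mulr_ge0 ?ltW.
  by have := Ps_ge0 x; move: (Ps x) (e * x ^+ 3) => a b *; nra.
have k1 : `|q * (x * y) - Ps x| <= e * x ^+ 2 / 4 by apply: le_trans hq h1.
have k2 : `|q * (x * y) * x ^+ 2 - Ps x * (x * y)| <= e * x ^+ 2 * (x * y).
  rewrite (_ : _ - _ = (q * (x * y) - Ps x) * x ^+ 2 + Ps x * x * (x - y)); last by ring.
  apply: le_trans (ler_normD _ _) _.
  have -> : `|(q * (x * y) - Ps x) * x ^+ 2| = `|q * (x * y) - Ps x| * x ^+ 2 by rewrite normrM (gtr0_norm x20).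
  have -> : `|Ps x * x * (x - y)| = Ps x * x * `|y - x|.
    by rewrite normrM distrC [ `|_ * x|]ger0_norm // mulr_ge0 ?Ps_ge0 // ltW.
  have l1 := ler_wpM2r (ltW x20) k1.
  have l2 : Ps x * x * `|y - x| <= x * (e * x ^+ 3 / 4).
    apply: (@le_trans _ _ (Ps x * x * d2)); first by rewrite ler_wpM2l // mulr_ge0 ?Ps_ge0 // ltW.
    by rewrite mulrAC mulrC ler_wpM2l // ltW.
  apply: (le_trans (lerD l1 l2)).
  have : e * x ^+ 2 * (x * (x / 2)) <= e * x ^+ 2 * (x * y).
    by rewrite ler_pM2l ?mulr_gt0 // ler_pM2l.
  by apply: le_trans; rewrite le_eqVlt; apply/orP; left; apply/eqP; field.
rewrite (_ : q - _ = (q * (x * y) * x ^+ 2 - Ps x * (x * y)) / (x ^+ 2 * (x * y))); last first.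
  by field; rewrite !gt_eqF.
have D0 : 0 < x ^+ 2 * (x * y) by rewrite mulr_gt0.
by rewrite normrM normfV (gtr0_norm D0) ler_pdivrMr // [leRHS]mulrA.
Qed.

Lemma is_derive_Fs x : 0 < x -> is_derive x 1 (@Fs R) (gP x).
Proof.
move=> x0; apply: is_derive_eps => e e0; have [dl /andP[dl0 _] H] := Fs_derive_eps x0 e0.
by exists dl.
Qed.

Lemma gP_cont t e : 0 < t -> 0 < e -> exists2 dl, 0 < dl < t & forall s : R, `|s - t| <= dl -> `|gP s - gP t| <= e.
Proof.
move=> t0 e0.
have C : Ps s @[s --> t] --> Ps t.
  apply/cvgrPdist_le => e1 e10; have [dl /andP[dl0 _] H] := Ps_cont t0 e10.
  near=> s; rewrite distrC; apply: H; near: s; exact: near_dist.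
have : gP s @[s --> t] --> gP t.
  apply: cvgM => //; apply: cvgV; first by rewrite gt_eqF // exprn_gt0.
  exact: exprn_continuous.
move=> /cvgrPdist_le/(_ e e0)/nbhs_normP[d /= d0 Hd].
exists (Num.min (d / 2) (t / 2)); first by rewrite lt_min !divr_gt0 //= gt_min; apply/orP; right; lra.
move=> s; rewrite le_min => /andP[h1 h2]; rewrite distrC; apply: Hd => /=.
by rewrite distrC; apply: le_lt_trans h1 _; lra.
Unshelve. all: by end_near. Qed.

(** The mean value theorem on [x, y] compares the increment with c (y - x); then x tends to 0, where
    [Fs] vanishes in the limit. *)
Lemma Fs_derive0 (c : R) e : (forall e, 0 < e -> exists2 dl, 0 < dl & forall t, 0 < t -> t <= dl -> `|gP t - c| <= e) ->
  0 < e -> exists2 dl, 0 < dl & forall y, 0 < y -> y <= dl -> `|Fs y / y - c| <= e.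
Proof.
move=> H e0; have [dl dl0 Hd] := H e e0; exists dl => // y y0 yd.
have key x : 0 < x -> x < y -> `|Fs y - Fs x - c * (y - x)| <= e * (y - x).
  move=> x0 xy; have [||z] := @MVT_segment R (@Fs R) (@gP R) x y (ltW xy).
  - by move=> z; rewrite in_itv /= => /andP[z1 _]; apply: is_derive_Fs; exact: lt_trans z1.
  - apply: derivable_within_continuous => z; rewrite in_itv /= => /andP[z1 _].
    apply: (@ex_derive _ _ _ _ _ _ _ (is_derive_Fs _)); exact: lt_le_trans z1.
  rewrite in_itv /= => /andP[z1 z2] ->; rewrite -mulrBl normrM [ `|y - x|]gtr0_norm ?subr_gt0 //.
  rewrite ler_wpM2r ?subr_ge0 ?(ltW xy) //; apply: Hd; first exact: lt_le_trans z1.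
  exact: le_trans z2 yd.
rewrite (_ : _ - c = (Fs y - c * y) / y); last by field; rewrite gt_eqF.
rewrite normrM normfV [ `|y|]gtr0_norm // ler_pdivrMr //.
apply/ler_addgt0Pr => k k0.
have c1 : 0 < `|c| + 1 by rewrite ltr_wpDl.
have [d1 d10 H1] := Fs_small (divr_gt0 k0 (ltr0n R 2)).
(* x is so small that both [Fs x] and |c| x are at most k / 2. *)
pose x := Num.min (y / 2) (Num.min d1 (k / (2 * (`|c| + 1)))).
have x0 : 0 < x by rewrite !lt_min !divr_gt0 ?d10 // mulr_gt0.
have xy : x < y by rewrite gt_min; apply/orP; left; lra.
have xd : x <= d1 by rewrite !ge_min lexx orbT.
have xk : `|c| * x <= k / 2.
  have : x <= k / (2 * (`|c| + 1)) by rewrite !ge_min lexx !orbT.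
  rewrite ler_pdivlMr ?mulr_gt0 // => h.
  by rewrite ler_pdivlMr //; have := normr_ge0 c; nra.
have h1 := key x x0 xy; have h2 := H1 x x0 xd; have h3 := @Fs_ge0 R x.
have h4 : `|c * x| <= k / 2 by rewrite normrM (gtr0_norm x0).
have h5 : 0 <= e * x by rewrite mulr_ge0 // ltW.
clearbody x; move: (Fs y) (Fs x) h1 h2 h3 => a b h1 h2 h3.
rewrite (_ : a - c * y = (a - b - c * (y - x)) + (b - c * x)); last by ring.
apply: le_trans (ler_normD _ _) _.
have h6 : `|b - c * x| <= k / 2 + k / 2.
  by apply: le_trans (ler_normB _ _) _; rewrite lerD // ger0_norm.
by have := lerD h1 h6; move: (`|_| + `|_|) => w; rewrite mulrBr; lra.
Qed.

Definition F0 x : R := if 0 < x then Fs x else 0.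

Lemma F0_C1 : exists g : R -> R,
  (forall x e, 0 <= x -> 0 < e -> exists2 dl, 0 < dl & forall y, 0 <= y -> y != x -> `|y - x| <= dl ->
     `|(F0 y - F0 x) / (y - x) - g x| <= e) /\
  (forall x e, 0 <= x -> 0 < e -> exists2 dl, 0 < dl & forall y, 0 <= y -> `|y - x| <= dl -> `|g y - g x| <= e).
Proof.
have [c Hc] := gP_limit0 R.
exists (fun x => if 0 < x then gP x else c); split => x e x0 e0; have [xp|xn] := ltP 0 x.
- have [dl /andP[dl0 dlx] H] := Fs_derive_eps xp e0; exists dl => // y _ yx h.
  have yp : 0 < y by move: h; rewrite ler_norml => /andP[]; lra.
  by rewrite /F0 xp yp; exact: H.
- have [dl dl0 H] := Fs_derive0 Hc e0; exists dl => // y y0 yx.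
  have -> : x = 0 by apply/eqP; rewrite eq_le xn x0.
  rewrite /F0 ltxx !subr0 => h; have yp : 0 < y by rewrite lt_def y0 andbT; move: yx; have -> : x = 0 by apply/eqP; rewrite eq_le xn x0.
  by rewrite yp; apply: H => //; move: h; rewrite ger0_norm.
- have [dl /andP[dl0 dlx] H] := gP_cont xp e0; exists dl => // y _ h.
  have yp : 0 < y by move: h; rewrite ler_norml => /andP[]; lra.
  by rewrite yp; exact: H.
have [dl dl0 H] := Hc e e0; exists dl => // y y0.
have -> : x = 0 by apply/eqP; rewrite eq_le xn x0.
rewrite subr0 ger0_norm // => h; have [yp|yn] := ltP 0 y; first exact: H.
by rewrite subrr normr0 ltW.
Qed.

Lemma R2_F0 x : R2 x = 8 / 3 * (zc * F0 (8 / 3 * x)).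
Proof.
rewrite /R2 /F0 pmulr_rgt0 ?divr_gt0 //; case: ifP => // _.
by rewrite !mulr0.
Qed.

Lemma R2_C1 : C1_on [set xi : R | 0 <= xi] (@R2 R).
Proof.
have [g [D C]] := F0_C1; pose k : R := 8 / 3.
have k0 : 0 < k by rewrite divr_gt0.
have z0 := zc_gt0 R; have kz : 0 < k ^+ 2 * zc by rewrite mulr_gt0 // exprn_gt0.
exists (fun x => k ^+ 2 * zc * g (k * x)); split.
  move=> x /= x0; apply/cvgrPdist_le => e e0.
  have [dl dl0 H] := D (k * x) (e / (k ^+ 2 * zc)) (mulr_ge0 (ltW k0) x0) (divr_gt0 e0 kz).
  have dk : 0 < dl / k by rewrite divr_gt0.
  rewrite near_withinE /dnbhs near_withinE; apply: filterS (near_dist x dk) => y yd yx y0.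
  rewrite distrC !R2_F0 -/k.
  have kyx : k * y != k * x by rewrite (inj_eq (mulfI _)) // gt_eqF.
  have kd : `|k * y - k * x| <= dl by rewrite -mulrBr normrM gtr0_norm // mulrC -ler_pdivlMr.
  have := H (k * y) (mulr_ge0 (ltW k0) y0) kyx kd.
  rewrite ler_pdivlMr // -[X in _ * X](gtr0_norm kz) -normrM.
  congr (`|_| <= _); move: (F0 (k * y)) (F0 (k * x)) (g (k * x)) zc => a b c z.
  by rewrite -mulrBr; field; rewrite subr_eq0 yx gt_eqF.
apply/subspace_continuousP => x /= x0; apply/cvgrPdist_le => e e0.
have [dl dl0 H] := C (k * x) (e / (k ^+ 2 * zc)) (mulr_ge0 (ltW k0) x0) (divr_gt0 e0 kz).
have dk : 0 < dl / k by rewrite divr_gt0.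
rewrite near_withinE; apply: filterS (near_dist x dk) => y yd y0.
have kd : `|k * y - k * x| <= dl by rewrite -mulrBr normrM gtr0_norm // mulrC -ler_pdivlMr.
have := H (k * y) (mulr_ge0 (ltW k0) y0) kd.
by rewrite distrC -mulrBr normrM (gtr0_norm kz) ler_pdivlMr // mulrC.
Qed.
End Smoothness.

(** * The volumes of the regions S and T *)

Section Dilation.
Variable R : realType.
Local Open Scope classical_set_scope.
Local Open Scope ring_scope.
Local Notation mu := (@lebesgue_measure R).
Local Notation RL := (measurableTypeR R).
Variables (c : R) (c0 : 0 < c).

Let phi (y : RL) : RL := y / c.

Let mphi : measurable_fun setT phi.
Proof. by apply: continuous_measurable_fun => x; apply: cvgM; [exact: cvg_id|exact: cvg_cst]. Qed.

Let ci0 : 0 <= c^-1. Proof. by rewrite invr_ge0 ltW. Qed.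

(** The measure of c A divided by c agrees with Lebesgue measure on intervals, hence on all
    measurable sets. *)
Lemma lebesgue_measure_dilation (A : set RL) : measurable A -> mu (phi @^-1` A) = (c%:E * mu A)%E.
Proof.
move=> mA; pose nu : {measure set RL -> \bar R} := mscale (NngNum ci0) (pushforward mu phi).
have -> : mu A = nu mphi A.
  apply: lebesgue_measure_unique => // _ [[a b] _ <-] /=.
  rewrite /nu /mscale /= -[pushforward mu phi _]/(mu (phi @^-1` `]a, b]%classic)).
  have -> : phi @^-1` `]a, b]%classic = `](a * c), (b * c)]%classic.
    by apply/seteqP; split => x; rewrite /= /phi !in_itv /= ltr_pdivlMr // ler_pdivrMr.
  rewrite !lebesgue_measure_itv /= !lte_fin ltr_pM2r //; case: ifP => _; last by rewrite mule0.
  by rewrite -!EFinB -EFinM -mulrBl mulrC mulfK // gt_eqF.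
by rewrite /nu /mscale /pushforward /= muleA -EFinM divff ?gt_eqF // mul1e.
Qed.

Lemma ge0_integral_dilation (f : RL -> \bar R) : measurable_fun setT f -> (forall y, 0 <= f y)%E ->
  (\int[mu]_y f (y / c)%R = c%:E * \int[mu]_v f v)%E.
Proof.
move=> mf f0; pose c' : {nonneg R} := NngNum (ltW c0).
transitivity (\int[pushforward mu phi]_y f y)%E.
  by rewrite ge0_integral_pushforward.
transitivity (\int[mscale c' mu]_y f y)%E; last by rewrite ge0_integral_mscale.
apply: (@eq_measure_integral _ _ _ setT (mscale c' mu) (pushforward mu phi)) => A mA _.
exact: lebesgue_measure_dilation.
Qed.
End Dilation.

Section MeasurableFunctions3.
Variable R : realType.
Local Open Scope classical_set_scope.
Local Open Scope ring_scope.
Local Notation RL := (measurableTypeR R).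
Local Notation meas3 := (@measurable _ (RL * RL * RL)%type).

Definition mfun3 (f : R * R * R -> R) : Prop :=
  measurable_fun (setT : set (RL * RL * RL)%type) (f : (RL * RL * RL)%type -> RL).

Lemma mfun3_cst (k : R) : mfun3 (fun=> k).
Proof. exact: measurable_cst. Qed.

Lemma mfun3_x : mfun3 (fun p => p.1.1).
Proof. by apply: (measurableT_comp measurable_fst); exact: measurable_fst. Qed.

Lemma mfun3_y : mfun3 (fun p => p.1.2).
Proof. by apply: (measurableT_comp measurable_snd); exact: measurable_fst. Qed.

Lemma mfun3_z : mfun3 (fun p => p.2).
Proof. exact: measurable_snd. Qed.

Lemma mfun3D f g : mfun3 f -> mfun3 g -> mfun3 (fun p => f p + g p).
Proof. exact: measurable_funD. Qed.

Lemma mfun3B f g : mfun3 f -> mfun3 g -> mfun3 (fun p => f p - g p).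
Proof. exact: measurable_funB. Qed.

Lemma mfun3M f g : mfun3 f -> mfun3 g -> mfun3 (fun p => f p * g p).
Proof. exact: measurable_funM. Qed.

Lemma mfun3X f k : mfun3 f -> mfun3 (fun p => f p ^+ k).
Proof. exact: measurable_funX. Qed.

Lemma mfun3_comp (h : R -> R) f : measurable_fun (setT : set RL) (h : RL -> RL) -> mfun3 f -> mfun3 (fun p => h (f p)).
Proof. by move=> mh mf; exact: (measurableT_comp mh mf). Qed.

Lemma mfun3A f : mfun3 f -> mfun3 (fun p => `|f p|).
Proof. by apply: mfun3_comp; exact: normr_measurable. Qed.

Lemma measurable_invr : measurable_fun (setT : set RL) (fun x : RL => x^-1 : RL).
Proof.
have mo : @measurable _ RL [set x : R | x != 0].
  rewrite (_ : [set x : R | x != 0] = ~` [set 0]); first by apply: measurableC; exact: measurable_set1.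
  by apply/seteqP; split => x /=; [move/eqP|move/eqP].
have -> : (fun x : RL => x^-1 : RL) = (fun x => if x != 0 then x^-1 else 0).
  by apply/funext => x; case: eqVneq => // ->; rewrite invr0.
apply: measurable_fun_if => //.
- apply: (measurable_fun_bool true); rewrite setTI; exact: mo.
- rewrite setTI; apply: (@subspace_continuous_measurable_fun R [set x : R | x != 0]) => //.
  by apply: continuous_in_subspaceT => x /set_mem /= x0; exact: inv_continuous.
Qed.

Lemma mfun3V f : mfun3 f -> mfun3 (fun p => (f p)^-1).
Proof. by apply: mfun3_comp; exact: measurable_invr. Qed.

Lemma mfun3_floor f : mfun3 f -> mfun3 (fun p => (Num.floor (f p))%:~R).
Proof.
apply: (mfun3_comp (h := fun x => (Num.floor x)%:~R)); apply: nondecreasing_measurable => // x y xy.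
by rewrite ler_int; exact: le_floor.
Qed.

Lemma mset3_le f g : mfun3 f -> mfun3 g -> meas3 [set p | f p <= g p].
Proof.
move=> mf mg; have m := measurable_fun_ler mf mg.
by rewrite -[X in meas3 X]setTI; exact: (m measurableT [set true]).
Qed.

Lemma mset3_lt f g : mfun3 f -> mfun3 g -> meas3 [set p | f p < g p].
Proof.
move=> mf mg; have m := measurable_fun_ltr mf mg.
by rewrite -[X in meas3 X]setTI; exact: (m measurableT [set true]).
Qed.

Lemma mfun3_quadM M : mfun3 (fun p => quadM M p.1.1 p.1.2).
Proof.
have x := mfun3_x; have y := mfun3_y; have k := mfun3_cst.
by apply: mfun3D; [apply: mfun3D; apply: mfun3M => //; exact: mfun3X|
  apply: mfun3M => //; apply: mfun3M => //; exact: mfun3M].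
Qed.

Lemma mfun3_XiM M : mfun3 (fun p => XiM M p.1.1 p.1.2).
Proof.
have x := mfun3_x; have y := mfun3_y; have k := mfun3_cst.
apply: mfun3M.
  apply: mfun3D; first by apply: mfun3M => //; exact: mfun3M.
  by apply: mfun3M => //; apply: mfun3B; exact: mfun3X.
by apply: mfun3V; apply: mfun3M; [apply: mfun3D; exact: mfun3X|exact: mfun3_quadM].
Qed.

Lemma mfun3_height : mfun3 (fun p => 1 / (1 + p.2 ^+ 2)).
Proof.
have z := mfun3_z; have k := mfun3_cst.
by apply: mfun3M => //; apply: mfun3V; apply: mfun3D => //; exact: mfun3X.
Qed.
End MeasurableFunctions3.

Section FubiniProduct.
Local Open Scope classical_set_scope.
Local Open Scope ring_scope.
Local Open Scope ereal_scope.
Context d1 d2 d3 (T1 : measurableType d1) (T2 : measurableType d2) (T3 : measurableType d3) (R : realType).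
Variables (m1 : {sigma_finite_measure set T1 -> \bar R}) (m2 : {sigma_finite_measure set T2 -> \bar R})
  (m3 : {sigma_finite_measure set T3 -> \bar R}).

Lemma fubini_tonelli_prod (f : T1 * (T2 * T3) -> \bar R) : measurable_fun setT f -> (forall q, 0 <= f q) ->
  \int[m1]_x \int[m2 \x m3]_p f (x, p) = \int[m2 \x m3]_p \int[m1]_x f (x, p).
Proof.
move=> mf f0.
have mf3 : measurable_fun setT (fun q : T1 * T2 * T3 => f (q.1.1, (q.1.2, q.2))).
  apply: (measurableT_comp mf); apply: measurable_fun_pair.
    by apply: (measurableT_comp measurable_fst); exact: measurable_fst.
  apply: measurable_fun_pair; last exact: measurable_snd.
  by apply: (measurableT_comp measurable_snd); exact: measurable_fst.
transitivity (\int[m1]_x \int[m2]_v \int[m3]_z f (x, (v, z))).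
  apply: eq_integral => x _; rewrite (@fubini_tonelli1 _ _ T2 T3 R m2 m3 (fun p => f (x, p))) //.
  exact: measurable_fun_pair2.
rewrite (@fubini_tonelli _ _ T1 T2 R m1 m2 (fun q => \int[m3]_z f (q.1, (q.2, z)))); last 2 first.
- exact: (measurable_fun_fubini_tonelli_F (m2 := m3) _ mf3).
- by move=> q; exact: integral_ge0.
rewrite [RHS](@fubini_tonelli1 _ _ T2 T3 R m2 m3 (fun p => \int[m1]_x f (x, p))); last 2 first.
- exact: (measurable_fun_fubini_tonelli_G (m1 := m1) _ mf).
- by move=> q; exact: integral_ge0.
apply: eq_integral => v _; rewrite /fubini_F (@fubini_tonelli _ _ T1 T3 R m1 m3 (fun r => f (r.1, (v, r.2)))) //.
apply: (measurableT_comp mf); apply: measurable_fun_pair; first exact: measurable_fst.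
by apply: measurable_fun_pair; [exact: measurable_cst|exact: measurable_snd].
Qed.
End FubiniProduct.

Section SquareChange.
Variable R : realType.
Local Open Scope classical_set_scope.
Local Open Scope ring_scope.
Implicit Types (M : 'M[int]_2) (v z w xi : R).
Local Notation mu := (@lebesgue_measure R).
Local Notation RL := (measurableTypeR R).
Local Notation meas3 := (@measurable _ (RL * RL * RL)%type).
Local Notation mu3 := (@mu3 R).

(* WM M xi in the homogeneous coordinates (x, y, z), with v = y / x and w = x^2. *)
Definition W3 M xi : set (R * R * R) := [set p | let: (x, y, z) := p in
  [/\ 0 < x, 0 < y & 0 < z <= 1] /\
  [/\ 0 < x * (M 0 0)%:~R + y * (M 1 0)%:~R, 0 < x * (M 0 1)%:~R + y * (M 1 1)%:~R,
      `|XiM M x y| <= xi, x ^+ 2 + y ^+ 2 <= 1 / (1 + z ^+ 2) & quadM M x y <= 1 / (1 + z ^+ 2)]].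

Lemma W3_WM M xi x y z : \det M = 1 -> W3 M xi (x, y, z) <-> 0 < x /\ WM M xi (y / x, z, x ^+ 2).
Proof.
move=> d; have [x0|x0] := ltP 0 x; last first.
  by split => [[[h _ _] _]|[h _]] //; move: (lt_le_trans h x0); rewrite ltxx.
have x2 : 0 < x ^+ 2 by rewrite exprn_gt0.
have z1 := sqrD1_gt0 z.
have yE : y = x * (y / x) by rewrite mulrC divfK // gt_eqF.
rewrite /W3 /WM /hg /hh /= {1 2 3 4 5 6}yE; set v := y / x.
have e1 : x * (M 0 0)%:~R + x * v * (M 1 0)%:~R = x * a1 M v by rewrite /a1; ring.
have e2 : x * (M 0 1)%:~R + x * v * (M 1 1)%:~R = x * a2 M v by rewrite /a2; ring.
have e3 : quadM M x (x * v) = x ^+ 2 * qM M v by rewrite quadME e1 e2 /qM; ring.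
have e4 : x ^+ 2 + (x * v) ^+ 2 = x ^+ 2 * (1 + v ^+ 2) by ring.
rewrite x2 e1 e2 e3 e4 XiM_bM // !(pmulr_rgt0 _ x0) !ler_pdivlMr // ler_pdivrMr //; split.
  by move=> [[_ v0 zz] [A1 A2 B H1 H2]].
by move=> [_ [[v0 zz _] [A1 A2 B H1 H2]]].
Qed.
Lemma measurable_W3 M xi : meas3 (W3 M xi).
Proof.
have x := @mfun3_x R; have y := @mfun3_y R; have z := @mfun3_z R; have k := @mfun3_cst R.
have lin (a b : R) : mfun3 (fun p => p.1.1 * a + p.1.2 * b) by apply: mfun3D; exact: mfun3M.
pose A1 := [set p : R * R * R | 0 < p.1.1] `&` [set p | 0 < p.1.2] `&` [set p | 0 < p.2] `&` [set p | p.2 <= 1].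
pose A2 := [set p : R * R * R | 0 < p.1.1 * (M 0 0)%:~R + p.1.2 * (M 1 0)%:~R] `&`
  [set p | 0 < p.1.1 * (M 0 1)%:~R + p.1.2 * (M 1 1)%:~R] `&` [set p | `|XiM M p.1.1 p.1.2| <= xi] `&`
  [set p | p.1.1 ^+ 2 + p.1.2 ^+ 2 <= 1 / (1 + p.2 ^+ 2)] `&` [set p | quadM M p.1.1 p.1.2 <= 1 / (1 + p.2 ^+ 2)].
rewrite (_ : W3 M xi = A1 `&` A2); last first.
  apply/seteqP; split => -[[a b] c] /=.
    by move=> [[? ? /andP[? ?]] [? ? ? ? ?]].
  by move=> [[[[? ?] ?] ?] [[[[? ?] ?] ?] ?]]; split; split => //; apply/andP.
have h := @mfun3_height R.
by apply: measurableI; [do 3?apply: measurableI|do 4?apply: measurableI]; try exact: mset3_lt; apply: mset3_le => //;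
  [apply: mfun3A; exact: mfun3_XiM|apply: mfun3D; exact: mfun3X|exact: mfun3_quadM].
Qed.

(** The density x on the points (x, v, z) with (v, z, x^2) in [WM M xi]. Integrating out v and z
    gives the area of the slice of [W3] at x, by y = x v; integrating out x gives half the length of
    the section of [WM] in w. *)
Let kint M xi : R * (R * R) -> \bar R := fun q =>
  if `[< 0 < q.1 /\ WM M xi (q.2, q.1 ^+ 2) >] then q.1%:E else 0%E.

(** The integral of x over [sqrt a, sqrt c] is (c - a)/2. *)
Lemma integral_lenW M xi v z : \det M = 1 -> 0 < xi ->
  (\int[mu]_x kint M xi (x, (v, z)) = (2^-1)%:E * (lenW M xi v z)%:E)%E.
Proof.
move=> d x0; rewrite /lenW; case: ifP => dm; last first.
  rewrite mule0 integral0_eq // => x _; rewrite /kint; case: asboolP => // -[_ /WM_itv[]].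
  by rewrite dm.
have m0 : 0 < mM M v * (1 + z ^+ 2) by rewrite mulr_gt0 ?mM_gt0 ?sqrD1_gt0.
have b0 := bM_ge0 v d; set c := (mM M v * (1 + z ^+ 2))^-1; set a := bM M v / xi.
have a0 : 0 <= a by rewrite divr_ge0 // ltW.
have c0 : 0 < c by rewrite invr_gt0.
have kE x : 0 < x -> (0 < x /\ WM M xi ((v, z), x ^+ 2)) <-> Num.sqrt a <= x <= Num.sqrt c.
  move=> xp; have x2 : 0 < x ^+ 2 by rewrite exprn_gt0.
  have xs : Num.sqrt (x ^+ 2) = x by rewrite sqrtr_sqr gtr0_norm.
  have -> : (Num.sqrt a <= x <= Num.sqrt c) = (a <= x ^+ 2 <= c).
    by rewrite -{1 2}xs !ler_sqrt // ltW.
  rewrite WM_itv dm; split.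
    move=> [_ [_ [_ B H]]]; apply/andP; split; first by rewrite ler_pdivrMr // mulrC.
    by rewrite /c -[_^-1]mul1r ler_pdivlMr.
  move=> /andP[B H]; split => //; split => //; split => //; first by rewrite mulrC -ler_pdivrMr.
  by rewrite -ler_pdivlMr // mul1r.
have -> : (fun x => kint M xi (x, (v, z))) = (fun x => x%:E) \_ `[Num.sqrt a, Num.sqrt c].
  apply/funext => x; rewrite patchE mem_setE in_itv /= /kint /=.
  have [xp|xn] := ltP 0 x; last first.
    case: asboolP => [[]//|_].
    case: ifP => // /andP[h _]; have : 0 <= x by apply: le_trans h; exact: sqrtr_ge0.
    by move=> xp; congr (_%:E); apply/eqP; rewrite eq_le xn xp.
  case: asboolP => [[_ h]|h]; first by rewrite (proj1 (kE x xp)).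
  by case: ifP => // /(proj2 (kE x xp))[_ h']; case: h.
rewrite -integral_mkcond; have [ac|ca] := ltP a c; last first.
  rewrite max_l ?subr_le0 // mule0.
  have [e|ne] := eqVneq (Num.sqrt a) (Num.sqrt c); first by rewrite e set_itv1 integral_set1.
  rewrite set_itv_ge ?integral_set0 // bnd_simp -ltNge lt_neqAle eq_sym ne /=.
  by rewrite ler_sqrt.
rewrite max_r ?subr_ge0 ?(ltW ac) //.
have sac : Num.sqrt a < Num.sqrt c by rewrite ltr_sqrt.
have D (x : R) : is_derive x (1 : R) (fun x : R => 2^-1 * x ^+ 2) x.
  apply: is_derive_eq (is_deriveM (is_derive_cst (2^-1 : R) x (1 : R)) (@is_deriveX R R id 2 x 1 _ (is_derive_id x (1 : R)))) _.
  by rewrite /GRing.scale /=; field.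
have C : continuous (fun x : R => 2^-1 * x ^+ 2).
  by move=> x; apply: cvgM; [exact: cvg_cst|exact: exprn_continuous].
rewrite (@continuous_FTC2 R (fun x => x) (fun x : R => 2^-1 * x ^+ 2)) //.
- by rewrite !sqr_sqrtr ?(ltW c0) // -EFinB -EFinM mulrBr.
- by apply: continuous_in_subspaceT => x _; exact: cvg_id.
- split; first by move=> x _; exact: (@ex_derive _ _ _ _ _ _ _ (D x)).
    by apply: cvg_at_right_filter; exact: C.
  by apply: cvg_at_left_filter; exact: C.
by move=> x _; rewrite derive1E (@derive_val _ _ _ _ _ _ _ (D x)).
Qed.
Lemma measurable_kint M xi : \det M = 1 ->
  measurable_fun (setT : set (RL * (RL * RL))%type) (kint M xi : (RL * (RL * RL))%type -> \bar R).
Proof.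
move=> d; have mW := measurable_WM xi d.
pose K : set (RL * (RL * RL)) := [set q | 0 < q.1 /\ WM M xi (q.2, q.1 ^+ 2)].
have mK : measurable K.
  rewrite (_ : K = (fst @^-1` `]0, +oo[%classic) `&` ((fun q => (q.2, q.1 ^+ 2)) @^-1` WM M xi)); last first.
    by apply/seteqP; split => q; rewrite /= /K /= in_itv /= andbT.
  apply: measurableI; rewrite -[X in measurable X]setTI.
    by apply: measurable_fst => //; exact: measurable_itv.
  have mf : measurable_fun (setT : set (RL * (RL * RL))%type)
      (fun q => (q.2, (q.1 : RL) ^+ 2 : RL) : (RL * RL * RL)%type).
    by apply: measurable_fun_pair; [exact: measurable_snd|apply: measurable_funX; exact: measurable_fst].
  exact: mf.
rewrite (_ : kint M xi = (fun q : (RL * (RL * RL))%type => (q.1 : R)%:E) \_ K).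
  apply/(measurable_restrictT _ _).1 => //; apply: measurable_funTS; apply/measurable_EFinP; exact: measurable_fst.
apply/funext => q; rewrite patchE /kint; case: asboolP => h; first by rewrite (mem_set (h : K q)).
by rewrite memNset.
Qed.

(** For fixed x the substitution y = x v brings in a factor x, and x dx = dw / 2 for w = x^2. *)
Lemma mu3_W3 M xi : \det M = 1 -> 0 < xi -> mu3 (W3 M xi) = ((2^-1)%:E * mu3 (WM M xi))%E.
Proof.
move=> d x0; have mW := measurable_WM xi d; have mW3 := measurable_W3 M xi.
have mY x : measurable (ysection (WM M xi) (x ^+ 2) : set (RL * RL)%type) by exact: measurable_ysection.
have kge0 q : (0 <= kint M xi q)%E.
  by rewrite /kint; case: asboolP => // -[q0 _]; rewrite lee_fin ltW.
transitivity (\int[mu]_x \int[(mu \x mu)%E]_p kint M xi (x, p))%E.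
  rewrite -[LHS]/(\int[(mu \x mu)%E]_p (mu \o xsection (W3 M xi)) p)%E.
  rewrite (@fubini_tonelli1 _ _ _ _ _ mu mu (mu \o xsection (W3 M xi))); last first.
  - by move=> p; exact: measure_ge0.
  - exact: measurable_fun_xsection.
  apply: eq_integral => x _; rewrite /fubini_F; have [xp|xn] := ltP 0 x; last first.
    rewrite integral0_eq; last first.
      move=> y _ /=; rewrite (_ : xsection _ _ = set0) ?measure0 //; apply/seteqP; split => // z /set_mem.
      by move=> [[h _ _] _]; move: (lt_le_trans h xn); rewrite ltxx.
    rewrite integral0_eq // => p _; rewrite /kint; case: asboolP => // -[/= h _].
    by move: (lt_le_trans h xn); rewrite ltxx.
  pose f (v : RL) : \bar R := mu (xsection (ysection (WM M xi) (x ^+ 2) : set (RL * RL)%type) v).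
  pose sc (y : RL) : RL := y / x.
  transitivity (\int[mu]_y f (sc y))%E.
    apply: eq_integral => y _ /=; congr (mu _); apply/seteqP; split => z /set_mem h; apply/mem_set.
      by apply/mem_set; have [_ h'] := (W3_WM xi x y z d).1 h.
    by apply/(W3_WM xi x y z d); split => //; move: h => /set_mem.
  rewrite (@ge0_integral_dilation R x xp f); last first.
  - by move=> y; exact: measure_ge0.
  - exact: measurable_fun_xsection.
  rewrite -[(\int[mu]_v f v)%E]/((mu \x mu)%E (ysection (WM M xi) (x ^+ 2) : set (RL * RL)%type)).
  rewrite -[X in (_ * (_ \x _)%E X)%E]setTI setIC -integral_indic // -ge0_integralZl //; first last.
  - by rewrite lee_fin ltW.
  - by apply/measurable_EFinP; exact: measurable_indic.
  apply: eq_integral => p _; rewrite /kint indicE /=.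
  case: asboolP => [[_ h]|h]; first by rewrite mem_set ?mule1 //; apply/mem_set.
  by rewrite memNset ?mule0 // => /set_mem h'; apply: h.
transitivity (\int[(mu \x mu)%E]_p \int[mu]_x kint M xi (x, p))%E.
  exact: (@fubini_tonelli_prod _ _ _ RL RL RL R mu mu mu (kint M xi) (measurable_kint xi d) kge0).
rewrite -[mu3 (WM M xi)]/(\int[(mu \x mu)%E]_p (mu \o xsection (WM M xi)) p)%E.
rewrite -ge0_integralZl //; last exact: measurable_fun_xsection.
apply: eq_integral => -[v z] _; rewrite integral_lenW //; congr (_ * _)%E.
by rewrite -secm_WM.
Qed.
End SquareChange.

(** * Digit expansions of connecting matrices *)

Section Digits.
Variable R : realType.
Local Open Scope classical_set_scope.
Local Open Scope ring_scope.
Implicit Types (M N : 'M[int]_2) (p : R * R) (xi : R) (l K : nat).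

(* Right multiplication by stepM k sends the row (x, y) to (y, k y - x), as Tmap does for k = floor ((1 + x) / y). *)
Definition stepM (k : int) : 'M[int]_2 :=
  \matrix_(i, j) (if i == 0 then (if j == 0 then 0 else -1) else (if j == 0 then 1 else k)).

Lemma stepM_mul k N : [/\ (stepM k *m N) 0 0 = - N 1 0, (stepM k *m N) 0 1 = - N 1 1,
  (stepM k *m N) 1 0 = N 0 0 + k * N 1 0 & (stepM k *m N) 1 1 = N 0 1 + k * N 1 1].
Proof. by rewrite !mul2E !mxE /= !mul0r !add0r !mulN1r !mul1r. Qed.

Lemma det_stepM k : \det (stepM k) = 1.
Proof. by rewrite det2E !mxE /= mul0r sub0r mulN1r opprK. Qed.

(** All digits but the last are forced by the point p; only their number l and the last digit K are
    free. *)
Fixpoint Mdig l K p : 'M[int]_2 :=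
  if l is l'.+1 then stepM (Num.floor ((1 + p.1) / p.2)) *m Mdig l' K (Tmap p) else stepM K.

Definition unit_sq p := (0 < p.1 <= 1) /\ (0 < p.2 <= 1).
Definition actx M p : R := p.1 * (M 0 0)%:~R + p.2 * (M 1 0)%:~R.
Definition acty M p : R := p.1 * (M 0 1)%:~R + p.2 * (M 1 1)%:~R.

Lemma Tmap_sq p : unit_sq p -> unit_sq (Tmap p) /\ 1 < (Tmap p).1 + (Tmap p).2.
Proof.
case: p => x y [/= /andP[x0 x1] /andP[y0 y1]]; rewrite /Tmap /unit_sq /=.
have := floor_le ((1 + x) / y); have := floorD1_gt ((1 + x) / y).
move: (Num.floor _) => k; rewrite intrD ltr_pdivrMr // ler_pdivlMr // => h1 h2.
by rewrite y0 y1; split; [split => //; apply/andP; split; lra|lra].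
Qed.

Lemma iter_sq i p : unit_sq p -> unit_sq (iter i (@Tmap R) p).
Proof. by move=> h; elim: i => //= i IH; have [] := Tmap_sq IH. Qed.

Lemma act_step k N p : actx (stepM k *m N) p = actx N (p.2, k%:~R * p.2 - p.1) /\
  acty (stepM k *m N) p = acty N (p.2, k%:~R * p.2 - p.1).
Proof.
have [e1 e2 e3 e4] := stepM_mul k N.
by rewrite /actx /acty e1 e2 e3 e4 /= !intrD !intrM !mulrNz; split; ring.
Qed.

Lemma L_S i p : L i.+1 p = L i (Tmap p).
Proof. by rewrite /L iterSr. Qed.

Lemma Lpred_S i p : Lpred i.+1 p = Lpred i (Tmap p).
Proof. by rewrite /Lpred iterSr. Qed.

Lemma L_itv i p : unit_sq p -> 0 < L i p <= 1.
Proof. by move=> /(iter_sq i)[]. Qed.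

Lemma Lpred_itv i p : unit_sq p -> 0 < Lpred i p <= 1.
Proof. by move=> /(iter_sq i)[]. Qed.

(** The middle sum of [Upsilon]. For given p it is strictly increasing in l, so it recovers l. *)
Definition gap l p : R := \sum_(1 <= i < l.+1) 1 / (Lpred i p * L i p).

Lemma gap_S l p : gap l.+1 p = 1 / (p.2 * L 1 p) + gap l (Tmap p).
Proof.
rewrite /gap big_ltn // big_add1 /=; congr (_ + _).
by apply: eq_bigr => i _; rewrite Lpred_S L_S.
Qed.

Lemma gap_recr l p : gap l.+1 p = gap l p + 1 / (Lpred l.+1 p * L l.+1 p).
Proof. by rewrite /gap big_nat_recr. Qed.

Lemma gap_term_ge1 i p : unit_sq p -> 1 <= 1 / (Lpred i p * L i p).
Proof.
move=> h; have /andP[a0 a1] := Lpred_itv i h; have /andP[b0 b1] := L_itv i h.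
by rewrite ler_pdivlMr ?mulr_gt0 // mul1r mulr_ile1 // ltW.
Qed.

Lemma gap_ge l p : unit_sq p -> l%:R <= gap l p.
Proof.
move=> h; elim: l => [|l IH]; first by rewrite /gap big_geq.
by rewrite gap_recr -natr1 lerD // gap_term_ge1.
Qed.

Lemma gap_lt l l' p : unit_sq p -> (l < l')%N -> gap l p < gap l' p.
Proof.
move=> h; elim: l' => // l' IH; rewrite ltnS leq_eqVlt => /predU1P[->|/IH lt']; rewrite gap_recr;
  have := gap_term_ge1 l'.+1 h; lra.
Qed.

(** The image of the row p and the entry [M 0 0] are the data from which [XiM_formula] computes
    [XiM]; the entry carries the middle sum of [Upsilon]. *)
Lemma Mdig_spec l K p : unit_sq p ->
  [/\ \det (Mdig l K p) = 1, actx (Mdig l K p) p = L l p, acty (Mdig l K p) p = Llast l K p &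
      - (Mdig l K p 0 0)%:~R = p.2 * L l p * gap l p].
Proof.
elim: l p => [|l IH] p h /=.
  rewrite det_stepM /actx /acty /gap big_geq // mulr0 !mxE /= /Llast /L /Lpred /=.
  by rewrite mulr0 add0r mulr1 oppr0 mulrN1 addrC (mulrC p.2).
have [hT _] := Tmap_sq h; have [d ax ay g] := IH _ hT.
have [e1 _ _ _] := stepM_mul (Num.floor ((1 + p.1) / p.2)) (Mdig l K (Tmap p)).
have [s1 s2] := act_step (Num.floor ((1 + p.1) / p.2)) (Mdig l K (Tmap p)) p.
rewrite det_mulmx det_stepM d mulr1 s1 s2 -/(Tmap p) ax ay e1 L_S; split => //.
  by rewrite /Llast L_S Lpred_S.
have /andP[y0 _] := h.2; have /andP[L10 _] := L_itv 0 hT; rewrite /L /= in L10.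
rewrite gap_S mulrNz opprK; move: ax g.
rewrite /actx -[(Tmap p).1]/(p.2) -[(Tmap p).2]/(L 1 p).
have L1p : 0 < L 1 p by [].
move: (Mdig l K (Tmap p) 0 0)%:~R (Mdig l K (Tmap p) 1 0)%:~R (L l (Tmap p)) (gap l (Tmap p)) (L 1 p) L1p => a b X g t t0.
move=> e1' e2'; apply: (mulfI (lt0r_neq0 t0)).
have -> : t * b = X - p.2 * a by rewrite -e1'; ring.
have -> : a = - (t * X * g) by rewrite -e2' opprK.
by field; rewrite !gt_eqF.
Qed.

(** [XiM_diff] for the upper row (1/y, 0), which makes the first real part a single fraction. *)
Lemma XiM_formula M (x y : R) : \det M = 1 -> 0 < y -> 0 < actx M (x, y) ->
  XiM M x y = x / (y * (x ^+ 2 + y ^+ 2)) - (M 0 0)%:~R / (y * actx M (x, y)) +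
    acty M (x, y) / (actx M (x, y) * (actx M (x, y) ^+ 2 + acty M (x, y) ^+ 2)).
Proof.
move=> d y0 x0'; have yn : y != 0 by rewrite gt_eqF.
have xn : actx M (x, y) != 0 by rewrite gt_eqF.
have p0 : 0 < x ^+ 2 + y ^+ 2 by rewrite ltr_wpDl ?sqr_ge0 // exprn_gt0.
have q0 : 0 < actx M (x, y) ^+ 2 + acty M (x, y) ^+ 2 by rewrite ltr_pwDl ?sqr_ge0 // exprn_gt0.
have qE : quadM M x y = actx M (x, y) ^+ 2 + acty M (x, y) ^+ 2 by rewrite quadME.
have d' : (M 0 0)%:~R * (M 1 1)%:~R - (M 0 1)%:~R * (M 1 0)%:~R = 1 :> R.
  by rewrite -!intrM -intrB -det2E d.
have key : (M 0 0)%:~R * acty M (x, y) - (M 0 1)%:~R * actx M (x, y) = y.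
  transitivity (y * ((M 0 0)%:~R * (M 1 1)%:~R - (M 0 1)%:~R * (M 1 0)%:~R)); last by rewrite d' mulr1.
  by rewrite /actx /acty /=; ring.
have h : y^-1 * y - 0 * x = 1 by rewrite mulVf // mul0r subr0.
rewrite -(XiM_diff h p0) ?qE // !mul0r !addr0 -/(actx M (x, y)) -/(acty M (x, y)).
move: (actx M (x, y)) (acty M (x, y)) (M 0 0)%:~R (M 0 1)%:~R xn q0 key => X Y a b xn q0 key.
have pn := lt0r_neq0 p0; have qn := lt0r_neq0 q0.
rewrite -addrA; congr (_ + _); first by field; rewrite yn pn.
have -> : b = (a * Y - y) / X by rewrite -key; field.
by field; rewrite yn xn qn.
Qed.

Lemma Upsilon_XiM l K p : unit_sq p -> XiM (Mdig l K p) p.1 p.2 = Upsilon l K p.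
Proof.
move=> h; have [d ax ay g] := Mdig_spec l K h; have /andP[L0 _] := L_itv l h; have /andP[y0 _] := h.2.
have pE : (p.1, p.2) = p by case: p {h d ax ay g L0 y0}.
rewrite XiM_formula // pE ?ax //= ay /Upsilon -/(gap l p); congr (_ + _ + _).
by rewrite -mulNr g mulrAC mulfV ?mul1r // mulf_neq0 // gt_eqF.
Qed.

(** Each term of the middle sum is at least 1, whence the bound for l. Moreover K = L_(l+1)/L_l +
    L_(l-1)/L_l: the first quotient is below the last term of [Upsilon], and the second is at most
    the last term of the middle sum, or below the first term of [Upsilon] if l = 0. This accounts
    for the ranges of l and K. *)
Lemma Upsilon_gt l K p : unit_sq p -> 0 < Llast l K p -> p.1 ^+ 2 + p.2 ^+ 2 < 1 ->
  L l p ^+ 2 + Llast l K p ^+ 2 < 1 -> l%:R < Upsilon l K p /\ K%:R < Upsilon l K p.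
Proof.
move=> h Y0 p1 q1; have /andP[x0 _] := h.1; have /andP[y0 _] := h.2.
have /andP[L0 _] := L_itv l h.
have first_gt : p.1 / p.2 < p.1 / (p.2 * (p.1 ^+ 2 + p.2 ^+ 2)).
  have p0 : 0 < p.1 ^+ 2 + p.2 ^+ 2 by rewrite addr_gt0 // exprn_gt0.
  by rewrite ltr_pM2l // ltf_pV2 ?posrE ?mulr_gt0 // gtr_pMr.
have last_gt : Llast l K p / L l p < Llast l K p / (L l p * (L l p ^+ 2 + Llast l K p ^+ 2)).
  have q0 : 0 < L l p ^+ 2 + Llast l K p ^+ 2 by rewrite addr_gt0 // exprn_gt0.
  by rewrite ltr_pM2l // ltf_pV2 ?posrE ?mulr_gt0 // gtr_pMr.
have xy0 : 0 < p.1 / p.2 by rewrite divr_gt0.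
have LL0 : 0 < Llast l K p / L l p by rewrite divr_gt0.
have KE : K%:R = Llast l K p / L l p + Lpred l p / L l p.
  by rewrite -mulrDl /Llast subrK mulfK // gt_eqF.
rewrite /Upsilon -[Lpred 0 p]/p.1 -[L 0 p]/p.2 -/(gap l p); split.
  have := gap_ge l h; lra.
rewrite KE; case: l h Y0 q1 L0 last_gt LL0 KE => [|l] h Y0 q1 L0 last_gt LL0 KE.
  have -> : Lpred 0 p / L 0 p = p.1 / p.2 by [].
  by rewrite /gap big_geq //; lra.
have : Lpred l.+1 p / L l.+1 p <= 1 / (Lpred l.+1 p * L l.+1 p).
  have /andP[a0 a1] := Lpred_itv l.+1 h.
  rewrite mul1r invfM ler_pM2r ?invr_gt0 //; apply: (le_trans a1).
  by rewrite invf_ge1.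
rewrite gap_recr; have := gap_ge l h; have := ler0n R l; lra.
Qed.

(** [M 0 0] and the image of p determine [gap l p], hence l; then L_(l+1) determines K. *)
Lemma Mdig_inj l K l' K' p : unit_sq p -> Mdig l K p = Mdig l' K' p -> l = l' /\ K = K'.
Proof.
move=> h e; have [_ ax ay g] := Mdig_spec l K h; have [_ ax' ay' g'] := Mdig_spec l' K' h.
have /andP[y0 _] := h.2; have /andP[L0 _] := L_itv l h.
have eL : L l p = L l' p by rewrite -ax -ax' e.
have eg : gap l p = gap l' p.
  have n0 : p.2 * L l p != 0 by rewrite mulf_neq0 // gt_eqF.
  by apply: (mulfI n0); rewrite -g e g' eL.
have el : l = l'.
  by case: (ltngtP l l') => // lt; have := gap_lt h lt; move: eg; move: (gap l p) (gap l' p) => a b ->; rewrite ltxx.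
subst l'; split => //; have : Llast l K p = Llast l K' p by rewrite -ay -ay' e.
by rewrite /Llast => /addIr /(mulIf (lt0r_neq0 L0)) /eqP; rewrite eqr_nat => /eqP.
Qed.

(** Strip the first digit, which p forces. With X = [actx M p], the quotient of -[M 0 0] by y X
    drops by 1/(y L_1) >= 1, so n bounds the number of digits. *)
Lemma Mdig_surj n M p : unit_sq p -> \det M = 1 -> M 0 0 <= 0 -> 0 < actx M p <= 1 -> 0 < acty M p ->
  - (M 0 0)%:~R < n%:R * (p.2 * actx M p) -> exists l K, (1 <= K)%N /\ M = Mdig l K p.
Proof.
elim: n M p => [|n IH] M p h d m0 /andP[X0 X1] Y0.
  by rewrite mul0r oppr_lt0 ltr0z ltNge m0.
have /andP[x0 x1] := h.1; have /andP[y0 y1] := h.2.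
move: d; have [e|ne] := eqVneq (M 0 0) 0 => d hn.
  have c0 : 0 < M 1 0 by move: X0; rewrite /actx e mulr0 add0r pmulr_rgt0 // ltr0z.
  have [c1 b1] : M 1 0 = 1 /\ M 0 1 = -1.
    move: d c0; rewrite det2E e mul0r sub0r; move: (M 0 1) (M 1 0) => b c; clear => bc c0.
    have b1 : b <= -1 by nia.
    have c1 : c <= 1 by nia.
    have c2 : c = 1 by lia.
    by move: bc; rewrite c2 mulr1 => bc; split; lia.
  have k0 : 0 < M 1 1.
    rewrite -(ltr0z R) -(pmulr_rgt0 _ y0); move: Y0; rewrite /acty b1 mulrN1.
    by move: (_ * (M 1 1)%:~R) => t; lra.
  exists 0%N, (absz (M 1 1)); split; first by rewrite absz_gt0 gt_eqF.
  rewrite /= gtz0_abs //; apply/matrixP => i j; rewrite !mxE.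
  by case: (ord2 i) => ->; case: (ord2 j) => -> /=.
have m1 : M 0 0 <= -1 by move: m0 ne; move: (M 0 0) => a; clear; lia.
have [hT T1] := Tmap_sq h.
pose k := Num.floor ((1 + p.1) / p.2).
pose N : 'M[int]_2 := \matrix_(i, j) (if i == 0 then k * M 0 j + M 1 j else - M 0 j).
have MN : M = stepM k *m N.
  have [e1 e2 e3 e4] := stepM_mul k N; apply/matrixP => i j.
  case: (ord2 i) => ->; case: (ord2 j) => ->; rewrite ?e1 ?e2 ?e3 ?e4 !mxE /=; ring.
have dN : \det N = 1 by move: d; rewrite MN det_mulmx det_stepM mul1r.
have [sx sy] := act_step k N p; rewrite -MN -/(Tmap p) in sx sy.
have L1E : (Tmap p).2 = k%:~R * p.2 - p.1 by [].
have L10 : 0 < (Tmap p).2 by have /andP[] := hT.2.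
have L11 : (Tmap p).2 <= 1 by have /andP[] := hT.2.
have m1' : (M 0 0)%:~R <= -1 :> R by rewrite -(intrN R 1) ler_int.
(* If [N 0 0] were at least 1, then y + L_1 <= X <= 1, against y + L_1 > 1 for the coordinates of
   [Tmap p]. *)
have N00 : N 0 0 <= 0.
  rewrite mxE /= leNgt; apply/negP => N0.
  have N1 : 1 <= k%:~R * (M 0 0)%:~R + (M 1 0)%:~R :> R by rewrite -intrM -intrD ler1z -gtz0_ge1.
  have : p.2 * 1 <= p.2 * (k%:~R * (M 0 0)%:~R + (M 1 0)%:~R) by rewrite ler_pM2l.
  have : (Tmap p).2 * 1 <= (Tmap p).2 * - (M 0 0)%:~R by rewrite ler_pM2l // lerNr.
  have -> : p.2 * (k%:~R * (M 0 0)%:~R + (M 1 0)%:~R) = actx M p - (Tmap p).2 * - (M 0 0)%:~R.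
    by rewrite L1E /actx; ring.
  rewrite -[(Tmap p).1]/(p.2) in T1; rewrite !mulr1.
  move: ((Tmap p).2 * - (M 0 0)%:~R) => b h1 h2.
  by move: T1 X1 h1 h2; move: (actx M p) (Tmap p).2 (p.2) => a c e; lra.
have [l [K [K1 NE]]] : exists l K, (1 <= K)%N /\ N = Mdig l K (Tmap p).
  apply: IH => //; rewrite -?sx -?sy ?X0 //.
  rewrite -(ltr_pM2l y0).
  have -> : p.2 * - (N 0 0)%:~R = - (M 0 0)%:~R * (Tmap p).2 - actx M p.
    by rewrite L1E !mxE /= intrD intrM /actx; ring.
  have hn' := hn; rewrite -(ltr_pM2r L10) in hn'; move: hn'.
  have : actx M p * (p.2 * (Tmap p).2) <= actx M p * 1 by rewrite ler_pM2l // mulr_ile1 // ltW.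
  rewrite -natr1 mulr1; move: (actx M p) (Tmap p).2 (p.2) (n%:R : R) ((M 0 0)%:~R : R) => a b c e f; lra.
by exists l.+1, K; split => //=; rewrite -NE.
Qed.
End Digits.

(** * Sums of measures over countable index sets *)

Section CountableSums.
Local Open Scope classical_set_scope.
Local Open Scope ring_scope.
Local Open Scope ereal_scope.

(** Rewrites a sum over a countable type as a series, where integral and sum may be exchanged. *)
Lemma esum_pickle (R : realType) (I : countType) (P : set I) (a : I -> \bar R) : (forall i, 0 <= a i) ->
  \esum_(i in P) a i = \sum_(n <oo) oapp (fun i => if i \in P then a i else 0) 0 (pickle_inv n).
Proof.
move=> a0; pose g n := oapp (fun i => if i \in P then a i else 0) 0 (@pickle_inv I n).
rewrite -[RHS]/(\sum_(n <oo) g n).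
have g0 n : 0 <= g n by rewrite /g; case: pickle_inv => //= i; case: ifP.
rewrite nneseries_esumT //.
transitivity (\esum_(n in @choice.pickle I @` P) g n).
  rewrite (@reindex_esum R I nat P (@choice.pickle I @` P) choice.pickle g).
    by apply: eq_esum => i Pi; rewrite /g pickleK_inv /= (mem_set Pi).
  split=> [i Pi|i j _ _|n [i Pi <-]]; [by exists i|exact: (pcan_inj (@choice.pickleK I))|by exists i].
rewrite esum_mkcond; apply: eq_esum => n _; case: ifPn => // /negP nP.
rewrite /g; have := @pickle_invK I n; case: pickle_inv => //= i pin.
by case: ifP => // /set_mem Pi; case: nP; apply/mem_set; exists i.
Qed.

Context d (T : measurableType d) (R : realType) (mu : {measure set T -> \bar R}).

Lemma esum_measureE (I : countType) (P : set I) (A : I -> set T) : (forall i, measurable (A i)) ->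
  \esum_(i in P) mu (A i) = \int[mu]_x \esum_(i in P) (\1_(A i) x)%:E.
Proof.
move=> mA; rewrite esum_pickle //.
pose b n x : \bar R := oapp (fun i => if i \in P then (\1_(A i) x)%:E else 0) 0 (pickle_inv n).
transitivity (\sum_(n <oo) \int[mu]_x b n x).
  apply: eq_eseriesr => n _; rewrite /b; case: pickle_inv => [i|] /=; last by rewrite integral0.
  by case: ifP => _; [rewrite integral_indic // setIT|rewrite integral0].
rewrite -integral_nneseries //.
- apply: eq_integral => x _; rewrite esum_pickle // => i; rewrite lee_fin indicE; exact: ler0n.
- move=> n; rewrite /b; case: pickle_inv => [i|] /=; last exact: measurable_cst.
  case: (i \in P); last exact: measurable_cst.
  by apply/measurable_EFinP; exact: measurable_indic.
- by move=> n x _; rewrite /b; case: pickle_inv => //= i; case: ifP.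
Qed.

(** The sum of the measures is the integral of the number of sets that contain x, so a bijection of
    the indices at each x is enough. It may vary with x, as the digits of M do. *)
Lemma esum_measure_bij (I J : countType) (P : set I) (Q : set J) (A : I -> set T) (B : J -> set T) :
  (forall i, measurable (A i)) -> (forall j, measurable (B j)) ->
  (forall x, exists f, set_bij [set i | P i /\ A i x] [set j | Q j /\ B j x] f) ->
  \esum_(i in P) mu (A i) = \esum_(j in Q) mu (B j).
Proof.
move=> mA mB bij; rewrite !esum_measureE //; apply: eq_integral => x _.
have E (K : countType) (S : set K) (C : K -> set T) :
    \esum_(i in S) (\1_(C i) x)%:E = \esum_(i in [set i | S i /\ C i x]) (1 : \bar R).
  rewrite -[[set i | _]]/(S `&` [set i | C i x]) esum_mkcondr; apply: eq_esum => i _.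
  rewrite indicE; case: (pselect (C i x)) => h; first by rewrite !mem_set.
  by rewrite !memNset.
have [f hf] := bij x; rewrite !E.
exact: (esym (reindex_esum _ _ _ (fun=> 1) hf)).
Qed.
End CountableSums.

(** * Identification of the volumes *)

Section DigitBijection.
Variable R : realType.
Local Open Scope classical_set_scope.
Local Open Scope ring_scope.
Implicit Types (M : 'M[int]_2) (xi x y z : R) (l K : nat).
Local Notation RL := (measurableTypeR R).
Local Notation meas3 := (@measurable _ (RL * RL * RL)%type).
Local Notation mu3 := (@mu3 R).

Lemma height_lt1 z : z != 0 -> 1 / (1 + z ^+ 2) < 1.
Proof.
move=> z0; have z2 : 0 < z ^+ 2 by rewrite exprn_even_gt0.
by rewrite ltr_pdivrMr ?mul1r ?ltrDl // ltr_wpDl.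
Qed.

Lemma sqr_lt1_le1 x y : 0 < x -> x ^+ 2 + y ^+ 2 < 1 -> x <= 1.
Proof.
move=> x0 h; have : x ^+ 2 < 1 by apply: le_lt_trans h; rewrite lerDl sqr_ge0.
by rewrite expr_lt1 ?(ltW x0) // => /ltW.
Qed.

(** The plane z = 0 is removed so that 1/(1 + z^2) < 1; [Upsilon_gt] needs this for the strict
    bounds l < xi and K < xi. *)
Lemma digit_bij xi (p : R * R * R) :
  set_bij [set q : nat * nat | [/\ q.1%:R < xi, (1 <= q.2)%N & q.2%:R < xi] /\
             (Tset q.2 q.1 xi `\` [set p | p.2 = 0]) p]
    [set M | leftS M /\ W3 M xi p] (fun q => Mdig q.1 q.2 p.1).
Proof.
case: p => -[x y] z; split.
- move=> [l K] [/= _ [[[X Y Zc] [[x0 y0] /andP[Y0 Y1] U Hm]] /eqP z0]].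
  have sq : unit_sq (x, y) by split; apply/andP; split => //; [case/andP: X|case/andP: Y].
  have [d ax ay g] := Mdig_spec l K sq.
  have L0 : 0 < L l (x, y) by case/andP: (L_itv l sq).
  have zp : 0 < z <= 1 by case/andP: Zc => h1 ->; rewrite lt_def z0 h1.
  have hl := height_lt1 z0.
  move: Hm; rewrite ge_max => /andP[H1 H2].
  have [U0 _] := Upsilon_gt sq Y0 (le_lt_trans H1 hl) (le_lt_trans H2 hl).
  have Up : 0 <= Upsilon l K (x, y) by apply: ltW; apply: le_lt_trans U0.
  split; first split => //.
    rewrite -(lerz0 R) -oppr_ge0 g mulr_ge0 ?mulr_ge0 // ?(ltW L0) ?(ltW y0) //.
    by apply: le_trans (gap_ge l sq).
  split => //; split => //; rewrite -?/(actx _ (x, y)) -?/(acty _ (x, y)).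
  + by rewrite -[X in 0 < X]/(actx (Mdig l K (x, y)) (x, y)) ax.
  + by rewrite -[X in 0 < X]/(acty (Mdig l K (x, y)) (x, y)) ay.
  + by rewrite (Upsilon_XiM l K sq) ger0_norm.
  rewrite quadME -[X in X ^+ 2 + _]/(actx (Mdig l K (x, y)) (x, y)).
  by rewrite -[X in _ + X ^+ 2]/(acty (Mdig l K (x, y)) (x, y)) ax ay.
- move=> [l K] [l' K'] /set_mem[/= _ [[[X Y _] [[x0 y0] _ _ _]] _]] _ /= e.
  have sq : unit_sq (x, y) by split; apply/andP; split => //; [case/andP: X|case/andP: Y].
  by have [-> ->] := Mdig_inj sq e.
move=> M [[d m0] [[x0 y0 /andP[z0 z1]] [X0 Y0 B H1 H2]]].
have zn : z != 0 by rewrite gt_eqF.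
have hl := height_lt1 zn; have h1 := le_lt_trans H1 hl; have h2 := le_lt_trans H2 hl.
have x1 : x <= 1 by exact: sqr_lt1_le1 h1.
have y1 : y <= 1 by rewrite addrC in h1; exact: sqr_lt1_le1 h1.
have sq : unit_sq (x, y) by split; apply/andP.
rewrite quadME in h2 H2.
have X1 : x * (M 0 0)%:~R + y * (M 1 0)%:~R <= 1 by exact: sqr_lt1_le1 h2.
have Y1 : x * (M 0 1)%:~R + y * (M 1 1)%:~R <= 1 by rewrite addrC in h2; exact: sqr_lt1_le1 h2.
have yX : 0 < y * actx M (x, y) by rewrite mulr_gt0.
have [l [K [K1 ME]]] : exists l K, (1 <= K)%N /\ M = Mdig l K (x, y).
  apply: (@Mdig_surj R (Num.truncn (- (M 0 0)%:~R / (y * actx M (x, y)))).+1) => //.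
    by apply/andP.
  by rewrite -ltr_pdivrMr //; exact: truncnS_gt.
have [_ ax ay _] := Mdig_spec l K sq; rewrite -ME in ax ay.
have aX : actx M (x, y) = x * (M 0 0)%:~R + y * (M 1 0)%:~R by [].
have aY : acty M (x, y) = x * (M 0 1)%:~R + y * (M 1 1)%:~R by [].
rewrite -aX -aY ax ay in X0 Y0 X1 Y1 h2 H2.
have [U1 U2] := Upsilon_gt sq Y0 h1 h2.
have UE : Upsilon l K (x, y) <= xi.
  by rewrite -(Upsilon_XiM l K sq) -ME; apply: le_trans B; exact: ler_norm.
exists (l, K); last by rewrite /= ME.
split; first by split => //=; [exact: lt_le_trans UE|exact: lt_le_trans UE].
split; last by move=> /= e; rewrite e eqxx in zn.
split; first by split; apply/andP; split => //; exact: ltW.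
by split => //; [apply/andP|rewrite ge_max H1 H2].
Qed.

Lemma mfun3_iterT i : mfun3 (fun p : R * R * R => (iter i (@Tmap R) p.1).1) /\
  mfun3 (fun p : R * R * R => (iter i (@Tmap R) p.1).2).
Proof.
elim: i => [|i [h1 h2]]; first by split; [exact: mfun3_x|exact: mfun3_y].
split; first exact: h2.
apply: mfun3B => //; apply: mfun3M => //; apply: mfun3_floor; apply: mfun3M; last exact: mfun3V.
by apply: mfun3D => //; exact: mfun3_cst.
Qed.

Lemma mfun3_sum (r : seq nat) (f : nat -> R * R * R -> R) : (forall i, mfun3 (f i)) ->
  mfun3 (fun p => \sum_(i <- r) f i p).
Proof.
move=> mf; elim: r => [|i r IH].
  by rewrite (_ : (fun p => _) = fun=> 0); [exact: mfun3_cst|apply/funext => p; rewrite big_nil].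
rewrite (_ : (fun p => _) = fun p => f i p + \sum_(i <- r) f i p); first exact: mfun3D.
by apply/funext => p; rewrite big_cons.
Qed.

Let unit_cubeE : unit_cube = [set p : R * R * R | 0 <= p.1.1] `&` [set p | p.1.1 <= 1] `&` [set p | 0 <= p.1.2] `&`
  [set p | p.1.2 <= 1] `&` [set p | 0 <= p.2] `&` [set p | p.2 <= 1].
Proof.
apply/seteqP; split => -[[x y] z] /=.
  by move=> [/andP[? ?] /andP[? ?] /andP[? ?]].
by move=> [[[[[? ?] ?] ?] ?] ?]; split; apply/andP.
Qed.

Lemma measurable_unit_cube : meas3 (@unit_cube R).
Proof.
have x := @mfun3_x R; have y := @mfun3_y R; have z := @mfun3_z R; have k := @mfun3_cst R.
by rewrite unit_cubeE; do 5?apply: measurableI; apply: mset3_le.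
Qed.

Lemma measurable_Tset K l xi : meas3 (Tset K l xi).
Proof.
have x := @mfun3_x R; have y := @mfun3_y R; have z := @mfun3_z R; have k := @mfun3_cst R.
have mL i : mfun3 (fun p : R * R * R => L i p.1) by case: (mfun3_iterT i).
have mP i : mfun3 (fun p : R * R * R => Lpred i p.1) by case: (mfun3_iterT i).
have mLl : mfun3 (fun p : R * R * R => Llast l K p.1) by apply: mfun3B => //; exact: mfun3M.
have mS (f g : R * R * R -> R) : mfun3 f -> mfun3 g -> mfun3 (fun p => f p ^+ 2 + g p ^+ 2).
  by move=> mf mg; apply: mfun3D; exact: mfun3X.
have mU : mfun3 (fun p : R * R * R => Upsilon l K p.1).
  apply: mfun3D; first apply: mfun3D.
  - by apply: mfun3M => //; apply: mfun3V; apply: mfun3M => //; exact: mS.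
  - by apply: mfun3_sum => i; apply: mfun3M => //; apply: mfun3V; exact: mfun3M.
  by apply: mfun3M => //; apply: mfun3V; apply: mfun3M => //; exact: mS.
have h := @mfun3_height R.
apply: measurableI; first exact: measurable_unit_cube.
rewrite (_ : mkset _ = [set p : R * R * R | 0 < p.1.1] `&` [set p | 0 < p.1.2] `&` [set p | 0 < Llast l K p.1] `&`
  [set p | Llast l K p.1 <= 1] `&` [set p | Upsilon l K p.1 <= xi] `&`
  [set p | p.1.1 ^+ 2 + p.1.2 ^+ 2 <= 1 / (1 + p.2 ^+ 2)] `&`
  [set p | L l p.1 ^+ 2 + Llast l K p.1 ^+ 2 <= 1 / (1 + p.2 ^+ 2)]).
  do 6?apply: measurableI; try (by apply: mset3_lt); apply: mset3_le => //; exact: mS.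
apply/seteqP; split => -[[a b] c] /=; rewrite ge_max.
  by move=> [[? ?] /andP[? ?] ? /andP[? ?]].
by move=> [[[[[[? ?] ?] ?] ?] ?] ?]; split => //; apply/andP.
Qed.

Lemma measurable_Sset M xi : meas3 (Sset M xi).
Proof.
have k := @mfun3_cst R; have h := @mfun3_height R.
apply: measurableI; first exact: measurable_unit_cube.
rewrite (_ : mkset _ = [set p : R * R * R | `|XiM M p.1.1 p.1.2| <= xi] `&` [set p | quadM M p.1.1 p.1.2 <= 1 / (1 + p.2 ^+ 2)]).
  by apply: measurableI; apply: mset3_le => //; [apply: mfun3A; exact: mfun3_XiM|exact: mfun3_quadM].
by apply/seteqP; split => -[[a b] c].
Qed.

Lemma meas3_eq0 (f : R * R * R -> R) : mfun3 f -> meas3 [set p | f p = 0].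
Proof.
move=> mf; rewrite (_ : [set p | f p = 0] = [set p | f p <= 0] `&` [set p | 0 <= f p]).
  by apply: measurableI; apply: mset3_le => //; exact: mfun3_cst.
apply/seteqP; split => p /=; first by move=> ->.
by move=> [a b]; apply/eqP; rewrite eq_le a b.
Qed.

Let plane0 : set (R * R * R) := [set p | p.2 = 0].

Lemma mu3_z0 : mu3 [set p | p.2 = 0] = 0%E.
Proof. by apply: mu3_graph; [apply: meas3_eq0; exact: mfun3_z|move=> v z w w' /= -> ->]. Qed.

Lemma mu3_setD_null (A N : set (R * R * R)) : meas3 A -> meas3 N -> mu3 N = 0%E -> mu3 (A `\` N) = mu3 A.
Proof.
move=> mA mN N0; have mD := measurableD mA mN.
apply/eqP; rewrite eq_le; apply/andP; split; first by apply: mu3_le => // p [].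
rewrite -[leRHS]adde0 -N0; apply: le_trans (mu3U_le mD mN); apply: mu3_le => //; first exact: measurableU.
by move=> p Ap; have [h|h] := pselect (N p); [right|left].
Qed.

Lemma sum_Tset xi : (\esum_(l in [set l : nat | (l%:R < xi)%R])
    \esum_(K in [set K : nat | (1 <= K)%N /\ (K%:R < xi)%R]) Vol (Tset K l xi) =
  \esum_(M in leftS) mu3 (W3 M xi))%E.
Proof.
have mz : meas3 plane0 by apply: meas3_eq0; exact: mfun3_z.
rewrite esum_esum; last by move=> l K _ _; exact: measure_ge0.
transitivity (\esum_(q in [set q : nat * nat | [/\ (q.1%:R < xi)%R, (1 <= q.2)%N & (q.2%:R < xi)%R]])
    mu3 (Tset q.2 q.1 xi `\` plane0))%E.
  rewrite (_ : _ `*`` _ = [set q : nat * nat | [/\ (q.1%:R < xi)%R, (1 <= q.2)%N & (q.2%:R < xi)%R]]).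
    by apply: eq_esum => q _; rewrite mu3_setD_null //; [exact: measurable_Tset|exact: mu3_z0].
  by apply/seteqP; split => q /=; [move=> [? [? ?]]|move=> [? ? ?]].
apply: (@esum_measure_bij _ (RL * RL * RL)%type R mu3).
- by move=> q; apply: measurableD => //; exact: measurable_Tset.
- by move=> M; exact: measurable_W3.
by move=> p; exists (fun q => Mdig q.1 q.2 p.1); exact: digit_bij.
Qed.

(** For nonnegative M the image row is automatically positive and x^2 + y^2 <= [quadM M x y], so the
    two sets differ only on the coordinate planes. *)
Lemma mu3_Sset M xi : frakS M -> mu3 (Sset M xi) = mu3 (W3 M xi).
Proof.
move=> fM; have mS := measurable_Sset M xi; have mW := measurable_W3 M xi.
have mx : meas3 [set p : R * R * R | p.1.1 = 0] by apply: meas3_eq0; exact: mfun3_x.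
have my : meas3 [set p : R * R * R | p.1.2 = 0] by apply: meas3_eq0; exact: mfun3_y.
have mz : meas3 [set p : R * R * R | p.2 = 0] by apply: meas3_eq0; exact: mfun3_z.
have [a0 b0 c0 e0 _] := frakS_entries fM.
have a1 : 1 <= (M 0 0)%:~R :> R by rewrite ler1z.
have b1 : 0 <= (M 0 1)%:~R :> R by rewrite ler0z.
have c1 : 0 <= (M 1 0)%:~R :> R by rewrite ler0z.
have e1 : 1 <= (M 1 1)%:~R :> R by rewrite ler1z.
have sub1 : W3 M xi `<=` Sset M xi.
  move=> [[x y] z] [[x0 y0 /andP[z0 z1]] [X0 Y0 B H1 H2]].
  have zn : z != 0 by rewrite gt_eqF.
  have h1 := le_lt_trans H1 (height_lt1 zn).
  split; last by split.
  have x1 : x <= 1 by exact: sqr_lt1_le1 h1.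
  have y1 : y <= 1 by rewrite addrC in h1; exact: sqr_lt1_le1 h1.
  by split; apply/andP; split => //; exact: ltW.
pose N := [set p : R * R * R | p.1.1 = 0] `|` [set p | p.1.2 = 0] `|` [set p | p.2 = 0].
have mN : meas3 N by apply: measurableU => //; exact: measurableU.
have N0 : mu3 N = 0%E.
  apply: mu3_null_setU => //; [exact: measurableU| |exact: mu3_z0].
  by apply: mu3_null_setU => //; [exact: (@mu3_v _ _ 0)|exact: (@mu3_z _ _ 0)].
apply/eqP; rewrite eq_le; apply/andP; split; last exact: mu3_le.
rewrite -[leRHS]adde0 -N0; apply: le_trans (mu3U_le mW mN); apply: mu3_le => //; first exact: measurableU.
move=> [[x y] z] [[/andP[x0 x1] /andP[y0 y1] /andP[z0 z1]] [B H2]].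
have [xe|xn] := eqVneq x 0; first by right; left; left.
have [ye|yn] := eqVneq y 0; first by right; left; right.
have [ze|zn] := eqVneq z 0; first by right; right.
left; have xp : 0 < x by rewrite lt_def xn.
have yp : 0 < y by rewrite lt_def yn.
have X0 : x <= x * (M 0 0)%:~R + y * (M 1 0)%:~R.
  by apply: (@le_trans _ _ (x * (M 0 0)%:~R)); [rewrite ler_peMr|rewrite lerDl mulr_ge0].
have Y0 : y <= x * (M 0 1)%:~R + y * (M 1 1)%:~R.
  by apply: (@le_trans _ _ (y * (M 1 1)%:~R)); [rewrite ler_peMr|rewrite lerDr mulr_ge0].
split; first by split => //; rewrite lt_def zn z0.
split => //; [exact: lt_le_trans X0|exact: lt_le_trans Y0|].
apply: le_trans H2; rewrite quadME lerD // ler_pXn2r ?nnegrE //; [exact: le_trans X0|exact: le_trans Y0].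
Qed.

Lemma sum_volumes xi : (\esum_(M in frakS) Vol (Sset M xi) + \esum_(l in [set l : nat | (l%:R < xi)%R])
    \esum_(K in [set K : nat | (1 <= K)%N /\ (K%:R < xi)%R]) Vol (Tset K l xi) =
  \esum_(M in baseS) mu3 (W3 M xi))%E.
Proof.
have E := esumID frakS baseS (fun M => mu3 (W3 M xi)) (fun M _ => measure_ge0 mu3 (W3 M xi)).
have eS : (\esum_(M in frakS) Vol (Sset M xi) = \esum_(M in baseS `&` frakS) mu3 (W3 M xi))%E.
  rewrite (_ : baseS `&` frakS = frakS); first by apply: eq_esum => M fM; exact: mu3_Sset.
  by apply/seteqP; split => M; [case|split => //; left].
have eL : baseS `&` ~` frakS = leftS.
  apply/seteqP; split => M; first by move=> [[fM|lM] nf]; [case: nf|].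
  by move=> lM; split; [right|move=> fM; exact: (disj_frakS_leftS fM lM)].
by rewrite sum_Tset eS -eL; exact: esym E.
Qed.

(** [mu3_W3] assumes xi > 0; at xi = 0 the region is contained in those of all small positive xi. *)
Lemma mu3_W3_0 M : baseS M -> mu3 (W3 M 0) = 0%E.
Proof.
move=> bM; have d := baseS_det bM; apply/eqP; rewrite eq_le measure_ge0 andbT.
apply/lee_addgt0Pr => e e0; rewrite add0e.
have [dl dl0 H] := wM_small bM e0.
apply: (@le_trans _ _ (mu3 (W3 M dl))).
  apply: mu3_le; try exact: measurable_W3.
  by move=> [[x y] z] [a [X0 Y0 B H1 H2]]; split => //; split => //; apply: le_trans B (ltW dl0).
rewrite (mu3_W3 d dl0) (wME d dl0) -EFinM lee_fin.
have := H dl dl0 (lexx _); have := @wM_ge0 R M dl; move: (wM M dl) => t; lra.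
Qed.

Lemma sum_volumes_F0 xi : 0 <= xi -> (\esum_(M in baseS) mu3 (W3 M xi) = (F0 xi / 2)%:E)%E.
Proof.
rewrite le_eqVlt /F0 => /predU1P[<-|x0].
  by rewrite ltxx mul0r esum1 // => M bM; exact: mu3_W3_0.
rewrite x0 mulrC EFinM -(FsE x0) -esumZl //.
by apply: eq_esum => M bM; rewrite mu3_W3 // (baseS_det bM).
Qed.

(** 8/3 (2 zeta(2))^-1 F0 = 8/(3 zeta(2)) (F0/2), where the half is the one of [mu3_W3]. *)
Lemma R2_volumes xi : 0 <= xi -> (R2 (3 / 8 * xi))%:E = ((8 / (3 * zeta 2))%:E *
   (\esum_(M in frakS) Vol (Sset M xi) + \esum_(l in [set l : nat | (l%:R < xi)%R])
      \esum_(K in [set K : nat | (1 <= K)%N /\ (K%:R < xi)%R]) Vol (Tset K l xi)))%E.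
Proof.
move=> x0; rewrite sum_volumes sum_volumes_F0 // -EFinM; congr (_%:E).
rewrite R2_F0 (_ : 8 / 3 * (3 / 8 * xi) = xi); last by field.
have := zeta2_gt0 R; move: (F0 xi) (zeta 2) => f z z0; field.
by rewrite gt_eqF.
Qed.
End DigitBijection.

Local Open Scope classical_set_scope.
Local Open Scope ring_scope.

Theorem theorem2 (R : realType) :
  exists R2 : R -> R,
    [/\ forall xi : R, 0 <= xi -> RQ Q xi @[Q --> +oo] --> R2 xi,
        C1_on [set xi : R | 0 <= xi] R2 &
        forall xi : R, 0 <= xi ->
          (R2 (3 / 8 * xi))%:E =
          ((8 / (3 * zeta 2))%:E *
           (\esum_(M in frakS) Vol (Sset M xi) +
            \esum_(l in [set l : nat | (l%:R < xi)%R])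
              \esum_(K in [set K : nat | (1 <= K)%N /\ (K%:R < xi)%R])
                Vol (Tset K l xi)))%E].
Proof.
exists (@R2 R); split; [exact: RQ_cvg|exact: R2_C1|exact: R2_volumes].
Qed.
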